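(* Let $n\geqslant 2$ and $r\in\{2,\dots,n\}$ be integers, let $\delta\in\mathbb{R}$, and let $\Sigma$ be a closed, connected and embedded hypersurface of $\mathbb{M}^{n+1}(\delta)$. Assume that the $r$-th mean curvature $H_r$ of $\Sigma$ is a positive function satisfying $H_r=aH+b$ on $\Sigma$ for some real constants $a\geqslant 0$ and $b>0$, where $H$ is the mean curvature. Then $\Sigma$ is a geodesic sphere of $\mathbb{M}^{n+1}(\delta)$.
   Context: $\mathbb{M}^{n+1}(\delta)$ denotes the Euclidean space $\mathbb{R}^{n+1}$ if $\delta=0$, the (open) half-sphere $\mathbb{S}^{n+1}_+(\delta)$ of constant sectional curvature $\delta$ if $\delta>0$, and the hyperbolic space $\mathbb{H}^{n+1}(\delta)$ of constant sectional curvature $\delta$ if $\delta<0$. Closed means compact without boundary. Let $\kappa_1,\dots,\kappa_n$ be the principal curvatures of $\Sigma$, with the orientation/sign convention (relative to the domain bounded by $\Sigma$) for which geodesic spheres have positive principal curvatures. The mean curvature is $H=\frac1n\sum_i\kappa_i$ and, for $r\in\{1,\dots,n\}$, $$H_r=\binom{n}{r}^{-1}\sum_{1\leqslant i_1<\dots<i_r\leqslant n}\kappa_{i_1}\cdots\kappa_{i_r}.$$ *)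

(* Defs.v *)
From mathcomp Require Import all_boot all_order all_algebra.
From mathcomp Require Import all_classical all_reals all_analysis.

Set Implicit Arguments.
Unset Strict Implicit.
Unset Printing Implicit Defensive.

Import Order.TTheory GRing.Theory Num.Theory.
Import numFieldNormedType.Exports.
Local Open Scope classical_set_scope.
Local Open Scope ring_scope.

(** The space form of dimension n+1 and curvature [delta] is realized inside
    the vector space of dimension n+2, equipped with the Euclidean product if
    [0 <= delta] and with the Lorentzian product if [delta < 0]:
    - [delta = 0]: the hyperplane of equation x_0 = 0;
    - [delta > 0]: the half x_0 > 0 of the sphere <x, x> = 1 / delta;
    - [delta < 0]: the sheet x_0 > 0 of the hyperboloid <x, x> = 1 / delta.
    The product is positive definite on the tangent spaces of the space form,
    and its restriction to them is the Riemannian metric. The norm of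
    ['rV[R]_n.+2] (the sup norm) is only used for its topology. *)

Definition ambient_prod (R : realType) (n : nat) (delta : R)
    (x y : 'rV[R]_n.+2) : R :=
  (if delta < 0 then -1 else 1) * (x 0 ord0 * y 0 ord0)
  + \sum_(i < n.+1) x 0 (lift ord0 i) * y 0 (lift ord0 i).

Definition space_form (R : realType) (n : nat) (delta : R) :
    set 'rV[R]_n.+2 :=
  [set x : 'rV[R]_n.+2 | if delta == 0 then x 0 ord0 = 0
           else ambient_prod delta x x = delta^-1 /\ 0 < x 0 ord0].

(** [f] is C^infinity in a neighbourhood of [p]: near [p], all the iterated
    directional derivatives of [f] are (Frechet) differentiable. *)
Definition smooth_at (R : realType) (V W : normedModType R) (p : V)
    (f : V -> W) : Prop :=
  \forall x \near p, forall vs : seq V,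
    differentiable (foldr (fun v g => 'D_v g) f vs) x.

Definition curve_through (R : realType) (V : normedModType R) (S : set V)
    (p v : V) (c : R -> V) : Prop :=
  [/\ smooth_at (0 : R) c, \forall t \near (0 : R), S (c t),
      c 0 = p & derive1 c 0 = v].

Definition tangent (R : realType) (V : normedModType R) (S : set V)
    (p v : V) : Prop :=
  exists c : R -> V, curve_through S p v c.

(** Embedded hypersurface of the space form: locally a regular level set. *)
Definition embedded_hypersurface (R : realType) (n : nat) (delta : R)
    (S : set 'rV[R]_n.+2) : Prop :=
  S `<=` space_form delta /\
  forall p, S p -> exists f : 'rV[R]_n.+2 -> R,
    [/\ smooth_at p f,
        \forall x \near p, S x <-> space_form delta x /\ f x = 0 &
        exists2 v, tangent (space_form delta) p v & 'D_v f p != 0].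

(** The domain bounded by a closed connected hypersurface [S]: the points
    off [S] whose component is relatively compact in the space form. For
    [delta > 0], [K `<=` space_form delta] matters: the open half-sphere is
    itself relatively compact in the whole sphere. *)
Definition bounded_domain (R : realType) (n : nat) (delta : R)
    (S : set 'rV[R]_n.+2) : set 'rV[R]_n.+2 :=
  [set q | (space_form delta `\` S) q /\
    exists K, [/\ compact K, K `<=` space_form delta &
                  connected_component (space_form delta `\` S) q `<=` K]].

(** [w] is the orthogonal projection of [u] on the tangent space at [p]. The
    Levi-Civita connection of the space form is the tangential part of the
    directional derivative of the ambient vector space. *)
Definition tangential_part (R : realType) (n : nat) (delta : R)
    (p u w : 'rV[R]_n.+2) : Prop :=
  tangent (space_form delta) p w /\
  forall z, tangent (space_form delta) p z -> ambient_prod delta (u - w) z = 0.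

Definition inner_unit_normal (R : realType) (n : nat) (delta : R)
    (S : set 'rV[R]_n.+2) (p v : 'rV[R]_n.+2) : Prop :=
  [/\ tangent (space_form delta) p v,
      ambient_prod delta v v = 1,
      forall z, tangent S p z -> ambient_prod delta v z = 0 &
      forall c : R -> 'rV[R]_n.+2, curve_through (space_form delta) p v c ->
        \forall t \near (0 : R)^'+, bounded_domain delta S (c t)].

(** [k] lists, with multiplicity, the eigenvalues of the shape operator
    v |-> - nabla_v N of the inner unit normal field N: the vectors [e i] form
    an orthonormal basis of the tangent space of [S] at [p] (of dimension n)
    and nabla_(e i) N = - k i *: e i. The values at [p] of the derivatives of N
    in directions tangent to [S] do not depend on the extension of N off [S].
    The inner normal makes the curvatures of geodesic spheres positive. *)
Definition principal_curvatures (R : realType) (n : nat) (delta : R)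
    (S : set 'rV[R]_n.+2) (p : 'rV[R]_n.+2) (k : 'I_n -> R) : Prop :=
  exists (N : 'rV[R]_n.+2 -> 'rV[R]_n.+2) (e : 'I_n -> 'rV[R]_n.+2),
    [/\ smooth_at p N,
        \forall x \near p, S x -> inner_unit_normal delta S x (N x),
        forall i, tangent S p (e i),
        forall i j, ambient_prod delta (e i) (e j) = (i == j)%:R &
        forall i, tangential_part delta p ('D_(e i) N p) (- (k i *: e i))].

Definition mean_curvature (R : realType) (n : nat) (k : 'I_n -> R) : R :=
  n%:R^-1 * \sum_(i < n) k i.

Definition higher_mean_curvature (R : realType) (n r : nat)
    (k : 'I_n -> R) : R :=
  'C(n, r)%:R^-1 * \sum_(I : {set 'I_n} | #|I| == r) \prod_(i in I) k i.

Definition unit_speed_geodesic (R : realType) (n : nat) (delta l : R)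
    (c : R -> 'rV[R]_n.+2) : Prop :=
  forall t : R, 0 <= t <= l ->
    [/\ smooth_at t c, space_form delta (c t),
        ambient_prod delta (derive1 c t) (derive1 c t) = 1 &
        tangential_part delta (c t) (derive1n 2 c t) 0].

(** The image under the exponential map at [p] of the tangent vectors of
    norm [rho]. *)
Definition geodesic_sphere (R : realType) (n : nat) (delta : R)
    (p : 'rV[R]_n.+2) (rho : R) : set 'rV[R]_n.+2 :=
  [set q | exists c : R -> 'rV[R]_n.+2,
    [/\ unit_speed_geodesic delta rho c, c 0 = p & c rho = q]].

(* Main.v *)
Require Import Defs.
From mathcomp Require Import all_boot all_order all_algebra reals.
From mathcomp Require polyrcf.
From mathcomp Require Import perm.
From mathcomp Require Import ring lra zify.

(** Alexandrov's method of moving planes. A point of [S] farthest from a base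
    point is elliptic, so by connectedness the principal curvatures stay in the
    Garding cone of the r-th elementary symmetric function; there the equation
    [H_r = a H + b] is elliptic, because Newton-Maclaurin and [b > 0] make the
    derivative of [H_r - a H] with respect to each curvature positive. Hence a
    strong maximum principle, interior and at the boundary, holds for two such
    hypersurfaces tangent at a point with one on one side of the other.

    Reflect the closed domain bounded by [S] across the hyperplanes orthogonal to
    a geodesic issued from a center [c], starting far away. A first contact of
    the reflected cap would make [S] symmetric with respect to a hyperplane that
    avoids [c]; this is impossible when [c] is the center of the smallest ball
    containing [S]. So all reflections through [c] map half of the domain into
    the domain, whence the distance to [c] is constant on [S].

    In the model used here, [psi c x = 1 + delta <x - c, c>] plays the role of
    the (hyperbolic) cosine of the distance, and [sqd] is the squared chord. *)

Set Implicit Arguments.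
Unset Strict Implicit.
Unset Printing Implicit Defensive.

Import Order.TTheory GRing.Theory Num.Theory.
Local Open Scope ring_scope.

(** The curvatures [k p] are given point by point, with no continuity and in no fixed order, and the
    normal fields are chosen separately at each point. Hence eigenvalues are never differentiated:
    the equation is rewritten as a polynomial in the entries of the two fundamental forms of a local
    graph ([weingarten]), and only symmetric functions of [k] are shown continuous. Central
    projection supplies the charts: it is algebraic, treats the three signs of [delta] alike, and
    makes the second fundamental form a multiple of the Hessian of the graph. An inner normal says
    only that one side of [S] is in the domain; that the other side is outside is a global fact,
    carried by connectedness from the point farthest from [base]. The maximum principle is applied
    to a difference of graphs through an inequality frozen at the contact point, which requires
    equal Hessians there: for a contact off the mirror they come from the signs of principal minors,
    for a contact on the mirror from the evenness of quadratic forms. For [delta > 0] the smallest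
    ball is sought on the full sphere, because its competitors may leave the half-sphere. *)

(** * Elementary symmetric functions and the Garding cone *)

Definition esp (R : realType) (T : finType) (k : T -> R) (J : {set T}) (m : nat) : R :=
  \sum_(I : {set T} | (I \subset J) && (#|I| == m)) \prod_(i in I) k i.

Lemma esp0 (R : realType) (T : finType) (k : T -> R) (J : {set T}) :
  esp k J 0 = 1.
Proof.
rewrite /esp (big_pred1 set0) ?big_set0 // => I /=.
by rewrite cards_eq0; have [->|_] := eqVneq I set0; rewrite ?sub0set ?andbF.
Qed.

(** The monomials are sorted by whether they contain [k i]. So [esp k J m.+1] is affine in [k i]
    with slope [esp k (J :\ i) m], and removing an index stands for differentiating throughout. *)
Lemma espS (R : realType) (T : finType) (k : T -> R) (J : {set T}) (i : T) (m : nat) :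
  i \in J -> esp k J m.+1 = k i * esp k (J :\ i) m + esp k (J :\ i) m.+1.
Proof.
move=> iJ; rewrite /esp (bigID (fun I : {set T} => i \in I)) /=; congr (_ + _).
  rewrite (reindex_onto (fun I => i |: I) (fun I => I :\ i)) /=; last first.
    by move=> I /andP[_ iI]; rewrite setD1K.
  rewrite big_distrr /=.
  rewrite (eq_bigl (fun I : {set T} => (I \subset J :\ i) && (#|I| == m))).
    apply: eq_bigr => I /andP[IJ _]; rewrite big_setU1 //=.
    by apply/negP => iI; move/subsetP: IJ => /(_ _ iI); rewrite !inE eqxx.
  move=> I; rewrite setU11 andbT subUset sub1set iJ /=.
  have [iI|iI] := boolP (i \in I).
    have -> : (I \subset J :\ i) = false.
      by apply/negP => /subsetP/(_ _ iI); rewrite !inE eqxx.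
    apply/negP => /andP[_ /eqP e]; move: iI; rewrite -e.
    by rewrite !inE eqxx.
  rewrite setU1K // eqxx andbT cardsU1 iI add1n eqSS subsetD1 iI andbT.
  by [].
apply: eq_bigl => I; rewrite subsetD1.
by rewrite -!andbA; congr (_ && _); rewrite andbC.
Qed.

(** Euler's identity for a homogeneous polynomial: [k i * esp k (J :\ i) m] collects the monomials
    that contain [k i], and each monomial of degree [m.+1] is collected once for each of its
    variables. *)
Lemma esp_euler (R : realType) (T : finType) (k : T -> R) (J : {set T}) (m : nat) :
  \sum_(i in J) k i * esp k (J :\ i) m = m.+1%:R * esp k J m.+1.
Proof.
under eq_bigr => i iJ.
  have -> : k i * esp k (J :\ i) m =
     \sum_(I : {set T} | (I \subset J) && (#|I| == m.+1) && (i \in I)) \prod_(j in I) k j.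
    have := espS k m iJ; rewrite /esp (bigID (fun I : {set T} => i \in I)) /=.
    have -> : \sum_(I : {set T} | (I \subset J) && (#|I| == m.+1) && (i \notin I)) \prod_(j in I) k j
      = \sum_(I : {set T} | (I \subset J :\ i) && (#|I| == m.+1)) \prod_(j in I) k j.
      apply: eq_bigl => I; rewrite subsetD1.
      by rewrite -!andbA; congr (_ && _); rewrite andbC.
    by move/addIr.
  over.
rewrite (exchange_big_dep (fun I : {set T} => (I \subset J) && (#|I| == m.+1))) /=; last first.
  by move=> i I _ /andP[].
rewrite /esp big_distrr /=; apply: eq_bigr => I /andP[IJ /eqP cI].
rewrite (eq_bigl (mem I)); last first.
  move=> i; rewrite IJ cI eqxx /=.
  by have [/(subsetP IJ) ->|_] := boolP (i \in I); rewrite ?andbF.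
by rewrite sumr_const cI mulr_natl.
Qed.

(** A set of [m] indices of [J] survives the removal of [i] for exactly the [#|J| - m] indices [i]
    outside it. *)
Lemma esp_sumD1 (R : realType) (T : finType) (k : T -> R) (J : {set T}) (m : nat) :
  \sum_(i in J) esp k (J :\ i) m = (#|J| - m)%:R * esp k J m.
Proof.
rewrite /esp (exchange_big_dep (fun I : {set T} => (I \subset J) && (#|I| == m))) /=; last first.
  by move=> i I _ /andP[]; rewrite subsetD1 => /andP[-> _].
rewrite big_distrr /=; apply: eq_bigr => I /andP[IJ /eqP cI].
rewrite (eq_bigl (mem (J :\: I))); last first.
  move=> i; rewrite subsetD1 IJ cI eqxx !inE andbT /=.
  by rewrite andbC.
by rewrite sumr_const mulr_natl cardsD (setIidPr IJ) cI.
Qed.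

(* A description of the Garding cone of the r-th elementary symmetric function
   that does not mention real-rootedness: all the iterated partial derivatives
   of order at most r are positive. *)
Definition gcone (R : realType) (T : finType) (r : nat) (J : {set T}) (k : T -> R) :=
  forall I : {set T}, I \subset J -> (#|I| <= r)%N -> 0 < esp k (J :\: I) (r - #|I|).

Definition gcone_cl (R : realType) (T : finType) (r : nat) (J : {set T}) (k : T -> R) :=
  forall I : {set T}, I \subset J -> (#|I| <= r)%N -> 0 <= esp k (J :\: I) (r - #|I|).

Lemma setDU1 (T : finType) (J I : {set T}) (i : T) : J :\: (i |: I) = (J :\ i) :\: I.
Proof. by rewrite setDDl. Qed.

Lemma gconeD1 (R : realType) (T : finType) (r : nat) (J : {set T}) (k : T -> R) i :
  i \in J -> gcone r.+1 J k -> gcone r (J :\ i) k.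
Proof.
move=> iJ g I; rewrite subsetD1 => /andP[IJ iI] cI.
have := g (i |: I); rewrite subUset sub1set iJ IJ cardsU1 iI add1n ltnS subSS setDU1.
by apply.
Qed.

Lemma gcone_clD1 (R : realType) (T : finType) (r : nat) (J : {set T}) (k : T -> R) i :
  i \in J -> gcone_cl r.+1 J k -> gcone_cl r (J :\ i) k.
Proof.
move=> iJ g I; rewrite subsetD1 => /andP[IJ iI] cI.
have := g (i |: I); rewrite subUset sub1set iJ IJ cardsU1 iI add1n ltnS subSS setDU1.
by apply.
Qed.

(* If the derivative [esp (J :\ i) r] vanished, Euler's identity would make
   [esp J r.+1] a nonpositive combination of squares. *)
Lemma gcone_cl_gt0 (R : realType) (T : finType) (r : nat) (J : {set T}) (k : T -> R) :
  gcone_cl r J k -> 0 < esp k J r -> gcone r J k.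
Proof.
elim: r J => [|r IH] J gJ pJ.
  move=> I _; rewrite leqn0 => /eqP ->; by rewrite subnn esp0.
have step i : i \in J -> 0 < esp k (J :\ i) r.
  move=> iJ; set L := J :\ i.
  have := gcone_clD1 iJ gJ => gL.
  have : 0 <= esp k L r by have := gL set0; rewrite sub0set cards0 subn0 setD0; apply.
  rewrite le_eqVlt => /orP[/eqP e|//].
  case: r IH gJ pJ gL e => [|r] IH gJ pJ gL e.
    by move: e; rewrite esp0 => /eqP; rewrite eq_sym oner_eq0.
  exfalso; move: pJ; rewrite (espS k r.+1 iJ) -/L -e mulr0 add0r.
  have := esp_euler k L r.+1.
  have: \sum_(j in L) k j * esp k (L :\ j) r.+1 <= 0.
    apply: sumr_le0 => j jL.
    have := espS k r jL; rewrite -e => /esym/eqP; rewrite addrC addr_eq0 => /eqP ->.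
    rewrite mulrN oppr_le0 mulrA -expr2 mulr_ge0 ?sqr_ge0 //.
    by have := gcone_clD1 jL gL (I := set0); rewrite sub0set cards0 subn0 setD0; apply.
  by move=> h1 h2; move: h1; rewrite h2 pmulr_rle0 ?ltr0n // => h3 h4; rewrite ltNge h3 in h4.
move=> I IJ cI; have [->|[i iI]] := set_0Vmem I.
  by rewrite setD0 cards0 subn0.
have iJ := subsetP IJ _ iI.
have g := IH _ (gcone_clD1 iJ gJ) (step _ iJ).
have := g (I :\ i); rewrite -setDU1 setD1K //.
move: cI; rewrite (cardsD1 i I) iI add1n ltnS subSS => cI; apply => //.
by rewrite subsetD1 setD11 andbT (subset_trans (subD1set _ _)).
Qed.

Lemma gcone_esp (R : realType) (T : finType) (r : nat) (J : {set T}) (k : T -> R) :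
  gcone r J k -> 0 < esp k J r.
Proof.
by move=> /(_ set0); rewrite sub0set cards0 subn0 setD0; apply.
Qed.

(** The positive partial derivatives sum to a multiple of the function one degree lower
    ([esp_sumD1]), so positivity descends in degree; the bound on [r] keeps that multiple
    positive. *)
Lemma gconeW (R : realType) (T : finType) (r : nat) (J : {set T}) (k : T -> R) :
  (r < #|J|)%N -> gcone r.+1 J k -> gcone r J k.
Proof.
elim: r J => [|r IH] J rJ gJ.
  by move=> I _; rewrite leqn0 => /eqP ->; rewrite subnn esp0.
move=> I IJ cI; have [->|[i iI]] := set_0Vmem I; last first.
  have iJ := subsetP IJ _ iI.
  have := IH (J :\ i) _ (gconeD1 iJ gJ) (I :\ i).
  rewrite -setDU1 setD1K //.
  move: cI; rewrite (cardsD1 i I) iI add1n ltnS subSS => cI; apply => //.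
    by move: rJ; rewrite (cardsD1 i J) iJ add1n ltnS.
  by rewrite subsetD1 setD11 andbT (subset_trans (subD1set _ _)).
rewrite setD0 cards0 subn0.
have [i iJ] : exists i, i \in J by apply/set0Pn; rewrite -card_gt0 (leq_ltn_trans _ rJ).
have : 0 < \sum_(i in J) esp k (J :\ i) r.+1.
  rewrite (bigD1 i) //= ltr_pwDl //; first exact: gcone_esp (gconeD1 iJ gJ).
  by apply: sumr_ge0 => j /andP[jJ _]; exact/ltW/gcone_esp/gconeD1.
by rewrite esp_sumD1 pmulr_rgt0 // ltr0n subn_gt0.
Qed.

Lemma gcone_esp1 (R : realType) (T : finType) (r : nat) (J : {set T}) (k : T -> R) :
  (r < #|J|)%N -> gcone r.+1 J k -> 0 < esp k J 1.
Proof.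
elim: r => [|r IH] rJ g; first exact: gcone_esp.
by apply: IH; [exact: ltnW | exact: gconeW].
Qed.

(** Newton-Maclaurin without binomial constants. Splitting off [i] reduces it to
    [e_(r+2) <= e_(r+1) e_1] on [L]. There Euler's identity writes [e_(r+1) e_1 - (r+2) e_(r+2)] as
    a sum of terms [k j ^+ 2 * esp k (L :\ j) r], which are nonnegative in the cone. *)
Lemma gcone_newton (R : realType) (T : finType) (r : nat) (J : {set T}) (k : T -> R) i :
  i \in J -> (r.+1 < #|J|)%N -> gcone r.+2 J k ->
  esp k J r.+2 <= esp k (J :\ i) r.+1 * esp k J 1.
Proof.
move=> iJ rJ g; set L := J :\ i.
have gL : gcone r.+1 L k by exact: gconeD1.
have cL : (r < #|L|)%N by move: rJ; rewrite (cardsD1 i J) iJ add1n.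
rewrite (espS k r.+1 iJ) (espS k 0 iJ) esp0 mulr1 -/L mulrDr mulrC lerD2l.
have pL := gcone_esp gL; have pL1 := gcone_esp1 cL gL.
have [h|h] := lerP (esp k L r.+2) 0; first by rewrite (le_trans h) // ltW // mulr_gt0.
apply: (@le_trans _ _ (r.+2%:R * esp k L r.+2)).
  by rewrite ler_peMl ?ler1n // ltW.
rewrite -esp_euler -subr_ge0.
have -> : esp k L 1 = \sum_(j in L) k j.
  have := esp_euler k L 0; rewrite mul1r => <-.
  by apply: eq_bigr => j _; rewrite esp0 mulr1.
rewrite big_distrr -sumrB /=; apply: sumr_ge0 => j jL.
rewrite (espS k r jL) (_ : _ - _ = k j ^+ 2 * esp k (L :\ j) r); last by ring.
by rewrite mulr_ge0 ?sqr_ge0 // ltW // (gcone_esp (gconeD1 jL gL)).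
Qed.

(** After multiplication by [esp k setT 1 > 0], the equation turns the subtracted term into
    [H_r - b], while [gcone_newton] bounds [H_r] by the other term; [b > 0] makes the inequality
    strict. *)
Lemma gcone_elliptic (R : realType) (n r : nat) (k : 'I_n -> R) (a b : R) (i : 'I_n) :
  (1 < r <= n)%N -> gcone r [set: 'I_n] k -> 0 < b ->
  'C(n, r)%:R^-1 * esp k [set: 'I_n] r = a * (n%:R^-1 * esp k [set: 'I_n] 1) + b ->
  0 < 'C(n, r)%:R^-1 * esp k ([set: 'I_n] :\ i) r.-1 - a * n%:R^-1.
Proof.
case: r => [|[|r]] // /andP[_ rn] g b0 e.
have h := gcone_newton (in_setT i) _ g; rewrite cardsT card_ord in h.
have {h} h := h rn.
have s1 : 0 < esp k [set: 'I_n] 1 by apply: gcone_esp1 g; rewrite cardsT card_ord.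
have C0 : 0 < 'C(n, r.+2)%:R^-1 :> R by rewrite invr_gt0 ltr0n bin_gt0.
rewrite /= subr_gt0 -(ltr_pM2r s1) -mulrA.
rewrite (_ : a * (_ * _) = 'C(n, r.+2)%:R^-1 * esp k [set: 'I_n] r.+2 - b); last by rewrite e addrK.
rewrite ltrBlDr ltr_pwDr // -mulrA ler_pM2l //.
Qed.

(** * The curvature equation as a polynomial in the two fundamental forms *)

Definition pencil (R : realType) (n : nat) (g B : 'M[R]_n) : 'M[{poly R}]_n :=
  \matrix_(i, j) ('X * (g i j)%:P + (B i j)%:P).

(** For [g = P *m P^T] and [B = P *m D *m P^T], with [D] the diagonal matrix of the curvatures, this
    is [det g] times [H_r - a H - b]. Clearing the inverse of the metric leaves a polynomial in the
    entries. *)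
Definition weingarten (R : realType) (n r : nat) (a b : R) (g B : 'M[R]_n) : R :=
  'C(n, r)%:R^-1 * (\det (pencil g B))`_(n - r)
  - a * (n%:R^-1 * (\det (pencil g B))`_(n - 1)) - b * (\det (pencil g B))`_n.

Lemma det_pencil_congr (R : realType) (n : nat) (P : 'M[R]_n) (k : 'I_n -> R) :
  \det (pencil (P *m P^T) (P *m diag_mx (\row_i k i) *m P^T)) =
  (\det P ^+ 2)%:P * \prod_i ('X + (k i)%:P).
Proof.
have -> : pencil (P *m P^T) (P *m diag_mx (\row_i k i) *m P^T) =
    map_mx polyC P *m diag_mx (\row_i ('X + (k i)%:P)) *m (map_mx polyC P)^T.
  apply/matrixP => i j; rewrite !mxE.
  rewrite !rmorph_sum big_distrr -big_split /=; apply: eq_bigr => l _.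
  rewrite !mul_mx_diag !mxE !rmorphM /=; ring.
rewrite !det_mulmx det_tr det_diag det_map_mx rmorphXn /= expr2.
rewrite mulrAC; congr (_ * _); apply: eq_bigr => i _; by rewrite mxE.
Qed.

Lemma esp_gt_card (R : realType) (T : finType) (k : T -> R) (J : {set T}) (m : nat) :
  (#|J| < m)%N -> esp k J m = 0.
Proof.
move=> h; rewrite /esp big_pred0 // => I; apply/negP => /andP[/subset_leq_card IJ /eqP e].
by move: h; rewrite -e ltnNge IJ.
Qed.

Lemma coef_prod_XDC (R : realType) (T : finType) (k : T -> R) (J : {set T}) (m : nat) :
  (\prod_(i in J) ('X + (k i)%:P))`_m =
  if (m <= #|J|)%N then esp k J (#|J| - m) else 0.
Proof.
elim: {J}#|J| {-2}J (erefl #|J|) m => [|c IH] J cJ m.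
  have -> : J = set0 by apply/eqP; rewrite -cards_eq0 cJ.
  rewrite big_set0 coef1 cards0 leqn0; case: m => [|m] //=.
  by rewrite esp0.
have [i iJ] : exists i, i \in J by apply/set0Pn; rewrite -card_gt0 cJ.
have cJi : #|J :\ i| = c by move: cJ; rewrite (cardsD1 i J) iJ add1n => -[].
rewrite (big_setD1 i iJ) /= mulrDl coefD coefXM coefCM !IH // cJi.
case: m => [|m] /=.
  by rewrite cJ !subn0 (espS _ _ iJ) (@esp_gt_card _ _ _ _ c.+1) ?cJi // addr0 add0r.
rewrite cJ ltnS subSS; have [|mc] := leqP m c; last by rewrite ltnNge ltnW // mulr0 addr0.
rewrite leq_eqVlt => /orP[/eqP ->|mc]; first by rewrite ltnn subnn !esp0 mulr0 addr0.
by rewrite mc -(subnSK mc) (espS _ _ iJ) addrC.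
Qed.

(** Its determinant is the principal minor on [I]. Completing by the identity keeps the size [n], so
    that no submatrix has to be reindexed. *)
Definition principal_block (A : pzRingType) (n : nat) (I : {set 'I_n}) (E : 'M[A]_n) : 'M[A]_n :=
  \matrix_(i, j) (if (i \in I) && (j \in I) then E i j else (i == j)%:R).

(** Expanding the product attached to a permutation chooses a set [I] of factors taken from [E]. The
    choice survives only if the permutation fixes every index outside [I], hence preserves [I]. *)
Lemma det_diagD (A : comNzRingType) (n : nat) (d : 'I_n -> A) (E : 'M[A]_n) :
  \det (\matrix_(i, j) (E i j + d i *+ (i == j))) =
  \sum_(I : {set 'I_n}) (\prod_(i | i \notin I) d i) * \det (principal_block I E).
Proof.
rewrite /determinant.
under [LHS]eq_bigr => s _.
  under eq_bigr do rewrite !mxE.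
  rewrite bigA_distr big_distrr /=.
  over.
rewrite exchange_big /=; apply: eq_bigr => I _; rewrite big_distrr /=.
apply: eq_bigr => s _; rewrite mulrCA; congr (_ * _).
have -> : \prod_i principal_block I E i (s i) =
    \prod_i (if (i \in I) && (s i \in I) then E i (s i) else (i == s i)%:R).
  by apply: eq_bigr => i _; rewrite mxE.
have [/existsP[i /andP[iI nis]]|h] := boolP [exists i, (i \notin I) && (i != s i)].
  rewrite [LHS](bigD1 i) //= (negPf iI) (negPf nis) mulr0n mul0r.
  by rewrite [X in _ = _ * X](bigD1 i) //= (negPf iI) (negPf nis) mul0r mulr0.
have fixI i : i \notin I -> s i = i.
  move=> iI; apply/eqP; rewrite eq_sym; apply/negPn/negP => c.
  by move/negP: h; apply; apply/existsP; exists i; rewrite iI.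
have stab i : i \in I -> s i \in I.
  move=> iI; apply/negPn/negP => c; have := fixI _ c => /perm_inj e.
  by rewrite e iI in c.
rewrite [LHS](bigID (mem I)) [X in _ = _ * X](bigID (mem I)) /= [RHS]mulrCA.
congr (_ * _); first by apply: eq_bigr => i iI; rewrite iI stab.
rewrite [X in _ = _ * X]big1 ?mulr1; last by move=> i iI; rewrite (negPf iI) fixI // eqxx.
by apply: eq_bigr => i iI; rewrite (negPf iI) fixI // eqxx.
Qed.

Definition psdmx (R : realType) (n : nat) (E : 'M[R]_n) :=
  forall v : 'rV[R]_n, 0 <= (v *m E *m v^T) 0 0.

Lemma mul_rV_tr (R : realType) (n : nat) (v : 'rV[R]_n) :
  (v *m v^T) 0 0 = \sum_i v 0 i ^+ 2.
Proof. by rewrite mxE; apply: eq_bigr => i _; rewrite mxE expr2. Qed.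

(** The characteristic polynomial of [- E] takes the value [\det (s%:M + E)] at [s]. It has no root
    [s > 0] and is positive far away, so it cannot be negative at 0. *)
Lemma psdmx_det (R : realType) (n : nat) (E : 'M[R]_n) : psdmx E -> 0 <= \det E.
Proof.
move=> pE; pose p := char_poly (- E).
have pev s : p.[s] = \det (s%:M + E).
  rewrite /p /char_poly -horner_evalE -det_map_mx; congr (\det _).
  apply/matrixP => i j; rewrite !mxE /= horner_evalE !hornerE.
  by rewrite opprK hornerMn hornerX.
have pn0 s : 0 < s -> p.[s] != 0.
  move=> s0; rewrite pev -unitfE -[_ \is a _]/(_ \in unitmx) -row_free_unit.
  rewrite -kermx_eq0; apply/negPn/negP => /rowV0Pn[v /sub_kermxP + v0]; rewrite mulmxDr mul_mx_scalar => e.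
  have := congr1 (fun M => (M *m v^T) 0 0) e.
  rewrite mulmxDl mul0mx -scalemxAl [RHS]mxE 2!mxE mul_rV_tr => e2.
  have vp : 0 < \sum_i v 0 i ^+ 2.
    case/rV0Pn: v0 => i vi; rewrite (bigD1 i) //= ltr_pwDl ?exprn_even_gt0 //.
    by apply: sumr_ge0 => *; exact: sqr_ge0.
  have := pE v; rewrite leNgt => /negP; apply.
  have -> : (v *m E *m v^T) 0 0 = - (s * \sum_i v 0 i ^+ 2).
    by apply/eqP; rewrite -addr_eq0 addrC e2.
  by rewrite oppr_lt0 mulr_gt0.
have -> : \det E = p.[0] by rewrite pev raddf0 add0r.
rewrite leNgt; apply/negP => p0.
have [x x0 px] : exists2 x, 0 < x & 0 < p.[x].
  have [|N hN] := @polyrcf.poly_pinfty_gt_lc _ p.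
    by rewrite (monicP (char_poly_monic _)).
  exists (Num.max 1 N); first by rewrite lt_max ltr01.
  have := hN (Num.max 1 N); rewrite le_max lexx orbT (monicP (char_poly_monic _)).
  by move=> /(_ isT); exact: lt_le_trans.
have [|y] := @poly_ivt R p 0 x (ltW x0) _.
  by rewrite ltW // ltW.
move=> /andP[y0 _] /rootP py.
move: y0; rewrite le_eqVlt => /orP[/eqP e|y0]; last by have := pn0 _ y0; rewrite py eqxx.
by move: p0; rewrite {1}e py ltxx.
Qed.

Lemma psdmx_block (R : realType) (n : nat) (I : {set 'I_n}) (E : 'M[R]_n) :
  psdmx E -> psdmx (principal_block I E).
Proof.
move=> pE v; pose w : 'rV[R]_n := \row_i (if i \in I then v 0 i else 0).
have -> : (v *m principal_block I E *m v^T) 0 0 =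
    (w *m E *m w^T) 0 0 + \sum_(i | i \notin I) v 0 i ^+ 2.
  rewrite !mxE.
  under eq_bigr do rewrite !mxE big_distrl /=.
  under [X in X + _]eq_bigr do rewrite !mxE big_distrl /=.
  rewrite exchange_big [X in X + _]exchange_big /= [X in _ + X]big_mkcond -big_split /=.
  apply: eq_bigr => i _; under eq_bigr do rewrite mxE.
  under [X in X + _]eq_bigr do rewrite !mxE.
  have [iI|iI] := boolP (i \in I).
    rewrite addr0; apply: eq_bigr => j _; have [//|jI] := boolP (j \in I).
    have -> : (i == j) = false by apply: contraNF jI => /eqP <-.
    by rewrite /= !(mulr0, mul0r).
  rewrite [X in _ = X + _]big1; last by move=> j _; rewrite !mul0r.
  rewrite add0r /= (bigD1 i) //= eqxx mulr1 -expr2 big1 ?addr0 // => j ji.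
  by rewrite eq_sym (negPf ji) mulr0 mul0r.
by rewrite addr_ge0 //; apply: sumr_ge0 => *; exact: sqr_ge0.
Qed.

Lemma det_pencil1D (R : realType) (n : nat) (k : 'I_n -> R) (E : 'M[R]_n) :
  \det (pencil 1%:M (diag_mx (\row_i k i) + E)) =
  \sum_(I : {set 'I_n}) (\prod_(i in ~: I) ('X + (k i)%:P)) * (\det (principal_block I E))%:P.
Proof.
have -> : pencil 1%:M (diag_mx (\row_i k i) + E) =
    \matrix_(i, j) ((map_mx polyC E) i j + ('X + (k i)%:P) *+ (i == j)).
  apply/matrixP => i j; rewrite !mxE polyCD; case: eqP => _ /=; last first.
    by rewrite polyC0 mulr0 !add0r addr0.
  by rewrite polyC1 mulr1; ring.
rewrite det_diagD; apply: eq_bigr => I _; congr (_ * _).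
  by apply: eq_bigl => i; rewrite inE.
rewrite -det_map_mx; congr (\det _); apply/matrixP => i j; rewrite !mxE.
by case: ifP => // _; case: eqP; rewrite ?polyC1 ?polyC0.
Qed.

Lemma coef_det_pencil1D (R : realType) (n : nat) (k : 'I_n -> R) (E : 'M[R]_n) (m : nat) :
  (m <= n)%N ->
  (\det (pencil 1%:M (diag_mx (\row_i k i) + E)))`_(n - m) =
  \sum_(I : {set 'I_n} | (#|I| <= m)%N) esp k (~: I) (m - #|I|) * \det (principal_block I E).
Proof.
move=> mn; rewrite det_pencil1D coef_sum [RHS]big_mkcond /=; apply: eq_bigr => I _.
rewrite coefMC coef_prod_XDC cardsCs setCK card_ord.
have cI : (#|I| <= n)%N by rewrite -[X in (_ <= X)%N](card_ord n) max_card.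
have -> : (n - m <= n - #|I|)%N = (#|I| <= m)%N by lia.
case: ifP => h; last by rewrite mul0r.
by rewrite subnAC subKn.
Qed.

Lemma det_block0 (R : realType) (n : nat) (E : 'M[R]_n) :
  \det (principal_block set0 E) = 1.
Proof.
rewrite (_ : principal_block _ _ = 1%:M) ?det1 //.
by apply/matrixP => i j; rewrite !mxE inE.
Qed.

Lemma det_block1 (R : realType) (n : nat) (E : 'M[R]_n) (i : 'I_n) :
  \det (principal_block [set i] E) = E i i.
Proof.
rewrite (_ : principal_block _ _ = diag_mx (\row_j (if j == i then E i i else 1))).
  rewrite det_diag (bigD1 i) //= mxE eqxx big1 ?mulr1 // => j ji.
  by rewrite mxE (negPf ji).
apply/matrixP => j l; rewrite !mxE !inE.
have [->|ji] := eqVneq j i; have [->|li] := eqVneq l i; rewrite ?eqxx //=.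
Qed.

Lemma big_card_le1 (R : realType) (n : nat) (F : {set 'I_n} -> R) :
  \sum_(I : {set 'I_n} | (#|I| <= 1)%N) F I = F set0 + \sum_i F [set i].
Proof.
rewrite (bigD1 set0) ?cards0 //=; congr (_ + _).
rewrite (eq_bigl (fun I : {set 'I_n} => #|I| == 1)%N); last first.
  by move=> I; rewrite -cards_eq0; case: #|I| => [|[|]].
rewrite (reindex_omap (fun i => [set i]) (@unset1 _)) /=; last first.
  by move=> I /cards1P[i ->]; rewrite set1K.
by apply: eq_bigl => i; rewrite cards1 set1K !eqxx.
Qed.

(** The derivative of [H_r - a H] in the curvature [k i]. *)
Definition elliptic_coef (R : realType) (n r : nat) (a : R) (k : 'I_n -> R) (i : 'I_n) : R :=
  'C(n, r)%:R^-1 * esp k ([set: 'I_n] :\ i) r.-1 - a * n%:R^-1.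

(** Expansion along the principal minors of [E]: sizes 0 and 1 give the value and the differential,
    and the coefficients of the larger minors are positive in the cone. *)
Lemma weingarten_expand (R : realType) (n r : nat) (a b : R) (k : 'I_n -> R) (E : 'M[R]_n) :
  (1 < r <= n)%N ->
  weingarten r a b 1%:M (diag_mx (\row_i k i) + E) =
  weingarten r a b 1%:M (diag_mx (\row_i k i)) + \sum_i elliptic_coef r a k i * E i i +
  'C(n, r)%:R^-1 * \sum_(I : {set 'I_n} | (1 < #|I| <= r)%N)
     esp k (~: I) (r - #|I|) * \det (principal_block I E).
Proof.
move=> /andP[r1 rn]; have n1 : (1 <= n)%N by lia.
rewrite -[in RHS](addr0 (diag_mx _)) /weingarten.
have c0 (M : 'M[R]_n) : (\det (pencil 1%:M (diag_mx (\row_i k i) + M)))`_n =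
    \sum_(I : {set 'I_n} | (#|I| <= 0)%N) esp k (~: I) (0 - #|I|) * \det (principal_block I M).
  by rewrite -coef_det_pencil1D // subn0.
rewrite !c0 !coef_det_pencil1D //.
have e0 (M : 'M[R]_n) : \sum_(I : {set 'I_n} | (#|I| <= 0)%N) esp k (~: I) (0 - #|I|) * \det (principal_block I M) = 1.
  rewrite (big_pred1 set0) => [|I /=]; last by rewrite leqn0 cards_eq0.
  by rewrite cards0 esp0 det_block0 mulr1.
have z i : \det (principal_block [set i] (0 : 'M[R]_n)) = 0 by rewrite det_block1 mxE.
have e1 (M : 'M[R]_n) : \sum_(I : {set 'I_n} | (#|I| <= 1)%N) esp k (~: I) (1 - #|I|) * \det (principal_block I M)
    = esp k setT 1 + \sum_i M i i.
  rewrite big_card_le1 cards0 subn0 det_block0 mulr1 setC0; congr (_ + _).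
  by apply: eq_bigr => i _; rewrite cards1 subnn esp0 mul1r det_block1.
have er (M : 'M[R]_n) : \sum_(I : {set 'I_n} | (#|I| <= r)%N) esp k (~: I) (r - #|I|) * \det (principal_block I M)
    = esp k setT r + \sum_i esp k (setT :\ i) r.-1 * M i i +
   \sum_(I : {set 'I_n} | (1 < #|I| <= r)%N) esp k (~: I) (r - #|I|) * \det (principal_block I M).
  rewrite (bigID (fun I : {set 'I_n} => (#|I| <= 1)%N)) /=; congr (_ + _).
    rewrite (eq_bigl (fun I : {set 'I_n} => (#|I| <= 1)%N)); last first.
      by move=> I; apply/andP/idP => [[]//|h]; rewrite (leq_trans h (ltnW r1)).
    rewrite big_card_le1 cards0 subn0 det_block0 mulr1 setC0; congr (_ + _).
    by apply: eq_bigr => i _; rewrite cards1 subn1 det_block1 setTD.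
  by apply: eq_bigl => I; rewrite -ltnNge andbC.
rewrite !e0 !e1 !er.
have -> : \sum_(I : {set 'I_n} | (1 < #|I| <= r)%N)
  esp k (~: I) (r - #|I|) * \det (principal_block I (0 : 'M[R]_n)) = 0.
  apply: big1 => I /andP[cI _]; have [i iI] : exists i, i \in I by apply/set0Pn; rewrite -card_gt0 ltnW.
  rewrite (expand_det_row _ i) big1 ?mulr0 // => j _.
  rewrite mxE iI /= mxE; case: ifP => [_|]; first by rewrite mul0r.
  by case: eqP => [<-|_ _]; rewrite ?iI // mul0r.
have -> : \sum_i elliptic_coef r a k i * E i i =
   'C(n, r)%:R^-1 * (\sum_i esp k (setT :\ i) r.-1 * E i i) - a * (n%:R^-1 * \sum_i E i i).
  rewrite !big_distrr /= -sumrB; apply: eq_bigr => i _; rewrite /elliptic_coef; ring.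
have -> : \sum_i (0 : 'M[R]_n) i i = 0 by apply: big1 => i _; rewrite mxE.
have -> : \sum_i esp k (setT :\ i) r.-1 * (0 : 'M[R]_n) i i = 0.
  by apply: big1 => i _; rewrite mxE mulr0.
ring.
Qed.

Lemma psdmx_diag_ge0 (R : realType) (n : nat) (E : 'M[R]_n) (i : 'I_n) :
  psdmx E -> 0 <= E i i.
Proof.
move=> /(_ (delta_mx 0 i)); rewrite -rowE mxE (bigD1 i) //= !mxE !eqxx mulr1.
rewrite big1 ?addr0 // => j ji; by rewrite !mxE (negPf ji) mulr0.
Qed.

Lemma psdmx_offdiag (R : realType) (n : nat) (E : 'M[R]_n) (i j : 'I_n) :
  psdmx E -> E^T = E -> 2 * `|E i j| <= E i i + E j j.
Proof.
move=> pE sE; have sym : E j i = E i j by rewrite -{1}sE mxE.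
have key (c : R) : 0 <= E i i + 2 * c * E i j + c ^+ 2 * E j j.
  have := pE (delta_mx 0 i + c *: delta_mx 0 j).
  rewrite mulmxDl -scalemxAl -!rowE linearD linearZ /= !trmx_delta.
  rewrite mulmxDr -scalemxAr -!colE !mxE sym.
  move=> h; apply: le_trans h _; rewrite le_eqVlt; apply/orP; left; apply/eqP; ring.
have := key 1; have := key (-1); rewrite sqrrN !expr1n !mul1r mulr1 mulrN1.
case: (ler0P (E i j)) => h; lra.
Qed.

(** Every term of [weingarten_expand] is nonnegative when [E] is positive semidefinite, so all of
    them vanish. The positive coefficients kill the diagonal of [E], and a positive semidefinite
    matrix with zero diagonal is zero. *)
Lemma weingarten_touch (R : realType) (n r : nat) (a b : R) (k : 'I_n -> R) (E : 'M[R]_n) :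
  (1 < r <= n)%N -> gcone r [set: 'I_n] k -> (forall i, 0 < elliptic_coef r a k i) ->
  weingarten r a b 1%:M (diag_mx (\row_i k i)) = 0 ->
  weingarten r a b 1%:M (diag_mx (\row_i k i) + E) = 0 ->
  psdmx E -> E^T = E -> E = 0.
Proof.
move=> hr gk Fpos W0; rewrite weingarten_expand // W0 add0r => e pE sE.
have rest : 0 <= 'C(n, r)%:R^-1 * \sum_(I : {set 'I_n} | (1 < #|I| <= r)%N)
     esp k (~: I) (r - #|I|) * \det (principal_block I E).
  rewrite mulr_ge0 ?invr_ge0 ?ler0n // sumr_ge0 // => I /andP[_ Ir].
  rewrite mulr_ge0 ?psdmx_det //; last exact: psdmx_block.
  by rewrite ltW // -setTD gk ?subsetT.
have d0 i : E i i = 0.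
  have pos j : 0 <= elliptic_coef r a k j * E j j.
    by rewrite mulr_ge0 ?psdmx_diag_ge0 // ltW.
  have s0 : \sum_j elliptic_coef r a k j * E j j = 0.
    apply/eqP; rewrite eq_le sumr_ge0 // andbT.
    by move/eqP: e; rewrite addr_eq0 => /eqP ->; rewrite oppr_le0.
  have := s0; move=> /eqP; rewrite psumr_eq0 // => /allP/(_ i).
  rewrite mem_index_enum /= mulf_eq0 (gt_eqF (Fpos i)) /= => h; exact/eqP/h.
apply/matrixP => i j; rewrite mxE; apply/eqP; rewrite -normr_le0.
by have := psdmx_offdiag i j pE sE; rewrite !d0; lra.
Qed.

(** * Strict differentiability of the curvature operator *)

Section StrictDifferentiability.
Context (R : realType) (T : finType) (z0 : T -> R).

Definition near_pt (t : R) (z : T -> R) := forall i, `|z i - z0 i| <= t.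

(** Strict differentiability at [z0]: both ends of the increment vary. Subtracting the equations of
    two nearby solutions needs this, since neither of them sits at [z0]. *)
Definition sdiff (phi : (T -> R) -> R) (c : T -> R) :=
  forall eta : R, 0 < eta -> exists2 t : R, 0 < t &
    forall z1 z2, near_pt t z1 -> near_pt t z2 ->
    `|phi z1 - phi z2 - \sum_i c i * (z1 i - z2 i)| <= eta * \sum_i `|z1 i - z2 i|.

Lemma near_ptW t t' z : t <= t' -> near_pt t z -> near_pt t' z.
Proof. by move=> h H i; exact: le_trans (H i) h. Qed.

Lemma sdiff_cst a : sdiff (fun _ => a) (fun _ => 0).
Proof.
move=> eta e0; exists 1 => // z1 z2 _ _; rewrite subrr big1 ?subr0 ?normr0 => [|i _].
  by rewrite mulr_ge0 ?sumr_ge0 // ltW.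
by rewrite mul0r.
Qed.

Lemma sdiff_coord j : sdiff (fun z => z j) (fun i => (i == j)%:R).
Proof.
move=> eta e0; exists 1 => // z1 z2 _ _; rewrite (bigD1 j) //= eqxx mul1r.
rewrite big1 ?addr0 => [|i /negPf ->]; last by rewrite mul0r.
by rewrite subrr normr0 mulr_ge0 ?sumr_ge0 // ltW.
Qed.

Lemma sdiff_lip phi c : sdiff phi c -> exists2 L : R, 0 <= L & exists2 t : R, 0 < t &
  forall z1 z2, near_pt t z1 -> near_pt t z2 ->
    `|phi z1 - phi z2| <= L * \sum_i `|z1 i - z2 i|.
Proof.
move=> /(_ 1 ltr01)[t t0 H].
have c0 : 0 <= \sum_i `|c i| by apply: sumr_ge0.
exists (\sum_i `|c i| + 1); first by rewrite addr_ge0.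
exists t => // z1 z2 h1 h2; have := H _ _ h1 h2.
set S := \sum_i c i * _; set N := \sum_i `|z1 i - _|; rewrite mul1r => h.
have hS : `|S| <= (\sum_i `|c i|) * N.
  apply: (le_trans (ler_norm_sum _ _ _)); rewrite big_distrl /=.
  apply: ler_sum => i _; rewrite normrM ler_wpM2l //.
  by rewrite /N (bigD1 i) //= lerDl sumr_ge0.
rewrite mulrDl mul1r -[phi z1 - phi z2](subrK S) addrC.
by apply: (le_trans (ler_normD _ _)); rewrite lerD.
Qed.

Lemma sdiffD phi psi c d : sdiff phi c -> sdiff psi d ->
  sdiff (fun z => phi z + psi z) (fun i => c i + d i).
Proof.
move=> Hc Hd eta e0; have e2 : 0 < eta / 2 by rewrite divr_gt0.
have [t t0 H1] := Hc _ e2; have [u u0 H2] := Hd _ e2.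
exists (Num.min t u); first by rewrite lt_min t0.
have mt : Num.min t u <= t by rewrite ge_min lexx.
have mu : Num.min t u <= u by rewrite ge_min lexx orbT.
move=> z1 z2 h1 h2.
have := H1 z1 z2 (near_ptW mt h1) (near_ptW mt h2).
have := H2 z1 z2 (near_ptW mu h1) (near_ptW mu h2).
have -> : \sum_i (c i + d i) * (z1 i - z2 i) =
   \sum_i c i * (z1 i - z2 i) + \sum_i d i * (z1 i - z2 i).
  by rewrite -big_split /=; apply: eq_bigr => i _; rewrite mulrDl.
set X := \sum_i c i * _; set Y := \sum_i d i * _; set N := \sum_i _ => A1 A2.
have -> : phi z1 + psi z1 - (phi z2 + psi z2) - (X + Y) =
  (phi z1 - phi z2 - X) + (psi z1 - psi z2 - Y) by ring.
by apply: (le_trans (ler_normD _ _)); lra.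
Qed.

Lemma sdiffM phi psi c d : sdiff phi c -> sdiff psi d ->
  sdiff (fun z => phi z * psi z) (fun i => c i * psi z0 + phi z0 * d i).
Proof.
move=> Hc Hd eta e0.
have [L L0 [t1 t10 lipL]] := sdiff_lip Hc; have [M M0 [t2 t20 lipM]] := sdiff_lip Hd.
(* The increment of the product is split into four pieces. [B] bounds the two factors and [f] their
   oscillation, so that each piece with a remainder costs [eta / 4] and the other two cost [eta / 4]
   together. *)
pose B := `|psi z0| + `|phi z0| + 1.
have B0 : 0 < B by rewrite ltr_wpDl // addr_ge0.
pose Cc := \sum_i `|c i|; pose Cd := \sum_i `|d i|.
have Cc0 : 0 <= Cc by apply: sumr_ge0.
have Cd0 : 0 <= Cd by apply: sumr_ge0.
pose e := eta / (4 * B).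
have e_gt0 : 0 < e by rewrite divr_gt0 // mulr_gt0.
have [t3 t30 H1] := Hc _ e_gt0; have [t4 t40 H2] := Hd _ e_gt0.
pose K := (L + M) * #|T|%:R.
have K0 : 0 <= K by rewrite mulr_ge0 ?addr_ge0.
pose f := Num.min 1 (eta / (4 * (Cc + Cd + 1))).
have q0 : 0 < 4 * (Cc + Cd + 1) by rewrite mulr_gt0 // ltr_wpDl // addr_ge0.
have f0 : 0 < f by rewrite lt_min ltr01 divr_gt0.
pose t5 := f / (K + 1).
have t50 : 0 < t5 by rewrite divr_gt0 // ltr_wpDl.
pose t := Num.min t1 (Num.min t2 (Num.min t3 (Num.min t4 t5))).
have tt1 : t <= t1 by rewrite ge_min lexx.
have tt2 : t <= t2 by rewrite !ge_min lexx orbT.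
have tt3 : t <= t3 by rewrite !ge_min lexx !orbT.
have tt4 : t <= t4 by rewrite !ge_min lexx !orbT.
have tt5 : t <= t5 by rewrite !ge_min lexx !orbT.
have t0 : 0 < t by rewrite !lt_min t10 t20 t30 t40.
have nz0 : near_pt t z0 by move=> i; rewrite subrr normr0 ltW.
have small z : near_pt t z -> \sum_i `|z i - z0 i| <= #|T|%:R * t5.
  move=> h; rewrite mulr_natl -sumr_const; apply: ler_sum => i _.
  exact: le_trans (h i) tt5.
have KT : (L + M) * (#|T|%:R * t5) <= f.
  rewrite mulrA -/K /t5 mulrCA ger_pMr // ler_pdivrMr ?mul1r ?ltr_wpDl //.
  by rewrite lerDl ler01.
have Tt5 : 0 <= #|T|%:R * t5 by apply: mulr_ge0 => //; exact: ltW.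
have LT : L * (#|T|%:R * t5) <= f.
  by apply: le_trans KT; rewrite ler_wpM2r // lerDl.
have MT : M * (#|T|%:R * t5) <= f.
  by apply: le_trans KT; rewrite ler_wpM2r // lerDr.
have f1 : f <= 1 by rewrite ge_min lexx.
have fC : f * (Cc + Cd + 1) <= eta / 4.
  apply: (@le_trans _ _ (eta / (4 * (Cc + Cd + 1)) * (Cc + Cd + 1))).
    rewrite ler_wpM2r ?addr_ge0 // ?ge_min ?lexx ?orbT //.
  by rewrite le_eqVlt; apply/orP; left; apply/eqP; field; rewrite gt_eqF // ltr_wpDl // addr_ge0.
exists t => // z1 z2 h1 h2.
set N := \sum_i `|z1 i - z2 i|.
have N0 : 0 <= N by apply: sumr_ge0.
have /= P1 := lipL _ _ (near_ptW tt1 h2) (near_ptW tt1 nz0).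
have /= P2 := lipM _ _ (near_ptW tt2 h1) (near_ptW tt2 nz0).
have {}P1 : `|phi z2 - phi z0| <= f by apply: le_trans P1 (le_trans _ LT); rewrite ler_wpM2l // small.
have {}P2 : `|psi z1 - psi z0| <= f by apply: le_trans P2 (le_trans _ MT); rewrite ler_wpM2l // small.
have := H1 _ _ (near_ptW tt3 h1) (near_ptW tt3 h2); rewrite -/N.
have := H2 _ _ (near_ptW tt4 h1) (near_ptW tt4 h2); rewrite -/N.
set X := \sum_i c i * (z1 i - z2 i); set Y := \sum_i d i * (z1 i - z2 i) => E2 E1.
have -> : \sum_i (c i * psi z0 + phi z0 * d i) * (z1 i - z2 i) = X * psi z0 + phi z0 * Y.
  by rewrite big_distrl big_distrr -big_split /=; apply: eq_bigr => i _; ring.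
have XN : `|X| <= Cc * N.
  apply: (le_trans (ler_norm_sum _ _ _)); rewrite big_distrl /=.
  apply: ler_sum => i _; rewrite normrM ler_wpM2l //.
  by rewrite /N (bigD1 i) //= lerDl sumr_ge0.
have YN : `|Y| <= Cd * N.
  apply: (le_trans (ler_norm_sum _ _ _)); rewrite big_distrl /=.
  apply: ler_sum => i _; rewrite normrM ler_wpM2l //.
  by rewrite /N (bigD1 i) //= lerDl sumr_ge0.
have -> : phi z1 * psi z1 - phi z2 * psi z2 - (X * psi z0 + phi z0 * Y) =
   (phi z1 - phi z2 - X) * psi z1 + X * (psi z1 - psi z0)
   + (phi z2 * (psi z1 - psi z2 - Y) + (phi z2 - phi z0) * Y) by ring.
have b1 : `|psi z1| <= B.
  rewrite -[psi z1](subrK (psi z0)); apply: (le_trans (ler_normD _ _)).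
  by have := normr_ge0 (phi z0); rewrite /B; lra.
have b2 : `|phi z2| <= B.
  rewrite -[phi z2](subrK (phi z0)); apply: (le_trans (ler_normD _ _)).
  by have := normr_ge0 (psi z0); rewrite /B; lra.
have eB : e * B = eta / 4 by rewrite /e; field; rewrite gt_eqF.
have T1 : `|(phi z1 - phi z2 - X) * psi z1| <= eta / 4 * N.
  rewrite normrM (le_trans (ler_pM _ _ E1 b1)) //.
  by rewrite mulrAC eB.
have T3 : `|phi z2 * (psi z1 - psi z2 - Y)| <= eta / 4 * N.
  rewrite normrM (le_trans (ler_pM _ _ b2 E2)) //.
  by rewrite mulrA [B * e]mulrC eB.
have T2 : `|X * (psi z1 - psi z0)| <= (f * Cc) * N.
  by rewrite normrM (le_trans (ler_pM _ _ XN P2)) // mulrC mulrA.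
have T4 : `|(phi z2 - phi z0) * Y| <= (f * Cd) * N.
  by rewrite normrM (le_trans (ler_pM _ _ P1 YN)) // mulrA.
have T5 : (f * Cc) * N + (f * Cd) * N <= eta / 4 * N.
  rewrite -mulrDl ler_wpM2r // (le_trans _ fC) // -mulrDr ler_wpM2l ?(ltW f0) //.
  by rewrite lerDl ler01.
apply: (le_trans (ler_normD _ _)).
have := ler_normD ((phi z1 - phi z2 - X) * psi z1) (X * (psi z1 - psi z0)).
have := ler_normD (phi z2 * (psi z1 - psi z2 - Y)) ((phi z2 - phi z0) * Y).
have eN : 0 <= eta * N by rewrite mulr_ge0 // ltW.
have -> : eta * N = 4 * (eta / 4 * N) by field.
have : 0 <= eta / 4 * N by rewrite mulr_ge0 // divr_ge0 // ltW.
lra.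
Qed.

Definition sdiffp (phi : (T -> R) -> {poly R}) :=
  forall m, exists c, sdiff (fun z => (phi z)`_m) c.

Lemma eq_sdiff phi psi c : phi =1 psi -> sdiff phi c -> sdiff psi c.
Proof.
move=> e H eta e0; have [t t0 h] := H _ e0.
by exists t => // z1 z2 h1 h2; rewrite -!e h.
Qed.

Lemma sdiff_sum (I : eqType) (s : seq I) (F : I -> (T -> R) -> R) :
  (forall i, exists c, sdiff (F i) c) -> exists c, sdiff (fun z => \sum_(i <- s) F i z) c.
Proof.
move=> H; elim: s => [|i s [c IH]].
  by exists (fun=> 0); apply: eq_sdiff (sdiff_cst 0) => z; rewrite big_nil.
have [d Hd] := H i.
exists (fun j => d j + c j); apply: eq_sdiff (sdiffD Hd IH) => z; by rewrite big_cons.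
Qed.

Lemma sdiffp_cst p : sdiffp (fun _ => p).
Proof. by move=> m; exists (fun=> 0); exact: sdiff_cst. Qed.

Lemma sdiffp_coord i : sdiffp (fun z => (z i)%:P).
Proof.
move=> m; have [->|m0] := eqVneq m 0%N.
  by exists (fun j => (j == i)%:R); apply: eq_sdiff (sdiff_coord i) => z; rewrite coefC.
by exists (fun=> 0); apply: eq_sdiff (sdiff_cst 0) => z; rewrite coefC (negPf m0).
Qed.

Lemma sdiffpD phi psi : sdiffp phi -> sdiffp psi -> sdiffp (fun z => phi z + psi z).
Proof.
move=> H1 H2 m; have [c Hc] := H1 m; have [d Hd] := H2 m.
by exists (fun i => c i + d i); apply: eq_sdiff (sdiffD Hc Hd) => z; rewrite coefD.
Qed.

Lemma sdiffpM phi psi : sdiffp phi -> sdiffp psi -> sdiffp (fun z => phi z * psi z).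
Proof.
move=> H1 H2 m.
have [] := @sdiff_sum _ (index_enum 'I_m.+1) (fun j z => (phi z)`_j * (psi z)`_(m - j)).
  move=> j; have [c Hc] := H1 j; have [d Hd] := H2 (m - j)%N.
  by exists (fun i => c i * (psi z0)`_(m - j) + (phi z0)`_j * d i); exact: sdiffM.
by move=> c Hc; exists c; apply: eq_sdiff Hc => z; rewrite coefM.
Qed.

Lemma sdiffp_sum (I : finType) (F : I -> (T -> R) -> {poly R}) :
  (forall i, sdiffp (F i)) -> sdiffp (fun z => \sum_i F i z).
Proof.
move=> H m; have [] := @sdiff_sum _ (index_enum I) (fun i z => (F i z)`_m).
  by move=> i; exact: H.
by move=> c Hc; exists c; apply: eq_sdiff Hc => z; rewrite coef_sum.
Qed.

Lemma sdiffp_prod (I : finType) (F : I -> (T -> R) -> {poly R}) :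
  (forall i, sdiffp (F i)) -> sdiffp (fun z => \prod_i F i z).
Proof.
move=> H; elim: (index_enum I) => [|i s IH].
  move=> m; have [c Hc] := sdiffp_cst 1 m.
  by exists c; apply: eq_sdiff Hc => z; rewrite big_nil.
move=> m; have [c Hc] := sdiffpM (H i) IH m.
by exists c; apply: eq_sdiff Hc => z; rewrite big_cons.
Qed.

End StrictDifferentiability.

Lemma sdiffZ (R : realType) (T : finType) (z0 : T -> R) phi c a :
  sdiff z0 phi c -> exists d, sdiff z0 (fun z => a * phi z) d.
Proof.
move=> H; have := sdiffM (sdiff_cst z0 a) H; set d := (X in sdiff _ _ X) => Hd.
by exists d.
Qed.

Definition pair_mx (R : realType) (n : nat) (z : bool * ('I_n * 'I_n) -> R) (s : bool) : 'M[R]_n :=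
  \matrix_(i, j) z (s, (i, j)).

Definition mx_pair (R : realType) (n : nat) (g B : 'M[R]_n) (t : bool * ('I_n * 'I_n)) : R :=
  if t.1 then g t.2.1 t.2.2 else B t.2.1 t.2.2.

Lemma mx_pairK (R : realType) (n : nat) (g B : 'M[R]_n) :
  (pair_mx (mx_pair g B) true = g) * (pair_mx (mx_pair g B) false = B).
Proof. by split; apply/matrixP => i j; rewrite mxE. Qed.

Lemma sdiff_weingarten (R : realType) (n r : nat) (a b : R) (z0 : bool * ('I_n * 'I_n) -> R) :
  exists c, sdiff z0 (fun z => weingarten r a b (pair_mx z true) (pair_mx z false)) c.
Proof.
have H : sdiffp z0 (fun z => \det (pencil (pair_mx z true) (pair_mx z false))).
  apply: sdiffp_sum => s; apply: sdiffpM; first exact: sdiffp_cst.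
  apply: sdiffp_prod => i m.
  have [c Hc] := sdiffpD (sdiffpM (sdiffp_cst z0 'X) (sdiffp_coord z0 (true, (i, s i))))
     (sdiffp_coord z0 (false, (i, s i))) m.
  by exists c; apply: eq_sdiff Hc => z; rewrite !mxE.
have [c1 H1] := H (n - r)%N; have [c2 H2] := H (n - 1)%N; have [c3 H3] := H n.
have [d1 D1] := sdiffZ ('C(n, r)%:R^-1) H1.
have [d2 D2] := sdiffZ (- (a * n%:R^-1)) H2.
have [d3 D3] := sdiffZ (- b) H3.
have := sdiffD (sdiffD D1 D2) D3; set d := (X in sdiff _ _ X) => D.
exists d; apply: eq_sdiff D => z; rewrite /weingarten; ring.
Qed.

(** A matrix with a single nonzero entry has no nonzero principal minor of size 2 or more, so the
    operator is exactly affine in that entry. *)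
Lemma weingarten_delta (R : realType) (n r : nat) (a b : R) (k : 'I_n -> R) (i j : 'I_n) (t : R) :
  (1 < r <= n)%N ->
  weingarten r a b 1%:M (diag_mx (\row_i k i) + t *: delta_mx i j) =
  weingarten r a b 1%:M (diag_mx (\row_i k i)) + elliptic_coef r a k i *+ (i == j) * t.
Proof.
move=> hr; rewrite weingarten_expand // -addrA; congr (_ + _).
rewrite [X in _ * X]big1 ?mulr0 ?addr0; last first.
  move=> I /andP[cI _]; apply/eqP; rewrite mulf_eq0; apply/orP; right; apply/eqP.
  have [l lI li] : exists2 l, l \in I & l != i.
    have : (0 < #|I :\ i|)%N by move: cI; rewrite (cardsD1 i I); case: (i \in I); [rewrite add1n ltnS | rewrite add0n => /ltnW].
    by rewrite card_gt0 => /set0Pn[l]; rewrite !inE => /andP[li lI]; exists l.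
  rewrite (expand_det_row _ l) big1 // => m _; rewrite !mxE lI /= (negPf li) mulr0.
  case: ifP => [_|/negP mI]; first by rewrite mul0r.
  by case: eqP mI => [<-|_ _]; rewrite ?lI // mul0r.
rewrite (bigD1 i) //= big1 ?addr0 => [|l li]; last by rewrite !mxE (negPf li) mulr0 mulr0.
by rewrite !mxE eqxx /=; case: eqP => _; rewrite ?mulr1 ?mulr0 ?mulr0n ?mul0r ?mulr1n.
Qed.

(** Moving one entry of [B] at a time identifies the part in [B] of the strict derivative. The part
    in [g] is only bounded, by [C]: the metric depends on lower order terms of the graph. *)
Lemma weingarten_linear (R : realType) (n r : nat) (a b : R) (k : 'I_n -> R) :
  (1 < r <= n)%N ->
  exists2 C : R, 0 <= C & forall eta : R, 0 < eta -> exists2 t : R, 0 < t &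
  forall g1 g2 B1 B2 : 'M[R]_n,
   (forall i j, `|g1 i j - (i == j)%:R| <= t) -> (forall i j, `|g2 i j - (i == j)%:R| <= t) ->
   (forall i j, `|B1 i j - k i *+ (i == j)| <= t) ->
   (forall i j, `|B2 i j - k i *+ (i == j)| <= t) ->
   `|weingarten r a b g1 B1 - weingarten r a b g2 B2
     - \sum_i elliptic_coef r a k i * (B1 i i - B2 i i)| <=
   eta * \sum_i \sum_j `|B1 i j - B2 i j| + C * \sum_i \sum_j `|g1 i j - g2 i j|.
Proof.
move=> hr; pose z0 := mx_pair 1%:M (diag_mx (\row_i k i)).
have [c Hc] := sdiff_weingarten r a b z0.
have cB i j : c (false, (i, j)) = elliptic_coef r a k i *+ (i == j).
  apply/eqP; rewrite eq_sym -subr_eq0 -normr_le0; apply/ler_addgt0Pl => e e0.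
  have [t t0 Ht] := Hc _ e0.
  pose z1 := mx_pair 1%:M (diag_mx (\row_i k i) + t *: delta_mx i j).
  have n0 : near_pt z0 t z0 by move=> l; rewrite subrr normr0 ltW.
  have zE l : z1 l - z0 l = t *+ (l == (false, (i, j))).
    case: l => -[] [l m] /=; rewrite /z1 /z0 /mx_pair /= ?subrr //.
    rewrite !mxE addrAC subrr add0r !xpair_eqE /=.
    by case: eqP => _; case: eqP => _; rewrite ?mulr1 ?mulr0.
  have n1 : near_pt z0 t z1.
    move=> l; rewrite zE; case: eqP => _; last by rewrite normr0 ltW.
    by rewrite gtr0_norm.
  have := Ht _ _ n1 n0; rewrite !mx_pairK weingarten_delta //.
  rewrite (bigD1 (false, (i, j))) //= zE eqxx big1 ?addr0 => [|l /negPf nl]; last first.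
    by rewrite zE nl mulr0.
  rewrite (bigD1 (false, (i, j))) //= zE eqxx big1 ?addr0 => [|l /negPf nl]; last first.
    by rewrite zE nl normr0.
  rewrite mulr1n [_ + _ * t]addrC addrK -mulrBl normrM (gtr0_norm t0) ler_pM2r // addr0.
pose C := \sum_l `|c l| + 1.
have C0 : 0 <= C by rewrite addr_ge0 // sumr_ge0.
exists C => // eta e0.
(* Capping [eta] by 1 lets the summand 1 of [C] absorb the remainder due to [g]. *)
have e1 : 0 < Num.min eta 1 by rewrite lt_min e0 ltr01.
have [t t0 Ht] := Hc _ e1; exists t => // g1 g2 B1 B2 hg1 hg2 hB1 hB2.
have np (g B : 'M[R]_n) : (forall i j, `|g i j - (i == j)%:R| <= t) ->
    (forall i j, `|B i j - k i *+ (i == j)| <= t) -> near_pt z0 t (mx_pair g B).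
  by move=> hg hB [[] [i j]]; rewrite /z0 /mx_pair /= !mxE.
have := Ht _ _ (np _ _ hg1 hB1) (np _ _ hg2 hB2); rewrite !mx_pairK.
have bigE (F : bool * ('I_n * 'I_n) -> R) :
   \sum_l F l = \sum_i \sum_j F (true, (i, j)) + \sum_i \sum_j F (false, (i, j)).
  rewrite (_ : \sum_l F l = \sum_s \sum_p F (s, p)); last first.
    by rewrite pair_bigA; apply: eq_bigr => -[].
  by rewrite big_bool /=; congr (_ + _); rewrite pair_bigA /=; apply: eq_bigr => -[].
rewrite !bigE /mx_pair /=.
set W := weingarten r a b g1 B1 - _; set SB := \sum_i \sum_j `|B1 i j - _|.
set SG := \sum_i \sum_j `|g1 i j - _|.
have -> : \sum_i \sum_j c (false, (i, j)) * (B1 i j - B2 i j) =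
   \sum_i elliptic_coef r a k i * (B1 i i - B2 i i).
  apply: eq_bigr => i _; rewrite (bigD1 i) //= cB eqxx big1 ?addr0 // => j ji.
  by rewrite cB eq_sym (negPf ji) mulr0n mul0r.
set X := \sum_i elliptic_coef _ _ _ _ * _; set Y := \sum_i \sum_j c _ * _ => h.
have SB0 : 0 <= SB by apply: sumr_ge0 => i _; apply: sumr_ge0.
have SG0 : 0 <= SG by apply: sumr_ge0 => i _; apply: sumr_ge0.
have hY : `|Y| <= (\sum_l `|c l|) * SG.
  apply: (le_trans (ler_norm_sum _ _ _)); rewrite big_distrr /=; apply: ler_sum => i _.
  apply: (le_trans (ler_norm_sum _ _ _)); rewrite big_distrr /=; apply: ler_sum => j _.
  rewrite normrM ler_wpM2r // (bigD1 (true, (i, j))) //= lerDl sumr_ge0 //.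
have h1 : Num.min eta 1 * (SG + SB) <= SG + eta * SB.
  rewrite mulrDr lerD // ?ler_wpM2r // ?ge_min ?lexx //.
  by rewrite ler_piMl // ge_min lexx orbT.
have -> : W - X = (W - (Y + X)) + Y by ring.
apply: (le_trans (ler_normD _ _)); rewrite /C mulrDl mul1r; lra.
Qed.

From mathcomp Require Import all_classical all_reals all_analysis.
Import numFieldNormedType.Exports.
Local Open Scope classical_set_scope.
Local Open Scope ring_scope.

(** * Squared Euclidean norm and second-order expansions *)

Definition dot (R : realType) (n : nat) (v w : 'rV[R]_n) : R := \sum_i v 0 i * w 0 i.
(** The squared Euclidean norm, since the norm of row vectors is the sup norm. The radii compared
    with [en] below are therefore squared lengths. *)
Definition en (R : realType) (n : nat) (v : 'rV[R]_n) : R := dot v v.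
Definition quad (R : realType) (n : nat) (Q : 'M[R]_n) (v : 'rV[R]_n) : R := (v *m Q *m v^T) 0 0.

Section Euclid.
Context (R : realType) (n : nat).
Implicit Types (v w y : 'rV[R]_n) (Q : 'M[R]_n).

Lemma dotC v w : dot v w = dot w v.
Proof. by apply: eq_bigr => i _; rewrite mulrC. Qed.
Lemma dotDl u v w : dot (u + v) w = dot u w + dot v w.
Proof. by rewrite -big_split /=; apply: eq_bigr => i _; rewrite mxE mulrDl. Qed.
Lemma dotZl a v w : dot (a *: v) w = a * dot v w.
Proof. by rewrite big_distrr /=; apply: eq_bigr => i _; rewrite mxE mulrA. Qed.
Lemma dotNl v w : dot (- v) w = - dot v w.
Proof. by rewrite -scaleN1r dotZl mulN1r. Qed.
Lemma dotDr u v w : dot u (v + w) = dot u v + dot u w.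
Proof. by rewrite dotC dotDl !(dotC u). Qed.
Lemma dotZr a v w : dot v (a *: w) = a * dot v w.
Proof. by rewrite dotC dotZl dotC. Qed.
Lemma dotNr v w : dot v (- w) = - dot v w.
Proof. by rewrite dotC dotNl dotC. Qed.
Lemma dot0l v : dot 0 v = 0.
Proof. by rewrite -(scale0r 0) dotZl mul0r. Qed.
Lemma dot0r v : dot v 0 = 0.
Proof. by rewrite dotC dot0l. Qed.

Definition dotE := (dotDl, dotDr, dotNl, dotNr, dotZl, dotZr).

Lemma en_ge0 v : 0 <= en v.
Proof. by apply: sumr_ge0 => i _; rewrite -expr2 sqr_ge0. Qed.

Lemma en_eq0 v : en v = 0 -> v = 0.
Proof.
move=> /eqP; rewrite psumr_eq0 => [/allP h|i _]; last by rewrite -expr2 sqr_ge0.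
apply/rowP => i; rewrite mxE; have := h i; rewrite mem_index_enum /= -expr2 sqrf_eq0.
by move=> /(_ isT)/eqP.
Qed.

Lemma en0 : en (0 : 'rV[R]_n) = 0. Proof. exact: dot0l. Qed.
Lemma enN v : en (- v) = en v. Proof. by rewrite /en !dotE opprK. Qed.
Lemma enZ a v : en (a *: v) = a ^+ 2 * en v.
Proof. by rewrite /en !dotE; ring. Qed.
Lemma enD v w : en (v + w) = en v + 2 * dot v w + en w.
Proof. by rewrite /en !dotE (dotC w v); ring. Qed.
Lemma enB v w : en (v - w) = en v - 2 * dot v w + en w.
Proof. by rewrite enD enN dotNr; ring. Qed.
Lemma enBC v w : en (v - w) = en (w - v). Proof. by rewrite -enN opprB. Qed.

Lemma enD_le v w : en (v + w) <= 2 * en v + 2 * en w.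
Proof.
have := en_ge0 (v - w); rewrite enB enD; lra.
Qed.

Lemma en_coord v i : v 0 i ^+ 2 <= en v.
Proof.
rewrite /en /dot (bigD1 i) //= -expr2 lerDl; apply: sumr_ge0 => j _.
by rewrite -expr2 sqr_ge0.
Qed.

Lemma coord_norm v i : `|v 0 i| <= `|v|.
Proof.
rewrite [`|v|]mx_normrE (le_trans _ (le_bigmax _ (fun ij => `|v ij.1 ij.2|) (0, i))) //.
Qed.

Lemma norm_coord v e : 0 < e -> (forall i, `|v 0 i| < e) -> `|v| < e.
Proof.
move=> e0 h; rewrite [`|v|]mx_normrE; apply/bigmax_ltP; split => // -[j i] _ /=.
by rewrite (ord1 j).
Qed.

Lemma en_norm v : en v <= n%:R * `|v| ^+ 2.
Proof.
have -> : n%:R * `|v| ^+ 2 = \sum_(i < n) `|v| ^+ 2.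
  by rewrite sumr_const card_ord mulr_natl.
apply: ler_sum => i _; rewrite -expr2 -real_normK ?num_real //.
by rewrite lerXn2r ?nnegrE // coord_norm.
Qed.

Lemma norm_en v e : 0 < e -> en v < e ^+ 2 -> `|v| < e.
Proof.
move=> e0 h; apply: norm_coord => // i.
rewrite -ltr_sqr ?nnegrE ?(ltW e0) // real_normK ?num_real //.
exact: le_lt_trans (en_coord v i) h.
Qed.

Lemma nbhs_en (y : 'rV[R]_n) (A : set 'rV[R]_n) :
  nbhs y A <-> exists2 d, 0 < d & forall x, en (x - y) < d -> A x.
Proof.
split.
  move=> /nbhs_ballP[e /= e0 H]; exists (e ^+ 2); first by rewrite exprn_gt0.
  by move=> x h; apply: H; rewrite -ball_normE /= distrC norm_en.
move=> [d d0 H]; apply/nbhs_ballP.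
pose e := Num.min 1 (d / (n.+1)%:R).
have e0 : 0 < e by rewrite lt_min ltr01 divr_gt0.
exists e => //= x; rewrite -ball_normE /= distrC => h; apply: H.
apply: (le_lt_trans (en_norm _)).
have e1 : e <= 1 by rewrite ge_min lexx.
have ed : e <= d / n.+1%:R by rewrite ge_min lexx orbT.
apply: (@le_lt_trans _ _ (n%:R * e)).
  rewrite ler_wpM2l // (le_trans _ (ltW h)) // expr2 ler_piMr // (le_trans (ltW h)) //.
apply: (@le_lt_trans _ _ (n%:R * (d / n.+1%:R))); first by rewrite ler_wpM2l.
by rewrite mulrCA gtr_pMr // ltr_pdivrMr ?ltr0n // mul1r ltr_nat.
Qed.

Lemma continuous_dot (T : topologicalType) (f g : T -> 'rV[R]_n) x :
  {for x, continuous f} -> {for x, continuous g} ->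
  {for x, continuous (fun t => dot (f t) (g t))}.
Proof.
move=> cf cg; rewrite /dot; apply: cvg_big; first exact: add_continuous.
move=> i _; apply: cvgM.
  exact: (continuous_comp cf (@coord_continuous _ _ _ _ _ _)).
exact: (continuous_comp cg (@coord_continuous _ _ _ _ _ _)).
Qed.

Lemma continuous_en (y : 'rV[R]_n) : continuous (fun x : 'rV[R]_n => en (x - y)).
Proof.
have c : continuous (fun x : 'rV[R]_n => x - y).
  by move=> x; apply: continuousB; [exact: cvg_id | exact: cst_continuous].
by move=> x; apply: (continuous_dot (c x) (c x)).
Qed.

Lemma compact_en_ball (y : 'rV[R]_n) (r : R) : compact [set x : 'rV[R]_n | en (x - y) <= r].
Proof.
apply: bounded_closed_compact; last first.
  apply: (@closed_comp _ _ (fun x : 'rV[R]_n => en (x - y)) [set t | t <= r]).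
    by move=> x _; exact: continuous_en.
  exact: closed_le.
exists (`|y| + (`|r| + 1)); split; first exact: num_real.
move=> t ht x /= hx; apply: (le_trans _ (ltW ht)).
rewrite -[x](subrK y) addrC; apply: (le_trans (ler_normD _ _)); rewrite lerD2l ltW //.
apply: norm_en; first by rewrite ltr_wpDl.
apply: (le_lt_trans hx); apply: (le_lt_trans (ler_norm r)).
have := normr_ge0 r; nra.
Qed.

Lemma continuous_enP (w : 'rV[R]_n -> R) y :
  {for y, continuous w} <->
  forall e, 0 < e -> exists2 d, 0 < d & forall x, en (x - y) < d -> `|w x - w y| <= e.
Proof.
have P := @cvgrPdist_le _ _ _ (nbhs y) (nbhs_filter y) w (w y).
split => [/P H e e0|H].
  have [d d0 Hd] := (nbhs_en _ _).1 (H e e0).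
  by exists d => // x /Hd; rewrite distrC.
apply/P => e e0; apply/nbhs_en; have [d d0 Hd] := H e e0.
by exists d => // x /Hd; rewrite distrC.
Qed.

(** Second-order Taylor expansion with Peano remainder, [l] being the gradient and [Q] the Hessian.
    This pointwise notion is the regularity used at the touching points of barriers. *)
Definition T2 (w : 'rV[R]_n -> R) (y : 'rV[R]_n) (l : 'rV[R]_n) (Q : 'M[R]_n) :=
  forall e : R, 0 < e -> exists2 d, 0 < d & forall h, en h < d ->
    `|w (y + h) - w y - dot l h - 2^-1 * quad Q h| <= e * en h.

Lemma quadZ Q a v : quad Q (a *: v) = a ^+ 2 * quad Q v.
Proof. by rewrite /quad linearZ /= -scalemxAr -!scalemxAl !mxE; ring. Qed.

Lemma quadE Q v : quad Q v = \sum_i \sum_j v 0 i * Q i j * v 0 j.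
Proof.
rewrite /quad mxE; under eq_bigr do rewrite !mxE big_distrl /=.
by rewrite exchange_big.
Qed.

Lemma quadD Q1 Q2 v : quad (Q1 + Q2) v = quad Q1 v + quad Q2 v.
Proof. by rewrite /quad mulmxDr mulmxDl mxE. Qed.

Lemma quadN Q v : quad (- Q) v = - quad Q v.
Proof. by rewrite /quad mulmxN mulNmx mxE. Qed.

Lemma quadZl Q a v : quad (a *: Q) v = a * quad Q v.
Proof. by rewrite /quad -scalemxAr -scalemxAl mxE. Qed.

Lemma quad1 v : quad 1%:M v = en v.
Proof. by rewrite /quad mulmx1 mul_rV_tr /en; apply: eq_bigr => i _; rewrite expr2. Qed.

Lemma quad_dyad z v : quad (z^T *m z) v = dot z v ^+ 2.
Proof.
rewrite /quad mulmxA -mulmxA mxE big_ord1 !mxE expr2.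
congr (_ * _); apply: eq_bigr => i _; rewrite mxE // mulrC //.
Qed.

Lemma quad_bound Q : exists2 B, 0 < B & forall v, `|quad Q v| <= B * en v.
Proof.
exists (\sum_i \sum_j `|Q i j| + 1).
  by rewrite ltr_wpDl // sumr_ge0 // => i _; rewrite sumr_ge0.
move=> v; rewrite quadE; apply: (@le_trans _ _ ((\sum_i \sum_j `|Q i j|) * en v)); last first.
  by rewrite ler_wpM2r ?en_ge0 // lerDl.
apply: (le_trans (ler_norm_sum _ _ _)); rewrite big_distrl; apply: ler_sum => i _ /=.
apply: (le_trans (ler_norm_sum _ _ _)); rewrite big_distrl; apply: ler_sum => j _ /=.
rewrite mulrAC mulrC normrM ler_wpM2l // normrM.
have := en_coord v i; have := en_coord v j.
rewrite -(real_normK (num_real (v 0 i))) -(real_normK (num_real (v 0 j))).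
have := sqr_ge0 (`|v 0 i| - `|v 0 j|); lra.
Qed.

Lemma dot_bound l v : `|dot l v| <= 1 + en l * en v.
Proof.
have key (c : R) : 0 <= en l + 2 * c * dot l v + c ^+ 2 * en v.
  by have := en_ge0 (l + c *: v); rewrite enD enZ dotZr; lra.
have CS : dot l v ^+ 2 <= en l * en v.
  have [e|ne] := eqVneq (en v) 0; first by rewrite (en_eq0 e) dot0r en0 mulr0 expr0n.
  have v0 : 0 < en v by rewrite lt_neqAle eq_sym ne en_ge0.
  have := key (- dot l v / en v).
  have -> : en l + 2 * (- dot l v / en v) * dot l v + (- dot l v / en v) ^+ 2 * en v =
     (en l * en v - dot l v ^+ 2) / en v by field.
  by rewrite pmulr_lge0 ?invr_gt0 // subr_ge0.
have := real_normK (num_real (dot l v)) => e.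
have := normr_ge0 (dot l v); rewrite -e in CS; nra.
Qed.

Lemma T2_nbhs (w : 'rV[R]_n -> R) y l Q : T2 w y l Q -> {for y, continuous w}.
Proof.
move=> H; apply/continuous_enP => e e0.
have [d d0 Hd] := H 1 ltr01; have [B B0 hB] := quad_bound Q.
pose a := Num.min 1 (e / 4).
have a0 : 0 < a by rewrite lt_min ltr01 divr_gt0.
(* dot l h is small: apply the crude bound to a suitably rescaled pair *)
pose m := e / 4.
have m0 : 0 < m by rewrite divr_gt0.
have dl h : `|dot l h| <= m + (en l / m) * en h.
  have := dot_bound (m^-1 *: l) h; rewrite dotZl enZ normrM gtr0_norm ?invr_gt0 //.
  rewrite ler_pdivrMl // => /le_trans; apply.
  rewrite mulrDr mulr1 lerD2l le_eqVlt; apply/orP; left; apply/eqP; field.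
  by rewrite gt_eqF.
pose K := en l / m + B + 1.
have K0 : 0 < K by rewrite ltr_wpDl // addr_ge0 ?divr_ge0 ?en_ge0 // ltW.
exists (Num.min d (m / K)); first by rewrite lt_min d0 divr_gt0.
move=> x; rewrite lt_min => /andP[xd]; rewrite ltr_pdivlMr // => xm.
have := Hd _ xd; rewrite [y + _]addrC subrK mul1r.
have := dl (x - y); have := hB (x - y); have := en_ge0 (x - y).
set h := x - y in xd xm * => h0 b1 b2 b3.
rewrite -[w x - w y](subrK (dot l h)) -[X in X + _](subrK (2^-1 * quad Q h)).
apply: (le_trans (ler_normD _ _)).
have := ler_normD (w x - w y - dot l h - 2^-1 * quad Q h) (2^-1 * quad Q h).
rewrite [`|2^-1 * quad Q h|]normrM gtr0_norm ?invr_gt0 // => b4.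
have : K * en h <= m by rewrite mulrC ltW.
rewrite /K !mulrDl mul1r.
have : 0 <= B * en h by rewrite mulr_ge0 // ltW.
have em : e = 4 * m by rewrite /m; field.
move: b1 b2 b3 b4; rewrite em.
set X1 := `|quad _ _|; set X2 := `|dot _ _|; set X3 := `|_ - _ - _ - _|.
lra.
Qed.

End Euclid.

(** * Hopf barrier and strong maximum principle *)

Lemma poly2_sign (R : realType) (P S : R) :
  (forall d : R, 0 < d -> exists2 t0, 0 < t0 &
     forall t, `|t| < t0 -> 0 <= t * P + t ^+ 2 * S + d * t ^+ 2) ->
  P = 0 /\ 0 <= S.
Proof.
move=> H; have P0 : P = 0.
  apply/eqP/negPn/negP => Pn0.
  have [t0 t00 Ht] := H 1 ltr01.
  have S0 : 0 < `|S| + 2 by rewrite ltr_wpDl.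
  have Pp : 0 < `|P| by rewrite normr_gt0.
  (* At [t = - c * P] the expression, with [d = 1], equals [c * P ^+ 2 * (c * S + c - 1)], which is
     negative once [c * (|S| + 2) <= 1]. *)
  pose c := Num.min (t0 / (2 * `|P|)) ((`|S| + 2)^-1).
  have c0 : 0 < c by rewrite lt_min invr_gt0 S0 andbT divr_gt0 // mulr_gt0.
  have c1 : c * (2 * `|P|) <= t0 by rewrite -ler_pdivlMr ?mulr_gt0 // ge_min lexx.
  have c2 : c * (`|S| + 2) <= 1.
    by rewrite -ler_pdivlMr // div1r ge_min lexx orbT.
  have : `|- c * P| < t0.
    rewrite normrM normrN (gtr0_norm c0) (lt_le_trans _ c1) // mulrCA.
    by rewrite ltr_pMl ?mulr_gt0 // ltr1n.
  move=> /Ht; rewrite (_ : _ + _ = c * P ^+ 2 * (c * S + c - 1)); last by ring.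
  rewrite pmulr_rge0; last by rewrite mulr_gt0 // exprn_even_gt0.
  have := ler_norm S; have : c * S <= c * `|S| by rewrite ler_pM2l // ler_norm.
  lra.
split => //; apply/ler_addgt0Pr => d d0; rewrite P0 in H.
have [t0 t00 Ht] := H d d0.
have h2 : 0 < t0 / 2 by rewrite divr_gt0.
have := Ht (t0 / 2); rewrite gtr0_norm // mulr0 add0r.
rewrite (_ : _ + _ = (S + d) * (t0 / 2) ^+ 2); last by ring.
by rewrite pmulr_lge0 ?exprn_gt0 //; apply; rewrite ltr_pdivrMr // ltr_pMr // ltr1n.
Qed.

(** The square of [1 + x / 2 <= expR (x / 2)], whose left side is nonnegative in this range. *)
Lemma expR_ge_sq (R : realType) (x : R) : -2 <= x -> 1 + x + 4^-1 * x ^+ 2 <= expR x.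
Proof.
move=> x2; have -> : x = x / 2 + x / 2 by field.
rewrite expRD; have h := expR_ge1Dx (x / 2); have h0 : 0 <= 1 + x / 2 by lra.
have := ler_pM h0 h0 h h; set e := expR _; move=> h3; apply: le_trans h3; lra.
Qed.

Section Barrier.
Context (R : realType) (n : nat).
Implicit Types (v z q y : 'rV[R]_n) (Q : 'M[R]_n) (w : 'rV[R]_n -> R).

(** A Gaussian barrier centered at [q - z] touches [w] from below at [q], with value [e] there:
    gradients agree and Hessians are ordered. The true Hessian of the barrier has [4 * al ^+ 2]
    where [2 * al ^+ 2] appears; the loss comes from [expR_ge_sq]. *)
Lemma T2_touch w q l Q z (al e : R) : 0 < al -> 0 < e -> T2 w q l Q ->
  (exists2 d, 0 < d & forall k, en k < d ->
      e * (expR (- al * (2 * dot z k + en k)) - 1) <= w (q + k) - w q) ->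
  l = (- 2 * al * e) *: z /\
  forall v, e * (2 * al ^+ 2 * dot z v ^+ 2 - 2 * al * en v) <= quad Q v.
Proof.
move=> al0 e0 HT [d d0 Hd].
have key v : dot l v + 2 * al * e * dot z v = 0 /\
   0 <= 2^-1 * quad Q v + e * (al * en v - al ^+ 2 * dot z v ^+ 2).
  apply: poly2_sign => dl dl0.
  set zv := dot z v; set ev := en v.
  have ev0 : 0 <= ev := en_ge0 v; have zv0 := normr_ge0 zv.
  pose e' := dl / (2 * (ev + 1)).
  have e'0 : 0 < e' by rewrite divr_gt0 // mulr_gt0 // ltr_wpDl.
  have [d1 d10 H1] := HT _ e'0.
  pose m := Num.min d d1.
  have m0 : 0 < m by rewrite lt_min d0.
  pose K := e * al ^+ 2 * `|zv| * ev.
  have K0 : 0 <= K by rewrite !mulr_ge0 // ?exprn_ge0 // ltW.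
  pose t1 := m / (ev + 1).
  pose t2 := (al * (2 * `|zv| + ev) + 1)^-1.
  pose t3 := dl / (2 * (K + 1)).
  have D2 : 0 < al * (2 * `|zv| + ev) + 1.
    by rewrite ltr_wpDl // mulr_ge0 ?addr_ge0 ?mulr_ge0 // ltW.
  have t10 : 0 < t1 by rewrite divr_gt0 // ltr_wpDl.
  have t20 : 0 < t2 by rewrite invr_gt0.
  have t30 : 0 < t3 by rewrite divr_gt0 // mulr_gt0 // ltr_wpDl.
  exists (Num.min 1 (Num.min t1 (Num.min t2 t3))); first by rewrite !lt_min ltr01 t10 t20.
  move=> t; rewrite !lt_min => /and4P[tl1 tt1 tt2 tt3].
  have t_ge0 := normr_ge0 t.
  have tsq : t ^+ 2 = `|t| ^+ 2 by rewrite real_normK ?num_real.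
  have tsq0 : 0 <= t ^+ 2 by exact: sqr_ge0.
  have tsql : t ^+ 2 <= `|t| by rewrite tsq expr2 ler_piMr // ltW.
  have small : en (t *: v) < m.
    rewrite enZ; move: tt1; rewrite ltr_pdivlMr ?ltr_wpDl // => tt1.
    apply: le_lt_trans tt1; rewrite (le_trans (y := `|t| * ev)) // ?ler_wpM2r // ler_wpM2l // lerDl //.
  have Hk := Hd (t *: v); have Hw := H1 (t *: v).
  move: small; rewrite lt_min => /andP[/Hk {}Hk /Hw {}Hw].
  move: Hk Hw; rewrite !dotZr enZ quadZ.
  rewrite -/zv -/ev.
  set x := - al * _ => Hk Hw.
  have xabs : `|x| <= 1.
    move: tt2; rewrite -[_ < t2]ltr_pdivlMr // || idtac.
    rewrite /t2 => tt2; have : `|t| * (al * (2 * `|zv| + ev) + 1) < 1.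
      by rewrite -ltr_pdivlMr // div1r.
    rewrite /x normrM normrN (gtr0_norm al0) => h.
    have : `|2 * (t * zv) + t ^+ 2 * ev| <= `|t| * (2 * `|zv| + ev).
      apply: (le_trans (ler_normD _ _)).
      rewrite normrM (ger0_norm (ler0n _ 2)) normrM normrM (ger0_norm tsq0) (ger0_norm ev0).
      have : t ^+ 2 * ev <= `|t| * ev by rewrite ler_wpM2r.
      lra.
    rewrite -(ler_pM2l al0) => h2; lra.
  have xm : -2 <= x by move: xabs; rewrite ler_norml => /andP[h _]; lra.
  have := expR_ge_sq xm; rewrite -(ler_pM2l e0) => hx.
  have hx2 : e * (x + 4^-1 * x ^+ 2) <= w (q + t *: v) - w q.
    by apply: le_trans Hk; lra.
  have {hx2} hx3 : e * (x + 4^-1 * x ^+ 2) <= t * dot l v + 2^-1 * (t ^+ 2 * quad Q v) + e' * (t ^+ 2 * ev).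
    by move: Hw; rewrite ler_norml => /andP[_ h]; lra.
  have xE : x + 4^-1 * x ^+ 2 = - (2 * al * t * zv) - al * (t ^+ 2 * ev) +
     al ^+ 2 * (t ^+ 2 * zv ^+ 2 + t ^+ 2 * (t * zv * ev) + (t ^+ 2 * ev) ^+ 2 / 4).
    by rewrite /x; field.
  have e'ev : e' * ev <= dl / 2.
    rewrite /e' mulrAC ler_pdivrMr ?mulr_gt0 ?ltr_wpDl //.
    have := ltW dl0; nra.
  have cub : e * al ^+ 2 * (t * zv * ev) >= - (dl / 2).
    have h1 : `|e * al ^+ 2 * (t * zv * ev)| = K * `|t|.
      rewrite /K !normrM (gtr0_norm e0) (ger0_norm ev0) ger0_norm ?exprn_ge0 ?ltW //; ring.
    have h2 : `|t| * (2 * (K + 1)) < dl by rewrite -ltr_pdivlMr // mulr_gt0 // ltr_wpDl.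
    have : `|e * al ^+ 2 * (t * zv * ev)| <= dl / 2 by rewrite h1; lra.
    by rewrite ler_norml => /andP[].
  rewrite xE in hx3.
  have p4 : 0 <= e * al ^+ 2 * ((t ^+ 2 * ev) ^+ 2 / 4).
    apply: mulr_ge0; last by apply: divr_ge0; first exact: sqr_ge0.
    by apply: mulr_ge0; [exact: ltW | exact: sqr_ge0].
  have a1 : t ^+ 2 * (e' * ev) <= t ^+ 2 * (dl / 2) by rewrite ler_wpM2l.
  have a2 : - (t ^+ 2 * (dl / 2)) <= t ^+ 2 * (e * al ^+ 2 * (t * zv * ev)).
    by rewrite -mulrN ler_wpM2l.
  lra.
split.
  apply/rowP => i; have [h _] := key (delta_mx 0 i).
  have dd u : dot u (delta_mx 0 i) = u 0 i.
    rewrite /dot (bigD1 i) //= mxE !eqxx mulr1 big1 ?addr0 // => j ji.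
    by rewrite mxE (negPf ji) mulr0.
  by move: h; rewrite !dd mxE; lra.
by move=> v; have [_] := key v; lra.
Qed.

(** This bounds [al], so that a steep barrier cannot touch. [E], the excess of the Hessian of [w]
    over that of the barrier, is positive semidefinite; its off-diagonal entries are bounded by its
    trace, which the ellipticity absorbs thanks to [eta * n%:R <= Fm / 2]. Quadratic terms in [al]
    then face linear ones. *)
Lemma barrier_alg (F : 'I_n -> R) (Fm FM eta C al e wq : R) (l z : 'rV[R]_n) Q :
  0 < Fm -> (forall i, Fm <= F i <= FM) -> 0 <= eta -> eta * n%:R <= Fm / 2 -> 0 <= C ->
  1 <= al -> 0 < e -> `|wq| <= e -> Q^T = Q ->
  l = (- 2 * al * e) *: z ->
  (forall v, e * (2 * al ^+ 2 * dot z v ^+ 2 - 2 * al * en v) <= quad Q v) ->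
  `|\sum_i F i * Q i i| <= eta * (\sum_i \sum_j `|Q i j|) + C * (\sum_i `|l 0 i| + `|wq|) ->
  al * Fm * en z <= 2 * n%:R * FM + Fm + C + 2 * C * \sum_i `|z 0 i|.
Proof.
move=> Fm0 hF eta0 hn C0 al1 e0 hw sQ hl hQ hstar.
have al0 : 0 < al by exact: lt_le_trans al1.
pose E := Q - (e * (2 * al ^+ 2)) *: (z^T *m z) + (e * (2 * al)) *: 1%:M.
have pE : psdmx E.
  move=> v; rewrite -/(quad E v) /E !quadD quadN !quadZl quad_dyad quad1.
  by have := hQ v; lra.
have sE : E^T = E.
  by rewrite /E linearD /= linearB /= !linearZ /= trmx1 sQ trmx_mul trmxK.
have QE i j : Q i j = E i j + e * (2 * al ^+ 2) * (z 0 i * z 0 j) - e * (2 * al) *+ (i == j).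
  rewrite /E !mxE big_ord1 !mxE; case: (i == j); rewrite ?mulr1n ?mulr0n; lra.
pose T := \sum_i E i i.
have T0 : 0 <= T by apply: sumr_ge0 => i _; exact: psdmx_diag_ge0.
have ez : en z = \sum_i z 0 i * z 0 i by [].
have ez0 := en_ge0 z.
have lower : Fm * T + e * (2 * al ^+ 2) * (Fm * en z) - e * (2 * al) * (n%:R * FM) <= \sum_i F i * Q i i.
  rewrite /T ez !big_distrr /=.
  have -> : e * (2 * al) * (n%:R * FM) = \sum_(i < n) e * (2 * al) * FM.
    by rewrite sumr_const card_ord -mulr_natr; ring.
  rewrite -big_split -sumrB /=; apply: ler_sum => i _.
  rewrite QE eqxx mulr1n; have /andP[F1 F2] := hF i.
  have e1 : Fm * E i i <= F i * E i i by rewrite ler_wpM2r // psdmx_diag_ge0.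
  have e2 : Fm * (z 0 i * z 0 i) <= F i * (z 0 i * z 0 i).
    by rewrite ler_wpM2r // -expr2 sqr_ge0.
  have c2 : 0 <= e * (2 * al ^+ 2) by rewrite !mulr_ge0 ?exprn_ge0 // ltW.
  have c1 : 0 <= e * (2 * al) by rewrite !mulr_ge0 // ltW.
  move: (ler_wpM2l c2 e2) (ler_wpM2l c1 F2) e1.
  set t1 := E i i; set t3 := z 0 i * z 0 i; set t2 := F i; clear.
  by move=> h1 h2 h3; lra.
have upper : \sum_i \sum_j `|Q i j| <= n%:R * T + e * (2 * al ^+ 2) * (n%:R * en z) + e * (2 * al) * n%:R.
  have c2 : 0 <= e * (2 * al ^+ 2) by rewrite !mulr_ge0 ?exprn_ge0 // ltW.
  have c1 : 0 <= e * (2 * al) by rewrite !mulr_ge0 // ltW.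
  have h i j : `|Q i j| <= 2^-1 * (E i i + E j j) + e * (2 * al ^+ 2) * (2^-1 * (z 0 i * z 0 i + z 0 j * z 0 j))
       + e * (2 * al) *+ (i == j).
    rewrite QE; apply: (le_trans (ler_normB _ _)).
    have n1 : `|e * (2 * al) *+ (i == j)| = e * (2 * al) *+ (i == j).
      by rewrite ger0_norm // mulrn_wge0.
    rewrite n1 lerD2r; apply: (le_trans (ler_normD _ _)).
    have n2 := psdmx_offdiag i j pE sE.
    rewrite [X in _ + X]normrM (ger0_norm c2) lerD //; first by lra.
    rewrite ler_wpM2l // ler_norml; have := sqr_ge0 (z 0 i + z 0 j); have := sqr_ge0 (z 0 i - z 0 j).
    by move=> ? ?; apply/andP; split; lra.
  apply: (@le_trans _ _ (\sum_(i < n) \sum_(j < n) (2^-1 * (E i i + E j j) + e * (2 * al ^+ 2) * (2^-1 * (z 0 i * z 0 i + z 0 j * z 0 j))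
       + e * (2 * al) *+ (i == j)))).
    by apply: ler_sum => i _; apply: ler_sum => j _.
  have S1 (f : 'I_n -> R) : \sum_i \sum_j (f i + f j) = 2 * n%:R * \sum_i f i.
    under eq_bigr do rewrite big_split /= sumr_const card_ord -mulr_natl.
    rewrite big_split /= -big_distrr /= sumr_const card_ord -mulr_natl; ring.
  under eq_bigr do rewrite !big_split /= -!big_distrr /=.
  rewrite !big_split /= -!big_distrr /= !S1.
  have -> : \sum_(i < n) \sum_(j < n) e * (2 * al) *+ (i == j) = e * (2 * al) * n%:R.
    have -> : e * (2 * al) * n%:R = \sum_(i < n) e * (2 * al).
      by rewrite sumr_const card_ord mulr_natr.
    apply: eq_bigr => i _.
    rewrite (bigD1 i) //= eqxx big1 ?addr0 // => j ji; by rewrite eq_sym (negPf ji).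
  rewrite -ez -/T; lra.
have ul : \sum_i `|l 0 i| = 2 * al * e * \sum_i `|z 0 i|.
  rewrite hl big_distrr /=; apply: eq_bigr => i _; rewrite mxE !normrM normrN.
  by rewrite (ger0_norm (ler0n _ 2)) (gtr0_norm al0) (gtr0_norm e0).
set Z := \sum_i `|z 0 i| in ul *.
have Z0 : 0 <= Z by apply: sumr_ge0.
have s1 := le_trans lower (le_trans (ler_norm _) hstar).
have s2 := le_trans s1 (lerD (ler_wpM2l eta0 upper) (ler_wpM2l C0 (lerD (lexx _) hw))).
rewrite ul in s2.
have nT : eta * (n%:R * T) <= Fm / 2 * T by rewrite mulrA ler_wpM2r.
have c2 : 0 <= e * (2 * al ^+ 2) by rewrite !mulr_ge0 ?exprn_ge0 // ltW.
have c1 : 0 <= e * (2 * al) by rewrite !mulr_ge0 // ltW.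
have nz : eta * (e * (2 * al ^+ 2) * (n%:R * en z)) <= e * (2 * al ^+ 2) * (Fm / 2 * en z).
  by rewrite mulrCA ler_wpM2l // mulrA ler_wpM2r.
have n1 : eta * (e * (2 * al) * n%:R) <= e * (2 * al) * (Fm / 2).
  by rewrite mulrCA ler_wpM2l.
have FT : 0 <= Fm / 2 * T by rewrite mulr_ge0 // divr_ge0 // ltW.
have ea : 0 < e * al by rewrite mulr_gt0.
have Ce : C * e <= C * (e * al) by rewrite ler_wpM2l // ler_pMr.
rewrite -(ler_pM2l ea).
rewrite !mulrDr in s2 *.
have : e * (2 * al ^+ 2) * (Fm * en z) - e * (2 * al ^+ 2) * (Fm / 2 * en z) = e * al * (al * Fm * en z) by field.
lra.
Qed.

Context (F : 'I_n -> R) (Fm FM eta C : R).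
Hypothesis Fm0 : 0 < Fm.
Hypothesis hF : forall i, Fm <= F i <= FM.
Hypothesis eta0 : 0 <= eta.
Hypothesis etan : eta * n%:R <= Fm / 2.
Hypothesis C0 : 0 <= C.
Context (w : 'rV[R]_n -> R) (l : 'rV[R]_n -> 'rV[R]_n) (Q : 'rV[R]_n -> 'M[R]_n).

(** The linearized equation with coefficients frozen at the base point: constant diagonal
    coefficients [F], an error with small factor [eta] in the Hessian, and a bounded factor [C] for
    the lower order terms. *)
Definition elliptic_at (y : 'rV[R]_n) :=
  [/\ T2 w y (l y) (Q y), (Q y)^T = Q y &
   `|\sum_i F i * Q y i i| <= eta * (\sum_i \sum_j `|Q y i j|) + C * (\sum_i `|l y 0 i| + `|w y|)].

Lemma hopf_barrier (z0 y1 : 'rV[R]_n) (t2 r2 : R) (A flat : set 'rV[R]_n) :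
  let B := A `&` [set y | en (y - z0) <= r2] in
  en (z0 - y1) = t2 -> 0 < r2 -> r2 <= t2 / 4 -> closed A -> A z0 ->
  (forall y, B y -> {for y, continuous w}) -> (forall y, B y -> 0 <= w y) -> w z0 = 0 ->
  (forall y, B y -> en (y - z0) < r2 -> ~ flat y ->
     elliptic_at y /\ exists2 d, 0 < d & forall x, en (x - y) < d -> B x) ->
  (forall y, B y -> flat y -> t2 <= en (y - y1)) ->
  (forall y, B y -> en (y - y1) <= t2 -> y = z0 \/ 0 < w y) ->
  flat z0 /\ exists ep al : R, [/\ 0 < ep, 0 < al &
    forall y, B y -> ep * (expR (- al * en (y - y1)) - expR (- al * t2)) <= w y].
Proof.
move=> B z0y1 r20 r2t clA Az0 cw w0 wz0 hint hflat hcont.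
have Bz0 : B z0 by split => //=; rewrite subrr en0 ltW.
have t20 : 0 < t2 by lra.
have cB : compact B.
  rewrite /B setIC; apply: compact_closedI => //; exact: compact_en_ball.
(* [X] bounds the right side of [barrier_alg] in the small ball, where [t2 / 4 <= en z] and
   [|z_i| <= 1 + en z <= 1 + 3 * t2]; [al] is then taken to violate that inequality. *)
pose X := 2 * n%:R * FM + Fm + C + 2 * C * (n%:R * (1 + 3 * t2)).
pose al := Num.max 1 ((X + 1) / (Fm * (t2 / 4))).
have al1 : 1 <= al by rewrite le_max lexx.
have al0 : 0 < al by exact: lt_le_trans al1.
have FT : 0 < Fm * (t2 / 4) by rewrite mulr_gt0 // divr_gt0.
have alX : X + 1 <= al * (Fm * (t2 / 4)) by rewrite -ler_pdivrMr // le_max lexx orbT.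
pose h y := expR (- al * en (y - y1)); pose h0 := expR (- al * t2).
have hh y : h y <= 1.
  rewrite /h -[X in _ <= X]expR0 ler_expR mulNr oppr_le0 mulr_ge0 ?en_ge0 // ltW //.
have hle y : t2 <= en (y - y1) -> h y <= h0.
  by move=> ?; rewrite /h ler_expR ler_nM2l // oppr_lt0.
have ch : continuous h.
  move=> y; apply: continuous_comp; last exact: continuous_expR.
  apply: continuousM; [exact: cst_continuous | exact: continuous_en].
have h00 : 0 < h0 by exact: expR_gt0.
have touch ep q : 0 < ep -> B q -> en (q - z0) < r2 -> ~ flat q ->
    w q <= ep * (h q - h0) ->
    (forall y, B y -> w q - ep * (h q - h0) <= w y - ep * (h y - h0)) -> False.
  move=> ep0 Bq qr nfl wq mq; have [[HT sQ hst] [d d0 Hd]] := hint _ Bq qr nfl.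
  pose z := q - y1; pose e := ep * h q.
  have e0 : 0 < e by rewrite mulr_gt0 // expR_gt0.
  have ez1 : t2 <= 2 * en z + 2 * en (q - z0).
    have e1 : z0 - y1 = (z0 - q) + z by rewrite /z addrA subrK.
    by rewrite -z0y1 (enBC q z0) e1; have := enD_le (z0 - q) z; lra.
  have ez2 : en z <= 2 * t2 + 2 * en (q - z0).
    have e1 : z = (q - z0) + (z0 - y1) by rewrite /z addrA subrK.
    by rewrite -z0y1 e1; have := enD_le (q - z0) (z0 - y1); lra.
  have hl : l q = (-2 * al * e) *: z /\
     forall v, e * (2 * al ^+ 2 * dot z v ^+ 2 - 2 * al * en v) <= quad (Q q) v.
    apply: (T2_touch al0 e0 HT); exists d => // k kd.
    have := mq (q + k); rewrite [q + k]addrC => /(_ (Hd _ _)).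
    rewrite addrK => /(_ kd) hk.
    have hqk : h (k + q) = h q * expR (- al * (2 * dot z k + en k)).
      rewrite /h -expRD; congr expR; rewrite -addrA -/z enD dotC; ring.
    rewrite hqk in hk.
    move: hk; rewrite /e; lra.
  case: hl => hl {}hQ.
  have wqe : `|w q| <= e.
    rewrite ger0_norm ?w0 //; apply: (le_trans wq).
    by apply: ler_wpM2l; [exact: ltW | rewrite gerBl ltW].
  have := barrier_alg Fm0 hF eta0 etan C0 al1 e0 wqe sQ hl hQ hst.
  have Zb : \sum_i `|z 0 i| <= n%:R * (1 + 3 * t2).
    rewrite (_ : n%:R * _ = \sum_(i < n) (1 + 3 * t2)); last by rewrite sumr_const card_ord mulr_natl.
    apply: ler_sum => i _; have := en_coord z i.
    rewrite -(real_normK (num_real (z 0 i))) => h1.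
    have : `|z 0 i| <= 1 + `|z 0 i| ^+ 2 by have := sqr_ge0 (`|z 0 i| - 1); have := normr_ge0 (z 0 i); lra.
    by move=> h2; apply: (le_trans h2); rewrite lerD2l (le_trans h1) // (le_trans ez2) //; lra.
  have := ler_wpM2l (mulr_ge0 (ler0n _ 2) C0) Zb.
  have : al * (Fm * (t2 / 4)) <= al * Fm * en z.
    rewrite -(mulrA al Fm) !ler_pM2l //; lra.
  move: alX; rewrite /X; lra.
pose Bc := B `&` [set y | en (y - y1) <= t2] `&` [set y | r2 <= en (y - z0)].
have cBc : compact Bc.
  apply: compact_closedI; first apply: compact_closedI => //.
    apply: (@closed_comp _ _ (fun x : 'rV[R]_n => en (x - y1)) [set t | t <= t2]); last exact: closed_le.
    by move=> x _; exact: continuous_en.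
  apply: (@closed_comp _ _ (fun x : 'rV[R]_n => en (x - z0)) [set t | r2 <= t]); last exact: closed_ge.
  by move=> x _; exact: continuous_en.
(* In the ball around [y1] and away from [z0], [w] is positive, hence bounded below by compactness.
   Its bound [m] can be the height of the barrier because [h <= 1]. *)
have [m m0 Hm] : exists2 m, 0 < m & forall y, Bc y -> m <= w y.
  have [->|/set0P Bc0] := eqVneq Bc classical_sets.set0; first by exists 1.
  have cwB : {within Bc, continuous w}.
    by apply: continuous_in_subspaceT => y /set_mem[[/cw]].
  have [q qB qmin] := compact_EVT_min Bc0 cBc cwB.
  exists (w q); last by move=> y yB; apply: qmin; exact/mem_set.
  move/set_mem: qB => [[Bq q1] q2]; have [qz|//] := hcont _ Bq q1.
  by move: q2; rewrite qz /= subrr en0 leNgt r20.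
pose phi y := w y - m * (h y - h0).
have cphi : {within B, continuous phi}.
  apply: continuous_in_subspaceT => y /set_mem /cw cwy.
  have c1 : {for y, continuous (fun x => h x - h0)}.
    by apply: continuousB; [exact: ch | exact: cst_continuous].
  have c2 : {for y, continuous (fun x => m * (h x - h0))}.
    by apply: continuousM; [exact: cst_continuous | exact: c1].
  exact: (continuousB cwy c2).
have B0 : B !=set0 by exists z0.
have [q qB qmin] := compact_EVT_min B0 cB cphi.
have {}qmin y : B y -> phi q <= phi y by move=> yB; apply: qmin; exact/mem_set.
move/set_mem: qB => Bq.
have phiz0 : phi z0 = 0 by rewrite /phi wz0 /h z0y1 /h0 subrr mulr0 subrr.
have nn : 0 <= phi q.
  rewrite leNgt; apply/negP => qneg.
  have nfl : ~ flat q.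
    move=> fq; move: qneg; rewrite /phi ltNge; apply/negP/negPn.
    have := hle _ (hflat _ Bq fq); have := w0 _ Bq; rewrite subr_ge0 => h1 h2.
    by apply: le_trans h1; rewrite pmulr_rle0 // subr_le0.
  have qr : en (q - z0) < r2.
    rewrite ltNge; apply/negP => qr; move: qneg; rewrite ltNge; apply/negP/negPn.
    rewrite /phi subr_ge0; have [q1|q1] := leP (en (q - y1)) t2.
      apply: (@le_trans _ _ m); last by apply: Hm; split.
      by rewrite ler_piMr ?(ltW m0) // lerBlDr (le_trans (hh q)) // lerDl ltW.
    apply: le_trans (w0 _ Bq); rewrite pmulr_rle0 // subr_le0 hle // ltW //.
  apply: (touch m q m0 Bq qr nfl) => //.
  by move: qneg; rewrite /phi subr_lt0 => /ltW.
split; last first.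
  exists m, al; split => // y By; have := le_trans nn (qmin _ By).
  by rewrite /phi subr_ge0.
apply: contrapT => nfl; apply: (touch m z0 m0 Bz0 _ nfl).
- by rewrite subrr en0.
- by move: phiz0; rewrite /phi => /eqP; rewrite subr_eq0 => /eqP ->.
- by move=> y By; have := le_trans nn (qmin _ By); rewrite -phiz0.
Qed.

Lemma en_ball_nbhs (y z : 'rV[R]_n) (r : R) : en (y - z) < r ->
  exists2 d, 0 < d & forall x, en (x - y) < d -> en (x - z) < r.
Proof.
move=> h; apply/(nbhs_en y [set x | en (x - z) < r]).
have : nbhs (en (y - z)) [set t | t < r] by apply: open_nbhs_nbhs; split => //; exact: open_lt.
exact: continuous_en.
Qed.

Lemma dot_pos_nbhs (nu y : 'rV[R]_n) : 0 < dot nu y ->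
  exists2 d, 0 < d & forall x, en (x - y) < d -> 0 < dot nu x.
Proof.
move=> h; apply/(nbhs_en y [set x | 0 < dot nu x]).
have : nbhs (dot nu y) [set t | 0 < t] by apply: open_nbhs_nbhs; split => //; exact: open_gt.
apply: (continuous_dot (x := y)); [exact: cst_continuous | exact: cvg_id].
Qed.

Lemma closed_zero (K : set 'rV[R]_n) (f : 'rV[R]_n -> R) : closed K ->
  (forall y, K y -> {for y, continuous f}) -> closed (K `&` [set y | f y = 0]).
Proof.
move=> cK cf y hy; have Ky : K y by apply: cK => B /hy[x [[Kx _] Bx]]; exists x.
split => //=; apply: contrapT => /eqP fy.
have := (continuous_enP _ _).1 (cf _ Ky); have f0 : 0 < `|f y| / 2 by rewrite divr_gt0 // normr_gt0.
move=> /(_ _ f0)[d d0 Hd].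
have : nbhs y [set x | en (x - y) < d] by apply/nbhs_en; exists d.
move=> /hy[x [[_ /= fx] /= /Hd]]; rewrite fx sub0r normrN; have := normr_ge0 (f y); lra.
Qed.

Lemma conn_ind (T : topologicalType) (S : set T) (P : T -> Prop) :
  connected S -> (exists2 x, S x & P x) ->
  (forall x, S x -> P x -> \forall y \near x, S y -> P y) ->
  (forall x, S x -> ~ P x -> \forall y \near x, S y -> ~ P y) ->
  forall x, S x -> P x.
Proof.
move=> cS [x0 Sx0 Px0] oP cP.
pose O := [set x : T | nbhs x [set y | S y -> P y]].
pose O' := [set x : T | nbhs x [set y | S y -> ~ P y]].
have op (A : set T) : open [set x | nbhs x A].
  by rewrite openE => x; exact: nbhs_interior.
suff e : S `&` P = S by move=> x Sx; have : (S `&` P) x by [rewrite e]; case.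
apply: cS; first by exists x0.
- exists O; first exact: (op [set y | S y -> P y]).
  apply/seteqP; split => x [Sx h]; split => //; first exact: oP.
  exact: (nbhs_singleton h).
- exists (~` O'); first by apply: open_closedC; exact: (op [set y | S y -> ~ P y]).
  apply/seteqP; split => x [Sx h]; split => //.
    by move=> /nbhs_singleton /(_ Sx); apply.
  by apply: contrapT => /(cP _ Sx).
Qed.

(** A point [y0] with nonzero value has a nearest zero [z0]. The ball with diameter from [y0] to
    [z0] meets the zero set at [z0] only, which the barrier forbids. The factor 16 keeps all these
    balls in the region of radius [th]. *)
Lemma smp_interior (c : 'rV[R]_n) (th : R) :
  (forall y, en (y - c) < th -> elliptic_at y) ->
  (forall y, en (y - c) < th -> 0 <= w y) -> w c = 0 ->
  forall y, en (y - c) < th / 16 -> w y = 0.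
Proof.
move=> hel w0 wc y0 hy0; apply/eqP/negPn/negP => wy0.
have th0 : 0 < th by have := en_ge0 (y0 - c); lra.
have cw y : en (y - c) < th -> {for y, continuous w} by move=> /hel[/T2_nbhs].
pose K := [set y | en (y - y0) <= en (y0 - c)].
have Kth y : K y -> en (y - c) < th.
  move=> hy; have {}hy : en (y - y0) <= en (y0 - c) := hy; have := enD_le (y - y0) (y0 - c); rewrite addrA subrK; lra.
pose Z := K `&` [set y | w y = 0].
have cZ : compact Z.
  apply: (subclosed_compact _ (compact_en_ball (y := y0) (r := en (y0 - c)))); last by move=> y [].
  apply: closed_zero; last by move=> y /Kth /cw.
  apply: compact_closed; [exact: norm_hausdorff | exact: compact_en_ball].
have Zc : Z c by split; [rewrite /K /= enBC | exact: wc].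
have [z0 /set_mem[Kz0 wz0] zmin] : exists2 z0, z0 \in Z & forall t, t \in Z -> en (z0 - y0) <= en (t - y0).
  apply: compact_EVT_min => //; first by exists c.
  by apply: continuous_subspaceT; exact: continuous_en.
pose y1 := 2^-1 *: (y0 + z0).
have e1 : z0 - y1 = 2^-1 *: (z0 - y0).
  by apply/rowP => i; rewrite !mxE; field.
have e2 : y0 - y1 = - (z0 - y1) by apply/rowP => i; rewrite !mxE; field.
pose t2 := en (z0 - y1).
have t2E : en (z0 - y0) = 4 * t2 by rewrite /t2 e1 enZ; field.
have t20 : 0 < t2.
  rewrite lt_neqAle en_ge0 andbT eq_sym; apply/negP => /eqP h0.
  have /en_eq0/eqP : en (z0 - y0) = 0 by rewrite t2E h0 mulr0.
  by rewrite subr_eq0 => /eqP h; move: wy0; rewrite -h wz0 eqxx.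
have Kz0' : en (z0 - y0) <= en (y0 - c) by [].
pose r2 := Num.min (t2 / 4) (th / 8).
have r20 : 0 < r2 by rewrite lt_min !divr_gt0.
have r2t : r2 <= t2 / 4 by rewrite ge_min lexx.
have r2th : r2 <= th / 8 by rewrite ge_min lexx orbT.
have Bth y : en (y - z0) <= r2 -> en (y - c) < th.
  move=> h; have := enD_le (y - z0) (z0 - c); have := enD_le (z0 - y0) (y0 - c).
  rewrite !addrA !subrK; lra.
have [] := @hopf_barrier z0 y1 t2 r2 setT classical_sets.set0 (erefl _) r20 r2t closedT I => //.
- by move=> y [_ /Bth /cw].
- by move=> y [_ /Bth /w0].
- move=> y [_ hy] yr _; split; first exact/hel/Bth.
  have [d d0 Hd] := en_ball_nbhs yr; exists d => // x /Hd hx.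
  by split => //=; exact: ltW.
- move=> y [_ /= hy] yt; have := w0 _ (Bth _ hy); rewrite le_eqVlt => /orP[/eqP wy|]; last by right.
  left; have h1 : en (y - y0) <= 4 * t2 - en (y - y1 + y0 - y1).
    have := enB (y - y1) (y0 - y1); have := enD (y - y1) (y0 - y1).
    have -> : y - y1 - (y0 - y1) = y - y0 by rewrite opprB addrA subrK.
    rewrite e2 enN -/t2 -e2 addrA; lra.
  have yZ : y \in Z.
    apply/mem_set; split => //=; apply: le_trans Kz0'; rewrite t2E.
    by apply: (le_trans h1); rewrite gerBl en_ge0.
  have := zmin _ yZ; rewrite t2E => h2.
  have /en_eq0/eqP : en (y - y1 + y0 - y1) = 0 by apply/eqP; rewrite eq_le en_ge0 andbT; lra.
  rewrite -addrA e2 subr_eq0 => /eqP h3.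
  by rewrite -[y](subrK y1) h3 subrK.
Qed.

Lemma en_segment (a b : 'rV[R]_n) (t : R) :
  en ((1 - t) *: a + t *: b) = (1 - t) * en a + t * en b - t * (1 - t) * en (a - b).
Proof. by rewrite /en !dotE (dotC b a); ring. Qed.

(** If [w] is nonzero at one point, it is positive in the whole half-ball, as a zero would spread
    along a segment by [smp_interior]. The barrier of a ball tangent to the hyperplane at 0 then
    forces at least linear growth along [nu], against the vanishing of the expansion of [w] at 0. *)
Lemma smp_boundary (nu : 'rV[R]_n) (th : R) :
  en nu = 1 ->
  (forall y, en y < th -> {for y, continuous w}) ->
  (forall y, en y < th -> 0 < dot nu y -> elliptic_at y) ->
  (forall y, en y < th -> 0 < dot nu y -> 0 <= w y) ->
  (forall y, en y < th -> dot nu y = 0 -> w y = 0) -> T2 w 0 0 0 ->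
  forall y, en y < th -> 0 < dot nu y -> w y = 0.
Proof.
move=> nu1 cw hel w0 wfl wT y0 hy0 nuy0; apply/eqP/negPn/negP => /eqP wy0.
have th0 : 0 < th by have := en_ge0 y0; lra.
have wpos y : en y < th -> 0 < dot nu y -> 0 < w y.
  move=> hy nuy; have := w0 _ hy nuy; rewrite le_eqVlt => /orP[/eqP wy|//]; exfalso; apply: wy0.
  pose g (t : R) := (1 - t) *: y + t *: y0.
  have cg : continuous g.
    move=> t; have h1 : {for t, continuous (fun t : R => (1 - t) *: y)}.
      apply: continuousZr_tmp.
      by apply: continuousB; [exact: cst_continuous | exact: cvg_id].
    have h2 : {for t, continuous (fun t : R => t *: y0)}.
      by apply: continuousZr_tmp; exact: cvg_id.
    exact: (continuousD h1 h2).
  have gth t : `[0, 1]%classic t -> en (g t) < th /\ 0 < dot nu (g t).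
    rewrite /= in_itv /= => /andP[t0 t1]; split.
      rewrite /g en_segment; have := en_ge0 (y - y0); set X := en (y - y0).
      have : 0 <= t * (1 - t) by rewrite mulr_ge0 // subr_ge0.
      move=> a1 a2; have := mulr_ge0 a1 a2.
      have [->|tn] := eqVneq t 0; first by rewrite subr0 !mul0r mul1r addr0 subr0.
      have tp : 0 < t by rewrite lt_neqAle eq_sym tn.
      have : (1 - t) * en y <= (1 - t) * th by rewrite ler_wpM2l ?subr_ge0 // ltW.
      have : t * en y0 < t * th by rewrite ltr_pM2l.
      lra.
    rewrite /g dotDr !dotZr.
    have [->|tn] := eqVneq t 0; first by rewrite subr0 mul1r mul0r addr0.
    have tp : 0 < t by rewrite lt_neqAle eq_sym tn.
    by rewrite ltr_wpDl ?mulr_gt0 // mulr_ge0 ?subr_ge0 // ltW.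
  have e1 : g 1 = y0 by rewrite /g subrr scale0r add0r scale1r.
  have e0 : g 0 = y by rewrite /g subr0 scale0r addr0 scale1r.
  rewrite -e1; apply: (@conn_ind _ (`[0, 1]%classic : set R) (fun t => w (g t) = 0) _ _ _ _ 1).
  - exact: segment_connected.
  - by exists 0; [rewrite /= in_itv /= lexx ler01 | rewrite e0].
  - move=> t It wt; have [gt1 gt2] := gth _ It.
    have [d1 d10 H1] : exists2 d, 0 < d & forall x, en (x - g t) < d -> en x < th.
      have := @en_ball_nbhs (g t) 0 th; rewrite subr0 => /(_ gt1)[d d0 H].
      by exists d => // x /H; rewrite subr0.
    have [d2 d20 H2] := dot_pos_nbhs gt2.
    pose d := Num.min d1 d2.
    have d0 : 0 < d by rewrite lt_min d10.
    have near0 : forall x, en (x - g t) < d / 16 -> w x = 0.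
      apply: (@smp_interior (g t) d) => //.
        by move=> x; rewrite lt_min => /andP[/H1 a1 /H2 a2]; exact: hel.
      by move=> x; rewrite lt_min => /andP[/H1 a1 /H2 a2]; exact: w0.
    have : nbhs (g t) [set x | w x = 0] by apply/nbhs_en; exists (d / 16) => //; rewrite divr_gt0.
    by move=> h; apply: (@filterS _ (nbhs t) _ _ _ _ (cg t _ h)) => s /=.
  - move=> t It wt; have [gt1 gt2] := gth _ It.
    have : {for t, continuous (w \o g)} by apply: continuous_comp; [exact: cg | exact: cw].
    move=> c; have : nbhs (w (g t)) [set x | x != 0].
      by apply: open_nbhs_nbhs; split; [exact: open_neq | exact/eqP].
    by move=> h; apply: (@filterS _ (nbhs t) _ _ _ _ (c _ h)) => s /= /eqP.
  - by rewrite /= in_itv /= ler01 lexx.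
pose ta := Num.sqrt (th / 16).
have ta2 : ta ^+ 2 = th / 16 by rewrite sqr_sqrtr // ltW // divr_gt0.
have ta0 : 0 < ta by rewrite sqrtr_gt0 divr_gt0.
pose t2 := ta ^+ 2; pose r2 := t2 / 4.
have t20 : 0 < t2 by rewrite exprn_gt0.
have r20 : 0 < r2 by rewrite divr_gt0.
have yy (y : 'rV[R]_n) : en (y - ta *: nu) = en y - 2 * ta * dot nu y + t2.
  by rewrite enB enZ nu1 dotZr (dotC y); rewrite /t2; ring.
have cA : closed [set y | 0 <= dot nu y].
  apply: (@closed_comp _ _ (dot nu) [set t | 0 <= t]); last exact: closed_ge.
  by move=> x _; apply: (continuous_dot (x := x)); [exact: cst_continuous | exact: cvg_id].
have Bth y : en (y - 0) <= r2 -> en y < th.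
  rewrite subr0 => h; apply: (le_lt_trans h); rewrite /r2 /t2 ta2; lra.
have [] := @hopf_barrier 0 (ta *: nu) t2 r2 [set y | 0 <= dot nu y] [set y | dot nu y = 0] _ r20 (lexx _) cA _.
- by rewrite yy en0 dot0r mulr0 subrr add0r.
- by rewrite /= dot0r.
- by move=> y [_ /Bth /cw].
- move=> y [/= h /Bth hy]; move: h; rewrite le_eqVlt => /orP[/eqP/esym h|h]; last exact: w0.
  by rewrite wfl.
- by rewrite wfl ?en0 ?dot0r.
- move=> y [/= h hy] yr nf; have h1 : 0 < dot nu y by rewrite lt_neqAle h andbT; apply/eqP => /esym.
  split; first by apply: hel => //; exact: Bth.
  have [d1 d10 H1] := en_ball_nbhs yr; have [d2 d20 H2] := dot_pos_nbhs h1.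
  exists (Num.min d1 d2); first by rewrite lt_min d10.
  by move=> x; rewrite lt_min => /andP[/H1 a1 /H2 a2]; split; exact: ltW.
- by move=> y [/= h hy] f; rewrite yy f mulr0 subr0 lerDr en_ge0.
- move=> y [/= h hy]; rewrite yy => h2; move: h; rewrite le_eqVlt => /orP[/eqP h|h]; last first.
    by right; apply: wpos => //; exact: Bth.
  by left; apply: en_eq0; apply/eqP; rewrite eq_le en_ge0 andbT; move: h2; rewrite -h; lra.
move=> _ [ep [al [ep0 al0 H]]].
have [d d0 Hd] := wT _ ltr01.
pose h0 := expR (- al * t2).
have h00 : 0 < h0 by exact: expR_gt0.
pose c := ep * h0 * al * ta.
have c0 : 0 < c by rewrite !mulr_gt0.
pose t := Num.min (Num.min 1 (ta / 2)) (Num.min (d / 2) (c / 2)).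
have t0 : 0 < t by rewrite !lt_min ltr01 !divr_gt0.
have t1 : t <= 1 by rewrite !ge_min lexx.
have tta : t <= ta / 2 by rewrite !ge_min lexx orbT.
have td : t <= d / 2 by rewrite !ge_min lexx !orbT.
have tc : t <= c / 2 by rewrite !ge_min lexx !orbT.
have et : en (t *: nu) = t ^+ 2 by rewrite enZ nu1 mulr1.
have tsq : t ^+ 2 <= t by rewrite expr2 ler_piMr // ltW.
have hw : `|w (t *: nu)| <= t ^+ 2.
  have h : t ^+ 2 < d by lra.
  have := Hd (t *: nu); rewrite et => /(_ h).
  rewrite add0r (wfl 0) ?en0 ?dot0r // dot0l /quad mulmx0 mul0mx mxE mulr0 !subr0 mul1r.
  by [].
have := H (t *: nu) _; rewrite yy dotZr -/(en nu) nu1 et mulr1 => hB.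
have {}hB : ep * (expR (- al * (t ^+ 2 - 2 * ta * t + t2)) - expR (- al * t2)) <= w (t *: nu).
  apply: hB; split => /=; first by rewrite dotZr -/(en nu) nu1 mulr1 ltW.
  rewrite subr0 et /r2 /t2 (_ : ta ^+ 2 / 4 = (ta / 2) ^+ 2); last by field.
  by rewrite ler_sqr ?nnegrE // ltW // divr_gt0.
have hE : expR (- al * (t ^+ 2 - 2 * ta * t + t2)) = h0 * expR (al * (2 * ta * t - t ^+ 2)).
  by rewrite -expRD; congr expR; ring.
have hx := expR_ge1Dx (al * (2 * ta * t - t ^+ 2)).
rewrite hE in hB.
have b1 : ep * h0 * (al * (2 * ta * t - t ^+ 2)) <= w (t *: nu).
  apply: le_trans hB; rewrite -/h0 -mulrA ler_pM2l //.
  have := ler_wpM2l (ltW h00) hx; lra.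
have b2 : c * t <= ep * h0 * (al * (2 * ta * t - t ^+ 2)).
  rewrite /c -!mulrA !ler_pM2l //; have := ler_wpM2l (ltW t0) tta; have := mulr_gt0 ta0 t0; lra.
have b3 := le_trans b2 (le_trans b1 (le_trans (ler_norm _) hw)).
have : c <= t by rewrite -(ler_pM2r t0) -expr2.
lra.
Qed.

End Barrier.

Module SpaceForm.
(** * Space forms *)

(* A locked copy of the ambient product, which rewriting does not unfold. *)
Definition lip (R : realType) (n : nat) (delta : R) (x y : 'rV[R]_n.+2) : R :=
  locked (@ambient_prod R n delta) x y.

Lemma lipE (R : realType) (n : nat) (delta : R) (x y : 'rV[R]_n.+2) :
  ambient_prod delta x y = lip delta x y.
Proof. by rewrite /lip -lock. Qed.

Section SpaceForm.
Context (R : realType) (n : nat) (delta : R).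
Notation V := 'rV[R]_n.+2.
Notation ip := (@lip R n delta).
Notation M := (@space_form R n delta).
Implicit Types (p q v w x y z c : V).

Definition tl v : 'rV[R]_n.+1 := \row_i v 0 (lift ord0 i).
Definition eps : R := if delta < 0 then -1 else 1.

Lemma ipE v w : ip v w = eps * (v 0 ord0 * w 0 ord0) + dot (tl v) (tl w).
Proof. by rewrite -lipE /ambient_prod /dot; congr (_ + _); apply: eq_bigr => i _; rewrite !mxE. Qed.

Lemma tlD v w : tl (v + w) = tl v + tl w. Proof. by apply/rowP => i; rewrite !mxE. Qed.
Lemma tlZ a v : tl (a *: v) = a *: tl v. Proof. by apply/rowP => i; rewrite !mxE. Qed.

Lemma ipC v w : ip v w = ip w v.
Proof. by rewrite !ipE dotC [v 0 _ * _]mulrC. Qed.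
Lemma ipDl u v w : ip (u + v) w = ip u w + ip v w.
Proof. by rewrite !ipE tlD dotDl !mxE; ring. Qed.
Lemma ipZl a v w : ip (a *: v) w = a * ip v w.
Proof. by rewrite !ipE tlZ dotZl !mxE; ring. Qed.
Lemma ipNl v w : ip (- v) w = - ip v w.
Proof. by rewrite -scaleN1r ipZl mulN1r. Qed.
Lemma ipDr u v w : ip u (v + w) = ip u v + ip u w.
Proof. by rewrite ipC ipDl !(ipC u). Qed.
Lemma ipZr a v w : ip v (a *: w) = a * ip v w.
Proof. by rewrite ipC ipZl ipC. Qed.
Lemma ipNr v w : ip v (- w) = - ip v w.
Proof. by rewrite ipC ipNl ipC. Qed.
Lemma ip0l v : ip 0 v = 0. Proof. by rewrite -(scale0r 0) ipZl mul0r. Qed.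
Lemma ip0r v : ip v 0 = 0. Proof. by rewrite ipC ip0l. Qed.
Definition ipL := (ipDl, ipDr, ipNl, ipNr, ipZl, ipZr).

Lemma ip_suml (I : finType) (f : I -> V) v : ip (\sum_i f i) v = \sum_i ip (f i) v.
Proof.
elim: (index_enum I) => [|i s IH]; first by rewrite !big_nil ip0l.
by rewrite !big_cons ipDl IH.
Qed.
Lemma ip_sumr (I : finType) (f : I -> V) v : ip v (\sum_i f i) = \sum_i ip v (f i).
Proof. by rewrite ipC ip_suml; apply: eq_bigr => i _; rewrite ipC. Qed.

Definition V0 v := delta = 0 -> v 0 ord0 = 0.
(** The tangent space in algebraic form for all signs at once: [V0] is the linear equation of the
    model when [delta = 0], and the factor [delta] makes orthogonality to [p] void in that case. *)
Definition TM p v := V0 v /\ delta * ip p v = 0.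

Lemma V0D v w : V0 v -> V0 w -> V0 (v + w).
Proof. by move=> hv hw d0; rewrite mxE hv // hw // addr0. Qed.
Lemma V0Z a v : V0 v -> V0 (a *: v).
Proof. by move=> hv d0; rewrite mxE hv // mulr0. Qed.
Lemma V0N v : V0 v -> V0 (- v).
Proof. by move=> hv d0; rewrite mxE hv // oppr0. Qed.
Lemma V0_0 : V0 0. Proof. by move=> _; rewrite mxE. Qed.

Lemma TMD p v w : TM p v -> TM p w -> TM p (v + w).
Proof. by move=> [v1 v2] [w1 w2]; split; [exact: V0D | rewrite ipDr mulrDr v2 w2 addr0]. Qed.
Lemma TMZ p a v : TM p v -> TM p (a *: v).
Proof. by move=> [v1 v2]; split; [exact: V0Z | rewrite ipZr mulrCA v2 mulr0]. Qed.
Lemma TM0 p : TM p 0.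
Proof. by split; [exact: V0_0 | rewrite ip0r mulr0]. Qed.
Lemma TM_sum p (I : finType) (f : I -> V) : (forall i, TM p (f i)) -> TM p (\sum_i f i).
Proof.
move=> h; elim: (index_enum I) => [|i s IH]; first by rewrite big_nil; exact: TM0.
by rewrite big_cons; apply: TMD.
Qed.

Lemma M_V0 p : M p -> V0 p.
Proof. by rewrite /space_form /= => h d0; move: h; rewrite d0 eqxx. Qed.

Lemma M_ip p : M p -> delta * ip p p = (delta != 0)%:R.
Proof.
rewrite /space_form /= lipE; case: eqP => [-> _|/eqP d0 [-> _]]; first by rewrite mul0r.
by rewrite mulfV.
Qed.

Lemma M_ip1 p : M p -> delta != 0 -> delta * ip p p = 1.
Proof. by move=> /M_ip -> ->. Qed.

Lemma M_pos p : M p -> delta != 0 -> 0 < p 0 ord0.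
Proof. by rewrite /space_form /= => + /negPf d0; rewrite d0 => -[]. Qed.

Lemma M_intro p : V0 p -> (delta != 0 -> delta * ip p p = 1) -> (delta != 0 -> 0 < p 0 ord0) -> M p.
Proof.
move=> h0 h1 h2; rewrite /space_form /= lipE; case: eqP => [|/eqP d0]; first exact: h0.
split; last exact: h2.
by apply: (mulfI d0); rewrite h1 // mulfV.
Qed.

Definition psi p x : R := locked (1 + delta * ip (x - p) p).

Lemma psi_def p x : psi p x = 1 + delta * ip (x - p) p.
Proof. by rewrite /psi -lock. Qed.

Lemma psiE p x : M p -> psi p x = delta * ip x p + (delta == 0)%:R.
Proof.
move=> /M_ip h; rewrite psi_def ipDl ipNl mulrDr mulrN h.
by case: (delta == 0) => /=; ring.
Qed.

Lemma psi_pp p : psi p p = 1.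
Proof. by rewrite psi_def subrr ip0l mulr0 addr0. Qed.

Lemma psiC p x : M p -> M x -> psi p x = psi x p.
Proof. by move=> hp hx; rewrite !psiE // ipC. Qed.

(** Gnomonic (Beltrami-Klein) coordinates: central projection to the tangent space at [p], with
    inverse [rho p]. They are [x - p] and [p + v] when [delta = 0], and they send geodesics to
    straight lines. *)
Definition lg p x : V := (psi p x)^-1 *: x - p.
Definition rho p v : V := (Num.sqrt (1 + delta * ip v v))^-1 *: (p + v).

Lemma lg_TM p x : M p -> M x -> psi p x != 0 -> TM p (lg p x).
Proof.
move=> Mp Mx s0; split; first by apply: V0D; [apply: V0Z; exact: M_V0 | apply: V0N; exact: M_V0].
rewrite /lg !ipL mulrDr mulrN (M_ip Mp).
have := psiE x Mp; case: eqP => [d0|_] /= h.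
  by rewrite d0 mul0r subr0.
rewrite ipC mulrCA; rewrite addr0 in h; rewrite -h mulVf // subrr //.
Qed.

Lemma lg_ip p x : M p -> M x -> psi p x != 0 ->
  1 + delta * ip (lg p x) (lg p x) = (psi p x)^-2.
Proof.
move=> Mp Mx s0; have h := psiE x Mp; have hp := M_ip Mp; have hx := M_ip Mx.
have -> : delta * ip (lg p x) (lg p x) = (psi p x)^-2 * (delta * ip x x)
   - 2 * (psi p x)^-1 * (delta * ip x p) + delta * ip p p.
  rewrite /lg !ipL (ipC p x) expr2 invfM; ring.
rewrite hp hx; case: eqP h => [d0|_] /= h; last by rewrite addr0 in h; rewrite -h; field.
by rewrite h d0 mul0r add0r; field.
Qed.

Lemma lgK p x : M p -> M x -> 0 < psi p x -> rho p (lg p x) = x.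
Proof.
move=> Mp Mx s0; rewrite /rho lg_ip ?gt_eqF // sqrtrV ?exprn_ge0 ?ltW //.
rewrite sqrtr_sqr gtr0_norm // invrK /lg addrC subrK scalerA mulfV ?gt_eqF //.
by rewrite scale1r.
Qed.

Lemma psi_rho p v : M p -> TM p v -> 0 < 1 + delta * ip v v ->
  psi p (rho p v) = (Num.sqrt (1 + delta * ip v v))^-1.
Proof.
move=> Mp [_ pv] h; rewrite psiE // /rho ipZl ipDl mulrCA mulrDr (ipC v p) pv addr0 (M_ip Mp).
case: eqP h => [->|_] h /=; last by rewrite mulr1 addr0.
by rewrite mulr0 add0r mul0r addr0 sqrtr1 invr1.
Qed.

Lemma cs_dot m (a b : 'rV[R]_m) : dot a b ^+ 2 <= en a * en b.
Proof.
have [e|ne] := eqVneq (en b) 0; first by rewrite (en_eq0 e) dot0r en0 mulr0 expr0n.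
have b0 : 0 < en b by rewrite lt_neqAle eq_sym ne en_ge0.
have := en_ge0 (a - (dot a b / en b) *: b); rewrite enB enZ dotZr.
have -> : en a - 2 * (dot a b / en b * dot a b) + (dot a b / en b) ^+ 2 * en b =
   (en a * en b - dot a b ^+ 2) / en b by field.
by rewrite pmulr_lge0 ?invr_gt0 // subr_ge0.
Qed.

Lemma ip_ge0 v : 0 <= delta -> 0 <= ip v v.
Proof.
move=> d0; rewrite ipE /eps ltNge d0 /= mul1r addr_ge0 ?en_ge0 //.
by rewrite -expr2 sqr_ge0.
Qed.

Lemma ip_eq0 v : 0 <= delta -> ip v v = 0 -> v = 0.
Proof.
move=> d0; rewrite ipE /eps ltNge d0 /= mul1r => /eqP.
rewrite paddr_eq0 ?en_ge0 -?expr2 ?sqr_ge0 // sqrf_eq0 => /andP[/eqP h1 /eqP/en_eq0 h2].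
apply/rowP => i; rewrite mxE; case: (unliftP ord0 i) => [j ->|->] //.
by have := congr1 (fun f : 'rV[R]_n.+1 => f 0 j) h2; rewrite !mxE.
Qed.

(** For [delta < 0], orthogonality gives [p_0 v_0 = <tl p, tl v>] while [|tl p| < p_0];
    Cauchy-Schwarz on the tails makes [v] space-like. *)
Lemma tangent_pos p v : M p -> TM p v -> 0 <= ip v v /\ (ip v v = 0 -> v = 0).
Proof.
move=> Mp [v0 pv]; have [d0|d0] := leP 0 delta.
  by split; [exact: ip_ge0 | exact: ip_eq0].
have dn : delta != 0 by rewrite lt_eqF.
have pp := M_ip Mp; rewrite dn in pp; have p0 := M_pos Mp dn.
have {}pv : ip p v = 0 by move/eqP: pv; rewrite mulf_eq0 (negPf dn) => /eqP.
move: pp pv; rewrite !ipE /eps d0 => pp pv.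
set a := p 0 ord0 in p0 pp pv; set b := v 0 ord0 in pv *.
have cs := cs_dot (tl p) (tl v).
have P1 : en (tl p) < a ^+ 2.
  move: pp; rewrite -/(en (tl p)) => pp; rewrite ltNge; apply/negP => h.
  have : delta * (-1 * (a * a) + en (tl p)) <= 0.
    by rewrite nmulr_rle0 //; lra.
  by rewrite pp /= ler10.
have e1 : dot (tl p) (tl v) = a * b by lra.
rewrite -/(en (tl v)); rewrite e1 in cs.
have q0 := en_ge0 (tl v); have q1 := en_ge0 (tl p).
have a2 : 0 < a ^+ 2 by rewrite exprn_gt0.
have b2 : b ^+ 2 <= en (tl v).
  rewrite -(ler_pM2l a2) -exprMn (le_trans cs) // ler_wpM2r // ltW //.
split; first by rewrite addrC; move: b2; rewrite expr2; lra.
move=> h; have eb : b ^+ 2 = en (tl v) by rewrite expr2; lra.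
have z : en (tl v) = 0.
  apply/eqP/negPn/negP => z; have z0 : 0 < en (tl v) by rewrite lt_neqAle eq_sym z.
  by move: cs; rewrite exprMn eb ler_pM2r // leNgt P1.
have b0 : b = 0 by apply/eqP; rewrite -sqrf_eq0 eb z.
apply/rowP => i; rewrite mxE; case: (unliftP ord0 i) => [j ->|->] //.
by have := congr1 (fun f : 'rV[R]_n.+1 => f 0 j) (en_eq0 z); rewrite !mxE.
Qed.

Lemma tangent_cs p v w : M p -> TM p v -> TM p w -> ip v w ^+ 2 <= ip v v * ip w w.
Proof.
move=> Mp tv tw; have [w0 w1] := tangent_pos Mp tw.
have [e|ne] := eqVneq (ip w w) 0; first by rewrite (w1 e) !ip0r expr0n mulr0.
have b0 : 0 < ip w w by rewrite lt_neqAle eq_sym ne.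
have [] := tangent_pos Mp (TMD tv (TMZ (- (ip v w / ip w w)) tw)).
set a := - (_ / _) => h _; move: h.
have -> : ip (v + a *: w) (v + a *: w) = (ip v v * ip w w - ip v w ^+ 2) / ip w w.
  by rewrite !ipL (ipC w v) /a; field.
by rewrite pmulr_lge0 ?invr_gt0 // subr_ge0.
Qed.

(** Inside the light cone the product of the tails cannot outweigh that of the time coordinates, so
    the sign of [ip p v] decides the sheet. *)
Lemma same_cone p v : delta < 0 -> M p -> 0 < delta * ip v v -> 0 < delta * ip p v -> 0 < v 0 ord0.
Proof.
move=> d0 Mp; have dn : delta != 0 by rewrite lt_eqF.
have pp := M_ip Mp; rewrite dn in pp; have p0 := M_pos Mp dn.
rewrite !nmulr_rgt0 //; move: pp; rewrite !ipE /eps d0 => pp vv pv.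
set a := p 0 ord0 in p0 pp pv; set b := v 0 ord0 in vv pv *.
have P1 : en (tl p) < a ^+ 2.
  move: pp; rewrite -/(en (tl p)) => pp; rewrite ltNge; apply/negP => h.
  have : delta * (-1 * (a * a) + en (tl p)) <= 0.
    by rewrite nmulr_rle0 //; lra.
  by rewrite pp /= ler10.
have P2 : en (tl v) < b ^+ 2 by move: vv; rewrite -/(en (tl v)) expr2; lra.
have cs := cs_dot (tl p) (tl v).
rewrite ltNge; apply/negP => b0.
have h1 : dot (tl p) (tl v) < a * b by lra.
have ab : a * b <= 0 by rewrite pmulr_rle0.
have : (a * b) ^+ 2 < dot (tl p) (tl v) ^+ 2.
  rewrite -[X in X < _]sqrrN -[X in _ < X]sqrrN ltr_sqr ?nnegrE ?oppr_ge0 //; first by rewrite ltrN2.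
  by rewrite ltW // (lt_le_trans h1).
have : en (tl p) * en (tl v) <= (a * b) ^+ 2.
  by rewrite exprMn ler_pM ?en_ge0 // ltW.
lra.
Qed.

Lemma M_rho p v : M p -> TM p v -> 0 < 1 + delta * ip v v ->
  (0 < delta -> 0 < (p + v) 0 ord0) -> M (rho p v).
Proof.
move=> Mp tv h hpos; have pp := M_ip Mp; case: (tv) => v0 pv.
have m0 : 0 < (Num.sqrt (1 + delta * ip v v))^-1 by rewrite invr_gt0 sqrtr_gt0.
have yy : delta != 0 -> delta * ip (p + v) (p + v) = 1 + delta * ip v v.
  by move=> dn; rewrite !ipL (ipC v p) !mulrDr (M_ip1 Mp) // pv; ring.
apply: M_intro; first by apply: V0Z; apply: V0D => //; exact: M_V0.
  move=> dn; rewrite /rho ipZl ipZr mulrCA [delta * (_ * _)]mulrCA yy // mulrA -invfM -expr2 sqr_sqrtr ?ltW //.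
  by rewrite mulVf // gt_eqF.
move=> dn; rewrite /rho mxE mulr_gt0 //.
have [dp|dm] := ltP 0 delta; first exact: hpos.
have {dm} d0 : delta < 0 by rewrite lt_neqAle dn.
apply: (same_cone d0 Mp); first by rewrite yy.
by rewrite ipDr mulrDr pv pp dn addr0 ltr01.
Qed.

Definition sqd c x : R := ip (c - x) (c - x).

Lemma sqdC c x : sqd c x = sqd x c.
Proof. by rewrite /sqd -(opprB x c) ipNl ipNr opprK. Qed.

Lemma psi_sqd c x : M c -> M x -> psi c x = 1 - delta * sqd c x / 2.
Proof.
move=> Mc Mx; have hc := M_ip Mc; have hx := M_ip Mx.
have -> : delta * sqd c x = delta * ip c c + delta * ip x x - 2 * (delta * ip x c).
  by rewrite /sqd !ipL (ipC c x); ring.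
by rewrite psiE // hc hx; case: (delta == 0); rewrite /= ?mulr0n ?mulr1n; field.
Qed.

Lemma psi_neg_gt0 c x : delta <= 0 -> M c -> M x -> 0 < psi c x.
Proof.
move=> d0 Mc Mx; rewrite psiE //; case: eqP => [->|/eqP dn] /=; first by rewrite mul0r add0r ltr01.
rewrite addr0; have {d0} d0 : delta < 0 by rewrite lt_neqAle dn.
have pp := M_ip Mc; have xx := M_ip Mx; rewrite dn in pp xx.
have p0 := M_pos Mc dn; have x0 := M_pos Mx dn.
have P z : 1 = delta * ip z z -> en (tl z) < z 0 ord0 ^+ 2.
  move=> zz; rewrite ltNge; apply/negP => h.
  have : delta * ip z z <= 0 by rewrite ipE /eps d0 -/(en (tl z)) nmulr_rle0 //; move: h; rewrite expr2; lra.
  by rewrite -zz ler10.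
have P1 := P _ (esym pp); have P2 := P _ (esym xx).
rewrite nmulr_rgt0 // ipE /eps d0 mulN1r addrC subr_lt0.
have xc0 : 0 <= x 0 ord0 * c 0 ord0 by rewrite mulr_ge0 // ltW.
apply: (le_lt_trans (ler_norm _)); rewrite -ltr_sqr ?nnegrE // real_normK ?num_real //.
apply: (le_lt_trans (cs_dot _ _)); rewrite exprMn ltr_pM ?en_ge0 //.
Qed.

(** For [delta < 0] the ambient product is indefinite and the sign comes from the space form:
    [lg_ip] gives [psi^-2 <= 1], hence [psi >= 1], that is, [delta * sqd <= 0]. *)
Lemma sqd_ge0 c x : M c -> M x -> 0 <= sqd c x /\ (sqd c x = 0 -> x = c).
Proof.
move=> Mc Mx; have [d0|d0] := leP 0 delta.
  split; first exact: ip_ge0.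
  by move=> /(ip_eq0 d0) /eqP; rewrite subr_eq0 => /eqP ->.
have s0 := psi_neg_gt0 (ltW d0) Mc Mx.
have tv := lg_TM Mc Mx (lt0r_neq0 s0); have [v0 v1] := tangent_pos Mc tv.
have vv := lg_ip Mc Mx (lt0r_neq0 s0); have sd := psi_sqd Mc Mx.
have s1 : 1 <= psi c x.
  have : (psi c x)^-2 <= 1 by rewrite -vv gerDl nmulr_rle0 //.
  rewrite invf_le1 ?exprn_gt0 // => h.
  by rewrite -(@expr_ge1 _ 2) // ltW.
split.
  have : delta * sqd c x <= 0 by lra.
  by rewrite nmulr_rle0.
move=> z; rewrite z mulr0 mul0r subr0 in sd.
have /v1 : ip (lg c x) (lg c x) = 0.
  rewrite sd expr1n invr1 in vv.
  have /eqP : delta * ip (lg c x) (lg c x) = 0 by lra.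
  by rewrite mulf_eq0 (lt_eqF d0) => /eqP.
by rewrite /lg sd invr1 scale1r => /eqP; rewrite subr_eq0 => /eqP.
Qed.

Definition frame p (E : 'I_n -> V) (N : V) :=
  [/\ forall i, TM p (E i), TM p N, forall i j, ip (E i) (E j) = (i == j)%:R,
      forall i, ip (E i) N = 0 & ip N N = 1].

(** Completed by [p], or by the coordinate vector of [x_0] when [delta = 0], the frame has an
    invertible diagonal Gram matrix; the difference of the two sides is orthogonal to all of it. The
    last coefficient uses [<p, p> = 1 / delta] and disappears for [delta = 0]. *)
Lemma frame_expand p E N v : M p -> frame p E N -> V0 v ->
  v = \sum_i ip v (E i) *: E i + ip v N *: N + (delta * ip v p) *: p.
Proof.
move=> Mp [TE TN EE EN NN] v0.
pose b0 : V := if delta == 0 then delta_mx 0 ord0 else p.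
pose b (k : 'I_n.+2) : V := match unlift ord0 k with None => b0 |
   Some k' => match unlift ord0 k' with None => N | Some i => E i end end.
pose d (k : 'I_n.+2) : R := if k == ord0 then (if delta == 0 then 1 else delta^-1) else 1.
have ipe v' : delta = 0 -> ip v' (delta_mx 0 ord0) = v' 0 ord0.
  move=> d0; rewrite -lipE /ambient_prod d0 ltxx mul1r !mxE !eqxx mulr1 big1 ?addr0 // => i _.
  by rewrite mxE andbC /= mulr0.
have b0T v' : TM p v' -> ip v' b0 = 0.
  move=> [hv pv]; rewrite /b0; case: eqP => [d0|/eqP dn]; first by rewrite ipe // hv.
  by rewrite ipC; apply/eqP; move/eqP: pv; rewrite mulf_eq0 (negPf dn).
have b00 : ip b0 b0 = d ord0.
  rewrite /b0 /d eqxx; case: eqP => [d0|/eqP dn]; first by rewrite ipe // mxE !eqxx.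
  by have := M_ip Mp; rewrite dn => h; apply: (mulfI dn); rewrite h mulfV.
have bb k m : ip (b k) (b m) = d k *+ (k == m).
  rewrite /b; case: (unliftP ord0 k) => [k' ->|->]; case: (unliftP ord0 m) => [m' ->|->].
  - have -> : d (lift ord0 k') = 1 by [].
    rewrite (inj_eq lift_inj).
    case: (unliftP ord0 k') => [i ->|->]; case: (unliftP ord0 m') => [j ->|->].
    + by rewrite EE (inj_eq lift_inj).
    + by rewrite EN.
    + by rewrite ipC EN.
    + by rewrite NN.
  - by case: (unliftP ord0 k') => [i _|_]; rewrite b0T.
  - by case: (unliftP ord0 m') => [i _|_]; rewrite ipC b0T.
  - by rewrite b00 eqxx.
have dn0 k : d k != 0.
  rewrite /d; case: (k == ord0); last exact: oner_neq0.
  by have [_|dn] := eqVneq delta 0; [exact: oner_neq0 | rewrite invr_eq0].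
pose B : 'M[R]_n.+2 := \matrix_k b k.
pose J : 'M[R]_n.+2 := diag_mx (\row_k (if k == ord0 then eps else 1)).
have ipJ x y : (x *m J *m y^T) 0 0 = ip x y.
  rewrite mxE big_ord_recl ipE; congr (_ + _).
    by rewrite /J mul_mx_diag !mxE eqxx; ring.
  by apply: eq_bigr => i _; rewrite /J mul_mx_diag !mxE mulr1.
have G : B *m J *m B^T = diag_mx (\row_k d k).
  apply/matrixP => k m; rewrite -[LHS]/((B *m J *m B^T) k m).
  have -> : (B *m J *m B^T) k m = (row k B *m J *m (row m B)^T) 0 0.
    by rewrite -row_mul tr_row -row_mul -!colE || rewrite !mxE; apply: eq_bigr => i _; rewrite !mxE; congr (_ * _); apply: eq_bigr => j _; rewrite !mxE.
  by rewrite !rowK ipJ bb !mxE.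
have uB : B^T \in unitmx.
  rewrite unitmx_tr unitmxE unitfE; have := congr1 determinant G.
  rewrite !det_mulmx det_tr => h; apply/negP => /eqP h0; rewrite h0 mulr0 in h.
  have : \prod_(k < n.+2) (\row_k d k) 0 k != 0 by apply/prodf_neq0 => k _; rewrite mxE dn0.
  by rewrite -det_diag -h eqxx.
have uJ : J \in unitmx.
  rewrite unitmxE unitfE det_diag; apply/prodf_neq0 => k _ /=; rewrite mxE.
  by case: ifP => _; rewrite /eps ?oner_neq0 //; case: ifP => _; rewrite ?oppr_eq0 oner_neq0.
set u := (X in _ = X); apply/eqP; rewrite -subr_eq0; apply/eqP; set r := v - u.
have rb k : ip r (b k) = 0.
  have rE i : ip r (E i) = 0.
    rewrite /r /u !ipL ip_suml (bigD1 i) //= ipZl EE eqxx big1 => [|j ji]; last first.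
      by rewrite ipZl EE (negPf ji) mulr0.
    rewrite (ipC N) EN; case: (TE i) => _ h.
    by rewrite [delta * ip v p * _]mulrAC h mulr1n; ring.
  have rN : ip r N = 0.
    rewrite /r /u !ipL ip_suml big1 => [|j _]; last by rewrite ipZl EN mulr0.
    by rewrite NN; case: TN => _ h; rewrite [delta * ip v p * _]mulrAC h; ring.
  rewrite /b; case: (unliftP ord0 k) => [k' _|_].
    by case: (unliftP ord0 k') => [i _|_]; rewrite ?rE ?rN.
  rewrite /r /u !ipL ip_suml big1 => [|j _]; last by rewrite ipZl b0T ?mulr0.
  rewrite (b0T N) // /b0; case: eqP => [d0|/eqP dn].
    by rewrite ipe // v0 // d0; ring.
  by rewrite [delta * ip v p * _]mulrAC (M_ip1 Mp dn); ring.
have : r *m J *m B^T = 0.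
  apply/rowP => k; rewrite [RHS]mxE.
  have -> : (r *m J *m B^T) 0 k = (r *m J *m (row k B)^T) 0 0.
    by rewrite !mxE; apply: eq_bigr => i _; rewrite !mxE.
  by rewrite rowK ipJ rb.
move=> h; have := congr1 (fun X => X *m invmx B^T *m invmx J) h.
by rewrite !mul0mx -(mulmxA (r *m J)) mulmxV // mulmx1 -mulmxA mulmxV // mulmx1.
Qed.

End SpaceForm.
End SpaceForm.
Import SpaceForm.

(** * First-order expansions *)

Section FirstOrder.
Context (R : realType).

Definition blin (V W : normedModType R) (L : V -> W) :=
  (forall a u v, L (a *: u + v) = a *: L u + L v) /\
  exists2 B : R, 0 < B & forall h, `|L h| <= B * `|h|.

(** Frechet differentiability with the differential as an explicit argument, so that chain and
    product rules compute it. *)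
Definition D1 (V W : normedModType R) (f : V -> W) (x : V) (L : V -> W) :=
  blin L /\ forall e : R, 0 < e -> exists2 d, 0 < d & forall h, `|h| < d ->
    `|f (x + h) - f x - L h| <= e * `|h|.

Lemma blin_add (V W : normedModType R) (L : V -> W) u v : blin L -> L (u + v) = L u + L v.
Proof. by move=> [h _]; rewrite -[u]scale1r h !scale1r. Qed.
Lemma blin0 (V W : normedModType R) (L : V -> W) : blin L -> L 0 = 0.
Proof.
move=> [h _]; have := h 1 0 0; rewrite scaler0 addr0 scale1r.
by move=> /eqP; rewrite eq_sym -subr_eq0 addrK => /eqP.
Qed.
Lemma blin_scale (V W : normedModType R) (L : V -> W) a v : blin L -> L (a *: v) = a *: L v.
Proof. by move=> b; case: (b) => h _; rewrite -[a *: v]addr0 h (blin0 b) addr0. Qed.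
Lemma blin_sum (V W : normedModType R) (L : V -> W) (I : finType) (f : I -> V) :
  blin L -> L (\sum_i f i) = \sum_i L (f i).
Proof.
move=> b; elim: (index_enum I) => [|i s IH]; first by rewrite !big_nil blin0.
by rewrite !big_cons (blin_add _ _ b) IH.
Qed.

Lemma D1_diff (V W : normedModType R) (f : V -> W) x :
  differentiable f x -> D1 f x (fun h => 'D_h f x).
Proof.
move=> df; have [cd dx] := (diff_locallyP _ _).1 df.
have E h : 'D_h f x = 'd f x h by rewrite deriveE.
split.
  split; first by move=> a u v; rewrite !E linearP.
  by have [k k0 kP] := linear_lipschitz cd; exists k => // h; rewrite E.
move=> e e0; have /eqaddoP/(_ e e0)/nbhs_normP[d /= d0 H] := dx.
exists d => // h hd; have /= := H h; rewrite sub0r normrN => /(_ hd).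
rewrite E /=; have -> : f (x + h) = f (shift x h) by rewrite /= addrC.
by rewrite opprD addrA.
Qed.

Lemma D1_cont (V W : normedModType R) (f : V -> W) x L : D1 f x L -> {for x, continuous f}.
Proof.
move=> [[_ [B B0 hB]] H]; apply/(@cvgrPdist_le _ _ _ (nbhs x) (nbhs_filter x)) => e e0.
have [d d0 Hd] := H 1 ltr01; apply/nbhs_normP; exists (Num.min d (e / (B + 1))) => /=.
  by rewrite lt_min d0 divr_gt0 // addr_gt0.
move=> t /=; rewrite lt_min distrC => /andP[td]; rewrite ltr_pdivlMr ?addr_gt0 // => te.
have := Hd _ td; rewrite [x + _]addrC subrK mul1r => h.
rewrite distrC -[f t - f x](subrK (L (t - x))).
apply: (le_trans (ler_normD _ _)); have := hB (t - x); lra.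
Qed.

Lemma D1_ext (V W : normedModType R) (f g : V -> W) x L L' :
  (\forall y \near x, f y = g y) -> L =1 L' -> D1 f x L -> D1 g x L'.
Proof.
move=> /nbhs_normP[d0 /= d00 fg] LL [[h1 [B B0 hB]] H]; split.
  by split=> [a u v|]; [rewrite -!LL | exists B => // h; rewrite -LL].
move=> e e0; have [d dp Hd] := H e e0; exists (Num.min d d0); first by rewrite lt_min dp.
move=> h; rewrite lt_min => /andP[hd hd0]; rewrite -LL -!fg ?Hd //= ?subrr ?normr0 //.
by rewrite opprD addrA subrr sub0r normrN.
Qed.

Lemma D1_cst (V W : normedModType R) (a : W) (x : V) : D1 (fun _ => a) x (fun _ => 0).
Proof.
split; first by split=> [b u v|]; [rewrite scaler0 addr0 | exists 1 => // h; rewrite normr0 mul1r].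
by move=> e e0; exists 1 => // h _; rewrite !subrr normr0 mulr_ge0 // ltW.
Qed.

Lemma D1_blin (V W : normedModType R) (L : V -> W) (x : V) : blin L -> D1 L x L.
Proof.
move=> b; split => // e e0; exists 1 => // h _.
by rewrite (blin_add _ _ b) [L x + _]addrC addrK subrr normr0 mulr_ge0 // ltW.
Qed.

Lemma blin_id (V : normedModType R) : blin (@id V).
Proof. by split=> //; exists 1 => // h; rewrite mul1r. Qed.

Lemma addr3B (W : zmodType) (a b c : W) : a + (b + c) - a - b = c.
Proof. by rewrite [a + _]addrC addrK [b + c]addrC addrK. Qed.

Lemma D1_rem (W : zmodType) (y a b : W) : y = a + (b + (y - a - b)).
Proof. by rewrite [b + _]addrC subrK [RHS]addrC subrK. Qed.

Lemma D1_add (V W : normedModType R) (f g : V -> W) x L L' :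
  D1 f x L -> D1 g x L' -> D1 (fun y => f y + g y) x (fun h => L h + L' h).
Proof.
move=> [[l1 [B B0 hB]] H] [[l2 [B' B'0 hB']] H']; split.
  split=> [a u v|]; first by rewrite l1 l2 scalerDr addrACA.
  exists (B + B'); first exact: addr_gt0.
  by move=> h; rewrite mulrDl (le_trans (ler_normD _ _)) // lerD.
move=> e e0; have e2 : 0 < e / 2 by rewrite divr_gt0.
have [d d0 Hd] := H _ e2; have [d' d'0 Hd'] := H' _ e2.
exists (Num.min d d'); first by rewrite lt_min d0.
move=> h; rewrite lt_min => /andP[/Hd h1 /Hd' h2].
have -> : f (x + h) + g (x + h) - (f x + g x) - (L h + L' h) =
   (f (x + h) - f x - L h) + (g (x + h) - g x - L' h).
  rewrite {1}(D1_rem (f (x + h)) (f x) (L h)) {1}(D1_rem (g (x + h)) (g x) (L' h)).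
  by rewrite addrACA [L h + _ + _]addrACA addr3B.
by apply: (le_trans (ler_normD _ _)); lra.
Qed.

Lemma D1_comp (U V W : normedModType R) (f : U -> V) (g : V -> W) x L L' :
  D1 f x L -> D1 g (f x) L' -> D1 (fun y => g (f y)) x (fun h => L' (L h)).
Proof.
move=> [[l1 [B B0 hB]] H] [bl' H']; have [l2 [B' B'0 hB']] := bl'; split.
  split=> [a u v|]; first by rewrite l1 l2.
  exists (B' * B); first exact: mulr_gt0.
  by move=> h; rewrite (le_trans (hB' _)) // -mulrA ler_pM2l.
move=> e e0.
have e1 : 0 < e / (2 * (B + 1)) by rewrite divr_gt0 // mulr_gt0 // addr_gt0.
have e2 : 0 < Num.min 1 (e / (2 * B')) by rewrite lt_min ltr01 divr_gt0 // mulr_gt0.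
have [d d0 Hd] := H _ e2; have [d' d'0 Hd'] := H' _ e1.
exists (Num.min d (d' / (B + 1))); first by rewrite lt_min d0 divr_gt0 // addr_gt0.
move=> h; rewrite lt_min ltr_pdivlMr ?addr_gt0 // => /andP[hd hd'].
have A1 := Hd _ hd; set r := f (x + h) - f x - L h in A1.
have A2 : `|r| <= 1 * `|h| by rewrite (le_trans A1) // ler_wpM2r // ge_min lexx.
have A3 : `|r| <= e / (2 * B') * `|h| by rewrite (le_trans A1) // ler_wpM2r // ge_min lexx orbT.
pose k := L h + r.
have fk : f (x + h) = f x + k by rewrite /k /r [L h + _]addrC subrK [RHS]addrC subrK.
have kh : `|k| <= (B + 1) * `|h|.
  by rewrite /k (le_trans (ler_normD _ _)) // mulrDl lerD.
have kd : `|k| < d' by rewrite (le_lt_trans kh) // mulrC.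
have := Hd' _ kd; rewrite -fk => A4.
have -> : g (f (x + h)) - g (f x) - L' (L h) = (g (f (x + h)) - g (f x) - L' k) + L' r.
  by rewrite /k (blin_add _ _ bl') opprD addrA subrK.
apply: (le_trans (ler_normD _ _)).
have A5 : e / (2 * (B + 1)) * `|k| <= e / 2 * `|h|.
  apply: (le_trans (ler_wpM2l (ltW e1) kh)); rewrite mulrA le_eqVlt; apply/orP; left; apply/eqP.
  by congr (_ * _); field; rewrite gt_eqF // addr_gt0.
have A6 : `|L' r| <= e / 2 * `|h|.
  apply: (le_trans (hB' _)); apply: (le_trans (ler_wpM2l (ltW B'0) A3)).
  rewrite mulrA le_eqVlt; apply/orP; left; apply/eqP; congr (_ * _); field; by rewrite gt_eqF.
lra.
Qed.

Definition bbil (V W U : normedModType R) (b : V -> W -> U) :=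
  [/\ forall w, (forall a u v, b (a *: u + v) w = a *: b u w + b v w),
      forall v, (forall a u w, b v (a *: u + w) = a *: b v u + b v w) &
      exists2 B : R, 0 < B & forall v w, `|b v w| <= B * `|v| * `|w|].

Lemma D1_bil (X V W U : normedModType R) (b : V -> W -> U) (f : X -> V) (g : X -> W) x L L' :
  bbil b -> D1 f x L -> D1 g x L' ->
  D1 (fun y => b (f y) (g y)) x (fun h => b (L h) (g x) + b (f x) (L' h)).
Proof.
move=> [bl br [K K0 hK]] [[l1 [B B0 hB]] H] [[l2 [B' B'0 hB']] H'].
have bDl u v w : b (u + v) w = b u w + b v w by have := bl w 1 u v; rewrite !scale1r.
have bDr u v w : b w (u + v) = b w u + b w v by have := br w 1 u v; rewrite !scale1r.
split.
  split=> [a u v|].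
    by rewrite l1 l2 bl br scalerDr addrACA.
  exists (K * B * `|g x| + K * `|f x| * B' + 1); first by rewrite ltr_wpDl // addr_ge0 // !mulr_ge0 // ltW.
  move=> h; rewrite mulrDl mul1r ler_wpDr // mulrDl.
  rewrite (le_trans (ler_normD _ _)) // lerD //.
    rewrite (le_trans (hK _ _)) // [_ * `|h|]mulrAC ler_wpM2r // -mulrA ler_pM2l //.
  by rewrite (le_trans (hK _ _)) // -[_ * B' * _]mulrA ler_wpM2l // mulr_ge0 // ltW.
move=> e e0.
pose G := K * (`|g x| + `|f x| + B + B' + 2).
have G0 : 0 < G by rewrite mulr_gt0 // ltr_wpDl // !addr_ge0 // ltW.
pose e1 := Num.min 1 (e / (4 * G)).
have e10 : 0 < e1 by rewrite lt_min ltr01 divr_gt0 // mulr_gt0.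
have [d d0 Hd] := H _ e10; have [d' d'0 Hd'] := H' _ e10.
pose c := e / (4 * (K * (B + 1) * (B' + 1))).
have KB : 0 < 4 * (K * (B + 1) * (B' + 1)) by rewrite !mulr_gt0 // addr_gt0.
have c0 : 0 < c by rewrite divr_gt0.
exists (Num.min c (Num.min d d')); first by rewrite !lt_min c0 d0.
move=> h; rewrite !lt_min => /and3P[hc /Hd A1 /Hd' A2].
set r := f (x + h) - f x - L h in A1; set r' := g (x + h) - g x - L' h in A2.
have fE : f (x + h) = f x + (L h + r) by rewrite /r [L h + _]addrC subrK [RHS]addrC subrK.
have gE : g (x + h) = g x + (L' h + r') by rewrite /r' [L' h + _]addrC subrK [RHS]addrC subrK.
have h0 := normr_ge0 h.
have -> : b (f (x + h)) (g (x + h)) - b (f x) (g x) - (b (L h) (g x) + b (f x) (L' h)) =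
   b r (g x) + (b (f x) r' + b (L h + r) (L' h + r')).
  have -> : b (f (x + h)) (g (x + h)) = b (f x) (g x) + ((b (L h) (g x) + b (f x) (L' h))
       + (b r (g x) + (b (f x) r' + b (L h + r) (L' h + r')))).
    rewrite fE gE bDl (bDr (g x) _ (f x)) (bDr (L' h) r' (f x)) (bDr (g x) _ (L h + r)) (bDl (L h) r (g x)).
    rewrite -addrA; congr (_ + _).
    set T := b (L h + r) _; set P1 := b (f x) (L' h); set P2 := b (f x) r'.
    set Q1 := b (L h) _; set Q2 := b r _.
    by rewrite (AC (2*(2*1)) ((3*1)*(4*(2*5)))%AC).
  by rewrite addr3B.
have e1G : e1 * G <= e / 4.
  apply: (@le_trans _ _ (e / (4 * G) * G)); first by rewrite ler_wpM2r ?(ltW G0) // ge_min lexx orbT.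
  rewrite le_eqVlt; apply/orP; left; apply/eqP; field; by rewrite gt_eqF.
have r1 : `|r| <= `|h| by rewrite (le_trans A1) // -[X in _ <= X]mul1r ler_wpM2r // ge_min lexx.
have r1' : `|r'| <= `|h| by rewrite (le_trans A2) // -[X in _ <= X]mul1r ler_wpM2r // ge_min lexx.
have P1 : K * `|g x| <= G by rewrite ler_pM2l //; have := normr_ge0 (f x); lra.
have P2 : K * `|f x| <= G by rewrite ler_pM2l //; have := normr_ge0 (g x); lra.
have T1 : `|b r (g x)| <= e / 4 * `|h|.
  apply: (le_trans (hK _ _)); apply: (@le_trans _ _ ((e1 * G) * `|h|)); last by rewrite ler_wpM2r.
  have := ler_wpM2l (mulr_ge0 (ltW K0) (normr_ge0 (g x))) A1.
  have := ler_wpM2l (mulr_ge0 (ltW e10) h0) P1; lra.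
have T2 : `|b (f x) r'| <= e / 4 * `|h|.
  apply: (le_trans (hK _ _)); apply: (@le_trans _ _ ((e1 * G) * `|h|)); last by rewrite ler_wpM2r.
  have := ler_wpM2l (mulr_ge0 (ltW K0) (normr_ge0 (f x))) A2.
  have := ler_wpM2l (mulr_ge0 (ltW e10) h0) P2; lra.
have T3 : `|b (L h + r) (L' h + r')| <= e / 4 * `|h|.
  apply: (le_trans (hK _ _)).
  have k1 : `|L h + r| <= (B + 1) * `|h| by rewrite (le_trans (ler_normD _ _)) // mulrDl mul1r lerD.
  have k2 : `|L' h + r'| <= (B' + 1) * `|h| by rewrite (le_trans (ler_normD _ _)) // mulrDl mul1r lerD.
  apply: (@le_trans _ _ (K * ((B + 1) * `|h|) * ((B' + 1) * `|h|))).
    by apply: ler_pM => //; [rewrite mulr_ge0 // ltW | rewrite ler_pM2l].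
  have : (K * (B + 1) * (B' + 1)) * `|h| <= e / 4.
    have := ltW hc; rewrite /c ler_pdivlMr // ; lra.
  move=> /(ler_wpM2r h0); lra.
have := ler_normD (b r (g x)) (b (f x) r' + b (L h + r) (L' h + r')).
have := ler_normD (b (f x) r') (b (L h + r) (L' h + r')).
have : 0 <= e * `|h| by rewrite mulr_ge0 // ltW.
lra.
Qed.

Lemma bbil_scale (V : normedModType R) : bbil (fun (k : R) (v : V) => k *: v).
Proof.
split=> [w a u v|v a u w|]; first by rewrite scalerDl scalerA.
  by rewrite scalerDr !scalerA mulrC.
by exists 1 => // v w; rewrite normrZ mul1r.
Qed.

Lemma bbil_mul : bbil (fun a b : R => a * b).
Proof.
split=> [w a u v|v a u w|]; first by rewrite mulrDl -scalerAl.
  by rewrite mulrDr -scalerAr.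
by exists 1 => // v w; rewrite normrM mul1r.
Qed.

Lemma D1_real (f : R -> R) (x a : R) : is_derive x 1 f a -> D1 f x (fun h => h * a).
Proof.
move=> [df <-]; have := D1_diff ((derivable1_diffP _ _).1 df).
apply: D1_ext => [|h]; first by near=> y.
by rewrite !deriveE //; [rewrite -[h in LHS]mulr1 linearZ | exact/derivable1_diffP | exact/derivable1_diffP].
Unshelve. all: by end_near. Qed.

Lemma D1_rsqrt (de x : R) : 0 < 1 + de * x ->
  D1 (fun t => (Num.sqrt (1 + de * t))^-1) x
     (fun h => h * (- (de / 2) * (Num.sqrt (1 + de * x))^-1 ^+ 3)).
Proof.
move=> h; apply: D1_real; set s := Num.sqrt (1 + de * x).
have s0 : 0 < s by rewrite sqrtr_gt0.
have d1 : is_derive x 1 (fun t => 1 + de * t) de.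
  have -> : (fun t => 1 + de * t) = cst (1 : R) + de \*: (@id R) by apply/funext.
  by apply: is_derive_eq; rewrite add0r -[_ *: _]/(_ * _) mulr1.
have d2 : is_derive x 1 (Num.sqrt \o (fun t => 1 + de * t)) (de * (2 * s)^-1).
  have := @is_derive1_comp _ Num.sqrt (fun t => 1 + de * t) x ((2 * s)^-1) de (is_derive1_sqrt h) d1.
  by rewrite mulrC.
have := @is_deriveV _ (Num.sqrt \o (fun t => 1 + de * t)) x _ 1 (lt0r_neq0 s0) d2.
move=> H; apply: (is_derive_eq H); rewrite /= -/s.
rewrite -[_ *: _]/(_ * _); field; by rewrite gt_eqF.
Qed.

End FirstOrder.

(** * Radial projection and implicit functions *)

Module RadialProjection.
Section Charts.
Context (R : realType) (n : nat) (delta : R).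
Notation V := 'rV[R]_n.+2.
Notation ip := (@lip R n delta).
Notation M := (@space_form R n delta).
Notation TM := (@TM R n delta).

Lemma bbil_lip : bbil (fun v w : V => ip v w).
Proof.
split=> [w a u v|v a u w|]; first by rewrite ipDl ipZl.
  by rewrite ipDr ipZr.
exists (n.+2)%:R; first by rewrite ltr0n.
move=> v w; rewrite ipE.
have h (i j : 'I_n.+2) : `|v 0 i * w 0 j| <= `|v| * `|w|.
  by rewrite normrM ler_pM // coord_norm.
apply: (le_trans (ler_normD _ _)).
have -> : n.+2%:R * `|v| * `|w| = `|v| * `|w| + n.+1%:R * (`|v| * `|w|).
  by rewrite -natr1; ring.
rewrite lerD //.
  have e1 : `|eps delta| = 1 by rewrite /eps; case: ifP => _; rewrite ?normrN normr1.
  by rewrite normrM e1 mul1r.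
rewrite (le_trans (ler_norm_sum _ _ _)) // (_ : _ * _ = \sum_(i < n.+1) `|v| * `|w|); last first.
  by rewrite sumr_const card_ord mulr_natl.
by apply: ler_sum => i _; rewrite !mxE.
Qed.

Definition lin_comb (E : 'I_n -> V) (y : 'rV[R]_n) : V := \sum_i y 0 i *: E i.

Lemma blin_lin_comb E : blin (lin_comb E).
Proof.
split=> [a u v|].
  rewrite /lin_comb scaler_sumr -big_split; apply: eq_bigr => i _ /=.
  by rewrite !mxE scalerDl scalerA.
exists (\sum_i `|E i| + 1); first by rewrite ltr_wpDl // sumr_ge0.
move=> h; rewrite mulrDl mul1r ler_wpDr // (le_trans (ler_norm_sum _ _ _)) //.
by rewrite mulr_suml; apply: ler_sum => i _; rewrite normrZ mulrC ler_wpM2l // coord_norm.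
Qed.

(** Extends [rho p] to ambient points near [p]. For [p] on the space form the quantity under the
    root is [delta * ip Y Y] if [delta != 0] and 1 otherwise, so one formula covers all signs. *)
Definition Rh (p Y : V) : V := (Num.sqrt (1 + delta * (ip Y Y - ip p p)))^-1 *: Y.

Lemma Rh_rho p v : delta * ip p v = 0 -> Rh p (p + v) = rho delta p v.
Proof.
move=> pv; rewrite /Rh /rho; congr ((Num.sqrt (1 + _))^-1 *: _).
rewrite !ipL (ipC _ v p) (_ : _ * _ = 2 * (delta * ip p v) + delta * ip v v); last by ring.
by rewrite pv mulr0 add0r.
Qed.

Lemma D1_Rh p Y : let m := (Num.sqrt (1 + delta * (ip Y Y - ip p p)))^-1 in
  0 < 1 + delta * (ip Y Y - ip p p) ->
  D1 (Rh p) Y (fun h => m *: h - (delta * m ^+ 3 * ip Y h) *: Y).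
Proof.
move=> m h.
have d1 : D1 (fun Z : V => ip Z Z - ip p p) Y (fun h => ip h Y + ip Y h + 0).
  apply: (D1_add (D1_bil bbil_lip (D1_blin Y (blin_id V)) (D1_blin Y (blin_id V)))).
  exact: D1_cst.
have d2 := D1_comp d1 (D1_rsqrt h).
have d3 := D1_bil (bbil_scale V) d2 (D1_blin Y (blin_id V)).
apply: D1_ext d3; first by near=> Z.
move=> k /=; rewrite -/m addrC; congr (_ + _).
rewrite -[RHS]scaleNr (ipC _ k Y); congr (_ *: _); field.
Unshelve. all: by end_near. Qed.

(** Monotonicity and the intermediate value theorem produce [u]; squeezing it between [u y - e'] and
    [u y + e'] gives continuity. Differentiability is left to [ift_D1]. *)
Lemma ift (phi : 'rV[R]_n -> R -> R) (th : R) : 0 < th ->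
  (forall y, en y < th -> forall s1 s2, `|s1| < th -> `|s2| < th -> s1 < s2 -> phi y s1 < phi y s2) ->
  (forall y s, en y < th -> `|s| < th -> {for y, continuous (fun x => phi x s)}) ->
  (forall y s, en y < th -> `|s| < th -> {for s, continuous (phi y)}) ->
  phi 0 0 = 0 ->
  exists ta sg : R, exists u : 'rV[R]_n -> R, [/\ 0 < ta, ta <= th, 0 < sg, sg < th &
    forall y, en y < ta -> [/\ `|u y| < sg, phi y (u y) = 0 & {for y, continuous u}]].
Proof.
move=> th0 mono cy cs p00; pose sg := th / 2.
have sg0 : 0 < sg by rewrite divr_gt0.
have sgth : sg < th by rewrite ltr_pdivrMr // ltr_pMr // ltr1n.
have asg : `|sg| < th by rewrite gtr0_norm.
have asg' : `|- sg| < th by rewrite normrN gtr0_norm.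
have e0 : en (0 : 'rV[R]_n) < th by rewrite en0.
have z0 : `|0 : R| < th by rewrite normr0.
have pp : 0 < phi 0 sg by rewrite -p00 mono.
have pm : phi 0 (- sg) < 0 by rewrite -p00 mono // oppr_lt0.
have near_pos y s : en y < th -> `|s| < th -> 0 < phi y s ->
    exists2 d, 0 < d & forall x, en (x - y) < d -> 0 < phi x s.
  move=> hy hs h; have := (continuous_enP _ _).1 (cy _ _ hy hs).
  have h2 : 0 < phi y s / 2 by rewrite divr_gt0.
  move=> /(_ _ h2)[d d0 H]; exists d => // x /H; rewrite ler_norml => /andP[h3 _]; lra.
have near_neg y s : en y < th -> `|s| < th -> phi y s < 0 ->
    exists2 d, 0 < d & forall x, en (x - y) < d -> phi x s < 0.
  move=> hy hs h; have := (continuous_enP _ _).1 (cy _ _ hy hs).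
  have h2 : 0 < - phi y s / 2 by rewrite divr_gt0 // oppr_gt0.
  move=> /(_ _ h2)[d d0 H]; exists d => // x /H; rewrite ler_norml => /andP[_ h3]; lra.
have [d1 d10 H1] := near_pos _ _ e0 asg pp.
have [d2 d20 H2] := near_neg _ _ e0 asg' pm.
pose ta := Num.min th (Num.min d1 d2).
have ta0 : 0 < ta by rewrite !lt_min th0 d10.
have tath : ta <= th by rewrite ge_min lexx.
have ex y : exists s, en y < ta -> `|s| < sg /\ phi y s = 0.
  have [hy|] := boolP (en y < ta); last by exists 0.
  have hth := lt_le_trans hy tath.
  have P1 : 0 < phi y sg by apply: H1; rewrite subr0 (lt_le_trans hy) // !ge_min lexx orbT.
  have P2 : phi y (- sg) < 0 by apply: H2; rewrite subr0 (lt_le_trans hy) // !ge_min lexx !orbT.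
  have [] := @IVT _ (phi y) (- sg) sg 0.
  - by rewrite gerN // ?ltW // || lra.
  - apply: continuous_in_subspaceT => s /set_mem /=; rewrite in_itv /= => hs.
    by apply: cs => //; rewrite (le_lt_trans _ sgth) // ler_norml.
  - by rewrite ge_min le_max (ltW P1) (ltW P2) orbT.
  move=> s; rewrite in_itv /= => /andP[s1 s2] ps; exists s => _; split => //.
  rewrite ltr_norml !lt_neqAle s1 s2 !andbT; apply/andP; split; apply/eqP => e.
    by move: P2; rewrite e ps ltxx.
  by move: P1; rewrite -e ps ltxx.
have [u Hu] := choice ex.
exists ta, sg, u; split => // y hy; have [uy py] := Hu _ hy; split => //.
have hth := lt_le_trans hy tath.
apply/continuous_enP => e ep.
pose e' := Num.min e ((sg - `|u y|) / 2).
have e'0 : 0 < e' by rewrite lt_min ep divr_gt0 // subr_gt0.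
have e'e : e' <= e by rewrite ge_min lexx.
have e'u : e' <= (sg - `|u y|) / 2 by rewrite ge_min lexx orbT.
have [b1 b2] : `|u y + e'| < th /\ `|u y - e'| < th.
  have := ler_norm (u y); have := ler_norm (- u y); rewrite normrN => h1 h2.
  split; rewrite ltr_norml; apply/andP; split; lra.
have uth : `|u y| < th by exact: lt_trans uy sgth.
have P1 : 0 < phi y (u y + e') by rewrite -py mono // ltrDl.
have P2 : phi y (u y - e') < 0 by rewrite -py mono // gtrBl.
have [d3 d30 H3] := near_pos _ _ hth b1 P1.
have [d4 d40 H4] := near_neg _ _ hth b2 P2.
have [d5 d50 H5] : exists2 d, 0 < d & forall x, en (x - y) < d -> en x < ta.
  have := @en_ball_nbhs R n y 0 ta; rewrite subr0 => /(_ hy)[d d0 H].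
  by exists d => // x /H; rewrite subr0.
exists (Num.min d3 (Num.min d4 d5)); first by rewrite !lt_min d30 d40.
move=> x; rewrite !lt_min => /and3P[/H3 h3 /H4 h4 /H5 h5].
have [ux px] := Hu _ h5; have uxth := lt_trans ux sgth; have xth := lt_le_trans h5 tath.
have a1 : u x < u y + e'.
  rewrite ltNge le_eqVlt; apply/negP => /orP[/eqP h|h].
    by move: h3; rewrite h px ltxx.
  by have := mono _ xth _ _ b1 uxth h; rewrite px; lra.
have a2 : u y - e' < u x.
  rewrite ltNge le_eqVlt; apply/negP => /orP[/eqP h|h].
    by move: h4; rewrite -h px ltxx.
  by have := mono _ xth _ _ uxth b2 h; rewrite px; lra.
by rewrite ler_norml; apply/andP; split; lra.
Qed.

(** The remainder of [Phi] involves the unknown increment [k] of [u], which is only known to be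
    small by continuity. The bound [e2 * NN <= 1 / 2] absorbs it and gives [|k| <= K * |h|]; with
    this the remainder becomes small compared with [h]. *)
Lemma ift_D1 (Phi LP : V -> R) (p N : V) (E : 'I_n -> V) (u : 'rV[R]_n -> R) (y : 'rV[R]_n) :
  let Y x := p + lin_comb E x + u x *: N in
  D1 Phi (Y y) LP -> LP N != 0 -> {for y, continuous u} ->
  (exists2 d, 0 < d & forall h, `|h| < d -> Phi (Y (y + h)) = 0) ->
  D1 u y (fun h => - LP (lin_comb E h) / LP N).
Proof.
move=> Y [bLP H] a0 cu [d0 d00 PY]; set a := LP N in a0.
have [[lE [B B0 hB]] [lP [B' B'0 hB']]] := (blin_lin_comb E, bLP).
have aa : 0 < `|a| by rewrite normr_gt0.
split.
  split=> [b v w|]; first by rewrite lE lP -[_ *: _]/(_ * _) -[_ *: (_ / _)]/(_ * _); field.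
  exists (B' * B / `|a|); first by rewrite divr_gt0 // mulr_gt0.
  move=> h; rewrite normrM normrN normfV mulrAC ler_wpM2r ?invr_ge0 //.
  by rewrite (le_trans (hB' _)) // -mulrA ler_pM2l.
move=> e e0.
pose NN := `|N| + 1; have NN0 : 0 < NN by rewrite ltr_wpDl.
pose K := 2 * (B' * B / `|a| + B).
have K0 : 0 < K by rewrite mulr_gt0 // addr_gt0 // divr_gt0 // mulr_gt0.
pose e2 := Num.min (2 * NN)^-1 (e / (B + K * NN)).
have BK : 0 < B + K * NN by rewrite addr_gt0 // mulr_gt0.
have e20 : 0 < e2 by rewrite lt_min invr_gt0 mulr_gt0 //= divr_gt0.
have e2N : e2 * NN <= 2^-1.
  rewrite -(@ler_pdivlMr _ NN) // -invfM ge_min lexx //.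
have e21 : e2 <= 1.
  apply: (@le_trans _ _ (2 * NN)^-1); first by rewrite ge_min lexx.
  rewrite invf_le1 ?mulr_gt0 // /NN; have := normr_ge0 N; lra.
have e1p : 0 < e2 * `|a| by rewrite mulr_gt0.
have [d1 d10 Hd] := H _ e1p.
have := (@cvgrPdist_le _ _ _ (nbhs y) (nbhs_filter y) u (u y)).1 cu.
have q0 : 0 < d1 / (2 * NN) / 2 by rewrite !divr_gt0 // mulr_gt0.
move=> /(_ _ q0)/nbhs_normP[d2 /= d20 Hu].
exists (Num.min d0 (Num.min d2 (d1 / (2 * B)))).
  by rewrite !lt_min d00 d20 divr_gt0 // mulr_gt0.
move=> h; rewrite !lt_min => /and3P[/PY hY hd2]; rewrite ltr_pdivlMr ?mulr_gt0 // => hB1.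
pose k := u (y + h) - u y; pose X := lin_comb E h + k *: N.
have YX : Y (y + h) = Y y + X.
  rewrite /Y /X (blin_add _ _ (blin_lin_comb E)) /k scalerBl.
  have e1 : u (y + h) *: N = u y *: N + (u (y + h) *: N - u y *: N) by rewrite [RHS]addrC subrK.
  by rewrite {1}e1 [p + (_ + _)]addrA addrACA.
have kd : `|k| <= d1 / (2 * NN) / 2.
  rewrite /k distrC; apply: Hu => /=; by rewrite opprD addrA subrr sub0r normrN.
have XB : `|X| <= B * `|h| + `|k| * NN.
  rewrite (le_trans (ler_normD _ _)) // lerD // normrZ ler_wpM2l // /NN lerDl //.
have Xd : `|X| < d1.
  apply: (le_lt_trans XB); have := ler_wpM2r (ltW NN0) kd.
  have -> : d1 / (2 * NN) / 2 * NN = d1 / 4 by field; rewrite gt_eqF.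
  lra.
have := Hd _ Xd; rewrite -YX hY.
have -> : Phi (Y y) = 0 by have := PY 0; rewrite normr0 addr0; apply.
rewrite subrr sub0r normrN => hX.
have LX : LP X = LP (lin_comb E h) + k * a by rewrite /X (blin_add _ _ bLP) (blin_scale _ _ bLP).
have T1 : `|k - - LP (lin_comb E h) / a| <= e2 * `|X|.
  rewrite -(ler_pM2l aa) -normrM (_ : a * _ = LP X); last by rewrite LX; field.
  by rewrite (le_trans hX) // [e2 * _]mulrC mulrA.
have T2 : `|- LP (lin_comb E h) / a| <= B' * B / `|a| * `|h|.
  rewrite normrM normrN normfV [leRHS]mulrAC ler_wpM2r ?invr_ge0 //.
  by rewrite (le_trans (hB' _)) // -mulrA ler_pM2l.
have h0 := normr_ge0 h; have k0 := normr_ge0 k.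
have T3 : e2 * `|X| <= e2 * (B * `|h|) + 2^-1 * `|k|.
  by have := ler_wpM2l k0 e2N; have := ler_wpM2l (ltW e20) XB; lra.
have T4 : `|k| <= K * `|h|.
  have := ler_normD (k - - LP (lin_comb E h) / a) (- LP (lin_comb E h) / a); rewrite subrK => T5.
  have : e2 * (B * `|h|) <= B * `|h| by rewrite ler_piMl // mulr_ge0 // ltW.
  rewrite /K; lra.
rewrite -/k; apply: (le_trans T1).
apply: (@le_trans _ _ (e2 * ((B + K * NN) * `|h|))).
  rewrite ler_pM2l // (le_trans XB) // mulrDl lerD2l mulrAC ler_wpM2r // ltW //.
rewrite mulrA ler_wpM2r // -ler_pdivlMr // ge_min lexx orbT //.
Qed.

End Charts.
End RadialProjection.
Import RadialProjection.

Section Tools.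
Context (R : realType).

Lemma D1_is_derive (V W : normedModType R) (f : V -> W) x L v :
  D1 f x L -> is_derive x v f (L v).
Proof.
move=> [bL H].
have cv : (fun h : R => h^-1 *: ((f \o shift x) (h *: v) - f x)) @ 0^' --> L v.
  apply/cvgrPdist_le => e e0.
  have e1 : 0 < e / (`|v| + 1) by rewrite divr_gt0 // ltr_wpDl.
  have [d d0 Hd] := H _ e1.
  near=> h.
  have h0 : h != 0 by near: h; exact: nbhs_dnbhs_neq.
  have hd : `|h *: v| < d.
    rewrite normrZ.
    have : `|h| < d / (`|v| + 1).
      near: h; apply: dnbhs0_lt; rewrite divr_gt0 // ltr_wpDl //.
    rewrite ltr_pdivlMr ?ltr_wpDl // => h1; apply: le_lt_trans h1.
    by rewrite ler_wpM2l // lerDl.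
  have -> : L v - h^-1 *: ((f \o shift x) (h *: v) - f x) = - (h^-1 *: (f (x + h *: v) - f x - L (h *: v))).
    rewrite (blin_scale _ _ bL) /= [h *: v + x]addrC [in RHS]scalerBr scalerA mulVf // scale1r opprB //.
  rewrite normrN normrZ normfV ler_pdivrMl ?normr_gt0 // (le_trans (Hd _ hd)) //.
  rewrite normrZ mulrC -mulrA ler_wpM2l // mulrC mulrAC ler_pdivrMr ?ltr_wpDl //.
  by rewrite ler_wpM2l ?lerDl // ltW.
split; first by apply/cvg_ex; exists (L v).
exact/cvg_lim.
Unshelve. all: by end_near. Qed.

Lemma cont_near (T U : topologicalType) (f g : T -> U) (t : T) :
  (\forall s \near t, f s = g s) -> {for t, continuous g} -> {for t, continuous f}.
Proof.
move=> fg cg A; rewrite (nbhs_singleton fg) => /cg H.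
have H' : nbhs t [set s | A (g s)] := H.
by apply: (@filterS2 _ (nbhs t) _ _ _ _ _ fg H') => s /= ->.
Qed.

Lemma cont_sum (T : topologicalType) (W : normedModType R) (I : finType) (f : I -> T -> W) (t : T) :
  (forall i, {for t, continuous (f i)}) -> {for t, continuous (fun s => \sum_i f i s)}.
Proof.
move=> h; elim: (index_enum I) => [|i s IH].
  apply: (@cont_near _ _ _ (fun=> 0)); last exact: cst_continuous.
  by apply: (@filterE _ (nbhs t)) => x; rewrite big_nil.
apply: (@cont_near _ _ _ (fun x => f i x + \sum_(j <- s) f j x)); last exact: (continuousD (h i) IH).
by apply: (@filterE _ (nbhs t)) => x; rewrite big_cons.
Qed.

Lemma cont_bil (T : topologicalType) (V W U : normedModType R) (b : V -> W -> U) (f : T -> V) (g : T -> W) t :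
  bbil b -> {for t, continuous f} -> {for t, continuous g} -> {for t, continuous (fun s => b (f s) (g s))}.
Proof.
move=> hb cf cg; pose F (z : V * W) := b z.1 z.2.
have bl1 : blin (@fst V W) by split=> //; exists 1 => // h; rewrite mul1r (_ : `|h| = Num.max `|h.1| `|h.2|) // le_max lexx.
have bl2 : blin (@snd V W) by split=> //; exists 1 => // h; rewrite mul1r (_ : `|h| = Num.max `|h.1| `|h.2|) // le_max lexx orbT.
have cF : {for (f t, g t), continuous F}.
  exact: (D1_cont (D1_bil hb (D1_blin _ bl1) (D1_blin _ bl2))).
have cp : {for t, continuous (fun s => (f s, g s))} by exact: cvg_pair cf cg.
exact: (continuous_comp cp cF).
Qed.

Lemma D1_inv (x : R) : x != 0 -> D1 (fun t : R => t^-1) x (fun h => - h / x ^+ 2).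
Proof.
move=> x0; have H := @is_deriveV _ id x _ 1 x0 (is_derive_id _ _).
have H2 : is_derive x 1 (fun t : R => t^-1) (- x ^- 2).
  by apply: (is_derive_eq H); rewrite /= -[_ *: _]/(_ * _) mulr1.
apply: D1_ext (D1_real H2); first by apply: (@filterE _ (nbhs x)).
by move=> h; rewrite mulrN mulNr.
Qed.

End Tools.

Section DirDeriv.
Context (R : realType) (n : nat) (W : normedModType R).
Notation V := 'rV[R]_n.

Lemma derive_sum_coord (g : V -> W) x L v : D1 g x L -> L v = \sum_k v 0 k *: L (delta_mx 0 k).
Proof.
move=> [bL _]; rewrite {1}[v]row_sum_delta (blin_sum _ bL).
by apply: eq_bigr => k _; rewrite (blin_scale _ _ bL).
Qed.

Lemma cont_derive (T : topologicalType) (g : V -> W) (w xf : T -> V) t :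
  (\forall x \near xf t, D1 g x (fun v => 'D_v g x)) ->
  (forall v, {for xf t, continuous (fun x => 'D_v g x)}) ->
  {for t, continuous w} -> {for t, continuous xf} ->
  {for t, continuous (fun s => 'D_(w s) g (xf s))}.
Proof.
move=> H1 H2 cw cx.
apply: (@cont_near _ _ _ (fun s => \sum_k w s 0 k *: 'D_(delta_mx 0 k) g (xf s))).
  have H : nbhs t [set s | D1 g (xf s) (fun v => 'D_v g (xf s))] := cx _ H1.
  by apply: (@filterS _ (nbhs t) _ _ _ _ H) => s /= h; exact: (derive_sum_coord (w s) h).
apply: cont_sum => k; apply: (cont_bil (bbil_scale W)).
  exact: (continuous_comp cw (@coord_continuous _ _ _ _ _ _)).
exact: (continuous_comp cx (H2 _)).
Qed.

End DirDeriv.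

(** Mean value theorem for [u (y + t *: h)] minus its candidate expansion on [[0, 1]]. The
    derivative at the intermediate point is controlled by the first-order expansion of the gradient
    at [y] alone. *)
Lemma T2_of_D1 (R : realType) (n : nat) (u : 'rV[R]_n -> R) (l : 'rV[R]_n -> 'rV[R]_n)
    (Q : 'M[R]_n) (y : 'rV[R]_n) :
  (exists2 d, 0 < d & forall x, en (x - y) < d -> D1 u x (dot (l x))) ->
  (forall i, D1 (fun x => l x 0 i) y (fun h => \sum_j Q i j * h 0 j)) ->
  T2 u y (l y) Q.
Proof.
move=> [d0 d00 Hu] Hl e e0.
pose e1 := e / n.+1%:R; have e10 : 0 < e1 by rewrite divr_gt0.
have [d d_gt0 Hd] : exists2 d, 0 < d & forall h, en h < d -> forall i,
    `|l (y + h) 0 i - l y 0 i - \sum_j Q i j * h 0 j| <= e1 * `|h|.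
  have H i : exists2 d, 0 < d & forall h, en h < d ->
      `|l (y + h) 0 i - l y 0 i - \sum_j Q i j * h 0 j| <= e1 * `|h|.
    have [_ /(_ _ e10)[d dp h]] := Hl i; exists (d ^+ 2); first by rewrite exprn_gt0.
    by move=> k kd; apply: h; exact: norm_en.
  pose dd := fun i => projT1 (cid2 (H i)).
  have ddP i : 0 < dd i /\ forall h, en h < dd i ->
      `|l (y + h) 0 i - l y 0 i - \sum_j Q i j * h 0 j| <= e1 * `|h|.
    by rewrite /dd; case: cid2.
  exists (\big[Num.min/1]_i dd i).
    by rewrite (big_ind (fun x => 0 < x)) // => [x z x0 z0|i _]; [rewrite lt_min x0 z0|have [] := ddP i].
  move=> h hd i; have [_ H2] := ddP i; apply: H2; apply: lt_le_trans hd _.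
  exact: bigmin_le_cond.
exists (Num.min d d0); first by rewrite lt_min d_gt0.
move=> h; rewrite lt_min => /andP[hd hd0].
have enh t : 0 <= t <= 1 -> en (t *: h) <= en h.
  move=> /andP[t0 t1]; rewrite enZ ler_piMl ?en_ge0 // expr_le1 //.
pose phi t := u (y + t *: h) - t * dot (l y) h - 2^-1 * (t ^+ 2 * quad Q h).
pose dphi t := dot (l (y + t *: h)) h - dot (l y) h - t * quad Q h.
have blm : blin (fun t : R => t *: h).
  split=> [a u' v|]; first by rewrite scalerDl scalerA.
  by exists (`|h| + 1); [rewrite ltr_wpDl | move=> t; rewrite normrZ mulrC ler_wpM2r // lerDl].
have dph (t : R) : 0 <= t <= 1 -> is_derive t 1 phi (dphi t).
  move=> t01.
  have d1 : D1 (fun s : R => y + s *: h) t (fun s => 0 + s *: h).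
    exact: D1_add (D1_cst _ _) (D1_blin _ blm).
  have du : D1 u (y + t *: h) (dot (l (y + t *: h))).
    by apply: Hu; rewrite addrC addKr (le_lt_trans (enh _ t01)).
  have := D1_is_derive (1 : R) (D1_comp d1 du); rewrite add0r scale1r => i1.
  have i2 : is_derive t 1 (fun s : R => s * dot (l y) h) (dot (l y) h).
    have bl2 : blin (fun s : R => s * dot (l y) h).
      split=> [a u' v|]; first by rewrite mulrDl -scalerAl.
      by exists (`|dot (l y) h| + 1); [rewrite ltr_wpDl | move=> s; rewrite normrM mulrC ler_wpM2r // lerDl].
    by have := D1_is_derive (1 : R) (D1_blin t bl2); rewrite mul1r.
  have i3 : is_derive t 1 (fun s : R => 2^-1 * (s ^+ 2 * quad Q h)) (t * quad Q h).
    have b1 := D1_blin t (blin_id (R : normedModType R)).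
    have b2 := D1_bil (bbil_mul R) b1 b1.
    have b3 := D1_bil (bbil_mul R) (D1_cst (2^-1 : R) t) (D1_bil (bbil_mul R) b2 (D1_cst (quad Q h : R) t)).
    have H := D1_is_derive (1 : R) b3.
    by apply: (is_derive_eq H); field.
  have i4 := is_deriveB i1 i2; have := is_deriveB i4 i3.
  by [].
have hm1 (x : R) : x \in `]0, 1[%R -> is_derive x 1 phi (dphi x).
  by rewrite in_itv /= => /andP[x0 x1]; apply: dph; rewrite !ltW.
have hm2 : {within `[0, 1], continuous phi}.
  apply: continuous_in_subspaceT => x /set_mem /=; rewrite in_itv /= => /dph [h1 _].
  exact/differentiable_continuous/derivable1_diffP.
have [c] := MVT (@ltr01 R) hm1 hm2.
rewrite in_itv /= => /andP[c0 c1] hE.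
have -> : u (y + h) - u y - dot (l y) h - 2^-1 * quad Q h = dphi c.
  have -> : dphi c = phi 1 - phi 0 by rewrite hE; ring.
  by rewrite /phi scale1r scale0r addr0; ring.
have c01 : 0 <= c <= 1 by rewrite !ltW.
have qE : c * quad Q h = \sum_i (\sum_j Q i j * (c *: h) 0 j) * h 0 i.
  rewrite quadE mulr_sumr; apply: eq_bigr => i _; rewrite mulr_suml mulr_sumr.
  by apply: eq_bigr => j _; rewrite mxE; ring.
rewrite /dphi qE /dot -!sumrB (le_trans (ler_norm_sum _ _ _)) //.
have nh2 : `|h| ^+ 2 <= en h.
  have [h0|h0] := eqVneq `|h| 0; first by rewrite h0 expr0n en_ge0.
  rewrite leNgt; apply/negP => hh.
  have : `|h| < `|h| by apply: norm_en => //; rewrite lt_neqAle eq_sym h0 normr_ge0.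
  by rewrite ltxx.
apply: (@le_trans _ _ (\sum_(i < n) e1 * `|h| ^+ 2)).
  apply: ler_sum => i _; rewrite -!mulrBl normrM.
  have := Hd (c *: h) (le_lt_trans (enh _ c01) hd) i => h1.
  rewrite expr2 mulrA; apply: ler_pM => //; last exact: coord_norm.
  apply: (le_trans h1); rewrite ler_pM2l // normrZ ger0_norm ?(ltW c0) //.
  by rewrite ler_piMl // ltW.
rewrite sumr_const card_ord -mulr_natr /e1 -!mulrA ler_pM2l //.
rewrite ler_pdivrMl ?ltr0n //.
have := en_ge0 h; have := nh2; have : (n%:R : R) <= n.+1%:R by rewrite ler_nat.
move=> h1 h2 h3; have h4 : 0 <= `|h| ^+ 2 by exact: sqr_ge0.
by have h5 : (0 : R) <= n%:R by []; nra.
Qed.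

(** * Generalized trigonometry and tangent vectors *)

Module CurvatureTrig.
Lemma D1_derive (R : realType) (V W : normedModType R) (f : V -> W) x L v :
  D1 f x L -> 'D_v f x = L v.
Proof. by move=> /D1_is_derive h; have [_ ->] := h v. Qed.

Lemma D1_near_cst (R : realType) (V W : normedModType R) (f : V -> W) x L v (a : W) :
  (\forall y \near x, f y = a) -> D1 f x L -> L v = 0.
Proof.
move=> fa Df; have H : D1 (fun=> a) x L by apply: D1_ext Df.
by rewrite -(D1_derive v H) (D1_derive v (D1_cst a x)).
Qed.

Section Geodesics.
Context (R : realType) (n : nat) (delta : R).
Notation V := 'rV[R]_n.+2.
Notation ip := (@lip R n delta).
Notation M := (@space_form R n delta).
Notation TM := (@TM R n delta).

(** Together with [sn], the solutions of [f'' = - delta * f] with initial data [(1, 0)] and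
    [(0, 1)]. *)
Definition cs (t : R) : R :=
  if delta == 0 then 1 else if 0 < delta then cos (Num.sqrt delta * t)
  else (expR (Num.sqrt (- delta) * t) + expR (- (Num.sqrt (- delta) * t))) / 2.

Definition sn (t : R) : R :=
  if delta == 0 then t else if 0 < delta then sin (Num.sqrt delta * t) / Num.sqrt delta
  else (expR (Num.sqrt (- delta) * t) - expR (- (Num.sqrt (- delta) * t))) / (2 * Num.sqrt (- delta)).

Lemma cs0 : cs 0 = 1.
Proof.
rewrite /cs mulr0; case: ifP => // _; case: ifP => _; first exact: cos0.
by rewrite ?mulr0 ?oppr0 expR0; field.
Qed.

Lemma sn0 : sn 0 = 0.
Proof.
rewrite /sn mulr0; case: ifP => // _; case: ifP => _; first by rewrite sin0 mul0r.
by rewrite ?mulr0 ?oppr0 expR0 subrr mul0r.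
Qed.

Lemma delta_cases : [\/ delta = 0, 0 < delta | delta < 0].
Proof. by case: (ltgtP delta 0) => h; [apply: Or33|apply: Or32|apply: Or31]. Qed.

Lemma is_derive_scale (f : R -> R) (c t d : R) :
  is_derive (c * t) 1 f d -> is_derive t 1 (fun s => f (c * s)) (c * d).
Proof.
move=> H.
have bl : blin (fun s : R => c * s : R).
  split=> [a u v|]; first by rewrite mulrDr /GRing.scale /=; ring.
  by exists (`|c| + 1); [rewrite ltr_wpDl | move=> s; rewrite normrM ler_wpM2r // lerDl].
have := D1_is_derive (1 : R) (D1_comp (D1_blin t bl) (D1_real H)).
by rewrite mulr1.
Qed.

Lemma is_derive_cs (t : R) : is_derive t 1 cs (- (delta * sn t)).
Proof.
rewrite /cs /sn; case: delta_cases => [->|d0|d0].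
- by rewrite eqxx mul0r oppr0; exact: is_derive_cst.
- rewrite gt_eqF // d0; set q := Num.sqrt delta.
  have q0 : q != 0 by rewrite gt_eqF // sqrtr_gt0.
  have qq : delta = q ^+ 2 by rewrite sqr_sqrtr // ltW.
  apply: (is_derive_eq (is_derive_scale (is_derive_cos (q * t)))).
  by rewrite {1}qq; field.
rewrite lt_eqF // ltNge (ltW d0) /=; set q := Num.sqrt (- delta).
have q0 : q != 0 by rewrite gt_eqF // sqrtr_gt0 oppr_gt0.
have qq : delta = - q ^+ 2 by rewrite sqr_sqrtr ?opprK // oppr_ge0 ltW.
have h1 := is_derive_scale (is_derive_expR (q * t)).
have h2 := is_derive_scale (is_derive_expR (- q * t)).
have h := is_deriveM (is_deriveD h1 h2) (is_derive_cst (2^-1 : R) t 1).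
rewrite (_ : (fun s => _) = ((fun s => expR (q * s)) + (fun s => expR (- q * s))) * cst (2^-1)); last first.
  by apply/funext => s; rewrite !fctE mulNr.
apply: (is_derive_eq h).
by rewrite /= qq scaler0 add0r !mulNr /GRing.scale /=; field.
Qed.

Lemma is_derive_sn (t : R) : is_derive t 1 sn (cs t).
Proof.
rewrite /cs /sn; case: delta_cases => [->|d0|d0].
- by rewrite eqxx; exact: is_derive_id.
- rewrite gt_eqF // d0; set q := Num.sqrt delta.
  have q0 : q != 0 by rewrite gt_eqF // sqrtr_gt0.
  have h := is_deriveM (is_derive_scale (is_derive_sin (q * t))) (is_derive_cst (q^-1 : R) t 1).
  by apply: (is_derive_eq h); rewrite /= scaler0 add0r /GRing.scale /=; field.
rewrite lt_eqF // ltNge (ltW d0) /=; set q := Num.sqrt (- delta).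
have q0 : q != 0 by rewrite gt_eqF // sqrtr_gt0 oppr_gt0.
have h1 := is_derive_scale (is_derive_expR (q * t)).
have h2 := is_derive_scale (is_derive_expR (- q * t)).
have h := is_deriveM (is_deriveB h1 h2) (is_derive_cst ((2 * q)^-1 : R) t 1).
rewrite (_ : (fun s => _) = ((fun s => expR (q * s)) - (fun s => expR (- q * s))) * cst ((2 * q)^-1)); last first.
  by apply/funext => s; rewrite !fctE mulNr.
apply: (is_derive_eq h).
by rewrite /= scaler0 add0r !mulNr /GRing.scale /=; field.
Qed.

Lemma cs_sn t : cs t ^+ 2 + delta * sn t ^+ 2 = 1.
Proof.
rewrite /cs /sn; case: delta_cases => [->|d0|d0].
- by rewrite eqxx; ring.
- rewrite gt_eqF // d0; have q0 : Num.sqrt delta != 0 by rewrite gt_eqF // sqrtr_gt0.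
  rewrite expr_div_n sqr_sqrtr ?ltW // mulrCA divff ?gt_eqF // mulr1.
  exact: cos2Dsin2.
rewrite lt_eqF // ltNge (ltW d0) /=; set q := Num.sqrt (- delta).
have q0 : q != 0 by rewrite gt_eqF // sqrtr_gt0 oppr_gt0.
have qq : delta = - q ^+ 2 by rewrite sqr_sqrtr ?opprK // oppr_ge0 ltW.
have hE := expRxMexpNx_1 (q * t).
by rewrite -[RHS]hE qq; field.
Qed.

Definition arc (A B : V) (la t : R) : V := cs (la * t) *: A + sn (la * t) *: B.

Lemma is_derive_arc A B la (t : R) : is_derive t 1 (arc A B la) (arc (la *: B) (- (la * delta) *: A) la t).
Proof.
have h1 := D1_real (is_derive_scale (is_derive_cs (la * t))).
have h2 := D1_real (is_derive_scale (is_derive_sn (la * t))).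
have b1 := D1_bil (bbil_scale V) h1 (D1_cst A t).
have b2 := D1_bil (bbil_scale V) h2 (D1_cst B t).
apply: (is_derive_eq (D1_is_derive (1 : R) (D1_add b1 b2))).
rewrite /arc !scaler0 !addr0 !mul1r !scalerA addrC; congr (_ *: _ + _ *: _); ring.
Qed.

(** Every iterated directional derivative of an arc is again an arc, with other coefficients. *)
Lemma smooth_arc A B la (t : R) : smooth_at t (arc A B la).
Proof.
apply: (@filterE _ (nbhs t)) => s vs.
have [A' [B' ->]] : exists A' B', foldr (fun v (g : R -> V) => 'D_v g) (arc A B la) vs = arc A' B' la.
  elim: vs => [|v vs [A' [B' IH]]]; first by exists A, B.
  exists (v *: (la *: B')), (v *: (- (la * delta) *: A')); rewrite /= IH.
  apply/funext => x; have [dx ->] : is_derive x v (arc A' B' la) (v *: arc (la *: B') (- (la * delta) *: A') la x).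
    have h1 := D1_real (is_derive_scale (is_derive_cs (la * x))).
    have h2 := D1_real (is_derive_scale (is_derive_sn (la * x))).
    have b1 := D1_bil (bbil_scale V) h1 (D1_cst A' x).
    have b2 := D1_bil (bbil_scale V) h2 (D1_cst B' x).
    apply: (is_derive_eq (D1_is_derive v (D1_add b1 b2))).
    rewrite /arc !scaler0 !addr0 scalerDr !scalerA addrC; congr (_ *: _ + _ *: _); ring.
  by rewrite /arc scalerDr !scalerA ![v * _]mulrC.
by have [h _] := is_derive_arc A' B' la s; apply/derivable1_diffP.
Qed.

Lemma arc0 A B la : arc A B la 0 = A.
Proof. by rewrite /arc mulr0 cs0 sn0 scale1r scale0r addr0. Qed.

Lemma M_arc p v t : M p -> TM p v -> ip v v = 1 -> 0 < (arc p v 1 t) 0 ord0 \/ delta = 0 -> M (arc p v 1 t).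
Proof.
move=> Mp [V0v pv] vv pos; have pM := M_V0 Mp.
apply: M_intro; first by apply: V0D; apply: V0Z.
  move=> d0; rewrite /arc mul1r !ipL [ip v p]ipC vv; have := M_ip1 Mp d0.
  have -> : ip p v = 0 by apply: (mulfI d0); rewrite mulr0.
  move=> h; rewrite -[RHS](cs_sn t).
  by transitivity (cs t ^+ 2 * (delta * ip p p) + delta * sn t ^+ 2); [ring | rewrite h; ring].
by move=> d0; case: pos => // h; rewrite h eqxx in d0.
Qed.

Lemma cont_arc A B la t : {for t, continuous (arc A B la)}.
Proof. by have [h _] := is_derive_arc A B la t; apply/differentiable_continuous/derivable1_diffP. Qed.

Lemma TM_unit p v : M p -> TM p v -> exists (e : V) (la : R), [/\ TM p e, v = la *: e & ip e e = 1 \/ e = 0 /\ la = 0].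
Proof.
move=> Mp Tv; have [v0 v00] := tangent_pos Mp Tv.
have [h|h] := eqVneq (ip v v) 0.
  by exists 0, 0; split; [exact: TM0 | rewrite scaler0 (v00 h) | right; split].
have q0 : Num.sqrt (ip v v) != 0 by rewrite gt_eqF // sqrtr_gt0 lt_neqAle eq_sym h.
exists ((Num.sqrt (ip v v))^-1 *: v), (Num.sqrt (ip v v)); split; first exact: TMZ.
  by rewrite scalerA divff // scale1r.
by left; rewrite !ipL -{3}(sqr_sqrtr v0); field.
Qed.

(** One direction differentiates the equations of the space form, the other follows a geodesic arc.
    Tangency by curves becomes linear algebra from here on. *)
Lemma tangentP p v : M p -> tangent M p v <-> TM p v.
Proof.
move=> Mp; split.
  move=> [c [sc Mc c0 <-]].
  have dc : D1 c 0 (fun h => 'D_h c 0) := D1_diff (nbhs_singleton sc [::]); split.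
    move=> d0.
    have bl : blin (fun v : V => v 0 ord0 : R).
      split=> [a u w|]; first by rewrite !mxE.
      by exists 1 => // h; rewrite mul1r; exact: coord_norm.
    rewrite derive1E; apply: (D1_near_cst (1 : R) _ (D1_comp dc (D1_blin _ bl)) (a := 0)).
    by apply: (@filterS _ (nbhs (0 : R)) _ _ _ _ Mc) => t /M_V0; exact.
  have [->|d0] := eqVneq delta 0; first by rewrite mul0r.
  have := D1_near_cst (1 : R) _ (D1_bil (bbil_lip n delta) dc dc) (a := delta^-1).
  rewrite -derive1E c0 [ip _ p]ipC => h; rewrite (_ : ip p _ = 0) ?mulr0 //.
  have : ip p (derive1 c 0) + ip p (derive1 c 0) = 0.
    apply: h; apply: (@filterS _ (nbhs (0 : R)) _ _ _ _ Mc) => t /M_ip1 /(_ d0) h.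
    by apply: (mulfI d0); rewrite h divff.
  lra.
move=> Tv; have [e [la [Te vE he]]] := TM_unit Mp Tv.
exists (arc p e la); split.
- exact: smooth_arc.
- case: he => [ee|[_ ->]]; last first.
    by apply: (@filterE _ (nbhs (0 : R))) => t; rewrite /arc mul0r cs0 sn0 scale1r scale0r addr0.
  have E t : arc p e la t = arc p e 1 (la * t) by rewrite /arc mul1r.
  have [d0|d0] := eqVneq delta 0.
    by apply: (@filterE _ (nbhs (0 : R))) => t /=; rewrite E; apply: M_arc => //; right.
  have ca : {for (0 : R), continuous (fun t => arc p e la t 0 ord0)}.
    exact: (continuous_comp (cont_arc (t := 0)) (@coord_continuous _ _ _ _ _ _)).
  have h : \forall t \near (0 : R), 0 < arc p e la t 0 ord0.
    by apply: (cvgr_gt _ ca); rewrite arc0; exact: (M_pos Mp d0).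
  apply: (@filterS _ (nbhs (0 : R)) _ _ _ _ h) => t /= h1.
  by rewrite E; apply: M_arc => //; left; rewrite -E.
- exact: arc0.
- by have [_ h] := is_derive_arc p e la 0; rewrite derive1E h arc0 vE.
Qed.

End Geodesics.
End CurvatureTrig.
Import CurvatureTrig.

(** * Graphs in central-projection charts *)

Module RadialDerivative.
Section Graph.
Context (R : realType) (n : nat) (delta : R).
Notation V := 'rV[R]_n.+2.
Notation ip := (@lip R n delta).
Notation M := (@space_form R n delta).
Notation TM := (@TM R n delta).
Notation V0 := (@V0 R n delta).
Notation Rh := (@Rh R n delta).
Notation frame := (@frame R n delta).

Definition slab (p : V) (E : 'I_n -> V) (N : V) (y : 'rV[R]_n) (s : R) : V := p + lin_comb E y + s *: N.
(** Gnomonic coordinates in an orthonormal frame, with the height [s] along the normal [N]. *)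
Definition chart p E N y s : V := Rh p (slab p E N y s).
Definition cfac (p Y : V) : R := (Num.sqrt (1 + delta * (ip Y Y - ip p p)))^-1.
Definition dRh (p Y h : V) : V := cfac p Y *: h - (delta * cfac p Y ^+ 3 * ip Y h) *: Y.

Lemma blin_dRh p Y : 0 < 1 + delta * (ip Y Y - ip p p) -> blin (dRh p Y).
Proof. by move=> /D1_Rh []. Qed.

Lemma V0_sum (I : finType) (f : I -> V) : (forall i, V0 (f i)) -> V0 (\sum_i f i).
Proof. by move=> h; apply: (big_ind V0) => //; [exact: V0_0 | exact: V0D]. Qed.

Lemma V0_slab p E N y s : M p -> frame p E N -> V0 (slab p E N y s).
Proof.
move=> /M_V0 Vp [TE [VN _] _ _ _]; rewrite /slab; apply: V0D; last exact: V0Z.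
by apply: V0D => //; apply: V0_sum => i; apply: V0Z; have [] := TE i.
Qed.

Section Metric.
Variables (p : V) (E : 'I_n -> V) (N : V).
Hypotheses (Mp : M p) (fr : frame p E N).

Lemma ip_lin y v : ip (lin_comb E y) v = \sum_i y 0 i * ip (E i) v.
Proof. by rewrite /lin_comb ip_suml; apply: eq_bigr => i _; rewrite !ipL. Qed.

Lemma ip_lin_E y j : ip (lin_comb E y) (E j) = y 0 j.
Proof.
have [_ _ EE _ _] := fr; rewrite ip_lin (bigD1 j) //= EE eqxx mulr1 big1 ?addr0 // => i ij.
by rewrite EE (negbTE ij) mulr0.
Qed.

Lemma ip_lin_lin y z : ip (lin_comb E y) (lin_comb E z) = dot y z.
Proof.
rewrite ipC ip_lin /dot; apply: eq_bigr => i _.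
by rewrite ipC ip_lin_E mulrC.
Qed.

Lemma ip_lin_N y : ip (lin_comb E y) N = 0.
Proof. by have [_ _ _ EN _] := fr; rewrite ip_lin big1 // => i _; rewrite EN mulr0. Qed.

Lemma dip_lin_p y : delta * ip (lin_comb E y) p = 0.
Proof.
have [TE _ _ _ _] := fr; rewrite ip_lin mulr_sumr big1 // => i _.
by rewrite mulrCA ipC; have [_ ->] := TE i; rewrite mulr0.
Qed.

Lemma dip_N_p : delta * ip N p = 0.
Proof. by have [_ [_ h] _ _ _] := fr; rewrite ipC. Qed.

Lemma slab_ip y s : delta * (ip (slab p E N y s) (slab p E N y s) - ip p p) = delta * (en y + s ^+ 2).
Proof.
have [_ _ _ _ NN] := fr.
have -> : ip (slab p E N y s) (slab p E N y s) =
   ip p p + (en y + s ^+ 2) + 2 * (ip (lin_comb E y) p + s * ip N p).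
  rewrite /slab !ipL NN ip_lin_lin -/(en y) ip_lin_N [ip N (lin_comb _ _)]ipC ip_lin_N.
  by rewrite [ip p (lin_comb _ _)]ipC [ip p N]ipC; ring.
have h1 := dip_lin_p y; have h2 := dip_N_p.
transitivity (delta * (en y + s ^+ 2) + 2 * (delta * ip (lin_comb E y) p + s * (delta * ip N p))); first by ring.
by rewrite h1 h2; ring.
Qed.

Lemma cfac_slab y s : cfac p (slab p E N y s) = (Num.sqrt (1 + delta * (en y + s ^+ 2)))^-1.
Proof. by rewrite /cfac slab_ip. Qed.

Lemma chart_rho y s : chart p E N y s = rho delta p (lin_comb E y + s *: N).
Proof.
rewrite /chart /slab -addrA Rh_rho // !ipL mulrDr ![ip p _]ipC.
by rewrite dip_lin_p mulrCA dip_N_p mulr0 addr0.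
Qed.

Lemma TM_slab y s : TM p (lin_comb E y + s *: N).
Proof.
have [TE TN _ _ _] := fr; apply: TMD; last exact: TMZ.
by apply: TM_sum => i; apply: TMZ.
Qed.

Lemma slab_tan_ip y s : ip (lin_comb E y + s *: N) (lin_comb E y + s *: N) = en y + s ^+ 2.
Proof.
have [_ _ _ _ NN] := fr.
by rewrite !ipL NN ip_lin_lin -/(en y) ip_lin_N [ip N (lin_comb _ _)]ipC ip_lin_N; ring.
Qed.

Lemma M_chart y s : 0 < 1 + delta * (en y + s ^+ 2) -> (0 < delta -> 0 < (slab p E N y s) 0 ord0) ->
  M (chart p E N y s).
Proof.
move=> h1 h2; rewrite chart_rho; apply: M_rho => //; first exact: TM_slab.
  by rewrite slab_tan_ip.
by rewrite addrA.
Qed.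

Lemma chart00 : chart p E N 0 0 = p.
Proof.
rewrite chart_rho /lin_comb big1 => [|i _]; last by rewrite mxE scale0r.
by rewrite scale0r addr0 /rho ip0r mulr0 addr0 sqrtr1 invr1 scale1r addr0.
Qed.

Lemma Rh_p : Rh p p = p.
Proof. by rewrite /RadialProjection.Rh subrr mulr0 addr0 sqrtr1 invr1 scale1r. Qed.

Lemma TM_dRh Y h : V0 Y -> V0 h -> M (Rh p Y) -> TM (Rh p Y) (dRh p Y h).
Proof.
move=> VY Vh MX; split; first by apply: V0D; [exact: V0Z | apply: V0N; exact: V0Z].
have [->|d0] := eqVneq delta 0; first by rewrite mul0r.
have := M_ip1 MX d0; rewrite /RadialProjection.Rh -/(cfac p Y) /dRh !ipL => hY.
transitivity (delta * cfac p Y ^+ 2 * ip Y h * (1 - delta * (cfac p Y * (cfac p Y * ip Y Y)))); first by ring.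
by rewrite hY subrr mulr0.
Qed.

(* The factor comes from the normalisation: [delta * <x, x> = 1] for [x = m Y]. *)
Lemma dRh_ip Y h k : M (Rh p Y) ->
  ip (dRh p Y h) (dRh p Y k) =
  cfac p Y ^+ 2 * (ip h k - delta * cfac p Y ^+ 2 * (ip Y h * ip Y k)).
Proof.
move=> MX; set m := cfac p Y; rewrite /dRh -/m.
have hY : delta * (m * (m * ip Y Y)) * delta = delta.
  have [->|d0] := eqVneq delta 0; first by rewrite !mulr0.
  by have := M_ip1 MX d0; rewrite /RadialProjection.Rh -/(cfac p Y) -/m !ipL => ->; rewrite mul1r.
rewrite !ipL [ip h Y]ipC.
transitivity (m ^+ 2 * ip h k - 2 * (delta * m ^+ 4 * (ip Y h * ip Y k)) +
   delta * (m * (m * ip Y Y)) * delta * (m ^+ 4 * (ip Y h * ip Y k))); first by ring.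
by rewrite hY; ring.
Qed.

Lemma near_slab (G : V -> Prop) : (\forall Y \near p, G Y) ->
  exists2 th : R, 0 < th & forall y s, en y < th -> `|s| < th -> G (slab p E N y s).
Proof.
move=> /nbhs_normP [d /= d0 H].
have [_ [B B0 HB]] := blin_lin_comb E.
pose c := B + `|N| + 1; have c0 : 0 < c by rewrite /c; have := normr_ge0 N; lra.
pose q := d / c; have q0 : 0 < q by rewrite divr_gt0.
exists (Num.min q (q ^+ 2)); first by rewrite lt_min q0 exprn_gt0.
move=> y s; rewrite !lt_min => /andP[_ y2] /andP[s1 _]; apply: H => /=.
rewrite /slab -addrA opprD addNKr normrN.
have yq : `|y| < q by apply: norm_en.
apply: le_lt_trans (ler_normD _ _) _.
rewrite normrZ; have h1 := HB y; have : d = q * c by rewrite /q divfK // gt_eqF.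
rewrite /c => ->; have := normr_ge0 N; have := normr_ge0 y; have := normr_ge0 s; nra.
Qed.

End Metric.
End Graph.
End RadialDerivative.
Import RadialDerivative.

Section GraphLemma.
Context (R : realType) (n : nat) (delta : R).
Notation V := 'rV[R]_n.+2.
Notation ip := (@lip R n delta).
Notation M := (@space_form R n delta).
Notation TM := (@TM R n delta).
Notation V0 := (@V0 R n delta).
Notation Rh := (@Rh R n delta).
Notation frame := (@frame R n delta).
Notation chart := (@chart R n delta).
Notation dRh := (@dRh R n delta).
Notation cfac := (@cfac R n delta).

Variables (S : set V) (p : V) (f : V -> R) (nu : V -> V) (E : 'I_n -> V) (N : V)
  (kk : V -> 'I_n -> R) (ee : V -> 'I_n -> V).

(** [nu] is a single smooth field near [p], whereas [ee] and [kk] may jump from point to point;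
    hence only identities at one point [x] are recorded. *)
Definition adapted (x : V) :=
  [/\ frame x (ee x) (nu x), forall i, 'D_(ee x i) f x = 0,
     forall i j, ip ('D_(ee x i) nu x) (ee x j) = - (kk x i * (i == j)%:R) &
     forall i, delta * ip x ('D_(ee x i) nu x) = 0].

Hypotheses (Mp : M p) (fr : frame p E N) (Sp : S p)
  (fD : \forall x \near p, D1 f x (fun v => 'D_v f x))
  (fC : forall v, {for p, continuous (fun x => 'D_v f x)})
  (nuD : \forall x \near p, D1 nu x (fun v => 'D_v nu x))
  (nuC : forall v, {for p, continuous (fun x => 'D_v nu x)})
  (fS : \forall x \near p, S x <-> M x /\ f x = 0)
  (fN : 0 < 'D_N f p) (nup : nu p = N)
  (loc : \forall x \near p, S x -> adapted x).

Let good (Y : V) : Prop :=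
  [/\ 0 < 1 + delta * (ip Y Y - ip p p), (0 < delta -> 0 < Y 0 ord0),
      D1 f (Rh p Y) (fun v => 'D_v f (Rh p Y)) /\ D1 nu (Rh p Y) (fun v => 'D_v nu (Rh p Y)),
      (S (Rh p Y) <-> M (Rh p Y) /\ f (Rh p Y) = 0) /\ (S (Rh p Y) -> adapted (Rh p Y)) &
      0 < 'D_(dRh p Y N) f (Rh p Y) /\ 0 < ip N (nu (Rh p Y))].

Lemma cont_ip (T : topologicalType) (a b : T -> V) t :
  {for t, continuous a} -> {for t, continuous b} -> {for t, continuous (fun s => ip (a s) (b s))}.
Proof. exact: (cont_bil (bbil_lip n delta)). Qed.

Lemma cont_Rh : {for p, continuous (Rh p)}.
Proof. by apply: (D1_cont (D1_Rh _)); rewrite subrr mulr0 addr0. Qed.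

Lemma cont_cfac Y : 0 < 1 + delta * (ip Y Y - ip p p) -> {for Y, continuous (cfac p)}.
Proof.
move=> h; pose F (x : V) := ip x x - ip p p.
have cF : {for Y, continuous F}.
  by have h1 := @cont_ip _ id id Y (@cvg_id _ _) (@cvg_id _ _); exact: (continuousB h1 (@cst_continuous _ _ _ _)).
exact: (continuous_comp cF (D1_cont (D1_rsqrt h))).
Qed.

Lemma cont_dRh2 (T : topologicalType) (a b : T -> V) t : 0 < 1 + delta * (ip (a t) (a t) - ip p p) ->
  {for t, continuous a} -> {for t, continuous b} -> {for t, continuous (fun s => dRh p (a s) (b s))}.
Proof.
move=> hY ca cb; have cm : {for t, continuous (fun s => cfac p (a s))} := continuous_comp ca (cont_cfac hY).
have c1 : {for t, continuous (fun s => cfac p (a s) *: b s)} := cont_bil (bbil_scale V) cm cb.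
have c3 : {for t, continuous (fun s => ip (a s) (b s))} := cont_ip ca cb.
have c4 : {for t, continuous (fun s => delta * cfac p (a s) ^+ 3)}.
  exact: (continuousM (@cst_continuous _ _ _ _) (continuousM cm (continuousM cm cm))).
have c5 : {for t, continuous (fun s => delta * cfac p (a s) ^+ 3 * ip (a s) (b s))} := continuousM c4 c3.
have c2 : {for t, continuous (fun s => (delta * cfac p (a s) ^+ 3 * ip (a s) (b s)) *: a s)} :=
  cont_bil (bbil_scale V) c5 ca.
exact: (continuousB c1 c2).
Qed.

Lemma cont_dRh Y h : 0 < 1 + delta * (ip Y Y - ip p p) -> {for Y, continuous (fun x => dRh p x h)}.
Proof. by move=> hY; exact: (cont_dRh2 hY (@cvg_id _ _) (@cst_continuous _ _ _ _)). Qed.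

Lemma dRh_pp h : dRh p p h = h - (delta * ip p h) *: p.
Proof. by rewrite /RadialDerivative.dRh /RadialDerivative.cfac subrr mulr0 addr0 sqrtr1 invr1 scale1r expr1n mulr1. Qed.

Lemma near_good : \forall Y \near p, good Y.
Proof.
have Rp := Rh_p delta p.
have cR : {for p, continuous (Rh p)} := cont_Rh.
have h0 : 0 < 1 + delta * (ip p p - ip p p) by rewrite subrr mulr0 addr0.
have g1 : \forall Y \near p, 0 < 1 + delta * (ip Y Y - ip p p).
  have h1 := @cont_ip _ id id p (@cvg_id _ _) (@cvg_id _ _).
  have k1 : {for p, continuous (fun _ : V => ip p p)} := @cst_continuous _ _ _ _.
  have k2 : {for p, continuous (fun _ : V => delta)} := @cst_continuous _ _ _ _.
  have k3 : {for p, continuous (fun _ : V => 1 : R)} := @cst_continuous _ _ _ _.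
  have c1 : {for p, continuous (fun Y : V => 1 + delta * (ip Y Y - ip p p))}.
    exact: (continuousD k3 (continuousM k2 (continuousB h1 k1))).
  exact: (cvgr_gt _ c1).
have g2 : \forall Y \near p, 0 < delta -> 0 < (Y : V) 0 ord0.
  have [d0|d0] := ltP 0 delta; last by apply: (@filterE _ (nbhs p)) => Y.
  have c1 := @coord_continuous R 1 n.+2 0 ord0 p.
  have H : \forall Y \near p, 0 < (Y : V) 0 ord0.
    by apply: (cvgr_gt _ c1); apply: (M_pos Mp); rewrite gt_eqF.
  by apply: (@filterS _ (nbhs p) _ _ _ _ H) => Y h _.
have pull (P : V -> Prop) : (\forall x \near p, P x) -> \forall Y \near p, P (Rh p Y).
  by move=> h; apply: cR; rewrite Rp.
have g3 := pull _ fD; have g4 := pull _ nuD; have g5 := pull _ fS; have g6 := pull _ loc.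
have g7 : \forall Y \near p, 0 < 'D_(dRh p Y N) f (Rh p Y).
  have cw : {for p, continuous (fun Y => dRh p Y N)} := cont_dRh (h:=N) h0.
  have c1 : {for p, continuous (fun Y => 'D_(dRh p Y N) f (Rh p Y))}.
    apply: cont_derive; [by rewrite Rp | by rewrite Rp | exact: cw | exact: cR].
  apply: (cvgr_gt _ c1); rewrite Rp dRh_pp; have [_ [_ ->] _ _ _] := fr.
  by rewrite scale0r subr0.
have g8 : \forall Y \near p, 0 < ip N (nu (Rh p Y)).
  have cn : {for p, continuous nu} by apply: D1_cont (nbhs_singleton nuD).
  have c2 : {for p, continuous (fun Y => nu (Rh p Y))}.
    by apply: (continuous_comp cR); rewrite Rp.
  have c1 := @cont_ip _ (fun=> N) _ p (@cst_continuous _ _ N p) c2.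
  by apply: (cvgr_gt _ c1); rewrite Rp nup; have [_ _ _ _ ->] := fr.
apply: (@filterS3 _ (nbhs p) _ _ _ _ _ _ (filterI g1 g2) (filterI (filterI g3 g4) (filterI g5 g6)) (filterI g7 g8)).
by move=> Y [? ?] [[? ?] [? ?]] [? ?].
Qed.

Lemma blin_slab (lv : 'rV[R]_n) : blin (fun h : 'rV[R]_n => lin_comb E h + dot lv h *: N).
Proof.
have [l1 [B B0 HB]] := blin_lin_comb E.
split=> [a u v|].
  rewrite l1; have -> : dot lv (a *: u + v) = a * dot lv u + dot lv v.
    by rewrite /dot mulr_sumr -big_split; apply: eq_bigr => i _; rewrite !mxE /=; ring.
  by rewrite scalerDl -scalerA !scalerDr addrACA.
exists (B + (\sum_i `|lv 0 i|) * `|N|); first by rewrite ltr_pwDl // mulr_ge0 // sumr_ge0.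
move=> h; rewrite (le_trans (ler_normD _ _)) // mulrDl lerD // normrZ mulrAC ler_wpM2r //.
rewrite mulr_suml (le_trans (ler_norm_sum _ _ _)) // ler_sum // => i _.
by rewrite normrM ler_wpM2l // coord_norm.
Qed.

(** The gradient of the graph function, read off from the normal: [E i + l_i *: N] has to be
    orthogonal to [nu]. Through [nu] instead of [f], the Hessian of the graph needs only first
    derivatives of the normal. *)
Definition lw (x : V) : 'rV[R]_n := \row_i (- ip (E i) (nu x) / ip N (nu x)).

Section At.
Variables (u : 'rV[R]_n -> R) (y : 'rV[R]_n).
Let Y := slab p E N y (u y).
Let x := chart p E N y (u y).
Hypotheses (gY : good Y) (Sx : S x).

Definition vt (h : 'rV[R]_n) : V := lin_comb E h + dot (lw x) h *: N.
Definition Tt h := dRh p Y (vt h).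

Lemma V0_vt h : V0 (vt h).
Proof.
have [TE [VN _] _ _ _] := fr; apply: V0D; last exact: V0Z.
by apply: V0_sum => i; apply: V0Z; have [] := TE i.
Qed.

Lemma at_b : 0 < ip N (nu x). Proof. by case: gY => _ _ _ _ []. Qed.
Lemma at_ad : adapted x. Proof. by case: gY => _ _ _ [_ h] _; exact: h. Qed.
Lemma at_M : M x. Proof. by case: gY => _ _ _ [[h _] _] _; have [] := h Sx. Qed.

Lemma vt_nu h : ip (vt h) (nu x) = 0.
Proof.
rewrite /vt ipDl ipZl ip_lin /dot mulr_suml -big_split big1 // => i _.
by have b0 := lt0r_neq0 at_b; rewrite /lw mxE /=; field.
Qed.

Lemma xE : x = cfac p Y *: Y. Proof. by []. Qed.
Lemma cf_gt0 : 0 < cfac p Y. Proof. by case: gY => h _ _ _ _; rewrite invr_gt0 sqrtr_gt0. Qed.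

Lemma dip_Y v : delta * ip x v = 0 -> delta * ip Y v = 0.
Proof.
rewrite xE ipZl mulrCA => /eqP; rewrite mulf_eq0 gt_eqF ?cf_gt0 //= => /eqP.
by [].
Qed.

Lemma Tt_ip h v : delta * ip x v = 0 -> ip (Tt h) v = cfac p Y * ip (vt h) v.
Proof.
move=> /dip_Y hv; rewrite /Tt /RadialDerivative.dRh ipDl ipNl !ipZl.
transitivity (cfac p Y * ip (vt h) v - cfac p Y ^+ 3 * ip Y (vt h) * (delta * ip Y v)); first by ring.
by rewrite hv mulr0 subr0.
Qed.

Lemma Tt_expand h : Tt h = \sum_i ip (Tt h) (ee x i) *: ee x i.
Proof.
have [fx _ _ _] := at_ad; have [_ [_ hnu] _ _ _] := fx.
have [VT hT] := TM_dRh (V0_slab y (u y) Mp fr) (V0_vt h) at_M.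
rewrite [LHS](frame_expand at_M fx VT) -/Y -/(Tt h) (Tt_ip _ hnu) vt_nu mulr0 scale0r addr0.
by rewrite [ip _ x]ipC hT scale0r addr0.
Qed.

Lemma Tt_f h : 'D_(Tt h) f x = 0.
Proof.
case: gY => _ _ [[bf _] _] _ _; have [_ fe _ _] := at_ad.
rewrite (Tt_expand h) (blin_sum _ bf) big1 // => i _.
by rewrite (blin_scale _ _ bf) fe scaler0.
Qed.

Lemma at_D1u : {for y, continuous u} ->
  (exists2 d, 0 < d & forall h, `|h| < d -> f (chart p E N (y + h) (u (y + h))) = 0) ->
  D1 u y (dot (lw x)).
Proof.
move=> cu hz; case: gY => g1 _ [fx _] _ [g5 _].
have DR := D1_Rh g1.
have H := @ift_D1 R n (fun Y => f (Rh p Y)) _ p N E u y (D1_comp DR fx) _ cu hz.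
apply: D1_ext (H _); first by apply: (@filterE _ (nbhs y)).
  move=> h /=; rewrite -!/(cfac p Y) -!/(dRh p Y _).
  have := Tt_f h; rewrite /Tt /vt.
  have bl := blin_dRh g1; case: fx => bf _.
  rewrite (blin_add _ _ bl) (blin_scale _ _ bl) (blin_add _ _ bf) (blin_scale _ _ bf) => /eqP.
  rewrite addr_eq0 => /eqP h0; rewrite -/x in h0 *; rewrite h0 opprK mulfK //.
  by rewrite gt_eqF.
by rewrite /= -!/(cfac p Y) -!/(dRh p Y _) gt_eqF.
Qed.

Definition Qt i j := - ip (E i + lw x 0 i *: N) ('D_(Tt (delta_mx 0 j)) nu x) / ip N (nu x).

Let m := cfac p Y.
Let b := ip N (nu x).
Let l := lw x.

Lemma vt_delta i : vt (delta_mx 0 i) = E i + l 0 i *: N.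
Proof.
rewrite /vt /lin_comb (bigD1 i) //= mxE !eqxx scale1r big1 ?addr0; last first.
  by move=> j ji; rewrite mxE (negbTE ji) andbF scale0r.
congr (_ + _ *: N); rewrite /dot (bigD1 i) //= [delta_mx _ _ _ _]mxE !eqxx mulr1 big1 ?addr0 // => j ji.
by rewrite [delta_mx _ _ _ _]mxE (negbTE ji) andbF mulr0.
Qed.

Lemma blin_Tt : blin Tt.
Proof.
have g1 : 0 < 1 + delta * (ip Y Y - ip p p) by case: gY.
have [l1 [B1 B10 H1]] := blin_slab (lw x); have [l2 [B2 B20 H2]] := blin_dRh g1.
split=> [a v w|]; first by rewrite /Tt -l2; congr (dRh p Y _); exact: l1.
exists (B2 * B1) => [|h]; first exact: mulr_gt0.
by rewrite (le_trans (H2 _)) // -mulrA ler_wpM2l ?(ltW B20) //; exact: H1.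
Qed.

Lemma Tt_sum h : Tt h = \sum_j h 0 j *: Tt (delta_mx 0 j).
Proof.
rewrite {1}[h]row_sum_delta (blin_sum _ blin_Tt).
by apply: eq_bigr => j _; rewrite (blin_scale _ _ blin_Tt).
Qed.

Lemma dnu_sum h : 'D_(Tt h) nu x = \sum_j h 0 j *: 'D_(Tt (delta_mx 0 j)) nu x.
Proof.
case: gY => _ _ [_ [bnu _]] _ _; rewrite {1}Tt_sum (blin_sum _ bnu).
by apply: eq_bigr => j _; rewrite (blin_scale _ _ bnu).
Qed.

Lemma at_D1l : D1 u y (dot l) ->
  forall i, D1 (fun z => lw (chart p E N z (u z)) 0 i) y (fun h => \sum_j Qt i j * h 0 j).
Proof.
move=> du i; case: gY => g1 _ [_ nx] _ [_ b0].
have d1 : D1 (fun z => slab p E N z (u z)) y vt.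
  have h1 := D1_add (D1_add (D1_cst p y) (D1_blin y (blin_lin_comb E))) (D1_bil (bbil_scale V) du (D1_cst N y)).
  by apply: D1_ext h1 => [|h]; [apply: (@filterE _ (nbhs y)) | rewrite /= scaler0 addr0 add0r].
have d2 : D1 (fun z => nu (chart p E N z (u z))) y (fun h => 'D_(Tt h) nu x).
  exact: (D1_comp (D1_comp d1 (D1_Rh g1)) nx).
have dip v : D1 (fun z => ip v (nu (chart p E N z (u z)))) y (fun h => ip v ('D_(Tt h) nu x)).
  have h1 := D1_bil (bbil_lip n delta) (D1_cst v y) d2.
  by apply: D1_ext h1 => [|h]; [apply: (@filterE _ (nbhs y)) | rewrite ip0l add0r].
have b0' : ip N (nu x) != 0 by rewrite gt_eqF.
have d3 := D1_comp (dip N) (D1_inv b0').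
have d4 := D1_bil (bbil_mul R) (dip (- E i)) d3.
apply: D1_ext d4; first by apply: (@filterE _ (nbhs y)) => z; rewrite /lw mxE ipNl.
move=> h; rewrite (eq_bigr (fun j => - ip (E i + l 0 i *: N) (h 0 j *: 'D_(Tt (delta_mx 0 j)) nu x) / b)); last first.
  by move=> j _; rewrite /Qt ipZr -/b -/l; ring.
rewrite -mulr_suml sumrN -ip_sumr -dnu_sum ipDl ipZl /l /lw mxE !ipNl -/b.
by field.
Qed.

(** The first fundamental form of the graph in the chart: [mu] is the radial factor, and the
    subtracted rank-one term is due to the radial part of the differential of the projection. *)
Definition gmet (mu : R) (z : 'rV[R]_n) (s : R) (lv : 'rV[R]_n) : 'M[R]_n :=
  \matrix_(i, j) (mu ^+ 2 * ((i == j)%:R + lv 0 i * lv 0 j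
     - delta * mu ^+ 2 * ((z 0 i + s * lv 0 i) * (z 0 j + s * lv 0 j)))).

Lemma dip_Yvt i : delta * ip Y (vt (delta_mx 0 i)) = delta * (y 0 i + u y * l 0 i).
Proof.
have [_ _ _ EN NN] := fr; rewrite vt_delta /Y /slab !ipL (ip_lin_E fr) NN (ip_lin_N fr) [ip N (E i)]ipC EN.
have h1 : delta * ip p (E i) = 0 by have [TE _ _ _ _] := fr; have [_ ->] := TE i.
have h2 : delta * ip p N = 0 by have [_ [_ ->] _ _ _] := fr.
transitivity (delta * ip p (E i) + l 0 i * (delta * ip p N) + delta * (y 0 i + u y * l 0 i)); first by ring.
by rewrite h1 h2; ring.
Qed.

Definition Pt : 'M[R]_n := \matrix_(i, a) ip (Tt (delta_mx 0 i)) (ee x a).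

Lemma Pt_metric : Pt *m Pt^T = gmet m y (u y) l.
Proof.
apply/matrixP => i j; rewrite mxE [RHS]mxE.
transitivity (ip (Tt (delta_mx 0 i)) (Tt (delta_mx 0 j))).
  rewrite [in RHS](Tt_expand (delta_mx 0 j)) ip_sumr; apply: eq_bigr => a _.
  by rewrite !mxE ipZr mulrC.
rewrite /Tt (dRh_ip _ _ at_M) -/m; congr (_ * _).
have -> : ip (vt (delta_mx 0 i)) (vt (delta_mx 0 j)) = (i == j)%:R + l 0 i * l 0 j.
  have [_ _ EE EN NN] := fr; rewrite !vt_delta !ipL EE EN NN [ip N _]ipC EN; ring.
congr (_ - _).
have h1 := dip_Yvt i; have h2 := dip_Yvt j.
have [d0|d0] := eqVneq delta 0; first by rewrite d0 !mul0r.
by move/(mulfI d0): h1 => ->; move/(mulfI d0): h2 => ->; ring.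
Qed.

Lemma dip_x_dnu h : delta * ip x ('D_(Tt h) nu x) = 0.
Proof.
case: gY => _ _ [_ [bnu _]] _ _; have [_ _ _ h0] := at_ad.
rewrite (Tt_expand h) (blin_sum _ bnu) ip_sumr mulr_sumr big1 // => i _.
by rewrite (blin_scale _ _ bnu) ipZr mulrCA h0 mulr0.
Qed.

(** The second fundamental form is a multiple of the Hessian, with no term in Christoffel symbols:
    totally geodesic hypersurfaces are affine in gnomonic coordinates. In the computation, the
    radial part of [Tt h] is orthogonal to the derivative of [nu]. *)
Lemma Pt_shape : Pt *m diag_mx (\row_i kk x i) *m Pt^T = (m * b) *: (\matrix_(i, j) Qt i j).
Proof.
have [_ _ hk _] := at_ad; have b0 := at_b; case: gY => _ _ [_ [bnu _]] _ _.
apply/matrixP => i j; rewrite [RHS]mxE [in RHS]mxE.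
transitivity (- ip (Tt (delta_mx 0 i)) ('D_(Tt (delta_mx 0 j)) nu x)); last first.
  rewrite (Tt_ip _ (dip_x_dnu _)) /Qt vt_delta -/m -/b -/l; field; rewrite gt_eqF //.
rewrite [in RHS](Tt_expand (delta_mx 0 i)) [in RHS](Tt_expand (delta_mx 0 j)).
rewrite (blin_sum _ bnu) ip_suml -sumrN mxE; apply: eq_bigr => a _.
rewrite ipZl ip_sumr (bigD1 a) //= big1 => [|c ca]; last first.
  by rewrite (blin_scale _ _ bnu) ipZr [ip (ee x a) _]ipC hk (negbTE ca) mulr0 oppr0 mulr0.
rewrite (blin_scale _ _ bnu) ipZr [ip (ee x a) _]ipC hk eqxx mul_mx_diag !mxE mulr1n; ring.
Qed.

Lemma at_nu : nu x = b *: (N - lin_comb E l + (delta * (dot y l - u y)) *: p).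
Proof.
have b0 := at_b; have b0' : b != 0 by rewrite gt_eqF.
have [fx _ _ _] := at_ad; have [_ [Vnu hnu] _ _ _] := fx.
rewrite [LHS](frame_expand Mp fr Vnu).
have hE i : ip (nu x) (E i) = - (b * l 0 i) by rewrite /l /lw mxE ipC -/b; field.
have hp : delta * ip (nu x) p = b * (delta * (dot y l - u y)).
  have := dip_Y hnu; rewrite /Y /slab !ipL ip_lin -/b [ip p _]ipC => h.
  have h2 : \sum_i y 0 i * ip (E i) (nu x) = - (b * dot y l).
    rewrite /dot mulr_sumr -sumrN; apply: eq_bigr => i _.
    by rewrite ipC hE; ring.
  by rewrite h2 in h; lra.
have -> : \sum_i ip (nu x) (E i) *: E i = - (b *: lin_comb E l).
  rewrite /lin_comb scaler_sumr -sumrN; apply: eq_bigr => i _.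
  by rewrite hE scaleNr scalerA.
by rewrite hp [ip _ N]ipC -/b !scalerDr scalerN scalerA [- _ + _]addrC.
Qed.

(** The unit length of [nu], computed from its expansion [at_nu] in the frame at [p]; positivity
    selects the root. *)
Lemma at_bE : b = (Num.sqrt (1 + en l + delta * (dot y l - u y) ^+ 2))^-1.
Proof.
have b0 : 0 < b := at_b; have [fx _ _ _] := at_ad; have [_ _ _ _ nn] := fx.
set t := dot y l - u y.
have : b ^+ 2 * (1 + en l + delta * t ^+ 2) = 1.
  rewrite -[RHS]nn at_nu -/t; have [_ _ _ _ NN] := fr.
  have h1 : delta * ip N p = 0 := dip_N_p fr.
  have h2 : delta * ip (lin_comb E l) p = 0 := dip_lin_p fr l.
  have h3 : delta * (delta * ip p p) = delta.
    by rewrite (M_ip Mp); case: eqVneq => [->|]; rewrite ?mul0r ?mulr1.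
  rewrite !ipL NN (ip_lin_lin fr) -/(en l) [ip N (lin_comb _ _)]ipC (ip_lin_N fr).
  rewrite [ip p N]ipC [ip p (lin_comb _ _)]ipC.
  transitivity (b ^+ 2 * (1 + en l + t ^+ 2 * (delta * (delta * ip p p)) + 2 * t * (delta * ip N p) - 2 * t * (delta * ip (lin_comb E l) p))); last by ring.
  by rewrite h1 h2 h3; ring.
move=> hb; have q0 : 0 < 1 + en l + delta * t ^+ 2.
  by rewrite -(pmulr_rgt0 _ (exprn_gt0 2 b0)) hb.
apply: (mulIf (x := Num.sqrt (1 + en l + delta * t ^+ 2))); first by rewrite gt_eqF // sqrtr_gt0.
rewrite mulVf; last by rewrite gt_eqF // sqrtr_gt0.
apply/eqP; rewrite -(@eqrXn2 _ 2) //; last by rewrite mulr_ge0 ?sqrtr_ge0 // ltW.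
by rewrite exprMn sqr_sqrtr ?ltW // hb expr1n.
Qed.

End At.

(** The field [graph_P] gives the two fundamental forms as congruent to the identity and to the
    diagonal of curvatures, the shape required by [det_pencil_congr]. *)
Record graph_of (S : set V) (p : V) (E : 'I_n -> V) (N : V) (nu : V -> V) (kk : V -> 'I_n -> R)
    (ta th : R) (u : 'rV[R]_n -> R) (l : 'rV[R]_n -> 'rV[R]_n) (Q : 'rV[R]_n -> 'M[R]_n) : Prop := {
  graph_ta : 0 < ta;
  graph_th : 0 < th;
  graph_M : forall y s, en y < ta -> `|s| < th ->
    0 < 1 + delta * (en y + s ^+ 2) /\ M (chart p E N y s);
  graph_S : forall y s, en y < ta -> `|s| < th -> (S (chart p E N y s) <-> s = u y);
  graph_u : forall y, en y < ta -> `|u y| < th /\ {for y, continuous u};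
  graph_T2 : forall y, en y < ta -> T2 u y (l y) (Q y);
  graph_nu : forall y, en y < ta ->
    let q := 1 + en (l y) + delta * (dot y (l y) - u y) ^+ 2 in
    0 < q /\ nu (chart p E N y (u y)) =
      (Num.sqrt q)^-1 *: (N - lin_comb E (l y) + (delta * (dot y (l y) - u y)) *: p);
  graph_P : forall y, en y < ta ->
    let q := 1 + en (l y) + delta * (dot y (l y) - u y) ^+ 2 in
    let m := (Num.sqrt (1 + delta * (en y + u y ^+ 2)))^-1 in
    exists P : 'M[R]_n, P *m P^T = gmet m y (u y) (l y) /\
      P *m diag_mx (\row_i kk (chart p E N y (u y)) i) *m P^T = (m / Num.sqrt q) *: Q y;
  graph_u0 : u 0 = 0;
  graph_l0 : l 0 = 0;
  graph_Q0 : forall i j, Q 0 i j = - ip (E i) ('D_(E j) nu p);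
  graph_lc : forall i, {for 0, continuous (fun y => l y 0 i)};
  graph_Qc : forall i j, {for 0, continuous (fun y => Q y i j)} }.

Lemma D1_slab_s y s : D1 (fun t : R => slab p E N y t) s (fun t => t *: N).
Proof.
have h1 := D1_add (D1_cst (p + lin_comb E y) s) (D1_bil (bbil_scale V) (D1_blin s (blin_id (R : normedModType R))) (D1_cst N s)).
by apply: D1_ext h1 => [|h]; [apply: (@filterE _ (nbhs s)) | rewrite /= scaler0 addr0 add0r].
Qed.

Lemma D1_slab_y y s : D1 (fun z : 'rV[R]_n => slab p E N z s) y (lin_comb E).
Proof.
have h1 := D1_add (D1_add (D1_cst p y) (D1_blin y (blin_lin_comb E))) (D1_cst (s *: N) y).
by apply: D1_ext h1 => [|h]; [apply: (@filterE _ (nbhs y)) | rewrite /= addr0 add0r].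
Qed.

Lemma fchart_mono y s1 s2 : (forall s, s1 <= s <= s2 -> good (slab p E N y s)) -> s1 < s2 ->
  f (chart p E N y s1) < f (chart p E N y s2).
Proof.
move=> H s12; pose phi (s : R) := f (chart p E N y s).
pose dphi (s : R) := 'D_(dRh p (slab p E N y s) N) f (chart p E N y s).
have dph (s : R) : s1 <= s <= s2 -> is_derive s 1 phi (dphi s).
  move=> /H [g1 _ [fx _] _ _].
  have := D1_is_derive (1 : R) (D1_comp (D1_slab_s y s) (D1_comp (D1_Rh g1) fx)).
  by rewrite scale1r.
have hm1 (s : R) : s \in `]s1, s2[%R -> is_derive s 1 phi (dphi s).
  by rewrite in_itv /= => /andP[h1 h2]; apply: dph; rewrite !ltW.
have hm2 : {within `[s1, s2], continuous phi}.
  apply: continuous_in_subspaceT => s /set_mem /=; rewrite in_itv /= => /dph [h1 _].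
  exact/differentiable_continuous/derivable1_diffP.
have [c] := MVT s12 hm1 hm2; rewrite in_itv /= => /andP[c1 c2] hE.
rewrite -subr_gt0 -/(phi s2) -/(phi s1) hE mulr_gt0 ?subr_gt0 //.
by have [_ _ _ _ []] : good (slab p E N y c) by apply: H; rewrite !ltW.
Qed.

Lemma near_en (ta : R) (y : 'rV[R]_n) : en y < ta -> \forall z \near y, en z < ta.
Proof.
move=> hy; have ce : {for y, continuous (fun x : 'rV[R]_n => en (x - 0))} := @continuous_en _ _ 0 y.
have H : \forall z \near y, en (z - 0) < ta by apply: (cvgr_lt _ ce); rewrite subr0.
by apply: (@filterS _ (nbhs y) _ _ _ _ H) => z; rewrite subr0.
Qed.

(** [f] increases along the vertical lines of the chart, which yields [u] by [ift] and decides the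
    sides of the graph. The gradient [lw] is a function of the normal and so is differentiable along
    the graph; this gives [u] its second-order expansions. *)
Lemma graph_lemma : exists ta th u l Q, graph_of S p E N nu kk ta th u l Q /\
  forall y s, en y < ta -> `|s| < th -> (u y < s <-> 0 < f (chart p E N y s)).
Proof.
have [th th0 Hg] := near_slab E N near_good.
have mono y : en y < th -> forall s1 s2, `|s1| < th -> `|s2| < th -> s1 < s2 ->
    f (chart p E N y s1) < f (chart p E N y s2).
  move=> hy s1 s2; rewrite !ltr_norml => /andP[a1 a2] /andP[b1 b2]; apply: fchart_mono => s /andP[c1 c2].
  by apply: Hg => //; rewrite ltr_norml (lt_le_trans a1) // (le_lt_trans c2).
have cy y s : en y < th -> `|s| < th -> {for y, continuous (fun x => f (chart p E N x s))}.
  move=> hy hs; have [g1 _ [fx _] _ _] := Hg _ _ hy hs.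
  exact: D1_cont (D1_comp (D1_slab_y y s) (D1_comp (D1_Rh g1) fx)).
have cs_ y s : en y < th -> `|s| < th -> {for s, continuous (fun t => f (chart p E N y t))}.
  move=> hy hs; have [g1 _ [fx _] _ _] := Hg _ _ hy hs.
  exact: D1_cont (D1_comp (D1_slab_s y s) (D1_comp (D1_Rh g1) fx)).
have f0 : f (chart p E N 0 0) = 0.
  by rewrite (chart00 fr); have [h _] := nbhs_singleton fS; have [] := h Sp.
have [ta [sg [u [ta0 tath sg0 sgth Hu]]]] := ift (phi := fun y s => f (chart p E N y s)) th0 mono cy cs_ f0.
have uth y : en y < ta -> `|u y| < th by move=> /Hu [h _ _]; exact: lt_trans h sgth.
have gu y : en y < ta -> good (slab p E N y (u y)).
  by move=> hy; apply: Hg; [exact: lt_le_trans tath | exact: uth].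
have MM y s : en y < ta -> `|s| < th -> 0 < 1 + delta * (en y + s ^+ 2) /\ M (chart p E N y s).
  move=> hy hs; have [g1 g2 _ _ _] := Hg _ _ (lt_le_trans hy tath) hs.
  by rewrite -(slab_ip fr); split=> //; apply: M_chart => //; rewrite -(slab_ip fr).
have SS y s : en y < ta -> `|s| < th -> (S (chart p E N y s) <-> s = u y).
  move=> hy hs; have hy' := lt_le_trans hy tath; have [_ _ _ [h _] _] := Hg _ _ hy' hs.
  have [_ fu _] := Hu _ hy; split.
    move=> /h [_ fs]; apply/eqP; rewrite eq_le !leNgt; apply/andP; split; apply/negP => hlt.
      by have := mono _ hy' _ _ (uth _ hy) hs hlt; rewrite fu fs ltxx.
    by have := mono _ hy' _ _ hs (uth _ hy) hlt; rewrite fu fs ltxx.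
  by move=> ->; have [_ _ _ [h' _] _] := gu _ hy; apply/h'; split; first by case: (MM _ _ hy (uth _ hy)).
have Su y : en y < ta -> S (chart p E N y (u y)) by move=> hy; apply/(SS _ _ hy (uth _ hy)).
have e0 : en (0 : 'rV[R]_n) < ta by rewrite en0.
have u0 : u 0 = 0.
  by apply/esym/(SS _ _ e0); rewrite ?normr0 // (chart00 fr).
pose l y := lw (chart p E N y (u y)).
pose Q y : 'M[R]_n := \matrix_(i, j) Qt u y i j.
have du y : en y < ta -> D1 u y (dot (l y)).
  move=> hy; have [_ _ cu] := Hu _ hy; apply: at_D1u => //; first exact: gu.
    exact: Su.
  have [d d0 Hd] : exists2 d, 0 < d & forall h, `|h| < d -> en (y + h) < ta.
    have : \forall z \near y, en z < ta by exact: near_en.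
    move=> /nbhs_normP [d /= d0 H]; exists d => // h hd; apply: H => /=.
    by rewrite opprD addNKr normrN.
  by exists d => // h /Hd /Hu [].
have dl y : en y < ta -> forall i, D1 (fun z => l z 0 i) y (fun h => \sum_j Q y i j * h 0 j).
  move=> hy i; have h := at_D1l (gu _ hy) (du _ hy) i.
  by apply: D1_ext h => [|k]; [apply: (@filterE _ (nbhs y)) | apply: eq_bigr => j _; rewrite mxE].
have c00 : chart p E N 0 (u 0) = p by rewrite u0 (chart00 fr).
have [_ _ _ EN NN] := fr.
have l0 : l 0 = 0.
  by apply/rowP => i; rewrite /l mxE c00 nup EN oppr0 mul0r mxE.
have T2u y : en y < ta -> T2 u y (l y) (Q y).
  move=> hy; apply: T2_of_D1; last by move=> i; exact: dl.
  have : \forall z \near y, en z < ta by exact: near_en.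
  move=> /nbhs_normP [d /= d0 H]; exists (d ^+ 2); first by rewrite exprn_gt0.
  by move=> z hz; apply: du; apply: H => /=; rewrite -normrN opprB; exact: norm_en.
have q0E y : en y < ta -> 0 < 1 + en (l y) + delta * (dot y (l y) - u y) ^+ 2 /\
    ip N (nu (chart p E N y (u y))) = (Num.sqrt (1 + en (l y) + delta * (dot y (l y) - u y) ^+ 2))^-1.
  move=> hy; have hb := at_bE (gu _ hy) (Su _ hy); split=> //.
  have := at_b (gu _ hy); rewrite hb invr_gt0 sqrtr_gt0 => //.
have slab0 : slab p E N 0 0 = p.
  rewrite /slab /lin_comb big1 ?addr0 ?scale0r ?addr0 // => i _; by rewrite mxE scale0r.
have cu0 : {for 0, continuous u} by have [_ _ ] := Hu _ e0.
have cx : {for 0, continuous (fun y => chart p E N y (u y))}.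
  have [g1 _ _ _ _] := gu _ e0.
  have h1 := D1_add (D1_add (D1_cst p (0 : 'rV[R]_n)) (D1_blin 0 (blin_lin_comb E))) (D1_bil (bbil_scale V) (du _ e0) (D1_cst N 0)).
  exact: (D1_cont (D1_comp h1 (D1_Rh g1))).
have cnu : {for 0, continuous (fun y => nu (chart p E N y (u y)))}.
  have [_ _ [_ h] _ _] := gu _ e0; exact: (continuous_comp cx (D1_cont h)).
have cN : {for 0, continuous (fun y => (ip N (nu (chart p E N y (u y))))^-1)}.
  have h1 := cont_ip (D1_cont (D1_cst N (0 : 'rV[R]_n))) cnu.
  apply: (continuous_comp h1); apply: inv_continuous; first by rewrite gt_eqF //; exact: at_b (gu _ e0).
have clc i : {for 0, continuous (fun y => l y 0 i)}.
  have k := continuousM (continuousN (cont_ip (D1_cont (D1_cst (E i) (0 : 'rV[R]_n))) cnu)) cN.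
  by apply: cont_near k; apply: (@filterE _ (nbhs 0)) => y; rewrite /l mxE.
exists ta, th, u, l, Q; split; last first.
  move=> y s hy hs; have hy' := lt_le_trans hy tath; have [_ fu _] := Hu _ hy.
  have [h|h|h] := ltgtP (u y) s.
  - by split=> // _; rewrite -fu; exact: mono _ hy' _ _ (uth _ hy) hs h.
  - by split=> //; rewrite -fu => h2; have := lt_trans h2 (mono _ hy' _ _ hs (uth _ hy) h); rewrite ltxx.
  - by split=> //; rewrite -h fu ltxx.
split => //.
- by move=> y hy; split; [exact: uth | have [] := Hu _ hy].
- move=> y hy /=; have [q0 hb] := q0E _ hy; split=> //.
  by rewrite (at_nu (gu _ hy) (Su _ hy)) hb.
- move=> y hy /=; have [q0 hb] := q0E _ hy; exists (Pt u y); split.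
    by rewrite (Pt_metric (gu _ hy) (Su _ hy)) (cfac_slab fr).
  by rewrite (Pt_shape (gu _ hy) (Su _ hy)) (cfac_slab fr) hb.
- move=> i j; rewrite mxE /Qt /Tt !vt_delta -![lw _]/(l 0) l0 !mxE !scale0r !addr0 c00 nup NN divr1 u0 slab0.
  by rewrite dRh_pp; have [TE _ _ _ _] := fr; have [_ ->] := TE j; rewrite scale0r subr0.
move=> i j.
have cv k : {for 0, continuous (fun y => E k + l y 0 k *: N)}.
  have h1 := cont_bil (bbil_scale V) (clc k) (D1_cont (D1_cst N (0 : 'rV[R]_n))).
  exact: (continuousD (D1_cont (D1_cst (E k) (0 : 'rV[R]_n))) h1).
have csl : {for 0, continuous (fun y => slab p E N y (u y))}.
  exact: (D1_cont (D1_add (D1_add (D1_cst p (0 : 'rV[R]_n)) (D1_blin 0 (blin_lin_comb E))) (D1_bil (bbil_scale V) (du _ e0) (D1_cst N 0)))).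
have cT : {for 0, continuous (fun y => Tt u y (delta_mx 0 j))}.
  have g0 : 0 < 1 + delta * (ip (slab p E N 0 (u 0)) (slab p E N 0 (u 0)) - ip p p) by have [] := gu _ e0.
  have k4 := @cont_dRh2 _ (fun y => slab p E N y (u y)) _ 0 g0 csl (cv j).
  by apply: cont_near k4; apply: (@filterE _ (nbhs (0 : 'rV[R]_n))) => y; rewrite /Tt vt_delta.
have cD : {for 0, continuous (fun y => 'D_(Tt u y (delta_mx 0 j)) nu (chart p E N y (u y)))}.
  apply: cont_derive; [by rewrite c00 | by rewrite c00 | exact: cT | exact: cx].
have k5 := continuousM (continuousN (cont_ip (cv i) cD)) cN.
by apply: cont_near k5; apply: (@filterE _ (nbhs (0 : 'rV[R]_n))) => y; rewrite mxE.
Qed.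

End GraphLemma.

Lemma smooth_D1 (R : realType) (V W : normedModType R) (p : V) (f : V -> W) :
  smooth_at p f -> \forall x \near p, D1 f x (fun v => 'D_v f x).
Proof. by move=> h; apply: (@filterS _ (nbhs p) _ _ _ _ h) => x /(_ [::]) /= /D1_diff. Qed.

Lemma smooth_derive_cont (R : realType) (V W : normedModType R) (p : V) (f : V -> W) v :
  smooth_at p f -> {for p, continuous (fun x => 'D_v f x)}.
Proof. by move=> /nbhs_singleton /(_ [:: v]) /= /differentiable_continuous. Qed.

Lemma near_near (T : topologicalType) (x : T) (P : T -> Prop) :
  (\forall y \near x, P y) -> \forall y \near x, \forall z \near y, P z.
Proof. by move=> h; exact: nbhs_interior. Qed.

Lemma near_and (T : topologicalType) (x : T) (P Q : T -> Prop) :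
  (\forall y \near x, P y) -> (\forall y \near x, Q y) -> \forall y \near x, P y /\ Q y.
Proof. by move=> h1 h2; apply: filterS2 h1 h2. Qed.

(** * Local geometry of [S] *)

Section LocalGeometry.
Context (R : realType) (n : nat) (delta : R).
Notation V := 'rV[R]_n.+2.
Notation ip := (@lip R n delta).
Notation M := (@space_form R n delta).
Notation TM := (@TM R n delta).
Notation frame := (@frame R n delta).
Variables (S : set V) (k : V -> 'I_n -> R) (Nf : V -> V -> V) (ef : V -> 'I_n -> V).

(** [principal_curvatures] with its witnesses exposed. A field is chosen for each [p], meaningful
    near [p]; fields chosen at different points are not related a priori. *)
Definition curvature_data (p : V) (N : V -> V) (e : 'I_n -> V) :=
    [/\ smooth_at p N,
        \forall x \near p, S x -> inner_unit_normal delta S x (N x),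
        forall i, tangent S p (e i),
        forall i j, ambient_prod delta (e i) (e j) = (i == j)%:R &
        forall i, tangential_part delta p ('D_(e i) N p) (- (k p i *: e i))].

Hypotheses (S_hyp : embedded_hypersurface delta S)
  (hS : forall p, S p -> curvature_data p (Nf p) (ef p)).

Lemma S_M p : S p -> M p. Proof. by case: S_hyp => h _ /h. Qed.

Lemma tangent_sub p v : tangent S p v -> tangent M p v.
Proof.
move=> [c [h1 h2 h3 h4]]; exists c; split=> //.
by apply: (@filterS _ (nbhs (0 : R)) _ _ _ _ h2) => t; exact: S_M.
Qed.

Lemma inner_frame p v : S p -> inner_unit_normal delta S p v -> frame p (ef p) v.
Proof.
move=> Sp [Tv vv vz _]; have Mp := S_M Sp; have [_ _ Te ee _] := hS Sp; split.
- by move=> i; apply/(tangentP _ Mp); exact: tangent_sub.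
- exact/(tangentP _ Mp).
- by move=> i j; rewrite -lipE.
- by move=> i; rewrite ipC -lipE; exact: vz.
by rewrite -lipE.
Qed.

Lemma inner_Nf p : S p -> inner_unit_normal delta S p (Nf p p).
Proof. by move=> Sp; have [_ /nbhs_singleton h _ _ _] := hS Sp; exact: h. Qed.

Lemma frame_Nf p : S p -> frame p (ef p) (Nf p p).
Proof. by move=> Sp; exact: inner_frame (inner_Nf Sp). Qed.

(** Both are unit vectors normal to the same hyperplane. The sign cannot be settled before the sides
    of [S] are known, in [inner_unique]. *)
Lemma inner_pm p v w : S p -> inner_unit_normal delta S p v -> inner_unit_normal delta S p w ->
  w = ip v w *: v /\ ip v w ^+ 2 = 1.
Proof.
move=> Sp hv hw; have Mp := S_M Sp; have fv := inner_frame Sp hv; have fw := inner_frame Sp hw.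
have [_ [Vw dw] _ Ew ww] := fw; have [_ _ _ _ vv] := fv.
have E : w = ip v w *: v.
  rewrite {1}(frame_expand Mp fv Vw) [ip w p]ipC dw scale0r addr0 ipC big1 ?add0r // => i _.
  by rewrite [ip w _]ipC Ew scale0r.
split=> //; rewrite -ww [in RHS]E !ipL vv; ring.
Qed.

(* Two smooth inner normal fields agree up to a sign, which is locally constant. *)
Lemma inner_sign p : S p -> \forall x \near p, S x ->
  \forall y \near x, S y -> Nf p y = ip (Nf p x) (Nf x x) *: Nf x y.
Proof.
move=> Sp; have [sp ip_ _ _ _] := hS Sp.
apply: (@filterS2 _ (nbhs p) _ _ _ _ _ (near_near ip_) (smooth_D1 sp)) => x hx Dx Sx.
have [sx ix _ _ _] := hS Sx.
have cN : {for x, continuous (fun y => ip (Nf p y) (Nf x y))}.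
  by apply: cont_ip; [exact: D1_cont Dx | exact: D1_cont (nbhs_singleton (smooth_D1 sx))].
have [_ s2] := inner_pm Sx (nbhs_singleton hx Sx) (nbhs_singleton ix Sx).
set s := ip (Nf p x) (Nf x x) in s2 *.
have cs_ : {for x, continuous (fun y => s * ip (Nf p y) (Nf x y))}.
  exact: (continuousM (D1_cont (D1_cst (s : R) x)) cN).
have H : \forall y \near x, 0 < s * ip (Nf p y) (Nf x y).
  by apply: (cvgr_gt _ cs_); rewrite -/s -expr2 s2.
apply: (@filterS3 _ (nbhs x) _ _ _ _ _ _ H hx ix) => y h1 h2 h3 Sy.
have [E1 E2] := inner_pm Sy (h3 Sy) (h2 Sy); rewrite {1}E1; congr (_ *: _).
rewrite ipC in E1 E2 *; set t := ip _ _ in h1 E2 *.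
have : (s - t) * (s + t) = 0 by rewrite -subr_sqr s2 E2 subrr.
move=> /eqP; rewrite mulf_eq0 => /orP[]; first by rewrite subr_eq0 => /eqP.
by rewrite addr_eq0 => /eqP st; have := sqr_ge0 t; move: h1; rewrite st; nra.
Qed.

Lemma tangent_D1 (W : normedModType R) x v (F : V -> W) L (a : W) : S x -> tangent S x v ->
  (\forall y \near x, S y -> F y = a) -> D1 F x L -> L v = 0.
Proof.
move=> Sx [c [sc Sc c0 <-]]; rewrite -c0 => Fa DF.
have dc : D1 c 0 (fun h => 'D_h c 0) := D1_diff (nbhs_singleton sc [::]).
rewrite derive1E; apply: (D1_near_cst (1 : R) _ (D1_comp dc DF) (a := a)).
have H : nbhs (0 : R) [set t | S (c t) -> F (c t) = a] := D1_cont dc Fa.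
by apply: (@filterS2 _ (nbhs (0 : R)) _ _ _ _ _ Sc H) => t h; apply.
Qed.

Lemma tangent_dip x v (N : V -> V) : S x -> tangent S x v ->
  (\forall y \near x, S y -> TM y (N y)) -> ip v (N x) = 0 -> D1 N x (fun v => 'D_v N x) ->
  delta * ip x ('D_v N x) = 0.
Proof.
move=> Sx Tv TN vN DN.
have DF := D1_bil (bbil_mul R) (D1_cst delta x) (D1_bil (bbil_lip n delta) (D1_blin x (blin_id V)) DN).
have := tangent_D1 (a := 0) Sx Tv _ DF; rewrite /= mul0r add0r vN add0r; apply.
by apply: (@filterS _ (nbhs x) _ _ _ _ TN) => y h /h [].
Qed.

(** The derivative of [f] vanishes along [ef p], so the transversal vector of the definition forces
    a nonzero derivative along the normal; [f] is replaced by [- f] if its sign is wrong. *)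
Lemma local_defining p : S p -> exists f : V -> R,
  [/\ \forall x \near p, D1 f x (fun v => 'D_v f x), forall v, {for p, continuous (fun x => 'D_v f x)},
      \forall x \near p, S x <-> M x /\ f x = 0 & 0 < 'D_(Nf p p) f p].
Proof.
move=> Sp; have [_ /(_ _ Sp)[f [sf0 fS [v /(tangentP _ (S_M Sp)) Tv fv]]]] := S_hyp.
have sf := smooth_D1 sf0; have cf v' : {for p, continuous (fun x => 'D_v' f x)} := smooth_derive_cont sf0.
have Df := nbhs_singleton sf; have [bl _] := Df.
have fz : \forall y \near p, S y -> f y = 0.
  by apply: (@filterS _ (nbhs p) _ _ _ _ fS) => y [h _] /h [].
have fe i : 'D_(ef p i) f p = 0.
  by have [_ _ Te _ _] := hS Sp; exact: (tangent_D1 Sp (Te i) fz Df).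
have fN : 'D_(Nf p p) f p != 0.
  apply: contra fv => /eqP h; have [Vv dv] := Tv.
  rewrite (frame_expand (S_M Sp) (frame_Nf Sp) Vv) [ip v p]ipC dv scale0r addr0.
  rewrite (blin_add _ _ bl) (blin_scale _ _ bl) h scaler0 addr0 (blin_sum _ bl).
  by rewrite big1 // => i _; rewrite (blin_scale _ _ bl) fe scaler0.
have [h|h|h] := ltgtP ('D_(Nf p p) f p) 0; last by rewrite h eqxx in fN.
  have DN x : D1 f x (fun v => 'D_v f x) -> D1 (fun x => - f x) x (fun v => - 'D_v f x).
    move=> D; have D2 := D1_bil (bbil_scale R) (D1_cst (-1 : R) x) D.
    by apply: D1_ext D2 => [|z]; [apply: (@filterE _ (nbhs x)) => y | rewrite /= scale0r add0r]; rewrite scaleN1r.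
  exists (fun x => - f x); split.
  - apply: (@filterS _ (nbhs p) _ _ _ _ sf) => x /DN D.
    by apply: (D1_ext _ _ D) => [|z]; [apply: (@filterE _ (nbhs x)) | rewrite (D1_derive z D)].
  - move=> w; apply: (cont_near _ (continuousN (cf w))).
    by apply: (@filterS _ (nbhs p) _ _ _ _ sf) => x /DN /(D1_derive w).
  - apply: (@filterS _ (nbhs p) _ _ _ _ fS) => y [h1 h2]; split=> [/h1 [? ->]|[? /eqP]]; first by rewrite oppr0.
    by rewrite oppr_eq0 => /eqP h3; exact: h2.
  - by rewrite (D1_derive _ (DN _ Df)) oppr_gt0.
by exists f; split.
Qed.

Lemma near_tangent_zero p (f : V -> R) : S p -> (\forall x \near p, D1 f x (fun v => 'D_v f x)) ->
  (\forall x \near p, S x <-> M x /\ f x = 0) ->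
  \forall x \near p, S x -> forall i, 'D_(ef x i) f x = 0.
Proof.
move=> Sp sf fS; apply: (@filterS2 _ (nbhs p) _ _ _ _ _ sf (near_near fS)) => x Df fx Sx i.
have [_ _ Te _ _] := hS Sx; apply: (tangent_D1 Sx (Te i) _ Df (a := 0)).
by apply: (@filterS _ (nbhs x) _ _ _ _ fx) => y [h _] /h [].
Qed.

Lemma curvature_Nf x i j : S x -> ip ('D_(ef x i) (Nf x) x) (ef x j) = - (k x i * (i == j)%:R).
Proof.
move=> Sx; have [_ _ Te ee Tk] := hS Sx; have [_ /(_ _ (tangent_sub (Te j)))] := Tk i.
by rewrite lipE opprK ipDl ipZl -[ip (ef x i) _]lipE ee => /eqP; rewrite addr_eq0 => /eqP.
Qed.

(** The sign between the field chosen at [p] and the one chosen at [x]. [Nf_near] will show that it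
    is 1 near [p]. *)
Definition sg p x := ip (Nf p x) (Nf x x).

Lemma near_adapted p (f : V -> R) : S p -> (\forall x \near p, D1 f x (fun v => 'D_v f x)) ->
  (\forall x \near p, S x <-> M x /\ f x = 0) ->
  \forall x \near p, S x -> adapted delta f (Nf p) (fun x i => sg p x * k x i) ef x.
Proof.
move=> Sp sf fS; have [sp ip_ _ _ _] := hS Sp.
have H3 := near_and (near_near ip_) (smooth_D1 sp).
have H := near_and (near_and (near_tangent_zero Sp sf fS) (inner_sign Sp)) H3.
apply: (@filterS _ (nbhs p) _ _ _ _ H) => x [[h1 h2] [h3 h4]] Sx.
have [sx ix Te ee _] := hS Sx; have Dx := nbhs_singleton (smooth_D1 sx).
have inx := nbhs_singleton h3 Sx.
have hD i : 'D_(ef x i) (Nf p) x = sg p x *: 'D_(ef x i) (Nf x) x.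
  have D := D1_add h4 (D1_bil (bbil_scale V) (D1_cst (- sg p x) x) Dx).
  have := tangent_D1 (a := 0) Sx (Te i) _ D.
  rewrite /= scale0r add0r scaleNr => h; apply/eqP; rewrite -subr_eq0; apply/eqP; apply: h.
  by apply: (@filterS _ (nbhs x) _ _ _ _ (h2 Sx)) => y hy /hy ->; rewrite scaleNr subrr.
have fx := inner_frame Sx inx; have [_ _ _ EN _] := fx.
split=> //.
- by move=> i; exact: h1.
- by move=> i j; rewrite hD ipZl (curvature_Nf _ _ Sx) mulrN mulrA.
- move=> i; apply: (tangent_dip Sx (Te i) _ _ h4) => //.
  apply: (@filterS _ (nbhs x) _ _ _ _ h3) => y hy Sy.
  by have [_ h _ _ _] := inner_frame Sy (hy Sy).
Qed.

Lemma local_graph_side p E : S p -> frame p E (Nf p p) -> exists f : V -> R,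
  [/\ \forall x \near p, D1 f x (fun v => 'D_v f x), forall v, {for p, continuous (fun x => 'D_v f x)},
      \forall x \near p, S x <-> M x /\ f x = 0, 0 < 'D_(Nf p p) f p &
  exists ta th u l Q,
  graph_of delta S p E (Nf p p) (Nf p) (fun x i => sg p x * k x i) ta th u l Q /\
  forall y s, en y < ta -> `|s| < th -> (u y < s <-> 0 < f (chart delta p E (Nf p p) y s))].
Proof.
move=> Sp fE; have [f [sf cf fS fN]] := local_defining Sp; have [sp _ _ _ _] := hS Sp.
exists f; split=> //.
apply: (graph_lemma (S_M Sp) fE Sp sf cf (smooth_D1 sp) _ fS fN erefl (near_adapted Sp sf fS)).
by move=> v; exact: smooth_derive_cont.
Qed.

Lemma local_graph p E : S p -> frame p E (Nf p p) -> exists ta th u l Q,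
  graph_of delta S p E (Nf p p) (Nf p) (fun x i => sg p x * k x i) ta th u l Q.
Proof.
move=> Sp fE; have [f [_ _ _ _ [ta [th [u [l [Q [g _]]]]]]]] := local_graph_side Sp fE.
by exists ta, th, u, l, Q.
Qed.

End LocalGeometry.

Lemma cmax (R : realType) (m : nat) (A : set 'rV[R]_m) (f : 'rV[R]_m -> R) :
  A !=set0 -> compact A -> continuous f -> exists2 z, A z & forall t, A t -> f t <= f z.
Proof.
move=> A0 cA cf; have [z /set_mem Az h] := EVT_max_rV A0 cA (continuous_subspaceT cf).
by exists z => // t At; apply: h; exact: mem_set.
Qed.

Lemma closed_le_fun (R : realType) (T : topologicalType) (f : T -> R) (a : R) :
  continuous f -> closed [set x | f x <= a].
Proof.
by move=> cf; apply: (@closed_comp _ _ f [set t | t <= a]) => [x _|]; [exact: cf | exact: closed_le].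
Qed.

Lemma deriv_pos (R : realType) (f : R -> R) L : D1 f 0 L -> 0 < L 1 ->
  exists2 d, 0 < d & forall t, 0 < t < d -> f 0 < f t.
Proof.
move=> [bL H] L1; have [d d0 Hd] := H _ (divr_gt0 L1 (ltr0Sn R 1)).
exists d => // t /andP[t0 td]; have := Hd t; rewrite gtr0_norm // add0r => /(_ td).
have -> : L t = t * L 1 by have := blin_scale t (1 : R) bL; rewrite /GRing.scale /= mulr1.
by rewrite ler_norml => /andP[h _]; have := mulr_gt0 t0 L1; lra.
Qed.

(** * The domain bounded by [S] *)

Section Domain.
Context (R : realType) (n : nat) (delta : R).
Notation V := 'rV[R]_n.+2.
Notation ip := (@lip R n delta).
Notation M := (@space_form R n delta).
Notation TM := (@TM R n delta).
Notation sqd := (@sqd R n delta).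
Notation psi := (@psi R n delta).
Notation Rh := (@Rh R n delta).

Lemma cont_ipxx (x : V) : {for x, continuous (fun y : V => ip y y)}.
Proof. exact: (@cont_ip R n delta _ id id x (@cvg_id _ _) (@cvg_id _ _)). Qed.

Lemma cont_psi p x : {for x, continuous (psi p)}.
Proof.
have c1 : {for x, continuous (fun y : V => y - p)} := continuousB (@cvg_id _ _) (D1_cont (D1_cst p x)).
have c2 := cont_ip (delta := delta) c1 (D1_cont (D1_cst p x)).
have c3 := continuousD (D1_cont (D1_cst (1 : R) x)) (continuousM (D1_cont (D1_cst (delta : R) x)) c2).
by apply: cont_near c3; apply: (@filterE _ (nbhs x)) => y; rewrite psi_def.
Qed.

Lemma cont_lg p x : psi p x != 0 -> {for x, continuous (lg delta p)}.
Proof.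
move=> h; have c1 : {for x, continuous (fun y => (psi p y)^-1)}.
  by apply: (continuous_comp (cont_psi (x := x))); exact: inv_continuous.
exact: (continuousB (cont_bil (bbil_scale V) c1 (@cvg_id _ _)) (D1_cont (D1_cst p x))).
Qed.

Lemma cont_sqd c : continuous (sqd c).
Proof.
move=> x; have c1 : {for x, continuous (fun y : V => c - y)} := continuousB (D1_cont (D1_cst c x)) (@cvg_id _ _).
exact: (cont_ip (delta := delta) c1 c1).
Qed.

(** The tangent vector [v = psi z c *: z - c] points away from [c], and the derivative of [sqd c]
    along it is [2 <v, v>]. It vanishes only at [z = c], as the antipode is excluded by the sign of
    the first coordinate. *)
Lemma sqd_increase c z (P : V -> Prop) : M c -> M z -> z <> c -> (\forall y \near z, P y) ->
  exists y, [/\ M y, P y & sqd c z < sqd c y].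
Proof.
move=> Mc Mz zc nP; pose v := psi z c *: z - c.
have d1 : delta = 0 -> psi z c = 1 by move=> d0; rewrite psi_def d0 mul0r addr0.
have Tv : TM z v.
  split; first by apply: V0D; [apply: V0Z; exact: M_V0 | apply: V0N; exact: M_V0].
  have [d0|d0] := eqVneq delta 0; first by rewrite d0 mul0r.
  rewrite /v !ipL mulrBr mulrCA (M_ip1 Mz d0) mulr1 psiE // (negbTE d0) addr0.
  by rewrite [ip c z]ipC subrr.
have vz : (psi z c - 1) * ip z v = 0.
  have [/d1 ->|d0] := eqVneq delta 0; first by rewrite subrr mul0r.
  by have [_ h] := Tv; apply: (mulfI d0); rewrite mulrCA h !mulr0.
have vE : ip (z - c) v = ip v v.
  have -> : ip v v = ip (z - c) v + (psi z c - 1) * ip z v.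
    by rewrite -ipZl -ipDl; congr (ip _ _); rewrite /v scalerBl scale1r [RHS]addrC addrA subrK.
  by rewrite vz addr0.
have v0 : 0 < ip v v.
  have [h1 h2] := tangent_pos Mz Tv; rewrite lt_neqAle h1 andbT eq_sym; apply/eqP => /h2 /eqP.
  rewrite subr_eq0 => /eqP cE; apply: zc.
  have [/d1 h|d0] := eqVneq delta 0; first by rewrite -cE h scale1r.
  have := M_ip1 Mc d0; rewrite -cE !ipL => h.
  have : psi z c ^+ 2 = 1 by rewrite -h -[LHS]mulr1 -(M_ip1 Mz d0); ring.
  have := M_pos Mc d0; rewrite -{1}cE mxE (pmulr_lgt0 _ (M_pos Mz d0)) => h3 /eqP.
  rewrite sqrf_eq1 => /orP[/eqP h4|/eqP h4]; first by move: cE; rewrite h4 scale1r.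
  by exfalso; move: h3; rewrite h4 oppr_gt0 ltr10.
have L1 : 0 < ip (- v) (c - z) + ip (c - z) (- v).
  have key : ip (c - z) (- v) = ip v v by rewrite -vE -[c - z]opprB ipNl ipNr opprK.
  by rewrite [ip (- v) _]ipC key addr_gt0.
have [c0 [sc Mc0 c00 c0v]] : tangent M z v by apply/tangentP.
have dc : D1 c0 0 (fun h => 'D_h c0 0) := D1_diff (nbhs_singleton sc [::]).
have D := D1_add (D1_cst c 0) (D1_bil (bbil_scale V) (D1_cst (-1 : R) 0) dc).
have := deriv_pos (D1_bil (bbil_lip n delta) D D); rewrite /= scale0r !add0r -derive1E c0v c00 !scaleN1r.
move=> /(_ L1)[d d0 Hd].
have H2 : nbhs (0 : R) [set t | P (c0 t)] by apply: (D1_cont dc); rewrite /= c00.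
have /nbhs_normP[d2 /= d20 H3] := near_and Mc0 H2.
pose t := Num.min d d2 / 2; have t0 : 0 < Num.min d d2 by rewrite lt_min d0.
have [|H4 H5] := H3 t; first by rewrite /= sub0r normrN gtr0_norm ?divr_gt0 // /t; have := ge_min d2 d d2; rewrite lexx orbT; lra.
exists (c0 t); split=> //.
have : 0 < t < d by rewrite divr_gt0 //=; have := ge_min d d d2; rewrite lexx /= /t; lra.
by move=> /Hd; rewrite !scaleN1r.
Qed.

Lemma near_Rh p : M p ->
  \forall Y \near p, 0 < 1 + delta * (ip Y Y - ip p p) /\ (0 < delta -> 0 < (Y : V) 0 ord0).
Proof.
move=> Mp; apply: near_and.
  have h1 := cont_ipxx (x := p).
  have c1 : {for p, continuous (fun Y : V => 1 + delta * (ip Y Y - ip p p))}.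
    exact: (continuousD (D1_cont (D1_cst (1 : R) p)) (continuousM (D1_cont (D1_cst (delta : R) p)) (continuousB h1 (D1_cont (D1_cst (ip p p) p))))).
  by apply: (cvgr_gt _ c1); rewrite subrr mulr0 addr0.
have [d0|d0] := ltP 0 delta; last by apply: (@filterE _ (nbhs p)) => Y.
have c1 := @coord_continuous R 1 n.+2 0 ord0 p.
have H : \forall Y \near p, 0 < (Y : V) 0 ord0 by apply: (cvgr_gt _ c1); apply: (M_pos Mp); rewrite gt_eqF.
by apply: (@filterS _ (nbhs p) _ _ _ _ H) => Y h _.
Qed.

Lemma tan_ip p v : delta * ip p v = 0 -> delta * (ip (p + v) (p + v) - ip p p) = delta * ip v v.
Proof.
move=> h; rewrite !ipL [ip v p]ipC; transitivity (delta * ip v v + 2 * (delta * ip p v)); first by ring.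
by rewrite h mulr0 addr0.
Qed.

Variable S : set V.
Hypotheses (cS : compact S) (S0 : S !=set0) (SM : S `<=` M).
Notation Om := (bounded_domain delta S).

Definition joined x y := exists A, [/\ connected A, A `<=` M `\` S, A x & A y].

Lemma joined_sym x y : joined x y -> joined y x.
Proof. by move=> [A [? ? ? ?]]; exists A. Qed.

Lemma joined_path (g : R -> V) : (forall t, 0 <= t <= 1 -> {for t, continuous g}) ->
  (forall t, 0 <= t <= 1 -> M (g t) /\ ~ S (g t)) -> joined (g 0) (g 1).
Proof.
move=> cg hg; exists (g @` `[0, 1]); split.
- apply: connected_continuous_connected; first exact: segment_connected.
  by apply: continuous_in_subspaceT => t /set_mem /=; rewrite in_itv /=; exact: cg.
- by move=> _ [t /= ht <-]; apply: hg; rewrite in_itv in ht.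
- by exists 0 => //=; rewrite in_itv /= lexx ler01.
- by exists 1 => //=; rewrite in_itv /= lexx ler01.
Qed.

Lemma joined_component x y : joined x y -> connected_component (M `\` S) x y.
Proof. by move=> [A [cA AM Ax Ay]]; exact: (connected_component_max Ax AM cA). Qed.

Lemma joined_domain x y : joined x y -> Om x -> Om y.
Proof.
move=> j [MSx [K [cK KM CK]]]; have [A [_ AM _ Ay]] := j; split; first exact: AM.
by exists K; split=> //; rewrite -(same_connected_component (joined_component j)).
Qed.

Lemma Om_M x : Om x -> M x. Proof. by move=> [[]]. Qed.
Lemma Om_S x : Om x -> ~ S x. Proof. by move=> [[]]. Qed.

Lemma near_notS z : ~ S z -> \forall y \near z, ~ S y.
Proof.
move=> h; have cl : closed S := compact_closed (@norm_hausdorff _ _) cS.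
exact: (open_nbhs_nbhs (conj (closed_openC cl) h)).
Qed.

(** In the central projection from [z], straight segments join [z] to the nearby points, and their
    images avoid [S]. *)
Lemma near_joined z : M z -> ~ S z -> \forall y \near z, M y -> joined z y.
Proof.
move=> Mz Sz.
have h1 : \forall Y \near z, ~ S (Rh z Y).
  have cR : {for z, continuous (Rh z)} by exact: cont_Rh.
  have h : nbhs (Rh z z) [set y | ~ S y] by rewrite Rh_p; exact: near_notS.
  exact: (cR _ h).
have /nbhs_normP[d /= d0 Hd] := near_and h1 (near_Rh Mz).
have p0 : psi z z != 0 by rewrite psi_pp oner_neq0.
have h2 : \forall y \near z, 0 < psi z y.
  by apply: (cvgr_gt _ (cont_psi (x := z))); rewrite psi_pp.
have lz : lg delta z z = 0 by rewrite /lg psi_pp invr1 scale1r subrr.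
have h3 : \forall y \near z, `|lg delta z y| < d.
  have H : nbhs (lg delta z z) [set v | `|v| < d].
    by rewrite lz; apply/nbhs_ballP; exists d => // v; rewrite -ball_normE /= sub0r normrN.
  exact: (cont_lg p0 H).
apply: (@filterS2 _ (nbhs z) _ _ _ _ _ h2 h3) => y py ly My.
have Tl : TM z (lg delta z y) by apply: lg_TM => //; rewrite gt_eqF.
set v := lg delta z y in ly Tl *.
have vt (t : R) : 0 <= t <= 1 -> `|z - (z + t *: v)| < d.
  move=> /andP[t0 t1]; rewrite opprD addNKr normrN normrZ ger0_norm //.
  by apply: le_lt_trans ly; rewrite ler_piMl.
pose g (t : R) := Rh z (z + t *: v).
have -> : z = g 0 by rewrite /g scale0r addr0 Rh_p.
have gE t : g t = rho delta z (t *: v) by rewrite /g Rh_rho //; have [_ h] := TMZ t Tl.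
have -> : y = g 1 by rewrite gE scale1r lgK.
apply: joined_path => t ht; have [a1 [a2 a3]] := Hd _ (vt t ht).
  have b1 := D1_add (D1_cst z t) (D1_bil (bbil_scale V) (D1_blin t (blin_id (R : normedModType R))) (D1_cst v t)).
  exact: (D1_cont (D1_comp b1 (D1_Rh a2))).
split=> //; rewrite gE; apply: M_rho => //; first exact: TMZ.
by have [_ h] := TMZ t Tl; rewrite (tan_ip h) in a2.
Qed.

(* [sqd c] has no local maximum on [M], so its maximum on the closure of a
   relatively compact component is attained on [S] only. *)
Lemma domain_sqd c d x : M c -> (forall s, S s -> sqd c s <= d) -> Om x -> sqd c x < d.
Proof.
move=> Mc Sd [[Mx Sx] [K [cK KM CK]]]; rewrite ltNge; apply/negP => dx.
set C := connected_component (M `\` S) x in CK.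
have Cx : C x by apply: connected_component_refl.
have clK : closure C `<=` K.
  have h := compact_closed (@norm_hausdorff _ _) cK.
  by rewrite closureE => y /(_ K) /=; apply.
have cC : compact (closure C) by apply: (subclosed_compact (@closed_closure _ C) cK clK).
have [z0 Cz0 Hz0] := cmax (ex_intro _ _ (subset_closure Cx)) cC (@cont_sqd c).
have [z [Sz Cz Hz]] : exists z, [/\ ~ S z, closure C z & forall t, closure C t -> sqd c t <= sqd c z].
  have [h|h] := pselect (S z0); last by exists z0.
  exists x; split=> //; first exact: subset_closure.
  by move=> t /Hz0 /le_trans; apply; exact: le_trans (Sd _ h) dx.
have Mz : M z by apply: KM; exact: clK.
have nj := near_joined Mz Sz.
have [y [Cy jy]] := Cz _ nj.
have My : M y by have [] := connected_component_sub Cy.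
have Cj w : joined z w -> C w.
  move=> /joined_component h; rewrite /C (same_connected_component Cy).
  by rewrite -(same_connected_component (joined_component (jy My))).
have [zc|zc] := pselect (z = c); last first.
  have [w [Mw jw]] := sqd_increase Mc Mz zc nj.
  by rewrite ltNge (Hz _ (subset_closure (Cj _ (jw Mw)))).
have c0 : sqd c z = 0 by rewrite zc /SpaceForm.sqd subrr ip0l.
have [s Ss] := S0; have [s0 s00] := sqd_ge0 Mc (SM Ss).
apply: Sz; rewrite zc -(s00 _) //; apply/eqP; rewrite eq_le s0 andbT.
by rewrite (le_trans (Sd _ Ss)) // -c0 (le_trans dx) // Hz //; exact: subset_closure.
Qed.

End Domain.

(** * A center whose balls are compact *)

Module BasePoint.
Section BasePoint.
Context (R : realType) (n : nat) (delta : R).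
Notation V := 'rV[R]_n.+2.
Notation ip := (@lip R n delta).
Notation M := (@space_form R n delta).
Notation sqd := (@sqd R n delta).
Notation psi := (@psi R n delta).

(** The pole of the half-sphere, the vertex of the hyperboloid, or the origin. What matters is that
    [psi base] is positive on the whole space form, also for [delta > 0]. *)
Definition base : V := if delta == 0 then 0 else (Num.sqrt `|delta|)^-1 *: delta_mx 0 ord0.

Lemma ip_e0 x : ip x (delta_mx 0 ord0) = eps delta * x 0 ord0.
Proof.
rewrite ipE mxE !eqxx mulr1 /dot big1 ?addr0 // => i _.
by rewrite /tl !mxE mulr0.
Qed.

Lemma delta_eps : delta * eps delta = `|delta|.
Proof. by rewrite /eps; have [h|h] := ltP delta 0; [rewrite ltr0_norm // mulrN1 | rewrite ger0_norm // mulr1]. Qed.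

Lemma M_base : M base.
Proof.
have [d0|d0] := eqVneq delta 0.
  by apply: M_intro; rewrite ?d0 ?eqxx // /base d0 eqxx => _; rewrite mxE.
have q0 : 0 < Num.sqrt `|delta| by rewrite sqrtr_gt0 normr_gt0.
apply: M_intro; rewrite /base (negbTE d0).
- by move=> h; rewrite h eqxx in d0.
- move=> _; rewrite ipZr ip_e0 !mxE !eqxx mulr1.
  rewrite (_ : _ * _ = (delta * eps delta) / Num.sqrt `|delta| ^+ 2); last by field; rewrite gt_eqF.
  by rewrite delta_eps sqr_sqrtr // divff // normr_eq0.
by move=> _; rewrite !mxE !eqxx mulr1 invr_gt0.
Qed.

Lemma psi_base x : M x -> delta != 0 -> psi base x = Num.sqrt `|delta| * x 0 ord0.
Proof.
move=> Mx d0; have q0 : 0 < Num.sqrt `|delta| by rewrite sqrtr_gt0 normr_gt0.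
rewrite (psiE _ M_base) (negbTE d0) addr0 /base (negbTE d0) ipZr ip_e0.
rewrite mulrCA [delta * _]mulrA delta_eps -{2}(sqr_sqrtr (normr_ge0 delta)); field.
by rewrite gt_eqF.
Qed.

Lemma psi_base_gt0 x : M x -> 0 < psi base x.
Proof.
move=> Mx; have [d0|d0] := eqVneq delta 0; first by rewrite psi_def d0 mul0r addr0.
by rewrite psi_base // mulr_gt0 ?(M_pos Mx) // sqrtr_gt0 normr_gt0.
Qed.

(** [delta * d < 2] says that [psi base] is positive on the ball; for [delta > 0] this keeps it away
    from the equator, where the open half-sphere fails to be closed. *)
Lemma compact_base d : delta * d < 2 -> compact (M `&` [set x | sqd base x <= d]).
Proof.
move=> dd; have Mb := M_base.
have cip : continuous (fun x : V => ip x x) by move=> x; exact: cont_ipxx.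
have c0 : continuous (fun x : V => x 0 ord0) by exact: coord_continuous.
have [d0|d0] := eqVneq delta 0.
  have -> : M `&` [set x | sqd base x <= d] = [set x : V | x 0 ord0 = 0 /\ en x <= d].
    have E (x : V) : x 0 ord0 = 0 -> sqd base x = en x.
      move=> x0; rewrite /SpaceForm.sqd /base d0 eqxx sub0r ipE !mxE x0 oppr0 !mulr0 add0r.
      rewrite /en /dot [in RHS]big_ord_recl x0 mul0r add0r; apply: eq_bigr => i _.
      by rewrite !mxE mulrNN.
    apply/seteqP; split=> x /= [h1 h2].
      by have x0 := M_V0 h1 d0; split=> //; rewrite -E.
    split; last by rewrite /= E.
    by apply: M_intro; rewrite ?d0 ?eqxx.
  have cB := @compact_en_ball R n.+2 0 d; apply: (subclosed_compact _ cB); last first.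
    by move=> x [_ h] /=; rewrite subr0.
  have cl1 : closed [set x : V | x 0 ord0 <= 0] := closed_le_fun (a := 0) c0.
  have cl2 : closed [set x : V | - x 0 ord0 <= 0].
    by apply: closed_le_fun => x; exact: continuousN (c0 x).
  have cl3 : closed [set x : V | en (x - 0) <= d] by apply: closed_le_fun; exact: continuous_en.
  have := closedI (closedI cl1 cl2) cl3; congr closed; apply/seteqP; split=> x /=.
    by move=> [[h1 h2] h3]; rewrite subr0 in h3; split=> //; apply/eqP; rewrite eq_le h1 -oppr_le0 h2.
  by move=> [-> h]; rewrite subr0 oppr0 lexx.
set q := Num.sqrt `|delta|; have q0 : 0 < q by rewrite sqrtr_gt0 normr_gt0.
have q2 : q ^+ 2 = `|delta| by rewrite sqr_sqrtr.
(* All conditions become non-strict. The strict sign of [x 0 ord0] is recovered from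
   [1 - delta * d / 2 <= q * x 0 ord0] when [delta > 0], and from the equation of the hyperboloid
   when [delta < 0]. *)
have -> : M `&` [set x | sqd base x <= d] =
    [set x : V | [/\ delta * ip x x = 1, 1 - delta * d / 2 <= q * x 0 ord0 \/ delta < 0,
       0 <= x 0 ord0 & (q * x 0 ord0 <= 1 - delta * d / 2 \/ 0 < delta)]].
  have E x : M x -> sqd base x <= d <-> (delta < 0 /\ q * x 0 ord0 <= 1 - delta * d / 2) \/ (0 < delta /\ 1 - delta * d / 2 <= q * x 0 ord0).
    move=> Mx; rewrite /q -(psi_base Mx d0) (psi_sqd Mb Mx).
    by have [h|h|h] := ltgtP delta 0; last (by rewrite h eqxx in d0); split; [move=> ?; left; nra|case=> -[? ?] //; nra|move=> ?; right; nra|case=> -[? ?] //; nra].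
  apply/seteqP; split=> x /=.
    move=> [Mx /(E _ Mx) h]; split; [exact: M_ip1 | | exact: ltW (M_pos Mx d0) |].
      by case: h => -[h1 h2]; [right | left].
    by case: h => -[h1 h2]; [left | right].
  move=> [h1 h2 h3 h4]; have Mx : M x.
    apply: M_intro => // [h|_]; first by rewrite h eqxx in d0.
    rewrite lt_neqAle h3 andbT eq_sym; apply/eqP => x0.
    case: h2 => [|dn]; first by rewrite x0 mulr0; lra.
    move: h1; rewrite ipE x0 mul0r mulr0 add0r -/(en _) => h1.
    have := en_ge0 (tl x); nra.
  split=> //; apply/(E _ Mx).
  have [h|h|h] := ltgtP delta 0; last by rewrite h eqxx in d0.
    by left; split=> //; case: h4 => // h5; have := lt_trans h h5; rewrite ltxx.
  by right; split=> //; case: h2 => // h5; have := lt_trans h h5; rewrite ltxx.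
have bnd (x : V) : delta * ip x x = 1 -> 0 <= x 0 ord0 -> (q * x 0 ord0 <= 1 - delta * d / 2 \/ 0 < delta) ->
    en x <= `|delta|^-1 + 2 * ((1 - delta * d / 2) / q) ^+ 2.
  have eE : en x = x 0 ord0 ^+ 2 + en (tl x).
    rewrite /en /dot big_ord_recl; congr (_ + _); apply: eq_bigr => i _; by rewrite !mxE.
  rewrite ipE -/(en _) => h1 h2 h3; rewrite eE.
  have := en_ge0 (tl x); set t := en _ in h1 *; move=> t0.
  have [h|h|h] := ltgtP delta 0; last by rewrite h eqxx in d0.
    have {}h3 : q * x 0 ord0 <= 1 - delta * d / 2 by case: h3 => // h5; have := lt_trans h h5; rewrite ltxx.
    have h5 : x 0 ord0 <= (1 - delta * d / 2) / q by rewrite ler_pdivlMr // mulrC.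
    move: h1; rewrite /eps h mulN1r => h1.
    have h6 : x 0 ord0 ^+ 2 <= ((1 - delta * d / 2) / q) ^+ 2 by rewrite ler_sqr ?nnegrE // (le_trans h2).
    have h7 : t <= x 0 ord0 ^+ 2 by rewrite expr2; nra.
    have : 0 < `|delta|^-1 by rewrite invr_gt0 normr_gt0.
    lra.
  move: h1; rewrite /eps ltNge (ltW h) /= mul1r -expr2 => h1.
  have -> : x 0 ord0 ^+ 2 + t = `|delta|^-1 by rewrite gtr0_norm // -[RHS]mulr1 -h1 mulKf.
  by rewrite lerDl mulr_ge0 // sqr_ge0.
have cB := @compact_en_ball R n.+2 0 (`|delta|^-1 + 2 * ((1 - delta * d / 2) / q) ^+ 2); apply: (subclosed_compact _ cB); last first.
  by move=> x [h1 _ h3 h4] /=; rewrite subr0; exact: bnd.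
have cst_ (a : R) (x : V) : {for x, continuous (fun _ : V => a)} by exact: D1_cont (D1_cst a x).
have cl1 : closed [set x : V | delta * ip x x - 1 <= 0].
  by apply: closed_le_fun => x; exact: (continuousB (continuousM (cst_ delta x) (cip x)) (cst_ 1 x)).
have cl2 : closed [set x : V | 1 - delta * ip x x <= 0].
  by apply: closed_le_fun => x; exact: (continuousB (cst_ 1 x) (continuousM (cst_ delta x) (cip x))).
have cl3 : closed [set x : V | - x 0 ord0 <= 0].
  by apply: closed_le_fun => x; exact: (continuousN (c0 x)).
have cT : closed [set: V] by exact: closedT.
have cl4 : closed [set x : V | 1 - delta * d / 2 <= q * x 0 ord0 \/ delta < 0].
  have [h|h] := ltP delta 0; first by rewrite (_ : [set x : V | _] = setT) //; apply/seteqP; split=> x // _; right.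
  have cl : closed [set x : V | 1 - delta * d / 2 - q * x 0 ord0 <= 0].
    by apply: closed_le_fun => x; exact: (continuousB (cst_ _ x) (continuousM (cst_ q x) (c0 x))).
  by move: cl; congr closed; apply/seteqP; split=> x /=; rewrite subr_le0; [left | case].
have cl5 : closed [set x : V | q * x 0 ord0 <= 1 - delta * d / 2 \/ 0 < delta].
  have [h|h] := ltP 0 delta; first by rewrite (_ : [set x : V | _] = setT) //; apply/seteqP; split=> x // _; right.
  have cl : closed [set x : V | q * x 0 ord0 - (1 - delta * d / 2) <= 0].
    by apply: closed_le_fun => x; exact: (continuousB (continuousM (cst_ q x) (c0 x)) (cst_ _ x)).
  by move: cl; congr closed; apply/seteqP; split=> x /=; rewrite subr_le0; [left | case].
have := closedI (closedI (closedI cl1 cl2) cl3) (closedI cl4 cl5); congr closed; apply/seteqP; split=> x /=.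
  move=> [[[h1 h2] h3] [h4 h5]]; split=> //; last by rewrite -oppr_le0.
  by apply/eqP; rewrite eq_le -subr_le0 h1 -subr_le0 h2.
by move=> [h1 h2 h3 h4]; rewrite h1 subrr oppr_le0.
Qed.

End BasePoint.
End BasePoint.
Import BasePoint.

Lemma D1_cst_cont (R : realType) (T : topologicalType) (W : normedModType R) (a : W) (t : T) :
  {for t, continuous (fun _ : T => a)}.
Proof. exact: cst_continuous. Qed.
Arguments D1_cst_cont {R T W} a t.

Lemma conv_gt0 (R : realFieldType) (t a b : R) : 0 <= t <= 1 -> 0 < a -> 0 < b -> 0 < (1 - t) * a + t * b.
Proof. by move=> /andP[t0 t1] a0 b0; case: (ltgtP t 1) t1 => // [t1 _|-> _]; [nra | lra]. Qed.

(** * The two sides of [S] *)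

Section Sides.
Context (R : realType) (n : nat) (delta : R).
Notation V := 'rV[R]_n.+2.
Notation ip := (@lip R n delta).
Notation M := (@space_form R n delta).
Notation TM := (@TM R n delta).
Notation sqd := (@sqd R n delta).
Notation psi := (@psi R n delta).
Notation frame := (@frame R n delta).
Notation chart := (@chart R n delta).
Notation base := (@base R n delta).

Lemma cont_chart (p : V) E N (T : topologicalType) (a : T -> 'rV[R]_n) (b : T -> R) t : M p -> frame p E N ->
  {for t, continuous a} -> {for t, continuous b} -> 0 < 1 + delta * (en (a t) + b t ^+ 2) ->
  {for t, continuous (fun t => chart p E N (a t) (b t))}.
Proof.
move=> Mp fr ca cb h; rewrite -(slab_ip fr) in h.
have c1 : {for t, continuous (fun t => lin_comb E (a t))}.
  exact: (continuous_comp ca (D1_cont (D1_blin (a t) (blin_lin_comb E)))).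
have c2 : {for t, continuous (fun t => slab p E N (a t) (b t))}.
  have c0 : {for t, continuous (fun _ : T => p)} := D1_cst_cont p t.
  have c01 : {for t, continuous (fun s => p + lin_comb E (a s))} := continuousD c0 c1.
  have c3 : {for t, continuous (fun s => b s *: N)} := cont_bil (bbil_scale V) cb (D1_cst_cont N t).
  exact: (continuousD c01 c3).
exact: (continuous_comp c2 (D1_cont (D1_Rh h))).
Qed.

Lemma near_chart (p : V) E N (ta th : R) : M p -> frame p E N -> 0 < ta -> 0 < th ->
  \forall z \near p, M z -> exists y s, [/\ en y < ta, `|s| < th & z = chart p E N y s].
Proof.
move=> Mp fr ta0 th0.
have p0 : psi p p != 0 by rewrite psi_pp oner_neq0.
have h2 : \forall y \near p, 0 < psi p y.
  by apply: (cvgr_gt _ (cont_psi (x := p))); rewrite psi_pp.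
have lz : lg delta p p = 0 by rewrite /lg psi_pp invr1 scale1r subrr.
have c1 := cont_ip (delta := delta) (cont_lg p0) (cont_lg p0).
have h3 : \forall y \near p, ip (lg delta p y) (lg delta p y) < Num.min ta (th ^+ 2).
  by apply: (cvgr_lt _ c1); rewrite lz ip0l lt_min ta0 exprn_gt0.
apply: (@filterS2 _ (nbhs p) _ _ _ _ _ h2 h3) => z pz hz Mz.
have Tl : TM p (lg delta p z) by apply: lg_TM => //; rewrite gt_eqF.
have [Vl dl] := Tl; have E1 := frame_expand Mp fr Vl.
rewrite [ip _ p]ipC dl scale0r addr0 in E1.
pose y : 'rV[R]_n := \row_i ip (lg delta p z) (E i); pose s := ip (lg delta p z) N.
have E2 : lg delta p z = lin_comb E y + s *: N.
  by rewrite {1}E1; congr (_ + _); apply: eq_bigr => i _; rewrite mxE.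
move: hz; rewrite E2 (slab_tan_ip fr) lt_min => /andP[hy hs].
exists y, s; split.
- by have := sqr_ge0 s; lra.
- rewrite -ltr_sqr ?nnegrE ?(ltW th0) // real_normK ?num_real //; have := en_ge0 y; lra.
by rewrite (chart_rho fr) -E2 lgK.
Qed.

Lemma chart_near (p : V) E N (P : V -> Prop) : M p -> frame p E N -> (\forall z \near p, P z) ->
  exists2 th : R, 0 < th & forall y s, en y < th -> `|s| < th -> P (chart p E N y s).
Proof.
move=> Mp fr nP; have cR : {for p, continuous (Rh delta p)} by exact: cont_Rh.
have h : nbhs (Rh delta p p) [set y | P y] by rewrite Rh_p.
have H : \forall Y \near p, P (Rh delta p Y) := cR _ h.
by have [th th0 Hth] := near_slab E N H; exists th.
Qed.

Lemma arc_curve (p v : V) : M p -> TM p v -> ip v v = 1 -> curve_through M p v (arc delta p v 1).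
Proof.
move=> Mp Tv vv; split; [exact: smooth_arc | | exact: arc0 |]; last first.
  by have [_ h] := is_derive_arc delta p v 1 0; rewrite derive1E h arc0 scale1r.
have [d0|d0] := eqVneq delta 0.
  by apply: (@filterE _ (nbhs (0 : R))) => t /=; apply: M_arc => //; right.
have ca : {for (0 : R), continuous (fun t => arc delta p v 1 t 0 ord0)}.
  exact: (continuous_comp (cont_arc (t := 0)) (@coord_continuous _ _ _ _ _ _)).
have h : \forall t \near (0 : R), 0 < arc delta p v 1 t 0 ord0.
  by apply: (cvgr_gt _ ca); rewrite arc0; exact: (M_pos Mp d0).
by apply: (@filterS _ (nbhs (0 : R)) _ _ _ _ h) => t /= h1; apply: M_arc => //; left.
Qed.

(** The geodesic issued from [p] along the normal is the vertical axis of the chart: its height is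
    the tangent [s = sn t / cs t], for which [1 + delta * s ^+ 2 = (cs t)^-2]. *)
Lemma arc_chart (p : V) E N sig th : sig = 1 \/ sig = -1 -> M p -> frame p E N -> 0 < th ->
  exists2 d : R, 0 < d & forall t, 0 < t < d -> exists2 s, 0 < s < th &
    arc delta p (sig *: N) 1 t = chart p E N 0 (sig * s).
Proof.
move=> hsig Mp fr th0.
have cc : {for (0 : R), continuous (cs delta)}.
  by have [h _] := is_derive_cs delta 0; apply/differentiable_continuous/derivable1_diffP.
have c_s : {for (0 : R), continuous (sn delta)}.
  by have [h _] := is_derive_sn delta 0; apply/differentiable_continuous/derivable1_diffP.
have h1 : \forall t \near (0 : R), 2^-1 < cs delta t.
  by apply: (cvgr_gt _ cc); rewrite cs0; lra.
have h2 : \forall t \near (0 : R), sn delta t < th / 2.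
  by apply: (cvgr_lt _ c_s); rewrite sn0 divr_gt0.
have p1 : 0 < 1 * cs delta 0 by rewrite cs0 mulr1.
have [d1 d10 H1] := deriv_pos (D1_real (is_derive_sn delta 0)) p1.
have /nbhs_normP[d2 /= d20 H2] := near_and h1 h2.
exists (Num.min d1 d2); first by rewrite lt_min d10.
move=> t /andP[t0]; rewrite lt_min => /andP[td1 td2].
have := H1 t; rewrite t0 td1 sn0 => /(_ isT) s0.
have [|c1 s1] := H2 t; first by rewrite /= sub0r normrN gtr0_norm.
have c0 : 0 < cs delta t by lra.
exists (sn delta t / cs delta t).
  by rewrite divr_gt0 //= ltr_pdivrMr //; nra.
have s2 : sig ^+ 2 = 1 by case: hsig => ->; ring.
rewrite (chart_rho fr) /SpaceForm.rho (slab_tan_ip fr) en0 add0r exprMn s2 mul1r.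
have -> : 1 + delta * (sn delta t / cs delta t) ^+ 2 = (cs delta t)^-1 ^+ 2.
  have cn0 : cs delta t != 0 by rewrite gt_eqF.
  by transitivity ((cs delta t ^+ 2 + delta * sn delta t ^+ 2) / cs delta t ^+ 2); [field | rewrite cs_sn; field].
rewrite sqrtr_sqr ger0_norm ?invr_ge0 ?(ltW c0) // invrK /arc mul1r.
rewrite /lin_comb big1 ?add0r => [|i _]; last by rewrite mxE scale0r.
rewrite scalerDr !scalerA; congr (_ + _ *: _); field; by rewrite gt_eqF.
Qed.

Variables (S : set V) (k : V -> 'I_n -> R) (Nf : V -> V -> V) (ef : V -> 'I_n -> V).
Hypotheses (S_hyp : embedded_hypersurface delta S)
  (hS : forall p, S p -> curvature_data delta S k p (Nf p) (ef p))
  (cS : compact S) (S0 : S !=set0) (S_conn : connected S).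
Notation Om := (bounded_domain delta S).
Definition Kd : set V := [set x | Om x \/ S x].
Let SM : S `<=` M := fun x Sx => S_M S_hyp Sx.

Lemma base_bound : exists d, [/\ forall s, S s -> sqd base s <= d, delta * d < 2 & exists2 s, S s & sqd base s = d].
Proof.
have [s Ss Hs] := cmax S0 cS (@cont_sqd _ _ delta base); exists (sqd base s); split=> //; last by exists s.
have Ms := SM Ss; have := psi_base_gt0 Ms; rewrite (psi_sqd (M_base n delta) Ms); lra.
Qed.

Lemma compact_Kd : compact Kd.
Proof.
have [d [Hd dd _]] := base_bound; have cB := @compact_base R n delta d dd.
have KB : Kd `<=` M `&` [set x | sqd base x <= d].
  move=> x [Ox|Sx]; last by split; [exact: SM | exact: Hd].
  split; first by case: Ox => -[].
  by apply: ltW; exact: (domain_sqd cS S0 SM (M_base n delta) Hd Ox).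
have cl : closed Kd; last by move: KB; apply: subclosed_compact.
move=> z Kz.
have [Mz _] : (M `&` [set x | sqd base x <= d]) z.
  have clB := compact_closed (@norm_hausdorff _ _) cB.
  by apply: clB; exact: closure_subset Kz.
have [Sz|Sz] := pselect (S z); [by right | left].
have [y [Ky [jy Sy]]] := Kz _ (near_and (near_joined cS Mz Sz) (near_notS cS Sz)).
case: Ky => // Oy; have My : M y by case: Oy => -[].
exact: (joined_domain (joined_sym (jy My)) Oy).
Qed.

Section Chart.
Variables (p : V) (E : 'I_n -> V) (N : V) (nu : V -> V) (kk : V -> 'I_n -> R) (ta th : R)
  (u : 'rV[R]_n -> R) (l : 'rV[R]_n -> 'rV[R]_n) (Q : 'rV[R]_n -> 'M[R]_n).
Hypotheses (Sp : S p) (fr : frame p E N) (g : graph_of delta S p E N nu kk ta th u l Q).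

(** Each side of the graph is connected off [S], hence entirely inside or outside the domain. The
    path goes vertically to the height [3 / 4 * th], up to the sign [sig], then horizontally to the
    axis; [|u| < th / 2] keeps the second part off the graph. *)
Lemma chart_side sig : sig = 1 \/ sig = -1 -> exists tb : R, [/\ 0 < tb, tb <= ta &
  forall y s, en y < tb -> `|s| < th -> 0 < sig * (s - u y) ->
   Om (chart p E N y s) <-> Om (chart p E N 0 (sig * (3 / 4 * th)))].
Proof.
move=> hsig; have th0 := graph_th g; have ta0 := graph_ta g.
have [_ cu] := graph_u g (y := 0) (eq_ind_r (fun x => x < ta) ta0 (en0 R n)).
have H : \forall y \near (0 : 'rV[R]_n), `|u y| < th / 2.
  have c2 : {for 0, continuous (fun y => `|u y|)} := continuous_comp cu (@norm_continuous _ _ _).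
  by apply: (cvgr_lt _ c2); rewrite (graph_u0 g) normr0 divr_gt0.
have [tc tc0 Hc] := (nbhs_en 0 _).1 H.
exists (Num.min tc ta); split; [by rewrite lt_min tc0 | by rewrite ge_min lexx orbT |].
move=> y s; rewrite lt_min => /andP[yc ya] hs hsu.
have SMp := SM Sp.
set h := sig * (3 / 4 * th).
have s1 : `|sig| = 1 by case: hsig => ->; rewrite ?normrN normr1.
have h34 : 0 < 3 / 4 * th by lra.
have hh : `|h| < th by rewrite /h normrM s1 mul1r (gtr0_norm h34); lra.
have uy z : en z <= en y -> `|u z| < th / 2.
  by move=> hz; apply: Hc; rewrite subr0; exact: le_lt_trans hz yc.
have hu z : en z <= en y -> 0 < sig * (h - u z).
  move=> /uy; rewrite /h ltr_norml => /andP[h1 h2]; case: hsig => ->; lra.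
have j1 : joined delta S (chart p E N y s) (chart p E N y h).
  pose w (t : R) := (1 - t) * s + t * h.
  have w0 : s = w 0 by rewrite /w; ring.
  have w1 : h = w 1 by rewrite /w; ring.
  have wt t : 0 <= t <= 1 -> `|w t| < th /\ 0 < sig * (w t - u y).
    move=> /andP[t0 t1]; have := hu y (lexx _); move: hs hh; rewrite !ltr_norml /w => /andP[? ?] /andP[? ?] hz.
    have t01 : 0 <= t <= 1 by rewrite t0.
    split; last first.
      have -> : sig * ((1 - t) * s + t * h - u y) = (1 - t) * (sig * (s - u y)) + t * (sig * (h - u y)) by ring.
      exact: conv_gt0.
    apply/andP; split; rewrite -subr_gt0.
      by rewrite (_ : _ - _ = (1 - t) * (s + th) + t * (h + th)); [apply: conv_gt0 => //; lra | ring].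
    by rewrite (_ : _ - _ = (1 - t) * (th - s) + t * (th - h)); [apply: conv_gt0 => //; lra | ring].
  rewrite w0 w1; apply: (joined_path (g := fun t => chart p E N y (w t))) => t ht; have [wa wb] := wt t ht.
    apply: (cont_chart (a := fun=> y) SMp fr (D1_cst_cont y t)); last by have [] := graph_M g ya wa.
    have d1 := continuousB (D1_cst_cont (1 : R) t) (@cvg_id _ (nbhs t)).
    exact: (continuousD (continuousM d1 (D1_cst_cont s t)) (continuousM (@cvg_id _ (nbhs t)) (D1_cst_cont h t))).
  split; first by have [] := graph_M g ya wa.
  by move=> /(graph_S g ya wa) wE; move: wb; rewrite wE subrr mulr0 ltxx.
have j2 : joined delta S (chart p E N y h) (chart p E N 0 h).
  pose z (t : R) := (1 - t) *: y.
  have z0 : y = z 0 by rewrite /z subr0 scale1r.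
  have z1 : 0 = z 1 by rewrite /z subrr scale0r.
  have zt t : 0 <= t <= 1 -> en (z t) <= en y.
    move=> /andP[t0 t1]; rewrite /z enZ ler_piMl ?en_ge0 // expr_le1 //; lra.
  rewrite {1}z0 z1; apply: (joined_path (g := fun t => chart p E N (z t) h)) => t ht; have zz := zt t ht;
    have za := le_lt_trans zz ya.
    apply: (cont_chart (b := fun=> h) SMp fr _ (D1_cst_cont h t)); last by have [] := graph_M g za hh.
    have d1 := continuousB (D1_cst_cont (1 : R) t) (@cvg_id _ (nbhs t)).
    exact: (cont_bil (bbil_scale _) d1 (D1_cst_cont y t)).
  split; first by have [] := graph_M g za hh.
  by move=> /(graph_S g za hh) wE; have := hu _ zz; rewrite wE subrr mulr0 ltxx.
split=> o; first exact: (joined_domain j2 (joined_domain j1 o)).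
exact: (joined_domain (joined_sym j1) (joined_domain (joined_sym j2) o)).
Qed.

End Chart.

Section InnerChart.
Variables (p : V) (E : 'I_n -> V) (nu : V -> V) (kk : V -> 'I_n -> R) (ta th : R)
  (u : 'rV[R]_n -> R) (l : 'rV[R]_n -> 'rV[R]_n) (Q : 'rV[R]_n -> 'M[R]_n).
Hypotheses (Sp : S p) (fr : frame p E (Nf p p))
  (g : graph_of delta S p E (Nf p p) nu kk ta th u l Q).
Let N := Nf p p.

(** The definition of an inner normal is applied to the geodesic arc, whose points lie on the chosen
    side of the chart; [chart_side] does the rest. *)
Lemma inner_side sig : sig = 1 \/ sig = -1 -> inner_unit_normal delta S p (sig *: N) ->
  Om (chart p E N 0 (sig * (3 / 4 * th))).
Proof.
move=> hsig [Tv vv _ Hc]; have Mp := SM Sp.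
have th0 := graph_th g; have [tb [tb0 tba Hb]] := chart_side Sp fr g hsig.
have Tv' : TM p (sig *: N) by apply/tangentP.
rewrite lipE in vv; have Ho := Hc _ (arc_curve Mp Tv' vv).
have [d d0 Hd] := arc_chart hsig Mp fr th0.
have hd : \forall t \near (0 : R)^'+, 0 < t < d.
  by near=> t; apply/andP; split; near: t; [exact: nbhs_right_gt | exact: nbhs_right_lt].
have [t [ht Ot]] : exists t, 0 < t < d /\ Om (arc delta p (sig *: N) 1 t).
  by apply: (@filter_ex _ (0 : R)^'+); near=> t; split; near: t; [exact: hd | exact: Ho].
have [s hs Es] := Hd t ht; rewrite Es in Ot.
have s2 : sig * sig = 1 by case: hsig => ->; ring.
apply/(Hb 0 (sig * s)) => //; first by rewrite en0.
  by rewrite normrM; case: hsig => ->; rewrite ?normrN normr1 mul1r ger0_norm; lra.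
by rewrite (graph_u0 g) subr0 mulrA s2 mul1r; case/andP: hs.
Unshelve. all: by end_near. Qed.

Lemma inner_upper : Om (chart p E N 0 (1 * (3 / 4 * th))).
Proof. by apply: inner_side; [left | rewrite scale1r; exact: (inner_Nf hS Sp)]. Qed.

End InnerChart.

(** The lower side of the graph must be shown to be outside. At the point of [S] farthest from
    [base], any farther point is outside by [domain_sqd]; the property is open and closed in [S]
    because each side of a chart is all in or all out. *)
Lemma not_interior p : S p -> ~ (\forall z \near p, M z -> Kd z).
Proof.
move=> Sp; move: p Sp; apply: (conn_ind (P := fun p => ~ (\forall z \near p, M z -> Kd z)) S_conn).
- have [d [Hd dd [s Ss sd]]] := base_bound; exists s => // H.
  have Mb := M_base n delta.
  have [sb|sb] := pselect (s = base).
    have fr := frame_Nf S_hyp hS Ss; have [ta [th [u [l [Q g]]]]] := local_graph S_hyp hS Ss fr.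
    have O1 := inner_upper Ss fr g; have := domain_sqd cS S0 SM Mb Hd O1.
    have d0 : d = 0 by rewrite -sd sb /SpaceForm.sqd subrr ip0l.
    by have [h1 _] := sqd_ge0 Mb (Om_M O1); rewrite d0 ltNge h1.
  have [y [My Ky]] := sqd_increase Mb (SM Ss) sb H.
  rewrite sd; case: (Ky My) => [Oy|Sy]; last by rewrite ltNge Hd.
  by rewrite ltNge (ltW (domain_sqd cS S0 SM Mb Hd Oy)).
- move=> p Sp nP; have fr := frame_Nf S_hyp hS Sp; have Mp := SM Sp.
  have [ta [th [u [l [Q g]]]]] := local_graph S_hyp hS Sp fr.
  have m1 : (-1 : R) = 1 \/ (-1 : R) = -1 by right.
  have [tb [tb0 tba Hb]] := chart_side Sp fr g m1.
  have th0 := graph_th g.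
  have nO : ~ Om (chart p (ef p) (Nf p p) 0 (-1 * (3 / 4 * th))).
    move=> O1; apply: nP.
    have p1 : (1 : R) = 1 \/ (1 : R) = -1 by left.
    have [tc [tc0 tca Hc]] := chart_side Sp fr g p1.
    have O2 := inner_upper Sp fr g.
    have t0 : 0 < Num.min tb tc by rewrite lt_min tb0.
    apply: (@filterS _ (nbhs p) _ _ _ _ (near_chart Mp fr t0 th0)) => z hz Mz.
    have [y [s [hy hs ->]]] := hz Mz; move: hy; rewrite lt_min => /andP[yb yc].
    have [h|h|h] := ltgtP s (u y).
    + by left; apply/(Hb y s) => //; rewrite mulN1r opprB subr_gt0.
    + by left; apply/(Hc y s) => //; rewrite mul1r subr_gt0.
    + by right; apply/(graph_S g (lt_le_trans yb tba) hs).
  apply: (@filterS _ (nbhs p) _ _ _ _ (near_chart Mp fr tb0 th0)) => z hz Sz HK.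
  have [y [s [yb hs zE]]] := hz (SM Sz).
  have ya := lt_le_trans yb tba.
  have sE : s = u y by apply/(graph_S g ya hs); rewrite -zE.
  have cc : {for s, continuous (fun t => chart p (ef p) (Nf p p) y t)}.
    by apply: (cont_chart (a := fun=> y) Mp fr (D1_cst_cont y s) (@cvg_id _ (nbhs s))); have [] := graph_M g ya hs.
  rewrite zE in HK; have /nbhs_normP[d /= d0 Hd] : nbhs s [set t | M (chart p (ef p) (Nf p p) y t) -> Kd (chart p (ef p) (Nf p p) y t)] := cc _ HK.
  (* A point slightly below the graph, still in the chart and close enough for [HK] to apply. *)
  pose e := Num.min d (s + th) / 2.
  have sth : 0 < s + th by move: hs; rewrite ltr_norml; lra.
  have e0 : 0 < e by rewrite divr_gt0 // lt_min d0.
  have [ed es] : e < d /\ e < s + th.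
    by have h1 := ge_min d d (s + th); have h2 := ge_min (s + th) d (s + th); move: h1 h2 e0; rewrite !lexx orbT /= /e; lra.
  have hs2 : `|s - e| < th by move: hs; rewrite !ltr_norml; lra.
  have [_ Me] := graph_M g ya hs2.
  have : Kd (chart p (ef p) (Nf p p) y (s - e)).
    by apply: Hd => //=; rewrite opprB addrCA subrr addr0 gtr0_norm.
  case=> [Oe|/(graph_S g ya hs2) eE]; last by move: e0 eE; rewrite -sE; lra.
  apply: nO; apply/(Hb y (s - e)) => //.
  by rewrite -sE mulN1r; lra.
- move=> p Sp nP; have H : \forall z \near p, M z -> Kd z by apply: contrapT.
  by apply: (@filterS _ (nbhs p) _ _ _ _ (near_near H)) => z hz _; exact.
Qed.

Lemma Om_chart p E nu kk ta th u l Q : S p -> frame p E (Nf p p) ->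
  graph_of delta S p E (Nf p p) nu kk ta th u l Q ->
  exists tb : R, [/\ 0 < tb, tb <= ta & forall y s, en y < tb -> `|s| < th ->
    Om (chart p E (Nf p p) y s) <-> u y < s].
Proof.
move=> Sp fr g; have Mp := SM Sp; have th0 := graph_th g.
have m1 : (-1 : R) = 1 \/ (-1 : R) = -1 by right.
have [tb [tb0 tba Hb]] := chart_side Sp fr g m1.
have p1 : (1 : R) = 1 \/ (1 : R) = -1 by left.
have [tc [tc0 tca Hc]] := chart_side Sp fr g p1.
have O2 := inner_upper Sp fr g.
have t0 : 0 < Num.min tb tc by rewrite lt_min tb0.
have nO : ~ Om (chart p E (Nf p p) 0 (-1 * (3 / 4 * th))).
  move=> O1; apply: (not_interior Sp).
  apply: (@filterS _ (nbhs p) _ _ _ _ (near_chart Mp fr t0 th0)) => z hz Mz.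
  have [y [s [hy hs ->]]] := hz Mz; move: hy; rewrite lt_min => /andP[yb yc].
  have [h|h|h] := ltgtP s (u y).
  + by left; apply/(Hb y s) => //; rewrite mulN1r opprB subr_gt0.
  + by left; apply/(Hc y s) => //; rewrite mul1r subr_gt0.
  + by right; apply/(graph_S g (lt_le_trans yb tba) hs).
exists (Num.min tb tc); split=> //; first by rewrite ge_min tba.
move=> y s; rewrite lt_min => /andP[yb yc] hs; have [h|h|h] := ltgtP s (u y).
- split=> // O1; exfalso; apply: nO; apply/(Hb y s) => //; by rewrite mulN1r opprB subr_gt0.
- by split=> // _; apply/(Hc y s) => //; rewrite mul1r subr_gt0.
split=> // O1; exfalso; case: O1 => -[_ Sx] _; apply: Sx.
by apply/(graph_S g (lt_le_trans yb tba) hs).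
Qed.

(** By [inner_pm] the only rival is the opposite vector, and [inner_side] would then put the lower
    side of the graph into the domain. *)
Lemma inner_unique p v : S p -> inner_unit_normal delta S p v -> v = Nf p p.
Proof.
move=> Sp hv; have [E1 E2] := inner_pm S_hyp hS Sp (inner_Nf hS Sp) hv.
have fr := frame_Nf S_hyp hS Sp; have [ta [th [u [l [Q g]]]]] := local_graph S_hyp hS Sp fr.
have [tb [tb0 tba Hb]] := Om_chart Sp fr g; have th0 := graph_th g.
move: E2 => /eqP; rewrite sqrf_eq1 => /orP[/eqP E2|/eqP E2]; first by rewrite E1 E2 scale1r.
have m1 : (-1 : R) = 1 \/ (-1 : R) = -1 by right.
rewrite E1 E2 in hv; have := inner_side Sp fr g m1 hv.
have h1 : en (0 : 'rV[R]_n) < tb by rewrite en0.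
have h2 : `|-1 * (3 / 4 * th)| < th by rewrite mulN1r normrN gtr0_norm; lra.
move=> /(Hb _ _ h1 h2); rewrite (graph_u0 g) mulN1r oppr_gt0 ltNge (_ : 0 <= 3 / 4 * th) //; lra.
Qed.

Lemma Nf_near p : S p -> \forall x \near p, S x -> Nf p x = Nf x x.
Proof.
move=> Sp; have [_ h _ _ _] := hS Sp.
by apply: (@filterS _ (nbhs p) _ _ _ _ h) => x hx Sx; exact: inner_unique (hx Sx).
Qed.

End Sides.

(** * Continuity of symmetric functions, and paths in the Garding cone *)

Section EspContinuity.
Context (R : realType) (T : topologicalType) (t : T).

Lemma cont_prod (I : Type) (s : seq I) (f : I -> T -> R) :
  (forall i, {for t, continuous (f i)}) -> {for t, continuous (fun x => \prod_(i <- s) f i x)}.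
Proof.
move=> h; elim: s => [|i s IH].
  apply: (@cont_near _ _ _ (fun=> 1 : R)); last exact: cst_continuous.
  by apply: (@filterE _ (nbhs t)) => x; rewrite big_nil.
apply: (@cont_near _ _ _ (fun x => f i x * \prod_(j <- s) f j x)); last exact: (continuousM (h i) IH).
by apply: (@filterE _ (nbhs t)) => x; rewrite big_cons.
Qed.

Definition pcont (F : T -> {poly R}) := forall j, {for t, continuous (fun s => (F s)`_j)}.

Lemma pcont_sum (I : finType) (F : I -> T -> {poly R}) :
  (forall i, pcont (F i)) -> pcont (fun s => \sum_i F i s).
Proof.
move=> h j; apply: (@cont_near _ _ _ (fun s => \sum_i (F i s)`_j)).
  by apply: (@filterE _ (nbhs t)) => x; rewrite coef_sum.
by apply: cont_sum => i; exact: h.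
Qed.

Lemma pcont_mul F G : pcont F -> pcont G -> pcont (fun s => F s * G s).
Proof.
move=> hF hG j; apply: (@cont_near _ _ _ (fun s => \sum_(i < j.+1) (F s)`_i * (G s)`_(j - i))).
  by apply: (@filterE _ (nbhs t)) => x; rewrite coefM.
by apply: cont_sum => i; exact: (continuousM (hF _) (hG _)).
Qed.

Lemma pcont_cst p : pcont (fun=> p). Proof. by move=> j; exact: cst_continuous. Qed.

Lemma pcont_prod (I : Type) (s : seq I) (F : I -> T -> {poly R}) :
  (forall i, pcont (F i)) -> pcont (fun x => \prod_(i <- s) F i x).
Proof.
move=> h; elim: s => [|i s IH] j.
  apply: (@cont_near _ _ _ (fun=> (1 : {poly R})`_j)); last exact: cst_continuous.
  by apply: (@filterE _ (nbhs t)) => x; rewrite big_nil.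
apply: (@cont_near _ _ _ (fun x => (F i x * \prod_(j <- s) F j x)`_j)); last exact: (pcont_mul (h i) IH).
by apply: (@filterE _ (nbhs t)) => x; rewrite big_cons.
Qed.

Lemma pcont_pencil n (g B : T -> 'M[R]_n) : (forall i j, {for t, continuous (fun s => g s i j)}) ->
  (forall i j, {for t, continuous (fun s => B s i j)}) -> pcont (fun s => \det (pencil (g s) (B s))).
Proof.
move=> hg hB j; rewrite /determinant; apply: pcont_sum => s; apply: pcont_mul; first exact: pcont_cst.
apply: pcont_prod => i k.
apply: (@cont_near _ _ _ (fun x => (k == 1%N)%:R * g x i (s i) + (k == 0%N)%:R * B x i (s i))).
  apply: (@filterE _ (nbhs t)) => x; rewrite mxE coefD coefXM !coefC.
  by case: k => [|[|k]] /=; rewrite ?mul0r ?mul1r ?add0r ?addr0.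
have c1 : {for t, continuous (fun x => (k == 1%N)%:R * g x i (s i))}.
  exact: (continuousM (D1_cst_cont ((k == 1%N)%:R : R) t) (hg _ _)).
have c2 : {for t, continuous (fun x => (k == 0%N)%:R * B x i (s i))}.
  exact: (continuousM (D1_cst_cont ((k == 0%N)%:R : R) t) (hB _ _)).
exact: (continuousD c1 c2).
Qed.

Lemma cont_esp n (kf : 'I_n -> T -> R) J m : (forall i, {for t, continuous (kf i)}) ->
  {for t, continuous (fun s => esp (fun i => kf i s) J m)}.
Proof.
move=> h; pose G (I : {set 'I_n}) s := if (I \subset J) && (#|I| == m) then \prod_(i <- enum I) kf i s else 0.
apply: (@cont_near _ _ _ (fun s => \sum_I G I s)).
  apply: (@filterE _ (nbhs t)) => x; rewrite /esp big_mkcond; apply: eq_bigr => I _.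
  by rewrite /G; case: ifP => // _; rewrite big_enum.
apply: cont_sum => I; rewrite /G; case: (_ && _); [exact: cont_prod | exact: cst_continuous].
Qed.

End EspContinuity.

Section GardingCone.
Context (R : realType) (n : nat).
Implicit Types k : 'I_n -> R.
Notation full := [set: 'I_n]%SET.

Lemma esp_ge0 (T : finType) (k : T -> R) J m : (forall i, 0 <= k i) -> 0 <= esp k J m.
Proof. by move=> h; apply: sumr_ge0 => I _; apply: prodr_ge0. Qed.

Lemma esp_gt0 (T : finType) (k : T -> R) (J : {set T}) m : (forall i, 0 < k i) -> (m <= #|J|)%N -> 0 < esp k J m.
Proof.
move=> h; elim: m J => [|m IH] J mJ; first by rewrite esp0.
have /card_gt0P[i iJ] : (0 < #|J|)%N by exact: leq_trans mJ.
rewrite (espS k m iJ) ltr_pwDl ?mulr_gt0 //; last by apply: esp_ge0 => j; exact: ltW.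
by apply: IH; move: mJ; rewrite (cardsD1 i) iJ.
Qed.

Lemma pos_gcone r k : (r <= n)%N -> (forall i, 0 < k i) -> gcone r full k.
Proof.
move=> rn h I IJ Ir; apply: esp_gt0 => //.
by rewrite finset.setTD; have := finset.cardsC I; rewrite card_ord; lia.
Qed.

Lemma coef_XDt (t : R) i : 0 < t ->
  (forall j, (j <= i)%N -> 0 < (('X + t%:P) ^+ i)`_j) /\ (forall j, (i < j)%N -> (('X + t%:P) ^+ i)`_j = 0).
Proof.
move=> t0; elim: i => [|i [h1 h2]].
  by rewrite expr0; split=> [[|j] //|[|j] // _]; rewrite coef1 // ltr01.
have E j : (('X + t%:P) ^+ i.+1)`_j = (if j is j'.+1 then (('X + t%:P) ^+ i)`_j' else 0) + t * (('X + t%:P) ^+ i)`_j.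
  by rewrite exprS mulrDl coefD coefXM coefCM; case: j.
split=> [[|j] ji|[|j] // ij]; rewrite E.
- by rewrite add0r mulr_gt0 // h1.
- have [ij|ij] := leqP j.+1 i; last by rewrite (h2 j.+1) // mulr0 addr0 h1.
  by rewrite addr_gt0 ?mulr_gt0 // h1 // ltnW.
by rewrite !h2 ?mulr0 ?addr0 // ltnW.
Qed.

(** Adding [t] to every [k i] composes the polynomial [p], product of the ['X + k i], with ['X + t].
    The coefficient of degree [n - m] is then a sum of nonnegative terms, and the leading
    coefficient of [p] contributes a positive one. *)
Lemma esp_shift k (t : R) m : (m <= n)%N -> (forall j, (j <= m)%N -> 0 <= esp k full j) -> 0 < t ->
  0 < esp (fun i => k i + t) full m.
Proof.
move=> mn hk t0.
have coefk (kk : 'I_n -> R) j : (\prod_(i in full) ('X + (kk i)%:P))`_j = if (j <= n)%N then esp kk full (n - j) else 0.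
  by rewrite coef_prod_XDC cardsT card_ord.
pose p := \prod_(i in full) ('X + (k i)%:P).
have pE : \prod_(i in full) ('X + (k i + t)%:P) = p \Po ('X + t%:P).
  rewrite rmorph_prod /=; apply: eq_bigr => i _.
  by rewrite comp_polyD comp_polyX comp_polyC polyCD -addrA [t%:P + _]addrC.
have := coefk (fun i => k i + t) (n - m)%N; rewrite leq_subr subKn // => <-.
rewrite pE coef_comp_poly.
have [hp hz] : (forall i, (i <= n)%N -> 0 < (('X + t%:P) ^+ i)`_(n-m) \/ (i < n - m)%N) /\ True.
  by split=> // i _; case: (leqP (n - m) i) => h; [left; have [h1 _] := coef_XDt i t0; exact: h1 | right].
have pn : p`_n = 1 by rewrite coefk leqnn subnn esp0.
have sp : (n < size p)%N.
  by rewrite ltnNge; apply/negP => h; move: pn; rewrite nth_default // => /eqP; rewrite eq_sym oner_eq0.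
have nonneg i : 0 <= p`_i * (('X + t%:P) ^+ i)`_(n - m).
  have [im|im] := leqP (n - m) i; last first.
    by have [_ ->] := coef_XDt i t0; rewrite ?mulr0.
  apply: mulr_ge0; last by have [h1 _] := coef_XDt i t0; rewrite ltW // h1.
  by rewrite coefk; case: leqP => // ni; apply: hk; lia.
rewrite (bigD1 (Ordinal sp)) //= ltr_pwDl //; last by apply: sumr_ge0.
by rewrite pn mul1r; have [h1 _] := coef_XDt n t0; rewrite h1 // leq_subr.
Qed.

(* Along the segment from [k] to [k + B], the value of [esp k r] stays positive,
   so that the path cannot leave the open cone. *)
Lemma gcone_of_nonneg r k : (r <= n)%N -> (forall m, (m <= r)%N -> 0 <= esp k full m) ->
  0 < esp k full r -> gcone r full k.
Proof.
move=> rn hk hr; pose B := 1 + \sum_i `|k i|.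
have B0 : 0 < B by rewrite ltr_pwDl ?ltr01 // sumr_ge0.
pose kt (t : R) := fun i => k i + t.
have ckt J m (t : R) : {for t, continuous (fun s => esp (kt s) J m)}.
  apply: (cont_esp (kf := fun i s => k i + s)) => i.
  exact: (continuousD (D1_cst_cont (k i) t) (@cvg_id _ (nbhs t))).
have hrt (t : R) : 0 <= t -> 0 < esp (kt t) full r.
  rewrite le_eqVlt => /orP[/eqP <-|t0]; last by apply: esp_shift => // m mr; exact: hk.
  by rewrite (_ : kt 0 = k) //; apply/funext => i; rewrite /kt addr0.
have : gcone r full (kt 0).
  apply: (conn_ind (P := fun t => gcone r full (kt t)) (@segment_connected R 0 B)).
  - exists B; first by rewrite /= in_itv /= lexx ltW.
    apply: pos_gcone => // i; rewrite /kt /B (bigD1 i) //=.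
    have h1 : 0 <= \sum_(j | j != i) `|k j| by apply: sumr_ge0.
    have := ler_norm (- k i); rewrite normrN; lra.
  - move=> t _ gt.
    have H : \forall s \near t, forall I : {set 'I_n}, I \in enum {set 'I_n} -> (#|I| <= r)%N -> 0 < esp (kt s) (full :\: I) (r - #|I|).
      elim: (enum _) => [|I l IH]; first by apply: (@filterE _ (nbhs t)).
      have [Ir|Ir] := boolP (#|I| <= r)%N; last first.
        apply: (@filterS _ (nbhs t) _ _ _ _ IH) => s hs J; rewrite inE => /orP[/eqP ->|]; last exact: hs.
        by move=> Ir'; rewrite Ir' in Ir.
      have h : \forall s \near t, 0 < esp (kt s) (full :\: I) (r - #|I|).
        by apply: (cvgr_gt _ (ckt _ _ t)); apply: gt => //; exact: subsetT.
      apply: (@filterS2 _ (nbhs t) _ _ _ _ _ IH h) => s hs h' J; rewrite inE => /orP[/eqP -> //|]; exact: hs.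
    by apply: (@filterS _ (nbhs t) _ _ _ _ H) => s hs _ I _ Ir; apply: hs => //; rewrite mem_enum.
  - move=> t; rewrite /= in_itv /= => /andP[t0 _] ng.
    have [I [Ir I0]] : exists I : {set 'I_n}, (#|I| <= r)%N /\ esp (kt t) (full :\: I) (r - #|I|) < 0.
      apply: contrapT => h; apply: ng; apply: gcone_cl_gt0; last exact: hrt.
      by move=> I _ Ir; rewrite leNgt; apply/negP => h0; apply: h; exists I.
    have h : \forall s \near t, esp (kt s) (full :\: I) (r - #|I|) < 0.
      by apply: (cvgr_lt _ (ckt _ _ t)).
    apply: (@filterS _ (nbhs t) _ _ _ _ h) => s h' _ g; have := g I (finset.subsetT _) Ir.
    by rewrite ltNge ltW.
  - by rewrite /= in_itv /= lexx ltW.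
by rewrite (_ : kt 0 = k) //; apply/funext => i; rewrite /kt addr0.
Qed.

Lemma gcone_esp_le r k m : (r <= n)%N -> (m <= r)%N -> gcone r full k -> 0 < esp k full m.
Proof.
move=> rn mr g; apply: gcone_esp; move: mr rn g; elim: r => [|r IH]; first by case: m.
rewrite leq_eqVlt => /orP[/eqP -> //|mr] rn g; apply: IH => //; first exact: ltnW.
by apply: gconeW => //; rewrite cardsT card_ord.
Qed.

End GardingCone.

(** * Curvatures along [S] *)

Section LocalStructure.
Context (R : realType) (n : nat) (delta : R).
Notation V := 'rV[R]_n.+2.
Notation ip := (@lip R n delta).
Notation M := (@space_form R n delta).
Notation TM := (@TM R n delta).
Notation sqd := (@sqd R n delta).
Notation psi := (@psi R n delta).
Notation frame := (@frame R n delta).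
Notation chart := (@chart R n delta).
Notation base := (@base R n delta).

(** An exact variation formula in gnomonic coordinates. The factor [1 + m] combines with
    [1 - m ^+ 2 = delta * m ^+ 2 * <w, w>] to avoid dividing by [delta]. *)
Lemma sqd_rho c p w : M c -> M p -> TM p w -> 0 < 1 + delta * ip w w ->
  let m := (Num.sqrt (1 + delta * ip w w))^-1 in
  (1 + m) * (sqd c (rho delta p w) - sqd c p) = 2 * m * (m * ip w w * psi p c - (1 + m) * ip w (c - p)).
Proof.
move=> Mc Mp [_ pw] h m.
have m2 : m ^+ 2 * (1 + delta * ip w w) = 1.
  by rewrite /m exprVn sqr_sqrtr ?ltW // mulVf // gt_eqF.
rewrite /SpaceForm.sqd /SpaceForm.rho -/m.
have -> : ip (c - m *: (p + w)) (c - m *: (p + w)) =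
   ip c c - 2 * m * ip c p - 2 * m * ip w c + m ^+ 2 * (ip p p + 2 * ip p w + ip w w).
  by rewrite !ipL [ip p c]ipC [ip w p]ipC [ip c w]ipC; ring.
have -> : ip (c - p) (c - p) = ip c c - 2 * ip c p + ip p p by rewrite !ipL [ip p c]ipC; ring.
have -> : ip w (c - p) = ip w c - ip p w by rewrite !ipL [ip w p]ipC.
have [d0|d0] := eqVneq delta 0.
  have m1 : m = 1 by rewrite /m d0 mul0r addr0 sqrtr1 invr1.
  by rewrite psi_def d0 mul0r addr0 m1; ring.
have pw0 : ip p w = 0 by apply: (mulfI d0); rewrite mulr0.
have c1 : ip c c = delta^-1 by apply: (mulfI d0); rewrite (M_ip1 Mc d0) divff.
have p1 : ip p p = delta^-1 by apply: (mulfI d0); rewrite (M_ip1 Mp d0) divff.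
rewrite (psiE _ Mp) (negbTE d0) addr0 pw0 c1 p1.
have -> : m ^+ 2 * (delta^-1 + 2 * 0 + ip w w) = delta^-1.
  by apply: (mulfI d0); rewrite divff // -m2; field.
have E : m ^+ 2 * ip w w * delta = 1 - m ^+ 2 by rewrite -{1}m2; ring.
transitivity ((1 + m) * (2 * (1 - m) * ip c p - 2 * m * ip w c)); first by ring.
transitivity (2 * (m ^+ 2 * ip w w * delta) * ip c p - 2 * m * (1 + m) * ip w c); last by ring.
by rewrite E; ring.
Qed.

Variables (S : set V) (k : V -> 'I_n -> R) (Nf : V -> V -> V) (ef : V -> 'I_n -> V).
Hypotheses (S_hyp : embedded_hypersurface delta S)
  (hS : forall p, S p -> curvature_data delta S k p (Nf p) (ef p))
  (cS : compact S) (S0 : S !=set0) (S_conn : connected S).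
Notation Om := (bounded_domain delta S).
Let SM : S `<=` M := fun x Sx => S_M S_hyp Sx.

Definition grad_norm2 (y l : 'rV[R]_n) (s : R) := 1 + en l + delta * (dot y l - s) ^+ 2.
Definition scale_fac (y : 'rV[R]_n) (s : R) := (Num.sqrt (1 + delta * (en y + s ^+ 2)))^-1.

(** [graph_of] improved by [Om_chart] and [Nf_near]: the domain is the epigraph, each normal is the
    one chosen at its own point, and the signs [sg] are gone. *)
Record nice (p : V) (E : 'I_n -> V) (ta th : R)
    (u : 'rV[R]_n -> R) (l : 'rV[R]_n -> 'rV[R]_n) (Q : 'rV[R]_n -> 'M[R]_n) : Prop := {
  nice_ta : 0 < ta;
  nice_th : 0 < th;
  nice_M : forall y s, en y < ta -> `|s| < th ->
    0 < 1 + delta * (en y + s ^+ 2) /\ M (chart p E (Nf p p) y s);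
  nice_S : forall y s, en y < ta -> `|s| < th -> (S (chart p E (Nf p p) y s) <-> s = u y);
  nice_Om : forall y s, en y < ta -> `|s| < th -> (Om (chart p E (Nf p p) y s) <-> u y < s);
  nice_u : forall y, en y < ta -> `|u y| < th /\ {for y, continuous u};
  nice_T2 : forall y, en y < ta -> T2 u y (l y) (Q y);
  nice_nu : forall y, en y < ta -> let x := chart p E (Nf p p) y (u y) in
    0 < grad_norm2 y (l y) (u y) /\ Nf x x = (Num.sqrt (grad_norm2 y (l y) (u y)))^-1 *:
       (Nf p p - lin_comb E (l y) + (delta * (dot y (l y) - u y)) *: p);
  nice_P : forall y, en y < ta -> let m := scale_fac y (u y) in
    exists P : 'M[R]_n, P *m P^T = gmet delta m y (u y) (l y) /\
      P *m diag_mx (\row_i k (chart p E (Nf p p) y (u y)) i) *m P^T =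
        (m / Num.sqrt (grad_norm2 y (l y) (u y))) *: Q y;
  nice_u0 : u 0 = 0;
  nice_l0 : l 0 = 0;
  nice_Q0 : E = ef p -> Q 0 = diag_mx (\row_i k p i);
  nice_lc : forall i, {for 0, continuous (fun y => l y 0 i)};
  nice_Qc : forall i j, {for 0, continuous (fun y => Q y i j)} }.

Lemma nice_graph p E : S p -> frame p E (Nf p p) -> exists ta th u l Q, nice p E ta th u l Q.
Proof.
move=> Sp fr; have Mp := SM Sp.
have [ta [th [u [l [Q g]]]]] := local_graph S_hyp hS Sp fr.
have [tb [tb0 tba Hb]] := Om_chart S_hyp hS cS S0 S_conn Sp fr g.
have [tc tc0 Hc] := chart_near Mp fr (Nf_near S_hyp hS cS S0 S_conn Sp).
have e0 : en (0 : 'rV[R]_n) < ta by rewrite en0; exact: graph_ta g.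
have [_ cu] := graph_u g e0.
have H : \forall y \near (0 : 'rV[R]_n), `|u y| < tc.
  have c2 : {for 0, continuous (fun y => `|u y|)} := continuous_comp cu (@norm_continuous _ _ _).
  by apply: (cvgr_lt _ c2); rewrite (graph_u0 g) normr0.
have [td td0 Hd] := (nbhs_en 0 _).1 H.
pose tt := Num.min (Num.min tb tc) td.
have tt0 : 0 < tt by rewrite !lt_min tb0 tc0 td0.
have tE y : en y < tt -> [/\ en y < ta, en y < tb, en y < tc & `|u y| < tc].
  rewrite !lt_min => /andP[/andP[h1 h2] h3]; split=> //; first exact: lt_le_trans tba.
  by apply: Hd; rewrite subr0.
have hN y : en y < tt -> let x := chart p E (Nf p p) y (u y) in S x /\ Nf p x = Nf x x.
  move=> /tE [h1 h2 h3 h4] x; have Sx : S x by apply/(graph_S g h1) => //; have [] := graph_u g h1.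
  by split=> //; exact: Hc Sx.
exists tt, th, u, l, Q; split => //.
- exact: graph_th g.
- by move=> y s /tE [h1 _ _ _]; exact: (graph_M g).
- by move=> y s /tE [h1 _ _ _]; exact: (graph_S g).
- by move=> y s /tE [_ h1 _ _]; exact: Hb.
- by move=> y /tE [h1 _ _ _]; exact: (graph_u g).
- by move=> y /tE [h1 _ _ _]; exact: (graph_T2 g).
- move=> y hy /=; have [h1 _ _ _] := tE _ hy; have [_ h2] := hN _ hy.
  by have [h3 h4] := graph_nu g h1; rewrite -h2.
- move=> y hy /=; have [h1 _ _ _] := tE _ hy; have [Sx h2] := hN _ hy.
  have [P [P1 P2]] := graph_P g h1; exists P; split=> //; rewrite -P2; congr (_ *m diag_mx _ *m _).
  apply/rowP => i; rewrite !mxE /sg h2.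
  by have [_ _ _ _ ->] := frame_Nf S_hyp hS Sx; rewrite mul1r.
- exact: graph_u0 g.
- exact: graph_l0 g.
- move=> EE; apply/matrixP => i j; rewrite (graph_Q0 g) EE !mxE ipC (curvature_Nf S_hyp hS _ _ Sp).
  by rewrite opprK eq_sym; case: eqVneq => [->|]; rewrite ?mulr1 ?mulr0 ?mulr1n ?mulr0n.
- exact: (graph_lc g).
- exact: (graph_Qc g).
Qed.

Lemma nice_chart0 p E ta th u l Q : frame p E (Nf p p) -> nice p E ta th u l Q ->
  chart p E (Nf p p) 0 (u 0) = p.
Proof. by move=> fr g; rewrite (nice_u0 g) chart00. Qed.

Lemma cont_scale_fac (u : 'rV[R]_n -> R) : {for 0, continuous u} -> u 0 = 0 ->
  {for 0, continuous (fun y => scale_fac y (u y))}.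
Proof.
move=> cu u0.
have ce : {for 0, continuous (fun y : 'rV[R]_n => en y)} := continuous_dot (@cvg_id _ _) (@cvg_id _ _).
have c2 : {for 0, continuous (fun y : 'rV[R]_n => u y ^+ 2)} := continuousM cu cu.
have c3 : {for 0, continuous (fun y : 'rV[R]_n => en y + u y ^+ 2)} := continuousD ce c2.
have h : 0 < 1 + delta * (en (0 : 'rV[R]_n) + u 0 ^+ 2) by rewrite u0 en0 expr0n addr0 mulr0 addr0.
exact: (continuous_comp c3 (D1_cont (D1_rsqrt h))).
Qed.

Lemma cont_gmet (m u : 'rV[R]_n -> R) (l : 'rV[R]_n -> 'rV[R]_n) : {for 0, continuous m} ->
  {for 0, continuous u} -> (forall i, {for 0, continuous (fun y => l y 0 i)}) ->
  forall i j, {for 0, continuous (fun y => gmet delta (m y) y (u y) (l y) i j)}.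
Proof.
move=> cm cu cl i j.
have cc i' : {for (0 : 'rV[R]_n), continuous (fun y : 'rV[R]_n => y 0 i')} by exact: coord_continuous.
have c1 i' : {for 0, continuous (fun y : 'rV[R]_n => y 0 i' + u y * l y 0 i')}.
  exact: (continuousD (cc i') (continuousM cu (cl i'))).
have cm2 : {for 0, continuous (fun y : 'rV[R]_n => m y ^+ 2)} := continuousM cm cm.
have c2 : {for 0, continuous (fun y : 'rV[R]_n => delta * m y ^+ 2 * ((y 0 i + u y * l y 0 i) * (y 0 j + u y * l y 0 j)))}.
  exact: (continuousM (continuousM (D1_cst_cont delta (0 : 'rV[R]_n)) cm2) (continuousM (c1 i) (c1 j))).
have c3 : {for 0, continuous (fun y : 'rV[R]_n => (i == j)%:R + l y 0 i * l y 0 j)}.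
  exact: (continuousD (D1_cst_cont ((i == j)%:R : R) (0 : 'rV[R]_n)) (continuousM (cl i) (cl j))).
have c4 := continuousM cm2 (continuousB c3 c2).
by apply: cont_near c4; apply: (@filterE _ (nbhs (0 : 'rV[R]_n))) => y; rewrite mxE.
Qed.

Notation full := [set: 'I_n]%SET.

Lemma coef_prod_full (kk : 'I_n -> R) j :
  (\prod_i ('X + (kk i)%:P))`_j = if (j <= n)%N then esp kk full (n - j) else 0.
Proof.
have -> : \prod_i ('X + (kk i)%:P) = \prod_(i in full) ('X + (kk i)%:P).
  by apply: eq_bigl => i; rewrite finset.in_setT.
by rewrite coef_prod_XDC finset.cardsT card_ord.
Qed.

(** The list [k x] may be ordered differently at each point, but its symmetric functions are
    quotients of coefficients of the determinant of the pencil, whose entries are continuous at the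
    center of the chart. *)
Lemma esp_near p m (e : R) : S p -> 0 < e ->
  \forall x \near p, S x -> `|esp (k x) full m - esp (k p) full m| < e.
Proof.
move=> Sp e0; have [mn|mn] := leqP m n; last first.
  apply: (@filterE _ (nbhs p)) => x _; rewrite !esp_gt_card ?cardsT ?card_ord //.
  by rewrite subrr normr0.
have fr := frame_Nf S_hyp hS Sp; have [ta [th [u [l [Q g]]]]] := nice_graph Sp fr.
have e00 : en (0 : 'rV[R]_n) < ta by rewrite en0; exact: nice_ta g.
have [_ cu] := nice_u g e00.
pose mm (y : 'rV[R]_n) := scale_fac y (u y).
have cm : {for 0, continuous mm} := cont_scale_fac cu (nice_u0 g).
pose gg y := gmet delta (mm y) y (u y) (l y).
have cg : forall i j, {for 0, continuous (fun y => gg y i j)} := cont_gmet cm cu (nice_lc g).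
pose qq (y : 'rV[R]_n) := grad_norm2 y (l y) (u y).
have cq : {for 0, continuous (fun y => (Num.sqrt (qq y))^-1)}.
  have cl : {for 0, continuous (fun y => en (l y))}.
    have cli i : {for 0, continuous (fun y => l y 0 i)} by exact: (nice_lc g).
    have cl2 i : {for 0, continuous (fun y => l y 0 i * l y 0 i)} := continuousM (cli i) (cli i).
    exact: (cont_sum (f := fun i y => l y 0 i * l y 0 i)).
  have cc i' : {for (0 : 'rV[R]_n), continuous (fun y : 'rV[R]_n => y 0 i')} by exact: coord_continuous.
  have cd : {for 0, continuous (fun y => dot y (l y))}.
    have cli i : {for 0, continuous (fun y => l y 0 i)} by exact: (nice_lc g).
    have cl2 i : {for 0, continuous (fun y : 'rV[R]_n => y 0 i * l y 0 i)} := continuousM (cc i) (cli i).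
    exact: (cont_sum (f := fun i (y : 'rV[R]_n) => y 0 i * l y 0 i)).
  have cb : {for 0, continuous (fun y => dot y (l y) - u y)} := continuousB cd cu.
  have cz : {for 0, continuous (fun y => en (l y) + delta * ((dot y (l y) - u y) ^+ 2))}.
    exact: (continuousD cl (continuousM (D1_cst_cont delta (0 : 'rV[R]_n)) (continuousM cb cb))).
  have h : 0 < 1 + 1 * (en (l 0) + delta * ((dot 0 (l 0) - u 0) ^+ 2)).
    by rewrite (nice_l0 g) (nice_u0 g) en0 subr0 -/(en _) en0 expr0n mulr0 addr0 mulr0 addr0.
  have c5 := continuous_comp cz (D1_cont (D1_rsqrt h)).
  apply: cont_near c5; apply: (@filterE _ (nbhs (0 : 'rV[R]_n))) => y.
  by rewrite /qq /grad_norm2 /= mul1r addrA.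
pose BB y := (mm y / Num.sqrt (qq y)) *: Q y.
have cB i j : {for 0, continuous (fun y => BB y i j)}.
  have cQ : {for 0, continuous (fun y => Q y i j)} by exact: (nice_Qc g).
  have c := continuousM (continuousM cm cq) cQ.
  by apply: cont_near c; apply: (@filterE _ (nbhs (0 : 'rV[R]_n))) => y; rewrite mxE.
pose D y := (\det (pencil (gg y) (BB y)))`_n.
pose F y := (\det (pencil (gg y) (BB y)))`_(n - m) / D y.
have key y : en y < ta -> D y != 0 -> F y = esp (k (chart p (ef p) (Nf p p) y (u y))) full m.
  move=> hy; have [P [P1 P2]] := nice_P g hy.
  rewrite /F /D /gg /BB -P1 -P2 det_pencil_congr !coefCM.
  rewrite !coef_prod_full leq_subr leqnn subnn esp0 mulr1 subKn // => h.
  by rewrite mulrAC divff // mul1r.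
have D0 : D 0 = 1.
  have E1 : gg 0 = 1%:M *m 1%:M^T.
    rewrite trmx1 mulmx1; apply/matrixP => i j; rewrite /gg /mm !mxE (nice_u0 g) (nice_l0 g) !mxE.
    by rewrite /scale_fac en0 expr0n addr0 mulr0 addr0 sqrtr1 invr1; ring.
  have E2 : BB 0 = 1%:M *m diag_mx (\row_i k p i) *m 1%:M^T.
    rewrite trmx1 mulmx1 mul1mx /BB (nice_Q0 g erefl) /mm /qq /grad_norm2 /scale_fac (nice_u0 g) (nice_l0 g).
    rewrite !en0 expr0n addr0 mulr0 !addr0 /dot big1 => [|i _]; last by rewrite mxE mul0r.
    by rewrite subr0 expr0n mulr0 addr0 sqrtr1 invr1 mulr1 scale1r.
  by rewrite /D E1 E2 det_pencil_congr coefCM coef_prod_full leqnn subnn esp0 det1 expr1n mulr1.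
have cD : {for 0, continuous D} by exact: (pcont_pencil cg cB).
have D00 : D 0 != 0 by rewrite D0 oner_neq0.
have cF : {for 0, continuous F}.
  have ci : {for 0, continuous (fun y => (D y)^-1)}.
    by apply: (continuous_comp cD); exact: inv_continuous.
  have cN : {for 0, continuous (fun y => (\det (pencil (gg y) (BB y)))`_(n - m))} by exact: (pcont_pencil cg cB).
  exact: (continuousM cN ci).
have H1 : \forall y \near (0 : 'rV[R]_n), D y != 0.
  have h : \forall y \near (0 : 'rV[R]_n), 0 < D y by apply: (cvgr_gt _ cD); rewrite D0.
  by apply: (@filterS _ (nbhs (0 : 'rV[R]_n)) _ _ _ _ h) => y /lt0r_neq0.
have H2 : \forall y \near (0 : 'rV[R]_n), `|F y - F 0| < e.
  have c := continuousB cF (D1_cst_cont (F 0) (0 : 'rV[R]_n)).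
  have c2 : {for 0, continuous (fun y => `|F y - F 0|)} := continuous_comp c (@norm_continuous _ _ _).
  by apply: (cvgr_lt _ c2); rewrite subrr normr0.
have [tb tb0 Hb] := (nbhs_en 0 _).1 (near_and H1 H2).
have t0 : 0 < Num.min ta tb by rewrite lt_min (nice_ta g).
apply: (@filterS _ (nbhs p) _ _ _ _ (near_chart (SM Sp) fr t0 (nice_th g))) => x hx Sx.
have [y [s [hy hs xE]]] := hx (SM Sx); move: hy; rewrite lt_min => /andP[ya yb].
have sE : s = u y by apply/(nice_S g ya hs); rewrite -xE.
have [|h1 h2] := Hb y; first by rewrite subr0.
by have := h2; rewrite (key _ ya h1) (key _ e00 D00) (nice_chart0 fr g) -sE -xE.
Qed.

(* Comparison with the smallest geodesic ball containing [S] and centered at [base]. *)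
Lemma elliptic_point : exists2 p, S p & forall i, 0 < k p i.
Proof.
have [d [Hd dd [p Sp pd]]] := base_bound S_hyp cS S0; exists p => // i.
have Mb := M_base n delta; have Mp := SM Sp; have fr := frame_Nf S_hyp hS Sp.
have [ta [th [u [l [Q g]]]]] := nice_graph Sp fr.
set v := base - p; pose h := ip (Nf p p) v; pose c j := ip (ef p j) v.
have psi0 : 0 < psi p base by rewrite psiC //; exact: psi_base_gt0.
(* By [hm] the radial factor satisfies [m >= 1 / 2], so [m / (1 + m) >= 1 / 3] when the comparison
   of distances is solved for the height. *)
pose ka := psi p base / 3; have ka0 : 0 < ka by rewrite divr_gt0.
have hm : \forall Y \near p, delta * (ip Y Y - ip p p) < 3.
  have c1 := cont_ipxx (delta := delta) (x := p).
  have c2 : {for p, continuous (fun Y : V => delta * (ip Y Y - ip p p))}.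
    exact: (continuousM (D1_cst_cont delta p) (continuousB c1 (D1_cst_cont (ip p p) p))).
  by apply: (cvgr_lt _ c2); rewrite subrr mulr0.
have [tc tc0 Hc] := near_slab (ef p) (Nf p p) hm.
have key y s : en y < ta -> `|s| < th -> en y < tc -> `|s| < tc -> u y <= s ->
    ka * (en y + s ^+ 2) <= dot y (\row_j c j) + s * h.
  move=> ya hs yc hc us; have [M1 M2] := nice_M g ya hs.
  have le : sqd base (chart p (ef p) (Nf p p) y s) <= sqd base p.
    rewrite pd; move: us; rewrite le_eqVlt => /orP[/eqP us|us].
      by apply: Hd; apply/(nice_S g ya hs).
    by apply: ltW; apply: (domain_sqd cS S0 SM Mb Hd); apply/(nice_Om g ya hs).
  pose w := lin_comb (ef p) y + s *: Nf p p.
  have Tw : TM p w := TM_slab fr y s.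
  have ww : ip w w = en y + s ^+ 2 := slab_tan_ip fr y s.
  have wv : ip w v = dot y (\row_j c j) + s * h.
    rewrite /w ipDl ipZl ip_lin; congr (_ + _); apply: eq_bigr => j _; by rewrite mxE.
  have h4 := Hc y s yc hc; rewrite (slab_ip fr) in h4.
  have := sqd_rho Mb Mp Tw; rewrite ww => /(_ M1); rewrite -(chart_rho fr) /=.
  set m := (Num.sqrt _)^-1; rewrite -/v wv => eq1.
  have m0 : 0 < m by rewrite invr_gt0 sqrtr_gt0.
  have m12 : 2^-1 <= m.
    rewrite lef_pV2 ?posrE ?sqrtr_gt0 // -[X in _ <= X]ger0_norm // -sqrtr_sqr ler_wsqrtr //; lra.
  have e2 : 0 <= en y + s ^+ 2 by rewrite addr_ge0 ?en_ge0 ?sqr_ge0.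
  have h5 : m * (en y + s ^+ 2) * psi p base <= (1 + m) * (dot y (\row_j c j) + s * h).
    rewrite -subr_le0; move: le; rewrite -subr_le0 => le.
    have : 2 * m * (m * (en y + s ^+ 2) * psi p base - (1 + m) * (dot y (\row_j c j) + s * h)) <= 0.
      by rewrite -eq1 pmulr_rle0 //; lra.
    by rewrite pmulr_rle0 //; lra.
  rewrite -(ler_pM2l (_ : 0 < 1 + m)); last by lra.
  apply: le_trans h5; rewrite /ka; have := mulr_ge0 e2 (ltW psi0); nra.
have th0 := nice_th g; have ta0 := nice_ta g.
have h0 : 0 < h.
  pose s := Num.min th tc / 2; have mt : 0 < Num.min th tc by rewrite lt_min th0.
  have [s1 s2] : s < th /\ s < tc.
    by have h1 := ge_min th th tc; have h2 := ge_min tc th tc; move: h1 h2; rewrite !lexx orbT /= /s; lra.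
  have s0 : 0 < s by rewrite divr_gt0.
  have := key 0 s; rewrite en0 gtr0_norm // (nice_u0 g) => /(_ ta0 s1 tc0 s2 (ltW s0)).
  rewrite (_ : dot 0 _ = 0) ?add0r; last by rewrite /dot big1 // => j _; rewrite [X in X * _]mxE mul0r.
  by rewrite -(pmulr_rgt0 _ s0) => /(lt_le_trans _); apply; rewrite mulr_gt0 // exprn_gt0.
have e00 : en (0 : 'rV[R]_n) < ta by rewrite en0.
have ep0 : 0 < ka / (2 * h) by rewrite divr_gt0 // mulr_gt0.
have [d1 d10 Hd1] := nice_T2 g e00 ep0.
have [_ cu] := nice_u g e00.
have H : \forall y \near (0 : 'rV[R]_n), `|u y| < tc.
  have c2 : {for 0, continuous (fun y => `|u y|)} := continuous_comp cu (@norm_continuous _ _ _).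
  by apply: (cvgr_lt _ c2); rewrite (nice_u0 g) normr0.
have [td td0 Hd2] := (nbhs_en 0 _).1 H.
pose tm := Num.min (Num.min ta tc) (Num.min d1 td).
have tm0 : 0 < tm by rewrite !lt_min ta0 tc0 d10 td0.
pose t := Num.min 1 (tm / 2); have t0 : 0 < t by rewrite lt_min ltr01 divr_gt0.
have ey sg : sg ^+ 2 = 1 -> en ((sg * t) *: (delta_mx 0 i : 'rV[R]_n)) = t ^+ 2.
  move=> s1; rewrite enZ exprMn s1 mul1r /en /dot (bigD1 i) //= mxE !eqxx big1 ?addr0 ?mulr1 // => j ji.
  by rewrite mxE (negbTE ji) andbF mul0r.
have tt : t ^+ 2 < tm.
  have t1 : t <= 1 by rewrite ge_min lexx.
  have t2 : t <= tm / 2 by rewrite ge_min lexx orbT.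
  by rewrite expr2; nra.
have main sg : sg ^+ 2 = 1 -> ka * t ^+ 2 <= sg * t * c i + h * (2^-1 * k p i * t ^+ 2 + ka / (2 * h) * t ^+ 2).
  move=> s1; set y := (sg * t) *: (delta_mx 0 i : 'rV[R]_n).
  have := tt; rewrite -(ey sg s1) -/y !lt_min => /andP[/andP[ya yc] /andP[yd yt]].
  have uc : `|u y| < tc by apply: Hd2; rewrite subr0.
  have [uh _] := nice_u g ya.
  have k1 := key y (u y) ya uh yc uc (lexx _).
  have := Hd1 y yd; rewrite add0r (nice_u0 g) subr0 (nice_l0 g) (nice_Q0 g erefl).
  have -> : dot 0 y = 0 by rewrite /dot big1 // => j _; rewrite [X in X * _]mxE mul0r.
  rewrite subr0 ler_norml => /andP[_]; rewrite {2}/y quadZ -/y (ey sg s1).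
  have -> : quad (diag_mx (\row_j k p j)) (delta_mx 0 i : 'rV[R]_n) = k p i.
    by rewrite /quad -rowE mxE (bigD1 i) //= !mxE !eqxx mulr1n mulr1 big1 ?addr0 // => j ji; rewrite !mxE (negbTE ji) andbF mulr0.
  rewrite exprMn s1 mul1r => uy.
  have cy : dot y (\row_j c j) = sg * t * c i.
    rewrite /dot (bigD1 i) //= !mxE !eqxx mulr1 big1 ?addr0 // => j ji.
    by rewrite !mxE (negbTE ji) andbF mulr0 mul0r.
  rewrite cy in k1; have := sqr_ge0 (u y); have e1 : en y = t ^+ 2 := ey sg s1; rewrite e1 in k1.
  have : h * u y <= h * (2^-1 * k p i * t ^+ 2 + ka / (2 * h) * t ^+ 2) by rewrite ler_wpM2l ?(ltW h0) //; lra.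
  nra.
(* Adding the estimates at two opposite points cancels the linear term [c i] and leaves
   [ka <= h * k p i]. *)
have m1 := main 1 (expr1n _ _); have m2 := main (-1) (_ : (-1) ^+ 2 = 1).
have {}m2 : ka * t ^+ 2 <= -1 * t * c i + h * (2^-1 * k p i * t ^+ 2 + ka / (2 * h) * t ^+ 2) by apply: m2; ring.
have t2 : 0 < t ^+ 2 by rewrite exprn_gt0.
have hh : h * (ka / (2 * h)) = ka / 2 by field; rewrite gt_eqF.
have : 0 < t ^+ 2 * (h * k p i) by nra.
by rewrite pmulr_rgt0 // pmulr_rgt0.
Qed.

(** Turns the sides of [S] into signs of a function whose derivative along a tangent vector sees
    only the normal component. *)
Lemma defining_side p : S p -> exists f : V -> R,
  [/\ \forall x \near p, D1 f x (fun v => 'D_v f x), forall v, {for p, continuous (fun x => 'D_v f x)},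
      forall v, TM p v -> 'D_v f p = ip v (Nf p p) * 'D_(Nf p p) f p, 0 < 'D_(Nf p p) f p &
      \forall z \near p, M z -> (Om z <-> 0 < f z) /\ (S z <-> f z = 0)].
Proof.
move=> Sp; have Mp := SM Sp; have fr := frame_Nf S_hyp hS Sp.
have [f [sf cf fS fN [ta [th [u [l [Q [g gf]]]]]]]] := local_graph_side S_hyp hS Sp fr.
have [tb [tb0 tba Hb]] := Om_chart S_hyp hS cS S0 S_conn Sp fr g.
exists f; split=> //.
  move=> v [Vv dv]; have [bl _] := nbhs_singleton sf.
  have fe := nbhs_singleton (near_tangent_zero hS Sp sf fS) : S p -> forall i, 'D_(ef p i) f p = 0.
  have {}fe := fe Sp.
  rewrite {1}(frame_expand Mp fr Vv) [ip v p]ipC dv scale0r addr0.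
  rewrite (blin_add _ _ bl) (blin_scale _ _ bl) (blin_sum _ bl) big1 ?add0r // => i _.
  by rewrite (blin_scale _ _ bl) fe scaler0.
apply: (@filterS2 _ (nbhs p) _ _ _ _ _ fS (near_chart Mp fr tb0 (graph_th g))) => z h1 h2 Mz; split.
  have [y [s [yb hs ->]]] := h2 Mz; rewrite -(gf _ _ (lt_le_trans yb tba) hs); exact: Hb.
by rewrite h1; split=> [[]|].
Qed.

(** Propagation from [elliptic_point]. By [gcone_of_nonneg] the cone is cut out by signs of the full
    symmetric functions, which are continuous by [esp_near]; as [esp (k p) setT r] never vanishes, a
    point outside the cone has some strictly negative one, so the complement is open too. *)
Lemma gcone_S r : (0 < r <= n)%N -> (forall p, S p -> 0 < esp (k p) full r) ->
  forall p, S p -> gcone r full (k p).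
Proof.
move=> /andP[r0 rn] hr; apply: (conn_ind S_conn).
- by have [p Sp kp] := elliptic_point; exists p => //; exact: pos_gcone.
- move=> p Sp g.
  have H q : \forall x \near p, S x -> forall m, (m < q)%N -> (m <= r)%N -> 0 < esp (k x) full m.
    elim: q => [|q IH]; first by apply: (@filterE _ (nbhs p)).
    have [qr|qr] := leqP q r; last first.
      apply: (@filterS _ (nbhs p) _ _ _ _ IH) => x hx Sx m; rewrite ltnS leq_eqVlt => /orP[/eqP ->|]; last exact: hx.
      by rewrite leqNgt qr.
    have ep := gcone_esp_le rn qr g.
    apply: (@filterS2 _ (nbhs p) _ _ _ _ _ IH (esp_near q Sp ep)) => x hx h2 Sx m; rewrite ltnS leq_eqVlt => /orP[/eqP ->|]; last exact: hx.
    by move=> _; have := h2 Sx; rewrite ltr_norml => /andP[h3 _]; move: h3; rewrite ltrBrDr addNr.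
  apply: (@filterS _ (nbhs p) _ _ _ _ (H r.+1)) => x hx Sx; apply: gcone_of_nonneg => //; last exact: hr.
  by move=> m mr; apply: ltW; exact: hx.
move=> p Sp ng.
have [m [mr m0]] : exists m, (m <= r)%N /\ esp (k p) full m < 0.
  apply: contrapT => h; apply: ng; apply: gcone_of_nonneg => //; last exact: hr.
  by move=> m mr; rewrite leNgt; apply/negP => h0; apply: h; exists m.
have e0 : 0 < - esp (k p) full m by rewrite oppr_gt0.
apply: (@filterS _ (nbhs p) _ _ _ _ (esp_near m Sp e0)) => x hx Sx g.
have := hx Sx; rewrite ltr_norml => /andP[_]; rewrite ltrBlDr addNr => h1.
by have := gcone_esp_le rn mr g; rewrite ltNge (ltW h1).
Qed.

End LocalStructure.

(** * Reflections of the space form *)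

Module Reflections.
Section Reflection.
Context (R : realType) (n : nat) (delta : R).
Notation V := 'rV[R]_n.+2.
Notation ip := (@lip R n delta).
Notation M := (@space_form R n delta).
Notation TM := (@TM R n delta).
Notation V0 := (@V0 R n delta).
Notation sqd := (@sqd R n delta).
Notation psi := (@psi R n delta).
Notation rho := (@rho R n delta).
Notation chart := (@chart R n delta).
Variables (c w0 : V).
Hypotheses (Mc : M c) (Tw : TM c w0) (ww : ip w0 w0 = 1).

(* The hyperplanes orthogonal to the geodesic issued from [c] with velocity [w0]. *)
Definition wv (s : R) : V := w0 - (s * delta) *: c.
(** This is [<wv s, wv s>]. It is positive for all [s] if [0 <= delta], and for [delta < 0] exactly
    when [s *: w0] is the gnomonic coordinate of a point. *)
Definition qf (s : R) : R := 1 + delta * s ^+ 2.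
(** It vanishes on the hyperplane through [rho c (s *: w0)] ([ell_mid]), so [s] is the tangent of
    the distance rather than the distance. For [delta != 0] it is [ip x (wv s)] on the space form;
    the present form also serves [delta = 0]. *)
Definition ell (s : R) (x : V) : R := ip (x - c) w0 - s * psi c x.
Definition refl (s : R) (x : V) : V := x - (2 * ell s x / qf s) *: wv s.
(** The linear part of the affine map [refl s]; the two agree on the space form when
    [delta != 0]. *)
Definition lrefl (s : R) (v : V) : V := v - (2 * ip v (wv s) / qf s) *: wv s.

Lemma dcw : delta * ip c w0 = 0. Proof. by case: Tw. Qed.

Lemma dcc : delta * (delta * ip c c) = delta.
Proof. by rewrite (M_ip Mc); case: eqVneq => [->|]; rewrite ?mul0r ?mulr1. Qed.

Lemma wv_ip s : ip (wv s) (wv s) = qf s.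
Proof.
rewrite /wv /qf !ipL ww [ip w0 c]ipC.
transitivity (1 - 2 * s * (delta * ip c w0) + s ^+ 2 * (delta * (delta * ip c c))); first by ring.
by rewrite dcw dcc; ring.
Qed.

Lemma V0_wv s : V0 (wv s).
Proof. by have [Vw _] := Tw; apply: V0D => //; apply: V0N; apply: V0Z; exact: M_V0. Qed.

Lemma ellD s x v : ell s (x + v) = ell s x + ip v (wv s).
Proof.
rewrite /ell !psi_def /wv !ipL; ring.
Qed.

Lemma reflD s x v : refl s (x + v) = refl s x + lrefl s v.
Proof.
rewrite /refl /lrefl ellD.
have -> : 2 * (ell s x + ip v (wv s)) / qf s = 2 * ell s x / qf s + 2 * ip v (wv s) / qf s by ring.
by rewrite scalerDl opprD addrACA.
Qed.

Lemma lreflD s v w : lrefl s (v + w) = lrefl s v + lrefl s w.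
Proof.
rewrite /lrefl ipDl mulrDr mulrDl scalerDl opprD; exact: addrACA.
Qed.

Lemma lreflZ s a v : lrefl s (a *: v) = a *: lrefl s v.
Proof.
by apply/rowP => j; rewrite /lrefl ipZl !mxE; ring.
Qed.

Lemma lreflN s v : lrefl s (- v) = - lrefl s v.
Proof. by rewrite -scaleN1r lreflZ scaleN1r. Qed.

Lemma lrefl_sum s (I : finType) (f : I -> V) : lrefl s (\sum_i f i) = \sum_i lrefl s (f i).
Proof.
apply: (big_morph (lrefl s) (lreflD s)).
by rewrite /lrefl ip0l mulr0 mul0r scale0r subr0.
Qed.

Lemma blin_lrefl s : blin (lrefl s).
Proof.
split=> [a u v|]; first by rewrite lreflD lreflZ.
have [_ _ [B B0 HB]] := bbil_lip n delta.
exists (1 + `|2 / qf s| * (B * `|wv s|) * `|wv s|).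
  by rewrite ltr_pwDl // !mulr_ge0 // ltW.
move=> h; apply: (@le_trans _ _ (`|h| + `|2 / qf s| * (B * `|h| * `|wv s|) * `|wv s|)); last first.
  by rewrite le_eqVlt; apply/orP; left; apply/eqP; ring.
apply: (le_trans (ler_normB _ _)); rewrite lerD2l normrZ.
have -> : 2 * ip h (wv s) / qf s = 2 / qf s * ip h (wv s) by ring.
by rewrite normrM ler_wpM2r // ler_wpM2l.
Qed.

Section Pos.
Variable s : R.
Hypothesis q0 : 0 < qf s.

Lemma lrefl_wv v : ip (lrefl s v) (wv s) = - ip v (wv s).
Proof. by rewrite /lrefl ipDl ipNl ipZl wv_ip; field; rewrite gt_eqF. Qed.

Lemma lreflK v : lrefl s (lrefl s v) = v.
Proof.
rewrite {1}/lrefl lrefl_wv /lrefl mulrN mulNr scaleNr opprK subrK.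
by [].
Qed.

Lemma lrefl_ip v w : ip (lrefl s v) (lrefl s w) = ip v w.
Proof.
rewrite {2}/lrefl ipDr ipNr ipZr lrefl_wv /lrefl ipDl ipNl ipZl [ip (wv s) w]ipC; field.
by rewrite gt_eqF.
Qed.

Lemma ell_refl x : ell s (refl s x) = - ell s x.
Proof. by rewrite /refl ellD ipNl ipZl wv_ip; field; rewrite gt_eqF. Qed.

Lemma reflK x : refl s (refl s x) = x.
Proof. by rewrite {1}/refl ell_refl /refl mulrN mulNr scaleNr opprK subrK. Qed.

Lemma refl_sub x y : refl s x - refl s y = lrefl s (x - y).
Proof. by rewrite -{1}(subrK y x) [x - y + y]addrC reflD addrAC subrr add0r. Qed.

Lemma refl_sqd x y : sqd (refl s x) (refl s y) = sqd x y.
Proof. by rewrite /SpaceForm.sqd refl_sub lrefl_ip. Qed.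

Lemma refl_id x : ell s x = 0 -> refl s x = x.
Proof. by move=> h; rewrite /refl h mulr0 mul0r scale0r subr0. Qed.

Lemma ip_cwv : delta != 0 -> ip c (wv s) = - s.
Proof.
move=> d0; have cw : ip c w0 = 0 by apply: (mulfI d0); rewrite dcw mulr0.
rewrite /wv !ipL cw; transitivity (- (s * (delta * ip c c))); first by ring.
by rewrite (M_ip1 Mc d0) mulr1.
Qed.

Lemma ell_ip x : M x -> delta != 0 -> ell s x = ip x (wv s).
Proof.
move=> Mx d0; have := ellD s c (x - c); rewrite addrC subrK => ->.
by rewrite /ell subrr ip0l psi_pp ipDl ipNl (ip_cwv d0); ring.
Qed.

Lemma refl_lin x : M x -> delta != 0 -> refl s x = lrefl s x.
Proof. by move=> Mx d0; rewrite /refl /lrefl ell_ip. Qed.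

Lemma M_refl x : M x -> (delta != 0 -> 0 < refl s x 0 ord0) -> M (refl s x).
Proof.
move=> Mx h; apply: M_intro => //.
  by apply: V0D; [exact: M_V0 | apply: V0N; apply: V0Z; exact: V0_wv].
by move=> d0; rewrite refl_lin // lrefl_ip M_ip1.
Qed.

Lemma V0_lrefl v : V0 v -> V0 (lrefl s v).
Proof. by move=> h; apply: V0D => //; apply: V0N; apply: V0Z; exact: V0_wv. Qed.

Lemma TM_lrefl x v : M x -> TM x v -> TM (refl s x) (lrefl s v).
Proof.
move=> Mx [Vv dv]; split; first exact: V0_lrefl.
have [->|d0] := eqVneq delta 0; first by rewrite mul0r.
by rewrite refl_lin // lrefl_ip.
Qed.

Lemma TM_wv x : M x -> ell s x = 0 -> TM x (wv s).
Proof.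
move=> Mx h; split; first exact: V0_wv.
have [->|d0] := eqVneq delta 0; first by rewrite mul0r.
by rewrite -ell_ip // h mulr0.
Qed.

Lemma frame_lrefl x E N : M x -> frame delta x E N -> frame delta (refl s x) (fun i => lrefl s (E i)) (lrefl s N).
Proof.
move=> Mx [h1 h2 h3 h4 h5]; split.
- by move=> i; exact: TM_lrefl.
- exact: TM_lrefl.
- by move=> i j; rewrite lrefl_ip.
- by move=> i; rewrite lrefl_ip.
by rewrite lrefl_ip.
Qed.

Lemma refl_chart x E N y t : M x -> frame delta x E N -> 0 < 1 + delta * (en y + t ^+ 2) ->
  refl s (chart x E N y t) = chart (refl s x) (fun i => lrefl s (E i)) (lrefl s N) y t.
Proof.
move=> Mx fr h; have fr' := frame_lrefl Mx fr.
rewrite (chart_rho fr) (chart_rho fr') /SpaceForm.rho (slab_tan_ip fr) (slab_tan_ip fr').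
set m := (Num.sqrt _)^-1.
have -> : lin_comb (fun i => lrefl s (E i)) y + t *: lrefl s N = lrefl s (lin_comb E y + t *: N).
  rewrite lreflD lreflZ /lin_comb lrefl_sum; congr (_ + _).
  by apply: eq_bigr => i _; rewrite lreflZ.
set v := lin_comb E y + t *: N.
have [d0|d0] := eqVneq delta 0.
  have -> : m = 1 by rewrite /m d0 mul0r addr0 sqrtr1 invr1.
  by rewrite !scale1r reflD.
rewrite (refl_lin Mx d0) -lreflD -lreflZ /refl /lrefl; congr (_ - (2 * _ / _) *: _).
have := ellD s c (m *: (x + v) - c); rewrite addrC subrK => ->.
by rewrite {1}/ell subrr ip0l psi_pp [ip (m *: (x + v) - c) _]ipDl ipNl (ip_cwv d0); ring.
Qed.

Lemma ell_mid : ell s (rho c (s *: w0)) = 0.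
Proof.
have Ts : TM c (s *: w0) := TMZ s Tw.
have iw : ip (s *: w0) (s *: w0) = s ^+ 2 by rewrite !ipL ww; ring.
have qE : 1 + delta * ip (s *: w0) (s *: w0) = qf s by rewrite iw.
rewrite /ell psi_rho ?qE // /SpaceForm.rho qE; set m := (Num.sqrt _)^-1.
have [d0|d0] := eqVneq delta 0.
  have -> : m = 1 by rewrite /m /qf d0 mul0r addr0 sqrtr1 invr1.
  by rewrite scale1r addrAC subrr add0r ipZl ww; ring.
have cw : ip c w0 = 0 by apply: (mulfI d0); rewrite dcw mulr0.
by rewrite !ipL cw ww; ring.
Qed.

End Pos.
End Reflection.
End Reflections.
Import Reflections.

(** * Geodesics and geodesic spheres *)

Section GeodesicSphere.
Context (R : realType) (n : nat) (delta : R).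
Notation V := 'rV[R]_n.+2.
Notation ip := (@lip R n delta).
Notation M := (@space_form R n delta).
Notation TM := (@TM R n delta).
Notation sqd := (@sqd R n delta).
Notation psi := (@psi R n delta).
Notation cs := (cs delta).
Notation sn := (sn delta).

(* Half the squared chord: [delta * vs = 1 - cs], also meaningful for [delta = 0]. *)
Definition vs (t : R) : R := if delta == 0 then t ^+ 2 / 2 else (1 - cs t) / delta.

Lemma cs_vs t : cs t = 1 - delta * vs t.
Proof.
rewrite /vs; have [->|d0] := eqVneq delta 0; first by rewrite /CurvatureTrig.cs eqxx; ring.
by field.
Qed.

Lemma sn_vs t : sn t ^+ 2 = vs t * (2 - delta * vs t).
Proof.
have [d0|d0] := eqVneq delta 0; first by rewrite /vs /CurvatureTrig.sn d0 eqxx; field.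
apply: (mulfI d0); have := cs_sn delta t; rewrite cs_vs => h.
have -> : delta * sn t ^+ 2 = 1 - (1 - delta * vs t) ^+ 2 by rewrite -[X in X - _]h; ring.
ring.
Qed.

Lemma is_derive_vs (t : R) : is_derive t 1 vs (sn t).
Proof.
rewrite /vs; have [d0|d0] := eqVneq delta 0.
  have H := is_deriveM (is_deriveM (is_derive_id t 1) (is_derive_id t 1)) (is_derive_cst (2^-1 : R) t 1).
  rewrite (_ : (fun t0 => _) = (id : R -> R) * (id : R -> R) * cst (2^-1)) //.
  by apply: (is_derive_eq H); rewrite /= scaler0 add0r /GRing.scale /= /CurvatureTrig.sn d0 eqxx; field.
have H := is_deriveM (is_deriveB (is_derive_cst (1 : R) t 1) (is_derive_cs delta t)) (is_derive_cst (delta^-1 : R) t 1).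
rewrite (_ : (fun t0 => _) = (cst 1 - cs) * cst (delta^-1)) //.
by apply: (is_derive_eq H); rewrite /= scaler0 add0r /GRing.scale /=; field.
Qed.

Lemma sqd_arc p v t : M p -> TM p v -> ip v v = 1 -> sqd p (arc delta p v 1 t) = 2 * vs t.
Proof.
move=> Mp [_ pv] vv; rewrite /SpaceForm.sqd /arc mul1r.
have dpp : delta * (delta * ip p p) = delta.
  by rewrite (M_ip Mp); case: eqVneq => [->|]; rewrite ?mul0r ?mulr1.
have -> : p - (cs t *: p + sn t *: v) = (delta * vs t) *: p - sn t *: v.
  by rewrite cs_vs scalerBl scale1r opprD opprB addrA [p + (_ - p)]addrC subrK.
rewrite !ipL vv [ip v p]ipC.
transitivity (vs t ^+ 2 * (delta * (delta * ip p p)) - 2 * vs t * sn t * (delta * ip p v) + sn t ^+ 2); first by ring.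
by rewrite dpp pv sn_vs; ring.
Qed.

Lemma is_derive_cst0 (f : R -> R) (a b : R) : a < b -> (forall t, a < t < b -> is_derive t 1 f 0) ->
  (forall t, a <= t <= b -> {for t, continuous f}) -> f b = f a.
Proof.
move=> ab df cf.
have h1 (s : R) : s \in `]a, b[%R -> is_derive s 1 f 0 by rewrite in_itv /=; exact: df.
have h2 : {within `[a, b], continuous f}.
  by apply: continuous_in_subspaceT => s /set_mem /=; rewrite in_itv /=; exact: cf.
by have [s _] := MVT ab h1 h2; rewrite mul0r => /eqP; rewrite subr_eq0 => /eqP.
Qed.

Lemma right_limit0 (f : R -> R) l : 0 < l -> {for 0, continuous f} -> (forall t, 0 < t < l -> f t = 0) -> f 0 = 0.
Proof.
move=> l0 cf f0; apply: contrapT => h.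
have ca : {for 0, continuous (fun t => `|f t|)} := continuous_comp cf (@norm_continuous _ _ _).
have H : \forall t \near (0 : R), 0 < `|f t|.
  by apply: (cvgr_gt _ ca); rewrite normr_gt0; exact/eqP.
have /nbhs_normP[d /= d0 Hd] := H.
pose t := Num.min d l / 2; have m0 : 0 < Num.min d l by rewrite lt_min d0.
have [td tl] : t < d /\ t < l.
  by have h1 := ge_min d d l; have h2 := ge_min l d l; move: h1 h2; rewrite !lexx orbT /= /t; lra.
have t0 : 0 < t by rewrite divr_gt0.
have := Hd t; rewrite /= sub0r normrN gtr0_norm // => /(_ td); rewrite f0 ?t0 // normr0 ltxx.
by [].
Qed.

Lemma smooth_derive1 (c : R -> V) t : smooth_at t c ->
  D1 c t (fun h => h *: derive1 c t) /\ D1 (derive1 c) t (fun h => h *: derive1n 2 c t).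
Proof.
move=> /nbhs_singleton h.
have e (f : R -> V) : differentiable f t -> D1 f t (fun h => h *: derive1 f t).
  move=> df; apply: (D1_ext _ _ (D1_diff df)); first by apply: (@filterE _ (nbhs t)).
  move=> x; rewrite derive1E; have [b _] := D1_diff df.
  by rewrite -(blin_scale x (1 : R) b) /GRing.scale /= mulr1.
split; first by apply: e; exact: (h [::]).
have -> : derive1n 2 c = derive1 (derive1 c) by rewrite derive1nS derive1n1.
have h1 := h [:: 1]; rewrite /= in h1.
have E : derive1 c = 'D_1 c by apply/funext => x; rewrite derive1E.
by apply: e; rewrite E.
Qed.

(* Solves [c'' = - delta c] by the constants of motion. *)
Lemma geodesic_arc p l (c : R -> V) : 0 < l -> unit_speed_geodesic delta l c -> c 0 = p ->
  [/\ M p, TM p (derive1 c 0), ip (derive1 c 0) (derive1 c 0) = 1 & c l = arc delta p (derive1 c 0) 1 l].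
Proof.
move=> l0 hc c0; set v := derive1 c 0.
have hl : (0 : R) <= 0 <= l by rewrite lexx ltW.
have D0 t : 0 <= t <= l -> D1 c t (fun h => h *: derive1 c t) /\ D1 (derive1 c) t (fun h => h *: derive1n 2 c t).
  by move=> ht; apply: smooth_derive1; have [] := hc t ht.
have near_int (t : R) : 0 < t < l -> \forall s \near t, 0 < s < l.
  move=> /andP[t0 tl]; have ci : {for t, continuous (fun s : R => s)} := @cvg_id _ _.
  have n1 : \forall s \near t, 0 < s by exact: (cvgr_gt _ ci).
  have n2 : \forall s \near t, s < l by exact: (cvgr_lt _ ci).
  by apply: (@filterS2 _ (nbhs t) _ _ _ _ _ n1 n2) => s -> ->.
have lt_le t : 0 < t < l -> 0 <= t <= l by move=> /andP[/ltW -> /ltW ->].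
have Mc t : 0 <= t <= l -> M (c t) by move=> /hc [].
have cc1 t : 0 <= t <= l -> ip (derive1 c t) (derive1 c t) = 1 by move=> /hc []; rewrite lipE.
have bl0 : blin (fun v : V => v 0 ord0 : R).
  split=> [a u w|]; first by rewrite !mxE.
  by exists 1 => // h; rewrite mul1r; exact: coord_norm.
have T1 t : 0 < t < l -> TM (c t) (derive1 c t).
  move=> ht; have [d1 _] := D0 t (lt_le _ ht); split.
    move=> d0; have := D1_near_cst (1 : R) (a := 0) _ (D1_comp d1 (D1_blin _ bl0)); rewrite scale1r; apply.
    by apply: (@filterS _ (nbhs t) _ _ _ _ (near_int _ ht)) => s hs; exact: M_V0 (Mc s (lt_le _ hs)) d0.
  have [->|d0] := eqVneq delta 0; first by rewrite mul0r.
  have := D1_near_cst (1 : R) (a := delta^-1) _ (D1_bil (bbil_lip n delta) d1 d1); rewrite scale1r [ip (derive1 c t) _]ipC => h.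
  have : ip (c t) (derive1 c t) + ip (c t) (derive1 c t) = 0.
    apply: h; apply: (@filterS _ (nbhs t) _ _ _ _ (near_int _ ht)) => s hs.
    by apply: (mulfI d0); rewrite (M_ip1 (Mc s (lt_le _ hs)) d0) divff.
  by move=> h2; rewrite (_ : ip _ _ = 0) ?mulr0 //; lra.
(* Since [delta * <c, c''> = - delta], the vector [c'' + delta *: c] is tangent. By the geodesic
   equation [c''] is orthogonal to every tangent vector, and so is [c], up to the factor [delta];
   the vector is therefore null. *)
have ode t : 0 < t < l -> derive1n 2 c t = - delta *: c t.
  move=> ht; have [d1 d2] := D0 t (lt_le _ ht); have Mt := Mc t (lt_le _ ht).
  have [_ _ _ [_ tz]] := hc t (lt_le _ ht).
  set a := derive1n 2 c t in tz d2 *; pose u := a + delta *: c t.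
  have Va : V0 delta a.
    move=> d0; have := D1_near_cst (1 : R) (a := 0) _ (D1_comp d2 (D1_blin _ bl0)); rewrite scale1r; apply.
    by apply: (@filterS _ (nbhs t) _ _ _ _ (near_int _ ht)) => s hs; have [h _] := T1 s hs; exact: h.
  have ac : delta * ip (c t) a = - delta.
    have := D1_near_cst (1 : R) (a := 0) _ (D1_bil (bbil_mul R) (D1_cst (delta : R) t) (D1_bil (bbil_lip n delta) d1 d2)).
    rewrite !scale1r mul0r add0r (cc1 t (lt_le _ ht)) => h.
    have : delta * (1 + ip (c t) a) = 0.
      by apply: h; apply: (@filterS _ (nbhs t) _ _ _ _ (near_int _ ht)) => s hs; have [_ h2] := T1 s hs.
    by rewrite mulrDr mulr1; lra.
  have Tu : TM (c t) u.
    split; first by apply: V0D => //; apply: V0Z; exact: M_V0.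
    rewrite /u ipDr ipZr mulrDr ac; have [->|d0] := eqVneq delta 0; first by rewrite oppr0 !mul0r addr0.
    by rewrite mulrCA (M_ip1 Mt d0) mulr1 addNr.
  have uu : ip u u = 0.
    have := tz u; rewrite lipE subr0 => /(_ (proj2 (tangentP u Mt) Tu)) h.
    by rewrite {1}/u ipDl ipZl h; have [_ ->] := Tu; rewrite addr0.
  have [_ /(_ uu) /eqP] := tangent_pos Mt Tu.
  by rewrite /u addr_eq0 -scaleNr => /eqP.
have Mp : M p by rewrite -c0; exact: Mc.
have cd1 : {for 0, continuous (derive1 c)} by have [_ d2] := D0 0 hl; exact: (D1_cont d2).
have cc0 : {for 0, continuous c} by have [d1 _] := D0 0 hl; exact: (D1_cont d1).
(* The curve is known to lie on the space form for [t >= 0] only, so tangency at the endpoint is a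
   limit from the right. *)
have Tv : TM p v.
  split.
    move=> d0; apply: (right_limit0 (f := fun t => derive1 c t 0 ord0) l0).
      exact: (continuous_comp cd1 (D1_cont (D1_blin _ bl0))).
    by move=> t ht; have [h _] := T1 t ht; exact: h.
  rewrite -c0; apply: (right_limit0 (f := fun t => delta * ip (c t) (derive1 c t)) l0).
    exact: (continuousM (D1_cont (D1_cst (delta : R) (0 : R))) (cont_ip (delta := delta) cc0 cd1)).
  by move=> t ht; have [_ h] := T1 t ht.
split=> //; first exact: cc1.
pose A t := cs t *: c t - sn t *: derive1 c t.
pose B t := (delta * sn t) *: c t + cs t *: derive1 c t.
apply/rowP => j.
have coord (F : R -> V) F' t : D1 F t (fun h => h *: F') -> is_derive t 1 (fun s => F s 0 j) (F' 0 j).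
  move=> D; have bl : blin (fun v : V => v 0 j : R).
    split=> [a u w|]; first by rewrite !mxE.
    by exists 1 => // h; rewrite mul1r; exact: coord_norm.
  by have := D1_is_derive (1 : R) (D1_comp D (D1_blin _ bl)); rewrite scale1r.
have iA t : 0 <= t <= l -> is_derive t 1 (fun s => A s 0 j) (sn t * (- delta * c t 0 j - derive1n 2 c t 0 j)).
  move=> ht; have [d1 d2] := D0 t ht.
  have i1 := is_deriveM (is_derive_cs delta t) (coord _ _ _ d1).
  have i2 := is_deriveM (is_derive_sn delta t) (coord _ _ _ d2).
  have i3 := is_deriveB i1 i2.
  rewrite (_ : (fun s => _) = cs * (fun s => c s 0 j) - sn * (fun s => derive1 c s 0 j)); last first.
    by apply/funext => s; rewrite /A !mxE.
  by apply: (is_derive_eq i3); rewrite ?fctE /GRing.scale /=; ring.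
have iB t : 0 <= t <= l -> is_derive t 1 (fun s => B s 0 j) (cs t * (delta * c t 0 j + derive1n 2 c t 0 j)).
  move=> ht; have [d1 d2] := D0 t ht.
  have i1 := is_deriveM (is_deriveM (is_derive_cst delta t 1) (is_derive_sn delta t)) (coord _ _ _ d1).
  have i2 := is_deriveM (is_derive_cs delta t) (coord _ _ _ d2).
  have i3 := is_deriveD i1 i2.
  rewrite (_ : (fun s => _) = cst delta * sn * (fun s => c s 0 j) + cs * (fun s => derive1 c s 0 j)); last first.
    by apply/funext => s; rewrite /B !mxE.
  by apply: (is_derive_eq i3); rewrite ?fctE /GRing.scale /=; ring.
have ctn (F : R -> R) (t a : R) : is_derive t 1 F a -> {for t, continuous F}.
  by move=> [h _]; exact/differentiable_continuous/derivable1_diffP.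
have EA : A l 0 j = A 0 0 j.
  apply: (is_derive_cst0 (f := fun s => A s 0 j) l0) => t ht; last exact: ctn (iA t ht).
  apply: (is_derive_eq (iA t (lt_le _ ht))); rewrite (ode t ht) !mxE; ring.
have EB : B l 0 j = B 0 0 j.
  apply: (is_derive_cst0 (f := fun s => B s 0 j) l0) => t ht; last exact: ctn (iB t ht).
  apply: (is_derive_eq (iB t (lt_le _ ht))); rewrite (ode t ht) !mxE; ring.
have A0 : A 0 0 j = p 0 j by rewrite /A cs0 sn0 c0 !mxE mul0r subr0 mul1r.
have B0 : B 0 0 j = v 0 j by rewrite /B cs0 sn0 mulr0 !mxE mul0r add0r mul1r.
have {}EA := etrans EA A0; have {}EB := etrans EB B0.
transitivity (cs l * p 0 j + sn l * v 0 j); last by rewrite /arc mul1r !mxE.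
rewrite -EA -EB /A /B !mxE -[LHS]mul1r -[X in X * _](cs_sn delta l); ring.
Unshelve. all: by end_near. Qed.

Lemma arc_geodesic p v l : M p -> TM p v -> ip v v = 1 ->
  (forall t, 0 <= t <= l -> M (arc delta p v 1 t)) -> unit_speed_geodesic delta l (arc delta p v 1).
Proof.
move=> Mp Tv vv hM t ht; have Mt := hM t ht.
have E1 : derive1 (arc delta p v 1) = arc delta v (- delta *: p) 1.
  by apply/funext => s; rewrite derive1E; have [_ ->] := is_derive_arc delta p v 1 s; rewrite scale1r mul1r.
have E2 : derive1n 2 (arc delta p v 1) t = - delta *: arc delta p v 1 t.
  rewrite derive1nS derive1n1 E1 derive1E; have [_ ->] := is_derive_arc delta v (- delta *: p) 1 t.
  by rewrite /arc !mul1r scale1r scalerDr !scalerA [- delta * _]mulrC [- delta * sn _]mulrC.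
have [_ pv] := Tv.
have dpp : delta * (delta * ip p p) = delta.
  by rewrite (M_ip Mp); case: eqVneq => [->|]; rewrite ?mul0r ?mulr1.
split=> //; first exact: smooth_arc.
  rewrite lipE E1 /arc mul1r !ipL vv [ip v p]ipC -[RHS](cs_sn delta t).
  transitivity (cs t ^+ 2 - 2 * cs t * sn t * (delta * ip p v) + sn t ^+ 2 * (delta * (delta * ip p p))); first by ring.
  by rewrite dpp pv; ring.
split; first by apply/(tangentP _ Mt); exact: TM0.
move=> z /(tangentP _ Mt) [_ hz]; rewrite lipE subr0 E2 ipZl mulNr hz oppr0 //.
Qed.

(** For [delta > 0], [t1] is a quarter of a period, where [vs t1 = 1 / delta > d / 2]; for
    [delta < 0] it comes from [1 + x <= expR x]. The last property is [0 <= sn (u - t)] in expanded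
    form. *)
Lemma sn_pos_range d : 0 < d -> (0 < delta -> delta * d < 2) ->
  exists t1 : R, [/\ 0 < t1, d / 2 <= vs t1, forall t, 0 < t <= t1 -> 0 < sn t &
    forall t u, 0 <= t <= u -> u <= t1 -> sn t * cs u <= sn u * cs t].
Proof.
move=> d0 hd; have [e0|e0|e0] := delta_cases delta.
- exists (d + 1); split; [by lra | | |].
  + by rewrite /vs e0 eqxx; nra.
  + by move=> t /andP[t0 _]; rewrite /CurvatureTrig.sn e0 eqxx.
  + by move=> t u /andP[t0 tu] _; rewrite /CurvatureTrig.sn /CurvatureTrig.cs e0 eqxx !mulr1.
- have q0 : 0 < Num.sqrt delta by rewrite sqrtr_gt0.
  have snE t : sn t = sin (Num.sqrt delta * t) / Num.sqrt delta by rewrite /CurvatureTrig.sn gt_eqF // e0.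
  have csE t : cs t = cos (Num.sqrt delta * t) by rewrite /CurvatureTrig.cs gt_eqF // e0.
  have pi0 := pi_gt0 R.
  have rng t : t <= pi / 2 / Num.sqrt delta -> Num.sqrt delta * t <= pi / 2.
    by move=> h; rewrite mulrC -ler_pdivlMr.
  exists (pi / 2 / Num.sqrt delta); split; first by rewrite !divr_gt0.
  + rewrite /vs gt_eqF // csE (_ : Num.sqrt delta * _ = pi / 2); last by field; rewrite gt_eqF.
    rewrite cos_pihalf subr0 ler_pdivrMr // mulrAC ler_pdivlMr // mul1r; have := hd e0; lra.
  + move=> t /andP[t0 t1]; rewrite snE divr_gt0 // sin_gt0_pi // mulr_gt0 //=.
    by have := rng t t1; lra.
  + move=> t u /andP[t0 tu] u1; rewrite -subr_ge0 !snE !csE.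
    have -> : sin (Num.sqrt delta * u) / Num.sqrt delta * cos (Num.sqrt delta * t) -
       sin (Num.sqrt delta * t) / Num.sqrt delta * cos (Num.sqrt delta * u) =
       sin (Num.sqrt delta * u - Num.sqrt delta * t) / Num.sqrt delta by rewrite sinB; ring.
    rewrite divr_ge0 ?(ltW q0) // sin_ge0_pi // -mulrBr mulr_ge0 ?(ltW q0) ?subr_ge0 //=.
    have := rng u u1; have := mulr_ge0 (ltW q0) t0; rewrite mulrBr; lra.
set a := Num.sqrt (- delta).
have q0 : 0 < a by rewrite sqrtr_gt0 oppr_gt0.
have a2 : delta = - a ^+ 2 by rewrite sqr_sqrtr ?opprK // oppr_ge0 ltW.
have snE t : sn t = (expR (a * t) - expR (- (a * t))) / (2 * a) by rewrite /CurvatureTrig.sn lt_eqF // ltNge (ltW e0).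
have csE t : cs t = (expR (a * t) + expR (- (a * t))) / 2 by rewrite /CurvatureTrig.cs lt_eqF // ltNge (ltW e0).
exists ((1 + a ^+ 2 * d) / a); split.
- by rewrite divr_gt0 // ltr_pwDl // mulr_ge0 ?sqr_ge0 // ltW.
- rewrite /vs lt_eqF // csE (_ : a * _ = 1 + a ^+ 2 * d); last by field; rewrite gt_eqF.
  rewrite a2 invrN mulrN -mulNr opprB.
  rewrite ler_pdivlMr ?exprn_gt0 //.
  by have := expR_ge1Dx (1 + a ^+ 2 * d); have := expR_gt0 (- (1 + a ^+ 2 * d)); lra.
- move=> t /andP[t0 _]; rewrite snE divr_gt0 ?mulr_gt0 // subr_gt0 ltr_expR.
  by have := mulr_gt0 q0 t0; lra.
move=> t u /andP[t0 tu] _; rewrite -subr_ge0 !snE !csE.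
have -> : (expR (a * u) - expR (- (a * u))) / (2 * a) * ((expR (a * t) + expR (- (a * t))) / 2) -
   (expR (a * t) - expR (- (a * t))) / (2 * a) * ((expR (a * u) + expR (- (a * u))) / 2) =
   (expR (a * u) * expR (- (a * t)) - expR (a * t) * expR (- (a * u))) / (2 * a).
  by field; rewrite gt_eqF.
rewrite divr_ge0 ?mulr_ge0 ?(ltW q0) // subr_ge0 -!expRD ler_expR.
have := mulr_ge0 (ltW q0) t0; have : a * t <= a * u by rewrite ler_pM2l.
lra.
Qed.

(** The radius solves [vs r = d / 2], because [2 * vs t] is the squared chord at time [t] of a
    unit-speed geodesic ([sqd_arc]). *)
Lemma sphere_geodesic (S : set V) c d : M c -> 0 < d -> (0 < delta -> delta * d < 2) ->
  (forall x, S x <-> M x /\ sqd c x = d) -> exists r : R, 0 < r /\ S = geodesic_sphere delta c r.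
Proof.
move=> Mc d0 hd HS; have [t1 [t10 vt1 sn0' mono]] := sn_pos_range d0 hd.
have vs0 : vs 0 = 0 by rewrite /vs cs0; case: ifP => _; rewrite ?expr0n ?subrr ?mul0r.
have cvs (t : R) : {for t, continuous vs}.
  by have [h _] := is_derive_vs t; exact/differentiable_continuous/derivable1_diffP.
have wvs : {within `[0, t1], continuous vs} by apply: continuous_in_subspaceT => t _; exact: cvs.
have hb : Num.min (vs 0) (vs t1) <= d / 2 <= Num.max (vs 0) (vs t1).
  by rewrite vs0 ge_min le_max vt1 divr_ge0 ?(ltW d0) // orbT.
have [r] := IVT (ltW t10) wvs hb; rewrite in_itv /= => /andP[r0 r1] vr.
have {}r0 : 0 < r.
  by rewrite lt_neqAle r0 andbT; apply/eqP => h; move: vr; rewrite -h vs0; lra.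
have snr : 0 < sn r by apply: sn0'; rewrite r0.
have csr : cs r = 1 - delta * d / 2 by rewrite cs_vs vr mulrA.
exists r; split=> //; apply/seteqP; split=> x; last first.
  move=> [g [hg g0 <-]]; have [Mp Tv vv ->] := geodesic_arc r0 hg g0.
  have := hg r; rewrite lexx ltW // => /(_ isT) [_ Mr _ _].
  have E := geodesic_arc r0 hg g0; have [_ _ _ Er] := E; rewrite Er in Mr.
  by apply/HS; split=> //; rewrite sqd_arc // vr; field.
move=> /HS [Mx xd].
have pcx : psi c x = cs r by rewrite psi_sqd // xd csr.
pose v := (sn r)^-1 *: (x - cs r *: c).
have dcc : delta * (delta * ip c c) = delta.
  by rewrite (M_ip Mc); case: eqVneq => [->|]; rewrite ?mul0r ?mulr1.
have Tv : TM c v.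
  apply: TMZ; split; first by apply: V0D; [exact: M_V0 | apply: V0N; apply: V0Z; exact: M_V0].
  have [->|dd] := eqVneq delta 0; first by rewrite mul0r.
  rewrite -pcx (psiE _ Mc) (negbTE dd) addr0 !ipL mulrBr [ip c x]ipC.
  transitivity (delta * ip x c - delta * ip x c * (delta * ip c c)); first by ring.
  by rewrite (M_ip1 Mc dd); ring.
have vv : ip v v = 1.
  have E : ip (x - cs r *: c) (x - cs r *: c) = sn r ^+ 2.
    have h1 : delta * ip (x - c) c = - delta * vs r.
      by have := psi_def delta c x; rewrite pcx csr vr => h; lra.
    have h2 : ip (x - c) (x - c) = 2 * vs r by rewrite -/(SpaceForm.sqd delta x c) sqdC xd vr; field.
    have -> : x - cs r *: c = (x - c) + (delta * vs r) *: c.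
      by rewrite cs_vs scalerBl scale1r opprB addrA addrAC.
    move: h1 h2; move: (x - c) => y h1 h2; rewrite !ipL [ip c y]ipC h2.
    transitivity (2 * vs r + 2 * vs r * (delta * ip y c) + vs r ^+ 2 * (delta * (delta * ip c c))); first by ring.
    by rewrite h1 dcc sn_vs; ring.
  by rewrite /v ipZl ipZr E; field; rewrite gt_eqF.
have ar : arc delta c v 1 r = x.
  by rewrite /arc mul1r /v scalerA divff ?gt_eqF // scale1r addrC subrK.
exists (arc delta c v 1); split=> //; last exact: arc0.
(* The arc must stay where the first coordinate is positive. It is the combination of [c] and [x]
   with weights [(sn r * cs t - sn t * cs r) / sn r] and [sn t / sn r], nonnegative on [[0, r]]. *)
apply: arc_geodesic => // t /andP[t0 tr]; apply: M_arc => //.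
have [->|dd] := eqVneq delta 0; [by right | left].
rewrite /arc mul1r /v scalerA scalerBr scalerA !mxE.
have sc : 0 <= sn t by move: t0; rewrite le_eqVlt => /orP[/eqP <-|t0]; [rewrite sn0 | apply: ltW; apply: sn0'; rewrite t0 (le_trans tr)].
have c0 := M_pos Mc dd; have x0 := M_pos Mx dd.
have := mono t r; rewrite t0 tr => /(_ isT r1); rewrite -subr_ge0 => g0.
have -> : cs t * c 0 ord0 + (sn t / sn r * x 0 ord0 - sn t / sn r * cs r * c 0 ord0) =
   (sn r * cs t - sn t * cs r) / sn r * c 0 ord0 + sn t / sn r * x 0 ord0.
  by field; rewrite gt_eqF.
have [te|tne] := eqVneq t 0.
  by rewrite te sn0 cs0 !mul0r addr0 subr0 mulr1 divff ?gt_eqF // mul1r.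
apply: ltr_wpDl; first by rewrite mulr_ge0 ?divr_ge0 ?(ltW snr) ?(ltW c0).
by apply: mulr_gt0 => //; apply: divr_gt0 => //; apply: sn0'; rewrite lt_neqAle eq_sym tne t0 (le_trans tr).
Qed.

End GeodesicSphere.

(** * Center of the smallest ball *)

Section Circumcenter.
Context (R : realType) (n : nat) (delta : R).
Notation V := 'rV[R]_n.+2.
Notation ip := (@lip R n delta).
Notation M := (@space_form R n delta).
Notation TM := (@TM R n delta).
Notation V0 := (@V0 R n delta).
Notation sqd := (@sqd R n delta).
Notation psi := (@psi R n delta).
Notation base := (@base R n delta).

Variables (S : set V).
Hypotheses (cS : compact S) (S0 : S !=set0) (SM : S `<=` M).

(** [sqd c x - ip c c] is affine in [c] with slope bounded over [S], so its maximum over [S] is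
    Lipschitz whatever maximizers [xm] are chosen. *)
Lemma max_sqd : exists F : V -> R, continuous F /\
  forall c, (forall x, S x -> sqd c x <= F c) /\ exists2 x, S x & sqd c x = F c.
Proof.
have [x1 Sx1 H1] := cmax S0 cS (@norm_continuous _ V).
have [_ _ [B B0 HB]] := bbil_lip n delta.
have /choice [xm Hxm] : forall c, exists x, S x /\ forall y, S y -> sqd c y <= sqd c x.
  by move=> c; have [x Sx h] := cmax S0 cS (@cont_sqd _ _ delta c); exists x.
exists (fun c => sqd c (xm c)); split; last first.
  by move=> c; have [h1 h2] := Hxm c; split=> //; exists (xm c).
pose G c := sqd c (xm c) - ip c c.
have key c x : sqd c x - ip c c = ip x x - 2 * ip c x by rewrite /SpaceForm.sqd !ipL [ip x c]ipC; ring.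
have lip_ c c' : G c - G c' <= 2 * B * `|x1| * `|c - c'|.
  have [Sx _] := Hxm c; have [_ h2] := Hxm c'; have := h2 _ Sx => h3.
  apply: (@le_trans _ _ (2 * ip (c' - c) (xm c))).
    by rewrite /G; have e1 := key c (xm c); have e2 := key c' (xm c); rewrite e1 ipDl ipNl; lra.
  rewrite -!mulrA ler_pM2l // (le_trans (ler_norm _)) // (le_trans (HB _ _)) //.
  rewrite -mulrA ler_pM2l // mulrC [`|c - c'|]distrC ler_wpM2r //; exact: H1.
have cG : continuous G.
  move=> c; apply: (proj2 (continuous_enP G c)) => e e0.
  pose L := 2 * B * `|x1| + 1; have L0 : 0 < L by rewrite ltr_pwDr // !mulr_ge0 // ltW.
  exists ((e / L) ^+ 2); first by rewrite exprn_gt0 // divr_gt0.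
  move=> c' /(norm_en (divr_gt0 e0 L0)) h.
  have h2 : L * `|c' - c| <= e by rewrite mulrC -ler_pdivlMr // ltW.
  have h4 := normr_ge0 (c' - c).
  have := lip_ c c'; have := lip_ c' c; rewrite [`|c - c'|]distrC => a1 a2.
  rewrite ler_norml; move: h2; rewrite /L mulrDl mul1r => h2; apply/andP; split; lra.
move=> c; have cip : {for c, continuous (fun y : V => ip y y)} by exact: cont_ipxx.
have cc := continuousD (cG c) cip.
by apply: cont_near cc; apply: (@filterE _ (nbhs c)) => y; rewrite /G subrK.
Qed.

(** In place of the triangle inequality: splitting [a] and [b] along [x] gives [psi a b] as a
    product of hyperbolic cosines plus a term bounded, by Cauchy-Schwarz, by the product of sines,
    hence of cosines. *)
Lemma cosh_triangle x a b : delta < 0 -> M x -> M a -> M b -> psi a b <= 2 * psi x a * psi x b.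
Proof.
move=> dn Mx Ma Mb; have d0 : delta != 0 by rewrite lt_eqF.
have al := psi_neg_gt0 (ltW dn) Mx Ma; have be := psi_neg_gt0 (ltW dn) Mx Mb.
have dE := M_ip1 Mx d0.
have E y : M y -> psi x y = delta * ip y x by move=> My; rewrite (psiE _ Mx) (negbTE d0) addr0.
have T y : M y -> TM x (y - psi x y *: x).
  move=> My; split; first by apply: V0D; [exact: M_V0 | apply: V0N; apply: V0Z; exact: M_V0].
  rewrite !ipL mulrBr mulrCA dE (E y My) [ip x y]ipC; ring.
have N y : M y -> delta * ip (y - psi x y *: x) (y - psi x y *: x) = 1 - psi x y ^+ 2.
  move=> My; have h := E y My; rewrite !ipL [ip x y]ipC.
  transitivity (delta * ip y y - 2 * psi x y * (delta * ip y x) + psi x y ^+ 2 * (delta * ip x x)); first by ring.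
  by rewrite -h dE (M_ip1 My d0); ring.
have cs_ := tangent_cs Mx (T a Ma) (T b Mb).
have na := N a Ma; have nb := N b Mb.
have ab : psi a b = psi x a * psi x b + delta * ip (a - psi x a *: x) (b - psi x b *: x).
  rewrite (psiE _ Ma) (negbTE d0) addr0 !ipL [ip x b]ipC [ip b a]ipC.
  transitivity (delta * ip a b - psi x b * (delta * ip a x) - psi x a * (delta * ip b x) + psi x a * psi x b * (delta * ip x x) + psi x a * psi x b); last by ring.
  by rewrite -(E a Ma) -(E b Mb) dE; ring.
rewrite ab; set t := ip (a - _) (b - _) in cs_ *.
set u := ip (a - _) (a - _) in cs_ na; set v := ip (b - _) (b - _) in cs_ nb.
have h : (delta * t) ^+ 2 <= (psi x a * psi x b) ^+ 2.
  have d2 : 0 < delta ^+ 2 by rewrite exprn_even_gt0.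
  have : delta ^+ 2 * t ^+ 2 <= (delta * u) * (delta * v) by have := ler_wpM2l (ltW d2) cs_; lra.
  have [u0 _] := tangent_pos Mx (T a Ma); have [v0 _] := tangent_pos Mx (T b Mb).
  rewrite na nb exprMn exprMn.
  have : 1 - psi x a ^+ 2 <= 0 by rewrite -na nmulr_rle0.
  have : 1 - psi x b ^+ 2 <= 0 by rewrite -nb nmulr_rle0.
  nra.
have p0 : 0 <= psi x a * psi x b by rewrite mulr_ge0 // ltW.
have : delta * t <= psi x a * psi x b.
  have [h1|h1] := leP (delta * t) 0; first exact: le_trans p0.
  by rewrite -ler_sqr ?nnegrE // ltW.
lra.
Qed.

(** For [delta > 0] the competitors [c'] range over the full sphere: the center produced in
    [sym_contra] may lie outside the half-sphere. Minimizing over the full sphere gives compactness,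
    and the minimizer is then shown to be in the half-sphere. For [delta <= 0], distant competitors
    are discarded first. *)
Lemma circumcenter : exists c, [/\ M c, forall x, S x -> 0 < psi c x &
  forall c' d, V0 c' -> (delta != 0 -> delta * ip c' c' = 1) -> (delta < 0 -> 0 < c' 0 ord0) ->
   (forall x, S x -> sqd c' x < d) -> forall x, S x -> sqd c x < d].
Proof.
have [F [cF HF]] := max_sqd; have Mb := M_base n delta.
have [x0 Sx0] := S0.
have concl (X : set V) : compact X -> X !=set0 ->
   exists2 c, X c & forall c', X c' -> F c <= F c'.
  move=> cX X0; have cN : continuous (fun c => - F c) by move=> c; exact: (continuousN (cF c)).
  by have [c Xc h] := cmax X0 cX cN; exists c => // c' /h; rewrite lerN2.
have less c' d : (forall x, S x -> sqd c' x < d) -> F c' < d.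
  by move=> h; have [_ [x Sx <-]] := HF c'; exact: h.
have geF c' x : S x -> sqd c' x <= F c' by move=> Sx; have [h _] := HF c'; exact: h.
have finish c : M c -> (forall x, S x -> 0 < psi c x) ->
   (forall c', V0 c' -> (delta != 0 -> delta * ip c' c' = 1) -> (delta < 0 -> 0 < c' 0 ord0) -> F c <= F c') ->
   exists c, [/\ M c, forall x, S x -> 0 < psi c x &
  forall c' d, V0 c' -> (delta != 0 -> delta * ip c' c' = 1) -> (delta < 0 -> 0 < c' 0 ord0) ->
   (forall x, S x -> sqd c' x < d) -> forall x, S x -> sqd c x < d].
  move=> Mc pc h; exists c; split=> // c' d v1 v2 v3 /less Fd.
  by move=> x Sx; apply: le_lt_trans (geF _ _ Sx) _; exact: le_lt_trans (h _ v1 v2 v3) Fd.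
have [e0|e0|e0] := delta_cases delta.
(* By the parallelogram identity [sqd base c' <= 2 * (sqd base x0 + sqd c' x0)], so a competitor
   beyond [DD] has [F c' >= F base]. *)
- pose DD := 2 * (F base + sqd base x0).
  have dD : delta * DD < 2 by rewrite e0 mul0r.
  have Bb : (M `&` [set x | sqd base x <= DD]) base.
    split=> //=; rewrite {1}/SpaceForm.sqd subrr ip0l /DD; have := geF base x0 Sx0; have [h _] := sqd_ge0 Mb (SM Sx0).
    lra.
  have [c [Mc _] Hc] := concl _ (compact_base dD) (ex_intro _ _ Bb).
  apply: (finish c Mc); first by move=> x /SM Mx; apply: psi_neg_gt0 => //; rewrite e0.
  move=> c' Vc' _ _; have Mc' : M c' by apply: M_intro => // h; rewrite e0 eqxx in h.
  have [h|h] := leP (sqd base c') DD; first exact: Hc.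
  apply: (le_trans (Hc _ Bb)); apply: le_trans (geF c' x0 Sx0).
  have p : 0 <= ip (base - x0 + (c' - x0)) (base - x0 + (c' - x0)) by apply: ip_ge0; rewrite e0.
  have : sqd base c' + ip (base - x0 + (c' - x0)) (base - x0 + (c' - x0)) = 2 * (sqd base x0 + sqd c' x0).
    by rewrite /SpaceForm.sqd !ipL ![ip x0 _]ipC ![ip c' base]ipC; ring.
  move: h; rewrite /DD; lra.
- pose X := [set x : V | en (x - 0) <= delta^-1] `&` [set x : V | - en (x - 0) <= - delta^-1].
  have ipen x : ip x x = en x.
    rewrite ipE /eps ltNge (ltW e0) /= mul1r /en /dot [in RHS]big_ord_recl; congr (_ + _).
    by apply: eq_bigr => i _; rewrite !mxE.
  have XE x : X x <-> delta * ip x x = 1.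
    rewrite ipen; split=> [[/= h1 h2]|h].
      have -> : en x = delta^-1 by apply/eqP; rewrite eq_le; rewrite subr0 in h1 h2; rewrite h1 -lerN2 h2.
      by rewrite divff // gt_eqF.
    have -> : X x = (en (x - 0) <= delta^-1 /\ - en (x - 0) <= - delta^-1) by [].
    have -> : delta^-1 = en x by apply: (mulfI (lt0r_neq0 e0)); rewrite divff ?gt_eqF.
    by rewrite subr0 lexx.
  have cX : compact X.
    apply: (subclosed_compact _ (@compact_en_ball R n.+2 0 delta^-1)) => [|x []//].
    apply: closedI; apply: closed_le_fun; first exact: continuous_en.
    by move=> x; exact: (continuousN (@continuous_en _ _ 0 x)).
  have Xb : X base by apply/XE; apply: (M_ip1 Mb); rewrite gt_eqF.
  have [c Xc Hc] := concl X cX (ex_intro _ _ Xb).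
  have dn0 : delta != 0 by rewrite gt_eqF.
  have sE c' x : X c' -> S x -> sqd c' x = 2 * (delta^-1 - ip c' x).
    move=> /XE h1 /SM /M_ip1 /(_ dn0) h2; have h3 : delta * delta^-1 = 1 by rewrite divff.
    have -> : delta^-1 = ip c' c' by apply: (mulfI dn0); rewrite h1 h3.
    have e : ip x x = ip c' c' by apply: (mulfI dn0); rewrite h1 h2.
    by rewrite /SpaceForm.sqd !ipL [ip x c']ipC e; ring.
  have Fc : F c < 2 * delta^-1.
    apply: le_lt_trans (Hc _ Xb) _; have [_ [x Sx <-]] := HF base.
    rewrite sE //; have := psi_base_gt0 (SM Sx); rewrite (psiE _ Mb) (negbTE dn0) addr0 ipC pmulr_rgt0 //; lra.
  have pcx x : S x -> 0 < ip c x by move=> Sx; have := geF c x Sx; rewrite sE //; lra.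
  have c0 : 0 < c 0 ord0.
    rewrite ltNge; apply/negP => c0.
    (* Otherwise moving [c] towards [base] would increase all the products [<c, x>]. *)
    pose m := delta^-1 - F c / 2; have m0 : 0 < m by rewrite /m; lra.
    have hm x : S x -> m <= ip c x by move=> Sx; have := geF c x Sx; rewrite sE // /m; lra.
    have bc : ip c base <= 0.
      rewrite /BasePoint.base (negbTE dn0) ipZr ip_e0 /eps ltNge (ltW e0) /= mul1r.
      by rewrite mulr_ge0_le0 // invr_ge0 sqrtr_ge0.
    pose mb := delta^-1 - F base / 2.
    have mb0 : 0 < mb.
      have [_ [x Sx xF]] := HF base; rewrite /mb -xF sE //.
      have := psi_base_gt0 (SM Sx); rewrite (psiE _ Mb) (negbTE dn0) addr0 ipC pmulr_rgt0 //; lra.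
    have hb x : S x -> mb <= ip base x by move=> Sx; have := geF base x Sx; rewrite sE // /mb; lra.
    (* This [t] maximizes [(m + t * mb) / sqrt (1 + t^2)], a lower bound for the products of the
       normalized [v] with the points of [S]. *)
    pose t := mb / m; have t0 : 0 < t by rewrite divr_gt0.
    pose v := c + t *: base; pose NN := delta * ip v v.
    have hv x : S x -> m + t * mb <= ip v x.
      by move=> Sx; rewrite /v ipDl ipZl lerD ?hm // ler_pM2l // hb.
    have N1 : NN <= 1 + t ^+ 2.
      have -> : NN = delta * ip c c + 2 * t * (delta * ip c base) + t ^+ 2 * (delta * ip base base).
        by rewrite /NN /v !ipL [ip base c]ipC; ring.
      have h1 : delta * ip c c = 1 by apply/XE.
      have h2 : delta * ip base base = 1 by apply/XE.
      have : 2 * t * (delta * ip c base) <= 0 by apply: mulr_ge0_le0; [rewrite mulr_ge0 // ltW | apply: mulr_ge0_le0 => //; exact: ltW].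
      by rewrite h1 h2; lra.
    have vp : 0 < ip v x0 by apply: lt_le_trans (hv x0 Sx0); rewrite addr_gt0 // mulr_gt0.
    have N0 : 0 < NN.
      rewrite pmulr_rgt0 // lt_neqAle ip_ge0 ?(ltW e0) // andbT eq_sym; apply/eqP => /(ip_eq0 (ltW e0)) v0.
      by move: vp; rewrite v0 ip0l ltxx.
    have q0 : 0 < Num.sqrt NN by rewrite sqrtr_gt0.
    have Xc' : X ((Num.sqrt NN)^-1 *: v).
      apply/XE; rewrite ipZl ipZr; transitivity (NN / (Num.sqrt NN) ^+ 2); first by move: (Num.sqrt NN) q0 => q qq; rewrite /NN; move: (ip v v) => vv; field; rewrite gt_eqF.
      by rewrite sqr_sqrtr ?(ltW N0) // divff // gt_eqF.
    have := Hc _ Xc'; have [_ [x Sx <-]] := HF ((Num.sqrt NN)^-1 *: v); rewrite (sE _ _ Xc' Sx) ipZl.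
    have h1 : m * Num.sqrt NN < m + t * mb.
      have P1 : 0 <= m * Num.sqrt NN by apply: mulr_ge0; [exact: ltW | exact: ltW].
      have P2 : 0 <= m + t * mb by apply: addr_ge0; [exact: ltW | apply: mulr_ge0; exact: ltW].
      rewrite -ltr_sqr ?nnegrE //.
      rewrite exprMn sqr_sqrtr ?(ltW N0) //.
      have : m ^+ 2 * NN <= m ^+ 2 * (1 + t ^+ 2) by rewrite ler_pM2l // exprn_gt0.
      have mt : m * t = mb by rewrite /t mulrC divfK // gt_eqF.
      have : m ^+ 2 * (1 + t ^+ 2) < (m + t * mb) ^+ 2.
        have -> : m ^+ 2 * (1 + t ^+ 2) = m ^+ 2 + mb ^+ 2 by rewrite -mt; ring.
        have -> : (m + t * mb) ^+ 2 = m ^+ 2 + 2 * (m * t) * mb + t ^+ 2 * mb ^+ 2 by ring.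
        have := sqr_ge0 (t * mb); have := exprn_gt0 2 mb0; rewrite mt exprMn; lra.
      lra.
    have h2 : m < (Num.sqrt NN)^-1 * ip v x.
      by rewrite mulrC ltr_pdivlMr //; exact: lt_le_trans h1 (hv x Sx).
    by rewrite /m in h2; lra.
  have Mc : M c.
    by apply: M_intro => //; [move=> h; rewrite h eqxx in dn0 | move=> _; exact/XE].
  apply: (finish c Mc).
    move=> x Sx; rewrite (psiE _ Mc) (negbTE dn0) addr0 pmulr_rgt0 // ipC; exact: pcx.
  by move=> c' _ h _; apply: Hc; apply/XE; exact: h.
have dn0 : delta != 0 by rewrite lt_eqF.
pose Psi := 1 - delta * F base / 2; pose q := psi x0 base.
have Mx0 := SM Sx0; have q0 : 0 < q := psi_neg_gt0 (ltW e0) Mx0 Mb.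
have qPsi : q <= Psi.
  by rewrite /q (psi_sqd Mx0 Mb) sqdC /Psi; have := geF base x0 Sx0; nra.
(* [DD] is the squared chord at which [psi base] equals [2 * q * Psi], the bound that
   [cosh_triangle] gives for a competitor better than [base]. *)
pose DD := 2 / (- delta) * (2 * q * Psi - 1).
have dDD : delta * DD = - (2 * (2 * q * Psi - 1)) by rewrite /DD; field.
have dD : delta * DD < 2 by rewrite dDD; have := mulr_gt0 q0 (lt_le_trans q0 qPsi); lra.
have Bb : (M `&` [set x | sqd base x <= DD]) base.
  split=> //=; rewrite {1}/SpaceForm.sqd subrr ip0l /DD mulr_ge0 ?divr_ge0 ?oppr_ge0 ?(ltW e0) //.
  have := cosh_triangle e0 Mx0 Mb Mb; rewrite psi_pp -/q; have := ler_pM2l q0 q Psi; rewrite qPsi; lra.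
have [c [Mc _] Hc] := concl _ (compact_base dD) (ex_intro _ _ Bb).
apply: (finish c Mc); first by move=> x /SM Mx; exact: psi_neg_gt0 (ltW e0) Mc Mx.
move=> c' Vc' h1 h2; have Mc' : M c' by apply: M_intro => // _; exact: h2.
have [h|h] := leP (sqd base c') DD; first exact: Hc.
apply: (le_trans (Hc _ Bb)); rewrite leNgt; apply/negP => Fl.
have p1 : psi x0 c' <= Psi.
  by rewrite (psi_sqd Mx0 Mc') sqdC /Psi; have := geF c' x0 Sx0; nra.
have := cosh_triangle e0 Mx0 Mb Mc'; rewrite (psi_sqd Mb Mc') -/q => p2.
have : 2 * q * psi x0 c' <= 2 * q * Psi by rewrite ler_pM2l // mulr_gt0.
have : delta * sqd base c' < delta * DD by rewrite ltr_nM2l.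
rewrite dDD; lra.
Qed.

End Circumcenter.

(** * Strong maximum principle for two solutions *)

Lemma T2_sub (R : realType) n (w1 w2 : 'rV[R]_n -> R) y l1 l2 Q1 Q2 : T2 w1 y l1 Q1 -> T2 w2 y l2 Q2 ->
  T2 (fun x => w1 x - w2 x) y (l1 - l2) (Q1 - Q2).
Proof.
move=> h1 h2 e e0; have e2 : 0 < e / 2 by rewrite divr_gt0.
have [d1 d10 H1] := h1 _ e2; have [d2 d20 H2] := h2 _ e2.
exists (Num.min d1 d2); first by rewrite lt_min d10.
move=> h; rewrite lt_min => /andP[/H1 a1 /H2 a2].
have -> : dot (l1 - l2) h = dot l1 h - dot l2 h.
  by rewrite /dot -sumrB; apply: eq_bigr => i _; rewrite !mxE mulrBl.
have -> : quad (Q1 - Q2) h = quad Q1 h - quad Q2 h by rewrite /quad mulmxBr mulmxBl !mxE.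
move: a1 a2; rewrite !ler_norml => /andP[? ?] /andP[? ?]; apply/andP; split; lra.
Qed.

Section LocallyLipschitz.
Context (R : realType) (n : nat).
Implicit Types F G : 'rV[R]_n -> R -> 'rV[R]_n -> R.

Definition jdist (y : 'rV[R]_n) (s : R) (l : 'rV[R]_n) (y' : 'rV[R]_n) (s' : R) (l' : 'rV[R]_n) : R :=
  \sum_i `|y 0 i - y' 0 i| + `|s - s'| + \sum_i `|l 0 i - l' 0 i|.

Definition small (th : R) (y : 'rV[R]_n) (s : R) (l : 'rV[R]_n) := [/\ en y < th, `|s| < th & en l < th].

Definition lipn F := exists C th : R, [/\ 0 <= C, 0 < th &
  forall y s l y' s' l', small th y s l -> small th y' s' l' ->
  `|F y s l| <= C /\ `|F y s l - F y' s' l'| <= C * jdist y s l y' s' l'].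

Lemma jdist_ge0 y s l y' s' l' : 0 <= jdist y s l y' s' l'.
Proof. by rewrite !addr_ge0 // sumr_ge0. Qed.

Lemma lipn_cst c : lipn (fun _ _ _ => c).
Proof.
exists `|c|, 1; split=> // y s l y' s' l' _ _; split=> //.
by rewrite subrr normr0 mulr_ge0 // jdist_ge0.
Qed.

Lemma lipn_s : lipn (fun _ s _ => s).
Proof.
exists 1, 1; split=> // y s l y' s' l' [_ h _] _; split; first exact: ltW.
by rewrite mul1r /jdist -addrA addrCA lerDl addr_ge0 // sumr_ge0.
Qed.

Lemma en_coord1 (y : 'rV[R]_n) i : en y < 1 -> `|y 0 i| <= 1.
Proof.
move=> h; rewrite -(ler_sqr (x := `|_|)) ?nnegrE // expr1n real_normK ?num_real //.
exact: le_trans (en_coord y i) (ltW h).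
Qed.

Lemma lipn_y i : lipn (fun y _ _ => y 0 i).
Proof.
exists 1, 1; split=> // y s l y' s' l' [h _ _] _; split; first exact: en_coord1.
by rewrite mul1r /jdist (bigD1 i) //= -!addrA lerDl !addr_ge0 // sumr_ge0.
Qed.

Lemma lipn_l i : lipn (fun _ _ l => l 0 i).
Proof.
exists 1, 1; split=> // y s l y' s' l' [_ _ h] _; split; first exact: en_coord1.
by rewrite mul1r /jdist [\sum_j `|l 0 j - l' 0 j|](bigD1 i) //= addrCA lerDl !addr_ge0 // sumr_ge0.
Qed.

Lemma smallW th th' y s l : th <= th' -> small th y s l -> small th' y s l.
Proof. by move=> h [h1 h2 h3]; split; exact: lt_le_trans h. Qed.

Lemma lipn_add F G : lipn F -> lipn G -> lipn (fun y s l => F y s l + G y s l).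
Proof.
move=> [C1 [t1 [C10 t10 H1]]] [C2 [t2 [C20 t20 H2]]].
exists (C1 + C2), (Num.min t1 t2); split; [exact: addr_ge0 | by rewrite lt_min t10 |].
have m1 : Num.min t1 t2 <= t1 by rewrite ge_min lexx.
have m2 : Num.min t1 t2 <= t2 by rewrite ge_min lexx orbT.
move=> y s l y' s' l' h h'.
have [a1 a2] := H1 _ _ _ _ _ _ (smallW m1 h) (smallW m1 h').
have [b1 b2] := H2 _ _ _ _ _ _ (smallW m2 h) (smallW m2 h'); split.
  by rewrite (le_trans (ler_normD _ _)) // lerD.
by rewrite opprD addrACA (le_trans (ler_normD _ _)) // mulrDl lerD.
Qed.

Lemma lipn_mul F G : lipn F -> lipn G -> lipn (fun y s l => F y s l * G y s l).
Proof.
move=> [C1 [t1 [C10 t10 H1]]] [C2 [t2 [C20 t20 H2]]].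
exists (2 * C1 * C2), (Num.min t1 t2); split; [by rewrite !mulr_ge0 | by rewrite lt_min t10 |].
have m1 : Num.min t1 t2 <= t1 by rewrite ge_min lexx.
have m2 : Num.min t1 t2 <= t2 by rewrite ge_min lexx orbT.
move=> y s l y' s' l' h h'.
have [a1 a2] := H1 _ _ _ _ _ _ (smallW m1 h) (smallW m1 h').
have [b1 b2] := H2 _ _ _ _ _ _ (smallW m2 h) (smallW m2 h').
have [b3 _] := H2 _ _ _ _ _ _ (smallW m2 h') (smallW m2 h).
have D0 := jdist_ge0 y s l y' s' l'; set D := jdist _ _ _ _ _ _ in a2 b2 D0 *.
split.
  rewrite normrM; apply: (@le_trans _ _ (C1 * C2)); first exact: ler_pM.
  by have := mulr_ge0 C10 C20; lra.
have -> : F y s l * G y s l - F y' s' l' * G y' s' l' =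
  F y s l * (G y s l - G y' s' l') + (F y s l - F y' s' l') * G y' s' l' by ring.
rewrite (le_trans (ler_normD _ _)) // !normrM.
have e1 : `|F y s l| * `|G y s l - G y' s' l'| <= C1 * (C2 * D) by exact: ler_pM.
have e2 : `|F y s l - F y' s' l'| * `|G y' s' l'| <= (C1 * D) * C2 by exact: ler_pM.
have -> : 2 * C1 * C2 * D = C1 * (C2 * D) + C1 * D * C2 by ring.
exact: lerD.
Qed.

Lemma lipn_sum (I : finType) (F : I -> 'rV[R]_n -> R -> 'rV[R]_n -> R) :
  (forall i, lipn (F i)) -> lipn (fun y s l => \sum_i F i y s l).
Proof.
move=> h; have H (r : seq I) : lipn (fun y s l => \sum_(i <- r) F i y s l).
  elim: r => [|i r IH].
    rewrite (_ : (fun y s l => _) = (fun _ _ _ => 0)); first exact: lipn_cst.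
    by apply/funext => y; apply/funext => s; apply/funext => l; rewrite big_nil.
  rewrite (_ : (fun y s l => _) = (fun y s l => F i y s l + \sum_(i <- r) F i y s l)); first exact: lipn_add.
  by apply/funext => y; apply/funext => s; apply/funext => l; rewrite big_cons.
exact: H.
Qed.

Lemma lipn_sqrt F : lipn F -> (exists2 th, 0 < th & forall y s l, small th y s l -> 4^-1 <= F y s l) ->
  lipn (fun y s l => Num.sqrt (F y s l)).
Proof.
move=> [C1 [t1 [C10 t10 H1]]] [t2 t20 H2].
exists (C1 + 1), (Num.min t1 t2); split; [by rewrite addr_ge0 | by rewrite lt_min t10 |].
have m1 : Num.min t1 t2 <= t1 by rewrite ge_min lexx.
have m2 : Num.min t1 t2 <= t2 by rewrite ge_min lexx orbT.
move=> y s l y' s' l' h h'.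
have [a1 a2] := H1 _ _ _ _ _ _ (smallW m1 h) (smallW m1 h').
have b1 := H2 _ _ _ (smallW m2 h); have b2 := H2 _ _ _ (smallW m2 h').
have D0 := jdist_ge0 y s l y' s' l'; set D := jdist _ _ _ _ _ _ in a2 D0 *.
set f := F y s l in a1 a2 b1 *; set f' := F y' s' l' in a2 b2 *.
have f0 : 0 <= f by lra. have f0' : 0 <= f' by lra.
have half (x : R) : 4^-1 <= x -> 2^-1 <= Num.sqrt x.
  move=> hx; rewrite -(@ler_sqr _ 2^-1) ?nnegrE ?sqrtr_ge0 // sqr_sqrtr; last by lra.
  by apply: le_trans hx; rewrite le_eqVlt; apply/orP; left; apply/eqP; field.
have q1 := half _ b1; have q2 := half _ b2.
split.
  rewrite ger0_norm ?sqrtr_ge0 //; have := sqr_sqrtr f0; have := sqr_ge0 (Num.sqrt f - 1).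
  by move: a1; rewrite ger0_norm //; nra.
have E : (Num.sqrt f - Num.sqrt f') * (Num.sqrt f + Num.sqrt f') = f - f' by rewrite -subr_sqr !sqr_sqrtr.
apply: (@le_trans _ _ (C1 * D)); last by rewrite ler_wpM2r // lerDl.
apply: le_trans a2; rewrite -E normrM ler_peMr // ger0_norm; lra.
Qed.

Lemma lipn_inv F : lipn F -> (exists2 th, 0 < th & forall y s l, small th y s l -> 4^-1 <= F y s l) ->
  lipn (fun y s l => (F y s l)^-1).
Proof.
move=> [C1 [t1 [C10 t10 H1]]] [t2 t20 H2].
exists (16 * C1 + 4), (Num.min t1 t2); split; [by rewrite addr_ge0 ?mulr_ge0 | by rewrite lt_min t10 |].
have m1 : Num.min t1 t2 <= t1 by rewrite ge_min lexx.
have m2 : Num.min t1 t2 <= t2 by rewrite ge_min lexx orbT.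
move=> y s l y' s' l' h h'.
have [a1 a2] := H1 _ _ _ _ _ _ (smallW m1 h) (smallW m1 h').
have b1 := H2 _ _ _ (smallW m2 h); have b2 := H2 _ _ _ (smallW m2 h').
have D0 := jdist_ge0 y s l y' s' l'; set D := jdist _ _ _ _ _ _ in a2 D0 *.
set f := F y s l in a1 a2 b1 *; set f' := F y' s' l' in a2 b2 *.
have f0 : 0 < f by lra. have f0' : 0 < f' by lra.
have inv4 (x : R) : 4^-1 <= x -> x^-1 <= 4.
  move=> hx; have x0 : 0 < x by lra.
  rewrite -[x^-1]mul1r ler_pdivrMr //; lra.
have i1 := inv4 _ b1; have i2 := inv4 _ b2.
have p1 : 0 < f^-1 by rewrite invr_gt0. have p2 : 0 < f'^-1 by rewrite invr_gt0.
split; first by rewrite gtr0_norm //; have := mulr_ge0 (ler0n R 16) C10; lra.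
have -> : f^-1 - f'^-1 = (f' - f) * (f^-1 * f'^-1) by field; rewrite !gt_eqF.
rewrite normrM distrC (gtr0_norm (mulr_gt0 p1 p2)).
apply: (@le_trans _ _ (C1 * D * 16)).
  apply: ler_pM => //; first by rewrite mulr_ge0 ?ltW.
  by have -> : 16 = 4 * 4 :> R by [ring]; apply: ler_pM => //; exact: ltW.
have := mulr_ge0 C10 D0; lra.
Qed.

End LocallyLipschitz.

Section Comparison.
Context (R : realType) (n : nat) (delta : R).

(** The first fundamental form divided by the factor between the second one and the Hessian. Scaling
    both forms by the same factor keeps the curvatures, so the equation holds for [Gm] with the
    Hessian itself as second argument. *)
Definition Gm (y : 'rV[R]_n) (s : R) (l : 'rV[R]_n) : 'M[R]_n :=
  (scale_fac delta y s / Num.sqrt (grad_norm2 delta y l s))^-1 *: gmet delta (scale_fac delta y s) y s l.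

Let d1 := `|delta| + 1.
(** Small enough for the arguments of both square roots in [Gm] to stay above 1/2. *)
Let th0 := (8 * d1)^-1.
Lemma th0P : [/\ 0 < th0, th0 <= 1 & 8 * `|delta| * th0 <= 1].
Proof.
have h : 1 <= d1 by rewrite lerDr.
have d0 : 0 < d1 by lra.
split; first by rewrite invr_gt0 mulr_gt0.
  by rewrite -[leRHS]invr1 lef_pV2 ?posrE ?mulr_gt0 //; lra.
by rewrite /th0 ler_pdivrMr ?mulr_gt0 // mul1r ler_pM2l // lerDl.
Qed.

Lemma bound_half (x : R) : 0 <= x -> x <= 4 * th0 -> 2^-1 <= 1 + delta * x.
Proof.
move=> x0 hx; have [h1 h2 h3] := th0P.
have : `|delta * x| <= 2^-1.
  rewrite normrM (ger0_norm x0); apply: (@le_trans _ _ (`|delta| * (4 * th0))); first by rewrite ler_wpM2l.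
  lra.
by rewrite ler_norml => /andP[? _]; lra.
Qed.

Let A (y : 'rV[R]_n) (s : R) (l : 'rV[R]_n) := 1 + delta * (en y + s ^+ 2).
Let q (y : 'rV[R]_n) (s : R) (l : 'rV[R]_n) := grad_norm2 delta y l s.

Lemma A_low : forall y s l, small th0 y s l -> 2^-1 <= A y s l.
Proof.
move=> y s l [h1 h2 _]; have [t0 t1 _] := th0P.
have s2 : s ^+ 2 <= th0 by rewrite -real_normK ?num_real //; have := normr_ge0 s; nra.
apply: bound_half; first by rewrite addr_ge0 ?en_ge0 ?sqr_ge0.
lra.
Qed.

Lemma q_low : forall y s l, small th0 y s l -> 2^-1 <= q y s l.
Proof.
move=> y s l [h1 h2 h3]; have [t0 t1 _] := th0P.
have s2 : s ^+ 2 <= th0 by rewrite -real_normK ?num_real //; have := normr_ge0 s; nra.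
have := bound_half (x := (dot y l - s) ^+ 2) (sqr_ge0 _); rewrite /q /grad_norm2.
have := en_ge0 l; have := en_ge0 y; have := cs_dot y l => c1 c2 c3 c4.
have : (dot y l - s) ^+ 2 <= 4 * th0.
  have : en y * en l <= th0 * 1 by apply: ler_pM => //; lra.
  have := sqr_ge0 (dot y l + s); nra.
by move=> /c4; lra.
Qed.

Lemma lipn_en_y : lipn (fun (y : 'rV[R]_n) (_ : R) (_ : 'rV[R]_n) => en y).
Proof. by apply: (lipn_sum (F := fun i y _ _ => y 0 i * y 0 i)) => i; apply: lipn_mul; exact: lipn_y. Qed.

Lemma lipn_A : lipn A.
Proof.
apply: lipn_add; first exact: lipn_cst; apply: lipn_mul; first exact: lipn_cst.
apply: lipn_add; first exact: lipn_en_y; apply: lipn_mul; exact: lipn_s.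
Qed.

Lemma lipn_q : lipn q.
Proof.
have hd : lipn (fun (y : 'rV[R]_n) (s : R) (l : 'rV[R]_n) => dot y l - s).
  rewrite (_ : (fun y s l => _) = (fun (y : 'rV[R]_n) (s : R) (l : 'rV[R]_n) => dot y l + (-1) * s)); last first.
    by apply/funext => y; apply/funext => s; apply/funext => l; rewrite mulN1r.
  apply: lipn_add; last by apply: lipn_mul; [exact: lipn_cst | exact: lipn_s].
  by apply: (lipn_sum (F := fun i y _ l => y 0 i * l 0 i)) => i; apply: lipn_mul; [exact: lipn_y | exact: lipn_l].
apply: lipn_add; last by apply: lipn_mul; [exact: lipn_cst | exact: lipn_mul].
apply: lipn_add; first exact: lipn_cst.
by apply: (lipn_sum (F := fun i _ _ l => l 0 i * l 0 i)) => i; apply: lipn_mul; exact: lipn_l.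
Qed.

Lemma sqrt_low (F : 'rV[R]_n -> R -> 'rV[R]_n -> R) : (forall y s l, small th0 y s l -> 2^-1 <= F y s l) ->
  forall y s l, small th0 y s l -> 4^-1 <= Num.sqrt (F y s l).
Proof.
move=> h y s l /h hx; rewrite -(@ler_sqr _ 4^-1) ?nnegrE ?sqrtr_ge0 // sqr_sqrtr; last by lra.
have : 4^-1 ^+ 2 <= 2^-1 :> R by rewrite -[2^-1]mulr1; nra.
lra.
Qed.

Lemma lipn_Gm i j : lipn (fun y s l => Gm y s l i j).
Proof.
have [t0 _ _] := th0P.
have lo (F : 'rV[R]_n -> R -> 'rV[R]_n -> R) : (forall y s l, small th0 y s l -> 2^-1 <= F y s l) ->
  exists2 th, 0 < th & forall y s l, small th y s l -> 4^-1 <= F y s l.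
  by move=> h; exists th0 => // y s l /h; lra.
have lA := lipn_sqrt lipn_A (lo _ A_low); have lq := lipn_sqrt lipn_q (lo _ q_low).
have lm : lipn (fun y s l => (Num.sqrt (A y s l))^-1).
  by apply: lipn_inv => //; exists th0 => //; exact: sqrt_low A_low.
have lt k : lipn (fun (y : 'rV[R]_n) (s : R) (l : 'rV[R]_n) => y 0 k + s * l 0 k).
  by apply: lipn_add; [exact: lipn_y | apply: lipn_mul; [exact: lipn_s | exact: lipn_l]].
have lm2 : lipn (fun y s l => (Num.sqrt (A y s l))^-1 ^+ 2) by exact: (lipn_mul lm lm).
pose X (y : 'rV[R]_n) (s : R) (l : 'rV[R]_n) := (i == j)%:R + l 0 i * l 0 j + (- delta) * (Num.sqrt (A y s l))^-1 ^+ 2 * ((y 0 i + s * l 0 i) * (y 0 j + s * l 0 j)).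
have lX : lipn X.
  apply: lipn_add; first by apply: lipn_add; [exact: lipn_cst | apply: lipn_mul; exact: lipn_l].
  by apply: lipn_mul; [apply: lipn_mul => //; exact: lipn_cst | exact: lipn_mul].
have H := lipn_mul (lipn_mul lA lq) (lipn_mul lm2 lX).
rewrite (_ : (fun y s l => _) = (fun y s l => Num.sqrt (A y s l) * Num.sqrt (q y s l) * ((Num.sqrt (A y s l))^-1 ^+ 2 * X y s l))) //.
apply/funext => y; apply/funext => s; apply/funext => l; rewrite /Gm !mxE /scale_fac -/(A y s l) invfM !invrK.
by rewrite /X /q; ring.
Qed.

Lemma Gm0 i j : Gm 0 0 0 i j = (i == j)%:R.
Proof.
rewrite /Gm /scale_fac /grad_norm2 !mxE en0 expr0n addr0 mulr0 !addr0 subr0 -/(en _) en0 expr0n mulr0 addr0.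
by rewrite sqrtr1 !invr1 mulr1 invr1; ring.
Qed.

Variables (r : nat) (a b : R) (k0 : 'I_n -> R).
Hypothesis (hr : (1 < r <= n)%N).

Definition solution (u : 'rV[R]_n -> R) (l : 'rV[R]_n -> 'rV[R]_n) (Q : 'rV[R]_n -> 'M[R]_n) (t : R) :=
  0 < t /\
  [/\ (forall y, en y < t -> [/\ weingarten r a b (Gm y (u y) (l y)) (Q y) = 0, T2 u y (l y) (Q y) & (Q y)^T = Q y]),
      {for 0, continuous u} /\ u 0 = 0,
      (forall i, {for 0, continuous (fun y => l y 0 i)}) /\ l 0 = 0 &
      forall i j, {for 0, continuous (fun y => Q y i j)}].

Lemma near_en0 (P : 'rV[R]_n -> Prop) : (\forall y \near (0 : 'rV[R]_n), P y) -> exists2 t, 0 < t & forall y, en y < t -> P y.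
Proof. by move=> /nbhs_en [t t0 h]; exists t => // y hy; apply: h; rewrite subr0. Qed.

Lemma solution_small u l Q t : solution u l Q t -> forall th, 0 < th ->
  \forall y \near (0 : 'rV[R]_n), small th y (u y) (l y) /\ jdist y (u y) (l y) 0 0 0 < th.
Proof.
move=> [t0 [_ [cu u0] [cl l0] _]] th th_0.
have cc i : {for (0 : 'rV[R]_n), continuous (fun y : 'rV[R]_n => y 0 i)} by exact: coord_continuous.
have nc (f : 'rV[R]_n -> R) : {for 0, continuous f} -> {for 0, continuous (fun y => `|f y|)}.
  by move=> cf; exact: (continuous_comp cf (@norm_continuous _ _ _)).
have h1 : \forall y \near (0 : 'rV[R]_n), en y < th by apply: near_en; rewrite en0.
have h2 : \forall y \near (0 : 'rV[R]_n), `|u y| < th by apply: (cvgr_lt _ (nc _ cu)); rewrite u0 normr0.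
have cel : {for 0, continuous (fun y => en (l y))}.
  have c i : {for 0, continuous (fun y => l y 0 i * l y 0 i)} := continuousM (cl i) (cl i).
  exact: (cont_sum (f := fun i y => l y 0 i * l y 0 i)).
have h3 : \forall y \near (0 : 'rV[R]_n), en (l y) < th by apply: (cvgr_lt _ cel); rewrite l0 en0.
have cj : {for 0, continuous (fun y : 'rV[R]_n => \sum_i `|y 0 i| + `|u y| + \sum_i `|l y 0 i|)}.
  have c1 : {for 0, continuous (fun y : 'rV[R]_n => \sum_i `|y 0 i|)}.
    by apply: (cont_sum (f := fun i (y : 'rV[R]_n) => `|y 0 i|)) => i; exact: (nc _ (cc i)).
  have c2 : {for 0, continuous (fun y => \sum_i `|l y 0 i|)}.
    by apply: (cont_sum (f := fun i y => `|l y 0 i|)) => i; exact: (nc _ (cl i)).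
  exact: (continuousD (continuousD c1 (nc _ cu)) c2).
pose jd (y : 'rV[R]_n) := \sum_i `|y 0 i| + `|u y| + \sum_i `|l y 0 i|.
  have h4 : \forall y \near (0 : 'rV[R]_n), jd y < th.
  apply: (cvgr_lt _ cj); rewrite /jd u0 l0 normr0 addr0 !big1 ?addr0 // => i _; by rewrite mxE normr0.
apply: (@filterS2 _ (nbhs (0 : 'rV[R]_n)) _ _ _ _ _ (near_and h1 h2) (near_and h3 h4)) => y [a1 a2] [a3 a4].
split=> //; have -> : jdist y (u y) (l y) 0 0 0 = jd y; last by [].
by rewrite /jdist /jd subr0; congr (_ + _ + _); apply: eq_bigr => i _; rewrite mxE subr0.
Qed.

(** The two equations are subtracted by [weingarten_linear]. The metrics are taken at the same [y],
    so each of the [n * n] entries differs by at most [L] times the difference of the 1-jets, which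
    makes the constant [C * (n * n * L)]. *)
Lemma compare u1 l1 Q1 t1 u2 l2 Q2 t2 : solution u1 l1 Q1 t1 -> solution u2 l2 Q2 t2 ->
  Q1 0 = diag_mx (\row_i k0 i) -> Q2 0 = diag_mx (\row_i k0 i) ->
  exists2 C, 0 <= C & forall eta, 0 < eta -> exists2 th, 0 < th & forall y, en y < th ->
    elliptic_at (elliptic_coef r a k0) eta C (fun y => u1 y - u2 y) (fun y => l1 y - l2 y) (fun y => Q1 y - Q2 y) y.
Proof.
move=> s1 s2 Q10 Q20; have [C C0 HC] := weingarten_linear a b k0 hr.
have /choice [Cg /= HCg] : forall ij : 'I_n * 'I_n, exists Ct : R * R, [/\ 0 <= Ct.1, 0 < Ct.2 &
  forall y s l y' s' l', small Ct.2 y s l -> small Ct.2 y' s' l' ->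
   `|Gm y s l ij.1 ij.2 - Gm y' s' l' ij.1 ij.2| <= Ct.1 * jdist y s l y' s' l'].
  move=> [i j]; have [C1 [t [h1 h2 h3]]] := lipn_Gm i j; exists (C1, t); split=> // y s l y' s' l' h h'.
  by have [] := h3 _ _ _ _ _ _ h h'.
pose L := \sum_i \sum_j (Cg (i, j)).1.
have L0 : 0 <= L by apply: sumr_ge0 => i _; apply: sumr_ge0 => j _; have [] := HCg (i, j).
have LC i j : (Cg (i, j)).1 <= L.
  rewrite /L (bigD1 i) //= (bigD1 j) //= -addrA lerDl addr_ge0 // ?sumr_ge0 // => [k _|k _]; first by have [] := HCg (i, k).
  by apply: sumr_ge0 => m _; have [] := HCg (k, m).
pose tg := \big[Num.min/1]_i \big[Num.min/1]_j (Cg (i, j)).2.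
have tg0 : 0 < tg.
  rewrite /tg; apply: (big_ind (fun x => 0 < x)) => // [x z x0 z0|i _]; first by rewrite lt_min x0.
  by apply: (big_ind (fun x => 0 < x)) => // [x z x0 z0|j _]; [rewrite lt_min x0 | have [] := HCg (i, j)].
have tgC i j : tg <= (Cg (i, j)).2.
  apply: (@le_trans _ _ (\big[Num.min/1]_j (Cg (i, j)).2)); last exact: bigmin_le_cond.
  by rewrite /tg; apply: bigmin_le_cond.
have HG i j y s l y' s' l' : small tg y s l -> small tg y' s' l' ->
  `|Gm y s l i j - Gm y' s' l' i j| <= L * jdist y s l y' s' l'.
  move=> h h'; have [_ _ H] := HCg (i, j); have := H _ _ _ _ _ _ (smallW (tgC i j) h) (smallW (tgC i j) h').
  by move=> /le_trans; apply; rewrite ler_wpM2r ?jdist_ge0.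
exists (C * (n%:R * n%:R * L)); first by rewrite !mulr_ge0.
move=> eta eta0; have [t t0 Ht] := HC _ eta0.
have z0 : small tg (0 : 'rV[R]_n) 0 (0 : 'rV[R]_n) by split; rewrite ?en0 ?normr0.
pose t3 := Num.min tg (t / (L + 1)).
have L1 : 0 < L + 1 by rewrite ltr_wpDl.
have t30 : 0 < t3 by rewrite lt_min tg0 divr_gt0.
have t3E : L * t3 <= t.
  have : t3 <= t / (L + 1) by rewrite ge_min lexx orbT.
  by rewrite ler_pdivlMr // => h; have := ltW t30; nra.
have close u l Q tt : solution u l Q tt -> Q 0 = diag_mx (\row_i k0 i) ->
   \forall y \near (0 : 'rV[R]_n), [/\ en y < tt, small tg y (u y) (l y),
     forall i j, `|Gm y (u y) (l y) i j - (i == j)%:R| <= t & forall i j, `|Q y i j - k0 i *+ (i == j)| <= t].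
  move=> sl Q0; have [tt0 [_ _ _ cQ]] := sl.
  have h1 : \forall y \near (0 : 'rV[R]_n), en y < tt by apply: near_en; rewrite en0.
  have h2 : \forall y \near (0 : 'rV[R]_n), \sum_i \sum_j `|Q y i j - k0 i *+ (i == j)| < t.
    have c : {for 0, continuous (fun y => \sum_i \sum_j `|Q y i j - k0 i *+ (i == j)|)}.
      apply: (cont_sum (f := fun i y => \sum_j `|Q y i j - k0 i *+ (i == j)|)) => i.
      apply: (cont_sum (f := fun j y => `|Q y i j - k0 i *+ (i == j)|)) => j.
      have c1 : {for 0, continuous (fun y => Q y i j - k0 i *+ (i == j))} := continuousB (cQ i j) (D1_cst_cont (k0 i *+ (i == j)) (0 : 'rV[R]_n)).
      exact: (continuous_comp c1 (@norm_continuous _ _ _)).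
    apply: (cvgr_lt _ c); rewrite Q0 big1 // => i _; rewrite big1 // => j _.
    by rewrite !mxE subrr normr0.
  apply: (@filterS2 _ (nbhs (0 : 'rV[R]_n)) _ _ _ _ _ (solution_small sl t30) (near_and h1 h2)) => y [s3 j3] [y1 y2].
  have sg : small tg y (u y) (l y) by apply: smallW s3; rewrite ge_min lexx.
  split=> // i j.
    rewrite -Gm0 (le_trans (HG _ _ _ _ _ _ _ _ sg z0)) // (le_trans _ t3E) // ler_wpM2l //; exact: ltW.
  apply: le_trans (ltW y2); rewrite (bigD1 i) //= (bigD1 j) //= -addrA lerDl addr_ge0 // sumr_ge0 // => k _.
  by apply: sumr_ge0.
have [th th_0 Hth] := near_en0 (near_and (close _ _ _ _ s1 Q10) (close _ _ _ _ s2 Q20)).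
exists th => // y /Hth [[y1 g1 G1 K1] [y2 g2 G2 K2]].
have [_ [/(_ y y1)[W1 T1 S1] _ _ _]] := s1; have [_ [/(_ y y2)[W2 T2_ S2] _ _ _]] := s2.
split; [exact: T2_sub | by rewrite linearB /= S1 S2 |].
have := Ht _ _ _ _ G1 G2 K1 K2; rewrite W1 W2 subrr sub0r normrN.
rewrite (eq_bigr (fun i => elliptic_coef r a k0 i * (Q1 y - Q2 y) i i)) => [|i _]; last by rewrite !mxE.
move=> /le_trans; apply; apply: lerD.
  by rewrite ler_pM2l // ler_sum // => i _; apply: ler_sum => j _; rewrite !mxE.
rewrite -!mulrA ler_wpM2l //.
apply: (@le_trans _ _ (\sum_(i < n) \sum_(j < n) L * jdist y (u1 y) (l1 y) y (u2 y) (l2 y))).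
  by apply: ler_sum => i _; apply: ler_sum => j _; exact: HG.
rewrite !sumr_const !card_ord -mulrnA -[leLHS]mulr_natl natrM -!mulrA !ler_wpM2l //.
rewrite /jdist big1 ?add0r => [|i _]; last by rewrite subrr normr0.
by rewrite addrC lerD // ler_sum // => i _; rewrite !mxE.
Qed.

End Comparison.

(** * Second-order tests at a contact *)

Section QuadraticContact.
Context (R : realType) (n : nat).
Implicit Types (w : 'rV[R]_n -> R) (Q : 'M[R]_n).

(** With zero value and gradient, [w (t *: v)] is [t ^+ 2 / 2] times [quad Q v] up to smaller terms;
    hence positive [t] suffice, as is needed on a half-ball. *)
Lemma T2_half w Q v : T2 w 0 0 Q -> w 0 = 0 ->
  (exists2 t0, 0 < t0 & forall t, 0 < t < t0 -> 0 <= w (t *: v)) -> 0 <= quad Q v.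
Proof.
move=> HT w0 [t0 t00 Ht]; rewrite leNgt; apply/negP => qn.
have v0 : 0 < en v + 1 by have := en_ge0 v; lra.
pose e := - quad Q v / (4 * (en v + 1)).
have e0 : 0 < e by rewrite divr_gt0 ?oppr_gt0 // mulr_gt0.
have [d d0 Hd] := HT _ e0.
pose t := Num.min 1 (Num.min t0 (d / (en v + 1)) / 2).
have m0 : 0 < Num.min t0 (d / (en v + 1)) by rewrite lt_min t00 divr_gt0.
have tp : 0 < t by rewrite lt_min ltr01 divr_gt0.
have t1 : t <= 1 by rewrite ge_min lexx.
have t2 : t <= Num.min t0 (d / (en v + 1)) / 2 by rewrite ge_min lexx orbT.
have [t3 t4] : t < t0 /\ t < d / (en v + 1).
  have h1 := ge_min t0 t0 (d / (en v + 1)); have h2 := ge_min (d / (en v + 1)) t0 (d / (en v + 1)).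
  by move: h1 h2; rewrite !lexx orbT /=; lra.
have ev : en (t *: v) < d.
  rewrite enZ; move: t4; rewrite ltr_pdivlMr // => t4; have := en_ge0 v; nra.
have := Hd _ ev; rewrite add0r w0 subr0 (_ : dot 0 _ = 0); last by rewrite /dot big1 // => i _; rewrite mxE mul0r.
rewrite subr0 quadZ enZ ler_norml => /andP[_ h1].
have h2 := Ht t; rewrite tp t3 in h2; have {}h2 := h2 isT.
have tt : 0 < t ^+ 2 by rewrite exprn_gt0.
have eE : e * (4 * (en v + 1)) = - quad Q v by rewrite /e divfK // gt_eqF // mulr_gt0.
have : t ^+ 2 * (- (2^-1 * quad Q v) - e * en v) <= 0 by lra.
rewrite pmulr_rle0 //; have := en_ge0 v; nra.
Qed.

Lemma T2_grad0 w y l Q : T2 w y l Q -> (\forall x \near y, w x = 0) -> l = 0.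
Proof.
move=> HT /nbhs_en[d0 d00 Hw].
have wy : w y = 0 by apply: Hw; rewrite subrr en0.
have key v : dot l v = 0.
  have [] // := @poly2_sign R (dot l v) (2^-1 * quad Q v) _.
  move=> d dp; have v0 : 0 < en v + 1 by have := en_ge0 v; lra.
  have [d1 d10 Hd] := HT _ (divr_gt0 dp v0).
  pose dm := Num.min d0 d1; have dm0 : 0 < dm by rewrite lt_min d00.
  exists (Num.min 1 (dm / (en v + 1))); first by rewrite lt_min ltr01 divr_gt0.
  move=> t; rewrite lt_min => /andP[t1 t2].
  have ev : en (t *: v) < dm.
    rewrite enZ -real_normK ?num_real //; move: t2; rewrite ltr_pdivlMr // => t2.
    have := en_ge0 v; have := normr_ge0 t; nra.
  move: ev; rewrite lt_min => /andP[e1 e2].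
  have := Hd _ e2; rewrite wy (Hw (y + t *: v)) ?subr0; last by rewrite addrC addKr.
  rewrite dotZr quadZ enZ ler_norml => /andP[_ h1].
  have : d / (en v + 1) * (t ^+ 2 * en v) <= d * t ^+ 2.
    have f1 : en v / (en v + 1) <= 1 by rewrite ler_pdivrMr //; lra.
    rewrite (_ : _ * _ = d * t ^+ 2 * (en v / (en v + 1))); last by ring.
    by rewrite ler_piMr // mulr_ge0 ?sqr_ge0 // ltW.
  move: h1; rewrite sub0r; lra.
apply/rowP => i; have := key (delta_mx 0 i); rewrite /dot (bigD1 i) //= [delta_mx _ _ _ _]mxE !eqxx mulr1 big1 ?addr0.
  by move=> ->; rewrite mxE.
by move=> j ji; rewrite [delta_mx _ _ _ _]mxE (negbTE ji) andbF mulr0.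
Qed.

Lemma quad_eq0 Q : (forall v, quad Q v = 0) -> Q^T = Q -> Q = 0.
Proof.
move=> h sQ.
have E (i j : 'I_n) : (delta_mx 0 i : 'rV[R]_n) *m Q *m (delta_mx 0 j : 'rV[R]_n)^T = (Q i j)%:M.
  apply/matrixP => k l; rewrite !ord1 -rowE trmx_delta -colE !mxE eqxx mulr1n.
  by [].
have Qii i : Q i i = 0 by have := h (delta_mx 0 i); rewrite /quad E mxE eqxx mulr1n.
apply/matrixP => i j; rewrite [RHS]mxE.
have := h (delta_mx 0 i + delta_mx 0 j); rewrite /quad linearD /= !mulmxDl !mulmxDr !E !mxE eqxx !mulr1n !Qii.
have -> : Q j i = Q i j by rewrite -{1}sQ mxE.
lra.
Qed.

Lemma elliptic_atN F eta C w l (Q : 'rV[R]_n -> 'M[R]_n) (y : 'rV[R]_n) : elliptic_at F eta C w l Q y ->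
  elliptic_at F eta C (fun y => - w y) (fun y => - l y) (fun y => - Q y) y.
Proof.
move=> [h1 h2 h3]; split.
- move=> e e0; have [d d0 H] := h1 _ e0; exists d => // h /H.
  have -> : dot (- l y) h = - dot (l y) h by rewrite /dot -sumrN; apply: eq_bigr => i _; rewrite mxE mulNr.
  have -> : quad (- Q y) h = - quad (Q y) h by rewrite /quad mulmxN mulNmx mxE.
  by rewrite -normrN; congr (`|_| <= _); ring.
- by rewrite linearN /= h2.
rewrite normrN (eq_bigr (fun i => - (F i * Q y i i))) => [|i _]; last by rewrite mxE mulrN.
rewrite sumrN normrN (le_trans h3) // le_eqVlt; apply/orP; left; apply/eqP; congr (_ * _ + _ * (_ + _)).
  by apply: eq_bigr => i _; apply: eq_bigr => j _; rewrite mxE normrN.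
by apply: eq_bigr => i _; rewrite mxE normrN.
Qed.

End QuadraticContact.

(** * Contact of the reflected domain *)

Section Symmetry.
Context (R : realType) (n : nat) (delta : R).
Notation V := 'rV[R]_n.+2.
Notation ip := (@lip R n delta).
Notation M := (@space_form R n delta).
Notation TM := (@TM R n delta).
Notation V0 := (@V0 R n delta).
Notation sqd := (@sqd R n delta).
Notation psi := (@psi R n delta).
Notation frame := (@frame R n delta).
Notation chart := (@chart R n delta).
Notation full := [set: 'I_n]%SET.

Variables (S : set V) (k : V -> 'I_n -> R) (Nf : V -> V -> V) (ef : V -> 'I_n -> V).
Hypotheses (S_hyp : embedded_hypersurface delta S)
  (hS : forall p, S p -> curvature_data delta S k p (Nf p) (ef p))
  (cS : compact S) (S0 : S !=set0) (S_conn : connected S).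
Variables (r : nat) (a b : R).
Hypotheses (hr : (1 < r <= n)%N) (hb : 0 < b)
  (Wk : forall p, S p -> 'C(n, r)%:R^-1 * esp (k p) full r = a * (n%:R^-1 * esp (k p) full 1) + b)
  (gc : forall p, S p -> gcone r full (k p)).
Notation Om := (bounded_domain delta S).
Notation Kd := (Kd delta S).
Notation nice := (nice delta S k Nf ef).
Let SM : S `<=` M := fun x Sx => S_M S_hyp Sx.

Lemma Kd_M x : Kd x -> M x.
Proof. by move=> [/Om_M|/SM]. Qed.

Lemma closed_Kd : closed Kd.
Proof. exact: (compact_closed (@norm_hausdorff _ _) (compact_Kd S_hyp cS S0)). Qed.

Lemma nice_K p E ta th u l Q y s : nice p E ta th u l Q -> en y < ta -> `|s| < th ->
  Kd (chart p E (Nf p p) y s) <-> u y <= s.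
Proof.
move=> g hy hs; split.
  by case=> [/(nice_Om g hy hs) /ltW //|/(nice_S g hy hs) ->].
rewrite le_eqVlt => /orP[/eqP h|h]; first by right; apply/(nice_S g hy hs).
by left; apply/(nice_Om g hy hs).
Qed.

Lemma nice_solution p E ta th u l Q : S p -> nice p E ta th u l Q -> solution delta r a b u l Q ta.
Proof.
move=> Sp g; have ta0 := nice_ta g; split=> //.
have e0 : en (0 : 'rV[R]_n) < ta by rewrite en0.
split; last exact: (nice_Qc g).
- move=> y hy; have [uy _] := nice_u g hy; have [A0 _] := nice_M g hy uy.
  have [q0 _] := nice_nu g hy; have [P [P1 P2]] := nice_P g hy.
  set x := chart p E (Nf p p) y (u y) in P2.
  set cc := _ / _ in P2.
  have c0 : 0 < cc by rewrite divr_gt0 ?invr_gt0 ?sqrtr_gt0.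
  have qc : Num.sqrt cc != 0 by rewrite gt_eqF // sqrtr_gt0.
  have qc2 : (Num.sqrt cc)^-1 * (Num.sqrt cc)^-1 = cc^-1 by rewrite -invfM -expr2 sqr_sqrtr // ltW.
  pose P' := (Num.sqrt cc)^-1 *: P.
  have E1 : P' *m P'^T = Gm delta y (u y) (l y).
    by rewrite /P' linearZ /= -scalemxAl -scalemxAr scalerA qc2 P1.
  have E2 : P' *m diag_mx (\row_i k x i) *m P'^T = Q y.
    rewrite /P' linearZ /= -!scalemxAl -scalemxAr scalerA qc2 P2 scalerA mulVf ?scale1r //.
    by rewrite gt_eqF.
  split; last 1 first.
  + by rewrite -E2 trmx_mul trmx_mul trmxK tr_diag_mx mulmxA.
  + have Sx : S x by apply/(nice_S g hy uy).
    rewrite -E1 -E2 /weingarten det_pencil_congr !coefCM !coef_prod_full !leq_subr leqnn subnn esp0.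
    have [r1 rn] := andP hr; have n1 : (1 <= n)%N by lia.
    rewrite !subKn //; have W := Wk Sx.
    set e1 := esp _ _ 1 in W *; set er := esp _ _ r in W *; set D := \det P' ^+ 2.
    transitivity (D * ('C(n, r)%:R^-1 * er - (a * (n%:R^-1 * e1) + b))); first by ring.
    by rewrite W subrr mulr0.
  + exact: (nice_T2 g).
- by have [_ cu] := nice_u g e0; split=> //; exact: nice_u0 g.
- by split; [exact: (nice_lc g) | exact: (nice_l0 g)].
Qed.

Lemma elliptic_bounds p : S p -> exists Fm FM eta : R, [/\ 0 < Fm,
  forall i, Fm <= elliptic_coef r a (k p) i <= FM, 0 < eta & eta * n%:R <= Fm / 2].
Proof.
move=> Sp; have F0 i : 0 < elliptic_coef r a (k p) i by exact: (gcone_elliptic i hr (gc Sp) hb (Wk Sp)).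
pose Fm := \big[Num.min/1]_i elliptic_coef r a (k p) i.
have Fm0 : 0 < Fm by apply: (big_ind (fun x => 0 < x)) => // x z x0 z0; rewrite lt_min x0.
exists Fm, (\sum_i elliptic_coef r a (k p) i), (Fm / (2 * n.+1%:R)); split=> //.
- move=> i; rewrite bigmin_le_cond //= (bigD1 i) //= lerDl sumr_ge0 // => j _; exact: ltW.
- by rewrite divr_gt0 // mulr_gt0.
have n0 : n.+1%:R != 0 :> R by rewrite pnatr_eq0.
rewrite mulrAC ler_pdivrMr ?mulr_gt0 // (_ : Fm / 2 * (2 * n.+1%:R) = Fm * n.+1%:R); last by field.
by rewrite ler_pM2l // ler_nat leqnSn.
Qed.

Variables (c w0 : V).
Hypotheses (Mc : M c) (Tw : TM c w0) (ww : ip w0 w0 = 1).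
Notation wv := (wv delta c w0).
Notation qf := (qf delta).
Notation ell := (ell delta c w0).
Notation refl := (refl delta c w0).
Notation lrefl := (lrefl delta c w0).

(** The closed form of the moving plane condition, stable under limits of [s]; [Good] is its open
    counterpart. *)
Definition weakP s := forall z, Kd z -> 0 < ell s z -> Kd (refl s z).
(** [S] and its mirror image are tangent at [refl s x], with their domains on the same side. *)
Definition Asym s x := S (refl s x) /\ Nf (refl s x) (refl s x) = lrefl s (Nf x x).

Lemma cont_lrefl s v : {for v, continuous (lrefl s)}.
Proof. exact: (D1_cont (D1_blin v (blin_lrefl delta c w0 s))). Qed.

Lemma cont_refl s x : {for x, continuous (refl s)}.
Proof.
have h := continuousD (D1_cst_cont (refl s 0) x) (cont_lrefl (s := s) (v := x)).
apply: cont_near h; apply: (@filterE _ (nbhs x)) => y.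
by rewrite -[in LHS](add0r y) reflD.
Qed.

Lemma cont_ell s x : {for x, continuous (ell s)}.
Proof.
have c1 : {for x, continuous (fun y : V => y - c)} := continuousB (@cvg_id _ _) (D1_cst_cont c x).
have c2 : {for x, continuous (fun y : V => ip (y - c) w0)} := cont_ip (delta := delta) c1 (D1_cst_cont w0 x).
have c3 : {for x, continuous (fun y : V => s * psi c y)} := continuousM (D1_cst_cont s x) (@cont_psi _ _ delta c x).
exact: (continuousB c2 c3).
Qed.

Section FixedPlane.
Variable s : R.
Hypotheses (q0 : 0 < qf s) (wP : weakP s).

(** The chart at [x1] uses the mirrored frame of [x2], so the reflection is the identity in
    coordinates and [S] and its image become graphs [u1], [u2] over the same ball. [weakP] orders
    them where [ell] is positive. *)
Lemma local_eq x1 x2 : S x1 -> S x2 -> refl s x1 = x2 -> Nf x2 x2 = lrefl s (Nf x1 x1) -> 0 <= ell s x1 ->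
  let E1 := fun i => lrefl s (ef x2 i) in
  exists t1 h1 u1 l1 Q1 t2 h2 u2 l2 Q2, [/\ frame x1 E1 (Nf x1 x1), nice x1 E1 t1 h1 u1 l1 Q1,
    nice x2 (ef x2) t2 h2 u2 l2 Q2 & exists2 t, 0 < t & forall y, en y < t -> u1 y = u2 y].
Proof.
move=> S1 S2 r12 N12 l0 E1.
have M1 := SM S1; have M2 := SM S2.
have r21 : refl s x2 = x1 by rewrite -r12 (reflK Mc Tw ww q0).
have N21 : lrefl s (Nf x2 x2) = Nf x1 x1 by rewrite N12 (lreflK Mc Tw ww q0).
have fr2 := frame_Nf S_hyp hS S2.
have fr1 : frame x1 E1 (Nf x1 x1).
  by have := frame_lrefl Mc Tw ww q0 M2 fr2; rewrite r21 N21.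
have [t1 [h1 [u1 [l1 [Q1 g1]]]]] := nice_graph S_hyp hS cS S0 S_conn S1 fr1.
have [t2 [h2 [u2 [l2 [Q2 g2]]]]] := nice_graph S_hyp hS cS S0 S_conn S2 fr2.
exists t1, h1, u1, l1, Q1, t2, h2, u2, l2, Q2; split=> //.
have chE y t : 0 < 1 + delta * (en y + t ^+ 2) ->
    refl s (chart x2 (ef x2) (Nf x2 x2) y t) = chart x1 E1 (Nf x1 x1) y t.
  by move=> h; rewrite (refl_chart Mc Tw ww q0 M2 fr2 h) r21 N21.
have chE' y t : 0 < 1 + delta * (en y + t ^+ 2) ->
    refl s (chart x1 E1 (Nf x1 x1) y t) = chart x2 (ef x2) (Nf x2 x2) y t.
  by move=> h; rewrite -chE // (reflK Mc Tw ww q0).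
have sol1 := nice_solution S1 g1; have sol2 := nice_solution S2 g2.
have Q20 := nice_Q0 g2 erefl.
pose th := Num.min h1 h2; have th0 : 0 < th by rewrite lt_min (nice_th g1) (nice_th g2).
have thE (x : R) : `|x| < th -> `|x| < h1 /\ `|x| < h2 by rewrite lt_min => /andP[].
have e1 : en (0 : 'rV[R]_n) < t1 by rewrite en0 (nice_ta g1).
have e2 : en (0 : 'rV[R]_n) < t2 by rewrite en0 (nice_ta g2).
have uth (u : 'rV[R]_n -> R) : {for 0, continuous u} -> u 0 = 0 -> \forall y \near (0 : 'rV[R]_n), `|u y| < th.
  move=> cu u00; have c2 : {for 0, continuous (fun y => `|u y|)} := continuous_comp cu (@norm_continuous _ _ _).
  by apply: (cvgr_lt _ c2); rewrite u00 normr0.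
have [_ cu1] := nice_u g1 e1; have [_ cu2] := nice_u g2 e2.
have n12 : \forall y \near (0 : 'rV[R]_n), [/\ en y < t1, en y < t2, `|u1 y| < th & `|u2 y| < th].
  apply: (@filterS2 _ (nbhs (0 : 'rV[R]_n)) _ _ _ _ _ (near_and (near_en e1) (near_en e2)) (near_and (uth _ cu1 (nice_u0 g1)) (uth _ cu2 (nice_u0 g2)))).
  by move=> y [? ?] [? ?].
(* below its own graph, a point of the first chart with positive height is sent into [Kd] *)
have le12 y : [/\ en y < t1, en y < t2, `|u1 y| < th & `|u2 y| < th] ->
    0 < ell s (chart x1 E1 (Nf x1 x1) y (u1 y)) -> u2 y <= u1 y.
  move=> [y1 y2 v1 v2] lp; have [v11 v12] := thE _ v1.
  have [A0 _] := nice_M g1 y1 v11.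
  have K1 : Kd (chart x1 E1 (Nf x1 x1) y (u1 y)) by apply/(nice_K g1 y1 v11).
  by have := wP K1 lp; rewrite chE' // => /(nice_K g2 y2 v12).
have le21 y : [/\ en y < t1, en y < t2, `|u1 y| < th & `|u2 y| < th] ->
    0 < ell s (chart x2 (ef x2) (Nf x2 x2) y (u2 y)) -> u1 y <= u2 y.
  move=> [y1 y2 v1 v2] lp; have [v21 v22] := thE _ v2.
  have [A0 _] := nice_M g2 y2 v22.
  have K1 : Kd (chart x2 (ef x2) (Nf x2 x2) y (u2 y)) by apply/(nice_K g2 y2 v22).
  by have := wP K1 lp; rewrite chE // => /(nice_K g1 y1 v21).
have [Fm [FM [eta [Fm0 FmM eta0 etan]]]] := elliptic_bounds S2.
have TD : T2 (fun y => u1 y - u2 y) 0 0 (Q1 0 - Q2 0).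
  by have := T2_sub (nice_T2 g1 e1) (nice_T2 g2 e2); rewrite (nice_l0 g1) (nice_l0 g2) subrr.
have D0 : u1 0 - u2 0 = 0 by rewrite (nice_u0 g1) (nice_u0 g2) subrr.
have [_ [hs1 _ _ _]] := sol1; have [_ [hs2 _ _ _]] := sol2.
have [W1 _ sy1] := hs1 0 e1; have [W2 _ sy2] := hs2 0 e2.
have G1 : Gm delta 0 (u1 0) (l1 0) = 1%:M.
  by rewrite (nice_u0 g1) (nice_l0 g1); apply/matrixP => i j; rewrite Gm0 mxE.
have G2_ : Gm delta 0 (u2 0) (l2 0) = 1%:M.
  by rewrite (nice_u0 g2) (nice_l0 g2); apply/matrixP => i j; rewrite Gm0 mxE.
have symD : (Q1 0 - Q2 0)^T = Q1 0 - Q2 0 by rewrite linearB /= sy1 sy2.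
move: l0; rewrite le_eqVlt => /orP[/eqP l0|l0].
(* Contact on the mirror: [ell] has the sign of [dot nu y] in the chart at [x2] and the opposite
   sign in the chart at [x1]. So the graphs are ordered on each half-ball, in opposite ways, and
   agree in between. *)
- have x12 : x1 = x2 by rewrite -r12 (refl_id (esym l0)).
  pose nu : 'rV[R]_n := \row_i (ip (ef x2 i) (wv s) / Num.sqrt (qf s)).
  have sq0 : 0 < Num.sqrt (qf s) by rewrite sqrtr_gt0.
  have ell2 : ell s x2 = 0 by rewrite -x12.
  have Twv := TM_wv Mc Tw M2 ell2.
  have Nw : ip (Nf x2 x2) (wv s) = 0.
    have := lrefl_wv Mc Tw ww q0 (Nf x2 x2); rewrite N21 x12; lra.
  have ellc y t : 0 < 1 + delta * (en y + t ^+ 2) -> exists2 m, 0 < m &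
      ell s (chart x2 (ef x2) (Nf x2 x2) y t) = m * dot nu y.
    move=> h; rewrite (chart_rho fr2) /SpaceForm.rho (slab_tan_ip fr2); set m := (Num.sqrt _)^-1.
    have m0 : 0 < m by rewrite invr_gt0 sqrtr_gt0.
    exists (m * Num.sqrt (qf s)); first exact: mulr_gt0.
    have E : ip (lin_comb (ef x2) y + t *: Nf x2 x2) (wv s) = Num.sqrt (qf s) * dot nu y.
      rewrite ipDl ipZl Nw mulr0 addr0 ip_lin /dot mulr_sumr; apply: eq_bigr => i _.
      by rewrite mxE; field; rewrite gt_eqF.
    have [d0|d0] := eqVneq delta 0.
      have m1 : m = 1 by rewrite /m d0 mul0r addr0 sqrtr1 invr1.
      by rewrite m1 scale1r ellD ell2 E; ring.
    have := ell_ip Mc Tw s M2 d0; rewrite ell2 => xw.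
    have -> : m *: (x2 + (lin_comb (ef x2) y + t *: Nf x2 x2)) = c + (m *: (x2 + (lin_comb (ef x2) y + t *: Nf x2 x2)) - c) by rewrite [RHS]addrC subrK.
    rewrite ellD ipDl ipNl (ip_cwv Mc Tw _ d0) ipZl [ip (x2 + _) _]ipDl -xw add0r E.
    by rewrite {1}/ell subrr ip0l psi_pp; ring.
  have nu1 : en nu = 1.
    have := frame_expand M2 fr2 (proj1 Twv); have [_ hw] := Twv.
    rewrite [ip _ x2]ipC hw scale0r addr0 [ip (wv s) _]ipC Nw scale0r addr0 => Ew.
    have qE := wv_ip Mc Tw ww s; rewrite {1}Ew ip_suml in qE.
    rewrite /en /dot (eq_bigr (fun i => ip (ip (wv s) (ef x2 i) *: ef x2 i) (wv s) / qf s)) => [|i _].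
      by rewrite -mulr_suml qE divff // gt_eqF.
    rewrite mxE ipZl [ip (wv s) _]ipC -[in RHS](sqr_sqrtr (ltW q0)); field; by rewrite gt_eqF.
  have ell1 y t : 0 < 1 + delta * (en y + t ^+ 2) -> exists2 m, 0 < m &
      ell s (chart x1 E1 (Nf x1 x1) y t) = - (m * dot nu y).
    by move=> h; have [m m0 e] := ellc y t h; exists m => //; rewrite -chE // (ell_refl Mc Tw ww q0) e.
  have [tn tn0 Htn] := near_en0 n12.
  have side y : en y < tn -> 0 < dot nu y -> 0 <= u2 y - u1 y.
    move=> hy dy; have [y1 y2 v1 v2] := Htn y hy; rewrite subr_ge0; apply: le21 => //.
    have [_ v22] := thE _ v2; have [A0 _] := nice_M g2 y2 v22.
    by have [m m0 ->] := ellc _ _ A0; rewrite mulr_gt0.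
  have side' y : en y < tn -> dot nu y < 0 -> 0 <= u1 y - u2 y.
    move=> hy dy; have [y1 y2 v1 v2] := Htn y hy; rewrite subr_ge0; apply: le12 => //.
    have [v11 _] := thE _ v1; have [A0 _] := nice_M g1 y1 v11.
    by have [m m0 ->] := ell1 _ _ A0; rewrite oppr_gt0 pmulr_rlt0.
  have flat y : en y < tn -> dot nu y = 0 -> u1 y = u2 y.
    move=> hy dy; have [y1 y2 v1 v2] := Htn y hy.
    have [v11 v12] := thE _ v1; have [A0 _] := nice_M g1 y1 v11.
    have Sx : S (chart x1 E1 (Nf x1 x1) y (u1 y)) by apply/(nice_S g1 y1 v11).
    have [m m0 el] := ell1 _ _ A0; rewrite dy mulr0 oppr0 in el.
    have := chE' _ _ A0; rewrite (refl_id el) => E.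
    by rewrite E in Sx; apply/(nice_S g2 y2 v12).
  have small_line (v : 'rV[R]_n) : exists2 t0, 0 < t0 & forall t, 0 < t < t0 -> en (t *: v) < tn.
    have v0 : 0 < en v + 1 by have := en_ge0 v; lra.
    exists (Num.min 1 (tn / (en v + 1))); first by rewrite lt_min ltr01 divr_gt0.
    move=> t /andP[t0]; rewrite lt_min => /andP[ta]; rewrite ltr_pdivlMr // => tb.
    rewrite enZ; have := en_ge0 v; nra.
  have TDN : T2 (fun y => u2 y - u1 y) 0 0 (Q2 0 - Q1 0).
    by have := T2_sub (nice_T2 g2 e2) (nice_T2 g1 e1); rewrite (nice_l0 g1) (nice_l0 g2) subrr.
  have D0N : u2 0 - u1 0 = 0 by rewrite (nice_u0 g1) (nice_u0 g2) subrr.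
  have pos v : 0 < dot nu v -> 0 <= quad (Q2 0 - Q1 0) v.
    move=> dv; apply: (T2_half TDN D0N); have [t0 t00 Ht] := small_line v; exists t0 => // t ht.
    by apply: side; [exact: Ht | rewrite dotZr mulr_gt0 //; case/andP: ht].
  have neg v : dot nu v < 0 -> 0 <= quad (Q1 0 - Q2 0) v.
    move=> dv; apply: (T2_half TD D0); have [t0 t00 Ht] := small_line v; exists t0 => // t ht.
    by apply: side'; [exact: Ht | rewrite dotZr pmulr_rlt0 //; case/andP: ht].
  have zer v : dot nu v = 0 -> quad (Q1 0 - Q2 0) v = 0.
    move=> dv; have [t0 t00 Ht] := small_line v; apply/eqP; rewrite eq_le; apply/andP; split.
      rewrite -oppr_ge0; have -> : - quad (Q1 0 - Q2 0) v = quad (Q2 0 - Q1 0) v by rewrite -[Q2 0 - Q1 0]opprB /quad mulmxN mulNmx [RHS]mxE.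
      apply: (T2_half TDN D0N); exists t0 => // t ht; rewrite flat ?subrr //; [exact: Ht | by rewrite dotZr dv mulr0].
    apply: (T2_half TD D0); exists t0 => // t ht; rewrite flat ?subrr //; [exact: Ht | by rewrite dotZr dv mulr0].
  have qN v : quad (Q2 0 - Q1 0) v = - quad (Q1 0 - Q2 0) v by rewrite -[Q2 0 - Q1 0]opprB /quad mulmxN mulNmx [LHS]mxE.
  have qv (v : 'rV[R]_n) : quad (Q1 0 - Q2 0) (- v) = quad (Q1 0 - Q2 0) v by rewrite -[- v]scaleN1r quadZ sqrrN expr1n mul1r.
  (* The order of the graphs switches with the sign of [dot nu v] while quadratic forms are even, so
     the Hessians agree. [compare] needs their common value, and [smp_boundary] the vanishing of the
     expansion at 0. *)
  have q_v v : quad (Q1 0 - Q2 0) v = 0.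
    have [dv|dv|dv] := ltgtP (dot nu v) 0; last exact: zer.
      have h1_ := neg v dv; have := pos (- v); rewrite dotNr oppr_gt0 qN qv => /(_ dv); lra.
    have := pos v dv; rewrite qN => h1_; have := neg (- v); rewrite dotNr oppr_lt0 qv => /(_ dv); lra.
  have QQ : Q1 0 - Q2 0 = 0 by exact: quad_eq0.
  have Q10 : Q1 0 = diag_mx (\row_i k x2 i) by rewrite -Q20; apply/eqP; rewrite -subr_eq0 QQ.
  have [C C0 HC] := compare hr sol1 sol2 Q10 Q20; have [te te0 He] := HC _ eta0.
  pose t := Num.min tn te; have t0 : 0 < t by rewrite lt_min tn0.
  have tE (y : 'rV[R]_n) : en y < t -> en y < tn /\ en y < te by rewrite lt_min => /andP[].
  have cuD y : en y < t -> {for y, continuous (fun y => u1 y - u2 y)}.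
    move=> /tE [/Htn [y1 y2 _ _] _]; have [_ k1] := nice_u g1 y1; have [_ k2] := nice_u g2 y2.
    exact: (continuousB k1 k2).
  exists t => // y hy; have [hn he] := tE y hy.
  rewrite QQ in TD.
  have [dv|dv|dv] := ltgtP (dot nu y) 0; last exact: flat.
    have nuN : en (- nu) = 1 by rewrite enN.
    apply/eqP; rewrite -subr_eq0; apply/eqP.
    apply: (smp_boundary Fm0 FmM (ltW eta0) etan C0 nuN cuD _ _ _ TD hy).
    - by move=> z /tE [_ /He h] _; exact: h.
    - by move=> z /tE [zn _]; rewrite dotNl oppr_gt0; exact: side'.
    - by move=> z /tE [zn _]; rewrite dotNl => /eqP; rewrite oppr_eq0 => /eqP /(flat _ zn) ->; rewrite subrr.
    - by rewrite dotNl oppr_gt0.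
  have TN : T2 (fun y => - (u1 y - u2 y)) 0 0 0.
    move=> e ep; have [d dp H] := TD _ ep; exists d => // h /H.
    by rewrite -normrN; congr (`|_| <= _); rewrite /quad !mulmx0 !mul0mx mxE; have -> : dot 0 h = 0 by [rewrite /dot big1 // => i _; rewrite mxE mul0r]; ring.
  have cuN z : en z < t -> {for z, continuous (fun y => - (u1 y - u2 y))} by move=> /cuD h; exact: (continuousN h).
  have : - (u1 y - u2 y) = 0.
    apply: (smp_boundary Fm0 FmM (ltW eta0) etan C0 nu1 cuN _ _ _ TN hy dv).
    - by move=> z /tE [_ /He h] _; exact: elliptic_atN h.
    - by move=> z /tE [zn _]; rewrite opprB; exact: side.
    - by move=> z /tE [zn _] /(flat _ zn) ->; rewrite subrr oppr0.
  by move=> /eqP; rewrite oppr_eq0 subr_eq0 => /eqP.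
have cel : {for 0, continuous (fun y => ell s (chart x1 E1 (Nf x1 x1) y (u1 y)))}.
  have [v1 _] := nice_u g1 e1; have [A0 _] := nice_M g1 e1 v1.
  have cch := cont_chart (a := id) (b := u1) M1 fr1 (@cvg_id _ _) cu1 A0.
  exact: (continuous_comp cch (cont_ell (s := s) (x := chart x1 E1 (Nf x1 x1) 0 (u1 0)))).
have nel : \forall y \near (0 : 'rV[R]_n), 0 < ell s (chart x1 E1 (Nf x1 x1) y (u1 y)).
  by apply: (cvgr_gt _ cel); rewrite (nice_chart0 fr1 g1).
have [tn tn0 Htn] := near_en0 (near_and n12 nel).
have side y : en y < tn -> 0 <= u1 y - u2 y.
  by move=> /Htn [h lp]; rewrite subr_ge0; exact: le12.
have psd v : 0 <= quad (Q1 0 - Q2 0) v.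
  apply: (T2_half TD D0); have v0 : 0 < en v + 1 by have := en_ge0 v; lra.
  exists (Num.min 1 (tn / (en v + 1))); first by rewrite lt_min ltr01 divr_gt0.
  move=> t /andP[t0]; rewrite lt_min => /andP[ta]; rewrite ltr_pdivlMr // => tb.
  apply: side; rewrite enZ; have := en_ge0 v; nra.
(* Contact off the mirror: the graphs are ordered on a full ball, so the difference of the Hessians
   is semidefinite and [weingarten_touch] annihilates it. *)
have QQ : Q1 0 - Q2 0 = 0.
  rewrite G1 in W1; rewrite G2_ Q20 in W2.
  apply: (weingarten_touch hr (gc S2) _ W2 _ _ symD) => //.
    by move=> i; have /andP[h _] := FmM i; exact: lt_le_trans h.
  by rewrite -Q20 addrC subrK.
have Q10 : Q1 0 = diag_mx (\row_i k x2 i) by rewrite -Q20; apply/eqP; rewrite -subr_eq0 QQ.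
have [C C0 HC] := compare hr sol1 sol2 Q10 Q20; have [te te0 He] := HC _ eta0.
pose t := Num.min tn te; have t0 : 0 < t by rewrite lt_min tn0.
exists (t / 16); first by rewrite divr_gt0.
move=> y hy; apply/eqP; rewrite -subr_eq0; apply/eqP.
have H1 (z : 'rV[R]_n) : en (z - 0) < t -> elliptic_at (elliptic_coef r a (k x2)) eta C
    (fun y => u1 y - u2 y) (fun y => l1 y - l2 y) (fun y => Q1 y - Q2 y) z.
  by rewrite subr0 lt_min => /andP[_ /He].
have H2 (z : 'rV[R]_n) : en (z - 0) < t -> 0 <= u1 z - u2 z.
  by rewrite subr0 lt_min => /andP[/side].
have hy' : en (y - 0) < t / 16 by rewrite subr0.
exact: (smp_interior Fm0 FmM (ltW eta0) etan C0 H1 H2 D0 hy').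
Qed.

(** Equal graphs have equal gradients ([T2_grad0]), and [nice_nu] computes the normals from them;
    hence the normals also correspond under the reflection. *)
Lemma sym_near x1 x2 : S x1 -> S x2 -> refl s x1 = x2 -> Nf x2 x2 = lrefl s (Nf x1 x1) -> 0 <= ell s x1 ->
  (\forall z \near x1, S z -> Asym s z) /\ (\forall z \near x2, S z -> Asym s z).
Proof.
move=> S1 S2 r12 N12 l0; have M1 := SM S1; have M2 := SM S2.
have r21 : refl s x2 = x1 by rewrite -r12 (reflK Mc Tw ww q0).
have N21 : lrefl s (Nf x2 x2) = Nf x1 x1 by rewrite N12 (lreflK Mc Tw ww q0).
have fr2 := frame_Nf S_hyp hS S2.
have [t1 [h1 [u1 [l1 [Q1 [t2 [h2 [u2 [l2 [Q2 [fr1 g1 g2 [t t0 Ht]]]]]]]]]]]] := local_eq S1 S2 r12 N12 l0.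
set E1 := fun i => lrefl s (ef x2 i) in fr1 g1.
pose tt := Num.min t (Num.min t1 t2).
have tt0 : 0 < tt by rewrite !lt_min t0 (nice_ta g1) (nice_ta g2).
have lE y : en y < tt -> l1 y = l2 y.
  rewrite !lt_min => /andP[yt /andP[y1 y2]].
  have h := T2_grad0 (T2_sub (nice_T2 g1 y1) (nice_T2 g2 y2)).
  apply/eqP; rewrite -subr_eq0; apply/eqP; apply: h.
  by apply: (@filterS _ (nbhs y) _ _ _ _ (near_en yt)) => z /Ht ->; rewrite subrr.
have chE y v : 0 < 1 + delta * (en y + v ^+ 2) ->
    refl s (chart x2 (ef x2) (Nf x2 x2) y v) = chart x1 E1 (Nf x1 x1) y v.
  by move=> h; rewrite (refl_chart Mc Tw ww q0 M2 fr2 h) r21 N21.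
(* The normals of [nice_nu] contain a multiple of the base point, on which [lrefl] and [refl] agree
   if [delta != 0]; the multiple is zero if [delta = 0]. *)
have dx : forall be : R, (delta * be) *: lrefl s x2 = (delta * be) *: x1.
  move=> be; have [->|d0] := eqVneq delta 0; first by rewrite !mul0r !scale0r.
  by rewrite -r21 (refl_lin Mc Tw s M2 d0).
have NE y : en y < tt -> let z2 := chart x2 (ef x2) (Nf x2 x2) y (u2 y) in let z1 := chart x1 E1 (Nf x1 x1) y (u1 y) in
   [/\ S z1, S z2, refl s z2 = z1 & Nf z1 z1 = lrefl s (Nf z2 z2)].
  move=> hy z2 z1; have lEy := lE _ hy; move: hy; rewrite !lt_min => /andP[yt /andP[y1 y2]].
  have uE := Ht _ yt; have [v1 _] := nice_u g1 y1; have [v2 _] := nice_u g2 y2.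
  have [A0 _] := nice_M g2 y2 v2; split; [exact/(nice_S g1 y1 v1) | exact/(nice_S g2 y2 v2) | |].
    by rewrite /z2 chE // -uE.
  have [_ n1] := nice_nu g1 y1; have [_ n2] := nice_nu g2 y2.
  rewrite /z1 n1 /z2 n2 lEy uE lreflZ !lreflD lreflN lreflZ dx N21; congr (_ *: (_ - _ + _)).
  by rewrite /lin_comb lrefl_sum; apply: eq_bigr => i _; rewrite lreflZ.
have hh0 : 0 < Num.min h1 h2 by rewrite lt_min (nice_th g1) (nice_th g2).
split.
  apply: (@filterS _ (nbhs x1) _ _ _ _ (near_chart M1 fr1 tt0 hh0)) => z hz Sz.
  have [y [v [hy]]] := hz (SM Sz); rewrite lt_min => /andP[v1 v2] zE.
  have := hy; rewrite !lt_min => /andP[_ /andP[y1 y2]].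
  have vE : v = u1 y by apply/(nice_S g1 y1 v1); rewrite -zE.
  have [_ Sz2 rz Nz] := NE y hy; rewrite vE in zE; rewrite -zE in rz Nz.
  by rewrite /Asym -rz (reflK Mc Tw ww q0); split=> //; rewrite rz Nz (lreflK Mc Tw ww q0).
apply: (@filterS _ (nbhs x2) _ _ _ _ (near_chart M2 fr2 tt0 hh0)) => z hz Sz.
have [y [v [hy]]] := hz (SM Sz); rewrite lt_min => /andP[v1 v2] zE.
have := hy; rewrite !lt_min => /andP[_ /andP[y1 y2]].
have vE : v = u2 y by apply/(nice_S g2 y2 v2); rewrite -zE.
have [Sz1 _ rz Nz] := NE y hy; rewrite vE in zE; rewrite -zE in rz Nz.
by rewrite /Asym rz; split.
Qed.

(** Openness is [sym_near]; a contact point with negative [ell] is treated through its mirror image,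
    where [ell] is positive. The complement is open since [S] is closed and the normals are
    continuous. *)
Lemma sym_all : (exists2 x, S x & Asym s x) -> forall x, S x -> Asym s x.
Proof.
move=> ex; apply: (conn_ind S_conn ex).
  move=> x Sx [Sr Nr]; have [l0|l0] := leP 0 (ell s x).
    by have [h _] := sym_near Sx Sr erefl Nr l0.
  have rr : refl s (refl s x) = x by rewrite (reflK Mc Tw ww q0).
  have N2 : Nf x x = lrefl s (Nf (refl s x) (refl s x)) by rewrite Nr (lreflK Mc Tw ww q0).
  have l1 : 0 <= ell s (refl s x) by rewrite (ell_refl Mc Tw ww q0) oppr_ge0 ltW.
  by have [_ h] := sym_near Sr Sx rr N2 l1.
move=> x Sx nA; have cr := cont_refl (s := s) (x := x).
have [Sr|Sr] := pselect (S (refl s x)); last first.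
  have H : nbhs x [set z | ~ S (refl s z)] := cr _ (near_notS cS Sr).
  by apply: (@filterS _ (nbhs x) _ _ _ _ H) => z hz _ [].
have H1 := Nf_near S_hyp hS cS S0 S_conn Sx.
have H2 : nbhs x [set z | S (refl s z) -> Nf (refl s x) (refl s z) = Nf (refl s z) (refl s z)] :=
  cr _ (Nf_near S_hyp hS cS S0 S_conn Sr).
have cN1 : {for x, continuous (Nf x)} by have [h _ _ _ _] := hS Sx; exact: D1_cont (nbhs_singleton (smooth_D1 h)).
have cN2 : {for refl s x, continuous (Nf (refl s x))} by have [h _ _ _ _] := hS Sr; exact: D1_cont (nbhs_singleton (smooth_D1 h)).
have c1 : {for x, continuous (fun z => lrefl s (Nf x z))} := continuous_comp cN1 (cont_lrefl (s := s) (v := Nf x x)).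
have c2 : {for x, continuous (fun z => Nf (refl s x) (refl s z))} := continuous_comp cr cN2.
have c3 : {for x, continuous (fun z => Nf (refl s x) (refl s z) - lrefl s (Nf x z))} := continuousB c2 c1.
have c4 : {for x, continuous (fun z => `|Nf (refl s x) (refl s z) - lrefl s (Nf x z)|)} := continuous_comp c3 (@norm_continuous _ _ _).
have H3 : \forall z \near x, 0 < `|Nf (refl s x) (refl s z) - lrefl s (Nf x z)|.
  apply: (cvgr_gt _ c4); rewrite normr_gt0 subr_eq0; apply/eqP => h; apply: nA; split=> //.
apply: (@filterS3 _ (nbhs x) _ _ _ _ _ _ H1 H2 H3) => z h1 h2 h3 Sz [Sz2 Nz].
by move: h3; rewrite (h2 Sz2) (h1 Sz) Nz subrr normr0 ltxx.
Qed.

End FixedPlane.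
End Symmetry.

(** * Moving planes *)

Section MovingPlanes.
Context (R : realType) (n : nat) (delta : R).
Notation V := 'rV[R]_n.+2.
Notation ip := (@lip R n delta).
Notation M := (@space_form R n delta).
Notation TM := (@TM R n delta).
Notation V0 := (@V0 R n delta).
Notation sqd := (@sqd R n delta).
Notation psi := (@psi R n delta).
Notation full := [set: 'I_n]%SET.

Variables (S : set V) (k : V -> 'I_n -> R) (Nf : V -> V -> V) (ef : V -> 'I_n -> V).
Hypotheses (S_hyp : embedded_hypersurface delta S)
  (hS : forall p, S p -> curvature_data delta S k p (Nf p) (ef p))
  (cS : compact S) (S0 : S !=set0) (S_conn : connected S).
Variables (r : nat) (a b : R).
Hypotheses (hr : (1 < r <= n)%N) (hb : 0 < b)
  (Wk : forall p, S p -> 'C(n, r)%:R^-1 * esp (k p) full r = a * (n%:R^-1 * esp (k p) full 1) + b)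
  (gc : forall p, S p -> gcone r full (k p)).
Notation Om := (bounded_domain delta S).
Notation Kd := (Kd delta S).
Let SM : S `<=` M := fun x Sx => S_M S_hyp Sx.

Variable c : V.
Hypotheses (Mc : M c) (psic : forall x, S x -> 0 < psi c x)
  (circ : forall c' d, V0 c' -> (delta != 0 -> delta * ip c' c' = 1) -> (delta < 0 -> 0 < c' 0 ord0) ->
   (forall x, S x -> sqd c' x < d) -> forall x, S x -> sqd c x < d).

Lemma cont_coord (T : topologicalType) (g : T -> V) (t : T) :
  {for t, continuous g} -> {for t, continuous (fun p => g p 0 ord0)}.
Proof.
move=> cg; have h : {for g t, continuous (fun v : V => v 0 ord0)} by exact: coord_continuous.
exact: (continuous_comp cg h).
Qed.

Lemma Om_near z : Om z -> \forall w \near z, M w -> Om w.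
Proof.
move=> Oz; have h := near_joined cS (Om_M Oz) (Om_S Oz).
by apply: (@filterS _ (nbhs z) _ _ _ _ h) => w hw Mw; exact: joined_domain (hw Mw) Oz.
Qed.

Lemma psi_Kd z : Kd z -> 0 < psi c z.
Proof.
case=> [Oz|]; last exact: psic.
have [x Sx Hx] := cmax S0 cS (@cont_sqd _ _ delta c).
have h := domain_sqd cS S0 SM Mc Hx Oz.
have [d0|d0] := leP delta 0; first exact: (psi_neg_gt0 d0 Mc (Om_M Oz)).
have := psic Sx; rewrite (psi_sqd Mc (SM Sx)) (psi_sqd Mc (Om_M Oz)); nra.
Qed.

Section Direction.
Variable w0 : V.
Hypotheses (Tw : TM c w0) (ww : ip w0 w0 = 1).
Notation wv := (wv delta c w0).
Notation qf := (qf delta).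
Notation ell := (ell delta c w0).
Notation refl := (refl delta c w0).
Notation lrefl := (lrefl delta c w0).
Notation weakP := (weakP delta S c w0).
Notation Asym := (Asym delta S Nf c w0).

(** The point [c' = rho c (s *: w0)] is on the mirror. By [sqd_rho] it is strictly closer than [c]
    to the points with [0 <= ell]; symmetry, which fixes [c'], extends the bound to all of [S],
    against the choice of [c]. *)
Lemma sym_contra s : 0 < s -> 0 < qf s -> (forall x, S x -> S (refl s x)) -> False.
Proof.
move=> s0 q0 hsym; have [xm Sxm Hd] := cmax S0 cS (@cont_sqd _ _ delta c); set d := sqd c xm in Hd.
have Ts : TM c (s *: w0) := TMZ s Tw.
have iw : ip (s *: w0) (s *: w0) = s ^+ 2 by rewrite !ipL ww; ring.
have h1 : 0 < 1 + delta * ip (s *: w0) (s *: w0) by rewrite iw.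
pose c' := rho delta c (s *: w0).
have m0 : 0 < (Num.sqrt (1 + delta * ip (s *: w0) (s *: w0)))^-1 by rewrite invr_gt0 sqrtr_gt0.
have m2 : (Num.sqrt (1 + delta * ip (s *: w0) (s *: w0)))^-1 ^+ 2 * (1 + delta * ip (s *: w0) (s *: w0)) = 1.
  by rewrite exprVn sqr_sqrtr ?(ltW h1) // mulVf // gt_eqF.
have lt_pos x : S x -> 0 <= ell s x -> sqd x c' < d.
  move=> Sx l0; apply: lt_le_trans (Hd _ Sx); rewrite sqdC -subr_lt0.
  have := sqd_rho (SM Sx) Mc Ts h1; rewrite /= -/c' iw [sqd x c]sqdC.
  set m := (Num.sqrt _)^-1 in m0 m2 *; move: m0; rewrite -/m => m0.
  have -> : ip (s *: w0) (x - c) = s * (ell s x + s * psi c x).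
    by rewrite ipZl [ip w0 _]ipC /Reflections.ell; ring.
  have mp : 0 < (Num.sqrt (1 + delta * s ^+ 2))^-1 by rewrite invr_gt0 sqrtr_gt0.
  move: mp; set mm := (Num.sqrt _)^-1 => mp E.
  have px := psic Sx.
  rewrite [sqd c' x]sqdC -(pmulr_rlt0 _ (_ : 0 < 1 + mm)); last by lra.
  rewrite E; have -> : 2 * mm * (mm * s ^+ 2 * psi c x - (1 + mm) * (s * (ell s x + s * psi c x))) =
     - (2 * mm * s * (s * psi c x + (1 + mm) * ell s x)) by ring.
  rewrite oppr_lt0 !mulr_gt0 // ltr_pwDl ?mulr_gt0 // mulr_ge0 //; lra.
have c'r : refl s c' = c' by apply: refl_id; exact: ell_mid.
suff : sqd c xm < d by rewrite ltxx.
apply: (circ (c' := c') (d := d)) => // [||| x Sx].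
- by apply: V0Z; apply: V0D; [exact: M_V0 | apply: V0Z; case: Tw].
- move=> d0; have [_ pw] := Ts; move: m2; rewrite /c' /SpaceForm.rho; move: (Num.sqrt _)^-1 => m m2.
  rewrite ipZl ipZr -m2 ipDl !ipDr [ip (s *: w0) c]ipC.
  transitivity (m ^+ 2 * (delta * ip c c + 2 * (delta * ip c (s *: w0)) + delta * ip (s *: w0) (s *: w0))); first by ring.
  by rewrite pw (M_ip1 Mc d0) mulr0 addr0.
- move=> dn; have Mc' : M c' by apply: M_rho => // dp; have := lt_trans dn dp; rewrite ltxx.
  by apply: (M_pos Mc'); rewrite lt_eqF.
- rewrite sqdC; have [l0|l0] := leP 0 (ell s x); first exact: lt_pos.
  rewrite -(refl_sqd Mc Tw ww q0) c'r; apply: lt_pos; first exact: hsym.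
  by rewrite (ell_refl Mc Tw ww q0) oppr_ge0 ltW.
Qed.

Lemma no_Asym s : 0 < s -> 0 < qf s -> weakP s -> forall x, S x -> ~ Asym s x.
Proof.
move=> s0 q0 wP x Sx Ax; apply: (sym_contra s0 q0) => y Sy.
by have [] := sym_all S_hyp hS cS S0 S_conn hr hb Wk gc Mc Tw ww q0 wP (ex_intro2 _ _ x Sx Ax) Sy.
Qed.

Lemma right_of_near (P : set R) : nbhs (0 : R) P -> exists2 d, 0 < d & forall t, 0 < t < d -> P t.
Proof.
move=> /nbhs_normP[d /= d0 Hd]; exists d => // t /andP[t0 td]; apply: Hd.
by rewrite /= sub0r normrN gtr0_norm.
Qed.

Lemma reflE s x : refl s x = refl s 0 + lrefl s x.
Proof. by rewrite -reflD add0r. Qed.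

(** An infinitesimal test of [weakP] at a contact: a curve leaving [z] along [v] enters the domain
    with [0 < ell], so its image stays in [Kd]. A negative normal component at [refl s z] would take
    it out at once. *)
Lemma inward s z v : 0 < qf s -> weakP s -> S z -> S (refl s z) -> TM z v -> 0 < ip v (Nf z z) ->
  0 < ell s z \/ (ell s z = 0 /\ 0 < ip v (wv s)) ->
  0 <= ip (lrefl s v) (Nf (refl s z) (refl s z)).
Proof.
move=> q0 wP Sz S2 Tv vN hl; rewrite leNgt; apply/negP => neg.
have Mz := SM Sz; have M2 := SM S2.
have [f1 [D1f _ T1 f1N side1]] := defining_side S_hyp hS cS S0 S_conn Sz.
have [f2 [D2f _ T2_ f2N side2]] := defining_side S_hyp hS cS S0 S_conn S2.
have [g [sg Mg g0 gv]] := proj2 (tangentP v Mz) Tv.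
have dg : D1 g 0 (fun h => 'D_h g 0) := D1_diff (nbhs_singleton sg [::]).
have cg : {for 0, continuous g} := D1_cont dg.
have dv : 'D_1 g 0 = v by rewrite -derive1E.
have e1 : D1 (fun t => f1 (g t)) 0 (fun h => 'D_('D_h g 0) f1 z).
  by apply: (D1_comp dg); rewrite g0; exact: nbhs_singleton D1f.
have p1 : 0 < 'D_('D_1 g 0) f1 z by rewrite dv T1 // mulr_gt0.
have [d1 d10 H1] := deriv_pos e1 p1.
have [_ f1z] := nbhs_singleton side1 Mz; have {}f1z : f1 z = 0 by apply/f1z.
have [_ f2z] := nbhs_singleton side2 M2; have {}f2z : f2 (refl s z) = 0 by apply/f2z.
have eL : D1 (fun t => refl s 0 + lrefl s (g t)) 0 (fun h => 0 + lrefl s ('D_h g 0)).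
  exact: (D1_add (D1_cst (refl s 0) (0 : R)) (D1_comp dg (D1_blin (g 0) (blin_lrefl delta c w0 s)))).
have e2 : D1 (fun t => f2 (refl s 0 + lrefl s (g t))) 0 (fun h => 'D_(0 + lrefl s ('D_h g 0)) f2 (refl s z)).
  by apply: (D1_comp eL); rewrite g0 -reflE; exact: nbhs_singleton D2f.
have bN : blin (fun x : R => - x).
  split=> [u x y|]; first by rewrite opprD scalerN.
  by exists 1 => // h; rewrite normrN mul1r.
have e3 := D1_comp e2 (D1_blin _ bN).
have p3 : 0 < - 'D_(0 + lrefl s ('D_1 g 0)) f2 (refl s z).
  rewrite add0r dv T2_; last exact: (TM_lrefl Mc Tw ww q0 Mz Tv).
  by rewrite -mulNr mulr_gt0 // oppr_gt0.
have [d2 d20 H2] := deriv_pos e3 p3.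
have [d3 d30 H3] : exists2 d, 0 < d & forall t, 0 < t < d -> 0 < ell s (g t).
  have ellE x : ell s x = ell s 0 + ip x (wv s) by rewrite -ellD add0r.
  case: hl => [lp|[l0 vw]].
    have ce : {for 0, continuous (fun t => ell s (g t))}.
      by apply: (continuous_comp cg); exact: (cont_ell (s := s) (x := g 0)).
    by apply: right_of_near; apply: (cvgr_gt _ ce); rewrite g0.
  have e4 := D1_add (D1_cst (ell s 0) (0 : R)) (D1_bil (bbil_lip n delta) dg (D1_cst (wv s) (0 : R))).
  have p4 : 0 < 0 + (ip ('D_1 g 0) (wv s) + ip (g 0) 0) by rewrite dv ip0r addr0 add0r.
  have [d d0 H] := deriv_pos e4 p4; exists d => // t ht; have := H t ht.
  by rewrite -!ellE g0 l0.
have n1 : \forall t \near (0 : R), M (g t) -> (Om (g t) <-> 0 < f1 (g t)) /\ (S (g t) <-> f1 (g t) = 0).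
  by rewrite -g0 in side1; exact: (cg _ side1).
have n2 : \forall t \near (0 : R), M (refl s (g t)) -> (Om (refl s (g t)) <-> 0 < f2 (refl s (g t))) /\ (S (refl s (g t)) <-> f2 (refl s (g t)) = 0).
  have cr : {for 0, continuous (fun t => refl s (g t))}.
    by apply: (continuous_comp cg); exact: (cont_refl (s := s) (x := g 0)).
  by rewrite -g0 in side2; exact: (cr _ side2).
have [d4 d40 H4] := right_of_near (near_and Mg (near_and n1 n2)).
pose t := Num.min (Num.min d1 d2) (Num.min d3 d4) / 2.
have m0 : 0 < Num.min (Num.min d1 d2) (Num.min d3 d4) by rewrite !lt_min d10 d20 d30 d40.
have t0 : 0 < t by rewrite divr_gt0.
have : t < Num.min (Num.min d1 d2) (Num.min d3 d4) by rewrite /t; lra.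
rewrite !lt_min => /andP[/andP[t1 t2] /andP[t3 t4]].
have [Mt [s1 s2]] := H4 t (introT andP (conj t0 t4)).
have l1 := H3 t (introT andP (conj t0 t3)).
have k1 := H1 t (introT andP (conj t0 t1)); rewrite g0 f1z in k1.
have k2 := H2 t (introT andP (conj t0 t2)); rewrite -!reflE g0 f2z oppr0 in k2.
have Ot : Om (g t) by apply/(proj1 (s1 Mt)).
have Kr := wP _ (or_introl Ot) l1.
have [k3 k4] := s2 (Kd_M S_hyp Kr); rewrite oppr_gt0 in k2.
by case: Kr => [/k3 h|/k4 h]; [have := lt_trans h k2; rewrite ltxx | rewrite h ltxx in k2].
Qed.

(** The strict condition: reflected points are interior, and [S] is nowhere orthogonal to the mirror
    along their intersection. The second clause is what survives a small change of [s] near the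
    mirror. *)
Definition Good s := (forall z, Kd z -> 0 < ell s z -> Om (refl s z)) /\
  (forall z, S z -> ell s z = 0 -> ip (Nf z z) (wv s) < 0).

(** For [delta < 0], [0 <= ell s z] means [s <= <lg c z, w0>]. Cauchy-Schwarz bounds [s ^+ 2] by
    [|lg c z|^2], and [1 + delta * |lg c z|^2 = psi^-2] is positive. *)
Lemma ell_qf s z : 0 < s -> Kd z -> 0 <= ell s z -> 0 < qf s.
Proof.
move=> s0 Kz l0; have Mz := Kd_M S_hyp Kz; have p0 := psi_Kd Kz.
have [d0|d0] := leP 0 delta; first by rewrite /qf ltr_pwDl // mulr_ge0 // sqr_ge0.
have pn : psi c z != 0 by rewrite gt_eqF.
have cs_ := tangent_cs Mc (lg_TM Mc Mz pn) Tw; rewrite ww mulr1 in cs_.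
have lgi := lg_ip Mc Mz pn.
have cw : ip c w0 = 0 by apply: (mulfI (ltr0_neq0 d0)); rewrite mulr0; case: Tw.
have E : ell s z = psi c z * (ip (lg delta c z) w0 - s).
  rewrite /Reflections.ell /lg !ipDl !ipNl ipZl cw; field; exact: pn.
have sl : s <= ip (lg delta c z) w0 by move: l0; rewrite E pmulr_rge0 // subr_ge0.
have ip0 : 0 < (psi c z)^-2 by rewrite invr_gt0 exprn_gt0.
rewrite /qf; apply: (lt_le_trans ip0); rewrite -lgi lerD2l ler_nM2l //.
by apply: le_trans cs_; rewrite ler_sqr ?nnegrE ?(le_trans (ltW s0) sl) // ltW.
Qed.

(** [inward] is applied to the difference [v] between the normal [N] at [z] and the reflected normal
    at the contact. If their product [ka] were less than 1, [v] would be inward and its image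
    outward; so [ka >= 1], the unit vectors coincide, and [no_Asym] excludes this. *)
Lemma Om_S_ s z : 0 < qf s -> 0 < s -> weakP s -> S z -> S (refl s z) -> 0 < ell s z -> False.
Proof.
move=> q0 s0 wP Sz S2 lp; have Mz := SM Sz; have M2 := SM S2.
have [_ TN _ _ NN] := frame_Nf S_hyp hS Sz; have [_ TN2 _ _ NN2] := frame_Nf S_hyp hS S2.
set N := Nf z z in TN NN; set N2 := Nf _ _ in TN2 NN2.
have TL : TM z (lrefl s N2) by have := TM_lrefl Mc Tw ww q0 M2 TN2; rewrite (reflK Mc Tw ww q0).
have Tv : TM z (N - lrefl s N2) by rewrite -scaleN1r; apply: TMD => //; exact: TMZ.
set ka := ip (lrefl s N2) N.
have vN : ip (N - lrefl s N2) N = 1 - ka by rewrite ipDl ipNl NN.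
have LL : ip (lrefl s N2) (lrefl s N2) = 1 by rewrite (lrefl_ip Mc Tw ww q0).
have ka1 : 1 <= ka.
  rewrite leNgt; apply/negP => k1.
  have vp : 0 < ip (N - lrefl s N2) (Nf z z) by rewrite vN subr_gt0.
  have := inward q0 wP Sz S2 Tv vp (or_introl lp).
  rewrite lreflD lreflN (lreflK Mc Tw ww q0) ipDl ipNl -/N2 NN2.
  have -> : ip (lrefl s N) N2 = ka by rewrite /ka -(lrefl_ip Mc Tw ww q0) (lreflK Mc Tw ww q0) ipC.
  lra.
have vv : ip (N - lrefl s N2) (N - lrefl s N2) = 2 - 2 * ka.
  by rewrite ipDr ipNr vN ipDl ipNl LL [ip N _]ipC -/ka; ring.
have [v0 vz] := tangent_pos Mz Tv.
have /eqP : N - lrefl s N2 = 0 by apply: vz; rewrite vv; rewrite vv in v0; lra.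
rewrite subr_eq0 => /eqP NE; apply: (no_Asym s0 q0 wP Sz); split=> //.
by rewrite -/N NE (lreflK Mc Tw ww q0).
Qed.

(** Near [refl s z], every point is the reflection of a point of the domain near [z], hence in [Kd],
    which [not_interior] forbids at a point of [S]. *)
Lemma Om_refl_int s z : 0 < qf s -> weakP s -> Om z -> 0 < ell s z -> S (refl s z) -> False.
Proof.
move=> q0 wP Oz lp S2; apply: (not_interior S_hyp hS cS S0 S_conn S2).
have cr := cont_refl (delta := delta) (c := c) (w0 := w0) (s := s) (x := refl s z).
have rr : refl s (refl s z) = z by rewrite (reflK Mc Tw ww q0).
have n1 : \forall w \near refl s z, M (refl s w) -> Om (refl s w).
  by have h := Om_near Oz; rewrite -rr in h; exact: (cr _ h).
have n2 : \forall w \near refl s z, 0 < ell s (refl s w).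
  have ce : {for refl s z, continuous (fun w => ell s (refl s w))}.
    by apply: (continuous_comp cr); exact: (cont_ell (s := s) (x := refl s (refl s z))).
  by apply: (cvgr_gt _ ce); rewrite rr.
have n3 : \forall w \near refl s z, delta != 0 -> 0 < refl s w 0 ord0.
  have [d0|d0] := eqVneq delta 0; first by apply: (@filterE _ (nbhs (refl s z))).
  have c1 : {for refl s z, continuous (fun w => refl s w 0 ord0)}.
    exact: (cont_coord cr).
  have h : \forall w \near refl s z, 0 < refl s w 0 ord0.
    by apply: (cvgr_gt _ c1); rewrite rr; exact: (M_pos (Om_M Oz) d0).
  by apply: (@filterS _ (nbhs (refl s z)) _ _ _ _ h).
apply: (@filterS3 _ (nbhs (refl s z)) _ _ _ _ _ _ n1 n2 n3) => w h1 h2 h3 Mw.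
have Mr : M (refl s w) := M_refl Mc Tw ww q0 Mw h3.
by have := wP _ (or_introl (h1 Mr)) h2; rewrite (reflK Mc Tw ww q0).
Qed.

(** Contacts off the mirror fall under the two preceding lemmas. On the mirror, a zero product would
    be a symmetric contact, and a positive one contradicts [inward] for [wv s], which the reflection
    reverses. *)
Lemma closed_step s : 0 < s -> weakP s -> Good s.
Proof.
move=> s0 wP; split=> [z Kz lp|z Sz l0].
  have q0 := ell_qf s0 Kz (ltW lp).
  case: (wP _ Kz lp) => // S2; case: Kz => [Oz|Sz].
    by have := Om_refl_int q0 wP Oz lp S2.
  by have := Om_S_ q0 s0 wP Sz S2 lp.
have q0 : 0 < qf s by apply: (ell_qf s0 (or_intror Sz : Kd z)); rewrite l0.
have Mz := SM Sz; have rz : refl s z = z := refl_id l0.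
have S2 : S (refl s z) by rewrite rz.
have Tv := TM_wv Mc Tw Mz l0.
rewrite ltNge; apply/negP; rewrite le_eqVlt => /orP[/eqP Nw|Nw].
  apply: (no_Asym s0 q0 wP Sz); split=> //.
  by rewrite rz /Reflections.lrefl -Nw mulr0 mul0r scale0r subr0.
have vp : 0 < ip (wv s) (Nf z z) by rewrite ipC.
have wp : 0 < ip (wv s) (wv s) by rewrite (wv_ip Mc Tw ww).
have := inward q0 wP Sz S2 Tv vp (or_intror (conj l0 wp)).
have -> : lrefl s (wv s) = - wv s.
  rewrite /Reflections.lrefl (wv_ip Mc Tw ww) mulfK ?gt_eqF // -{1}[wv s]scale1r -scalerBl.
  by rewrite (_ : 1 - 2 = -1 :> R) ?scaleN1r //; lra.
by rewrite ipNl rz oppr_ge0 leNgt vp.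
Qed.

Lemma cont_qf s : {for s, continuous qf}.
Proof.
have h : {for s, continuous (fun t : R => 1 + delta * (t * t))}.
  exact: (continuousD (D1_cst_cont (1 : R) s) (continuousM (D1_cst_cont delta s) (continuousM (@cvg_id _ _) (@cvg_id _ _)))).
by apply: cont_near h; apply: (@filterE _ (nbhs s)) => t; rewrite /Reflections.qf expr2.
Qed.

Lemma cont_wv s : {for s, continuous wv}.
Proof.
have h : {for s, continuous (fun t : R => t * delta)} := continuousM (@cvg_id _ _) (D1_cst_cont delta s).
have h2 : {for s, continuous (fun t : R => (t * delta) *: c)} := cvgZ h (D1_cst_cont c s).
have h3 : {for s, continuous (fun t : R => w0 - (t * delta) *: c)}.
  by apply: continuousB; [exact: D1_cst_cont | exact: h2].
exact: h3.
Qed.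

Section Joint.
Variables (T : topologicalType) (xf : T -> V) (sf : T -> R) (t : T).
Hypotheses (cx : {for t, continuous xf}) (cs : {for t, continuous sf}).

Lemma cont_ell2 : {for t, continuous (fun p => ell (sf p) (xf p))}.
Proof.
have c1 : {for t, continuous (fun p => xf p - c)} := continuousB cx (D1_cst_cont c t).
have c2 : {for t, continuous (fun p => ip (xf p - c) w0)} := cont_ip (delta := delta) c1 (D1_cst_cont w0 t).
have c3 : {for t, continuous (fun p => psi c (xf p))} by apply: (continuous_comp cx); exact: (@cont_psi _ _ delta c (xf t)).
exact: (continuousB c2 (continuousM cs c3)).
Qed.

Lemma cont_refl2 : 0 < qf (sf t) -> {for t, continuous (fun p => refl (sf p) (xf p))}.
Proof.
move=> q0; have ce := cont_ell2.
have cq : {for t, continuous (fun p => qf (sf p))} by apply: (continuous_comp cs); exact: (@cont_qf (sf t)).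
have cw : {for t, continuous (fun p => wv (sf p))} by apply: (continuous_comp cs); exact: (@cont_wv (sf t)).
have cv : {for t, continuous (fun p => (qf (sf p))^-1)} by apply: continuousV => //; rewrite gt_eqF.
have ck : {for t, continuous (fun p => 2 * ell (sf p) (xf p) / qf (sf p))}.
  exact: (continuousM (continuousM (D1_cst_cont (2 : R) t) ce) cv).
have cz : {for t, continuous (fun p => (2 * ell (sf p) (xf p) / qf (sf p)) *: wv (sf p))} := cvgZ ck cw.
have h3 : {for t, continuous (fun p => xf p - (2 * ell (sf p) (xf p) / qf (sf p)) *: wv (sf p))}.
  by apply: continuousB; [exact: cx | exact: cz].
exact: h3.
Qed.
End Joint.

Lemma weak_limit s : 0 < qf s -> (\forall t \near s, s < t -> Good t) -> weakP s.
Proof.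
move=> q0 hG z Kz lp.
have cr : {for s, continuous (fun t => refl t z)} := cont_refl2 (D1_cst_cont z s) (@cvg_id _ _) q0.
have cl : {for s, continuous (fun t => ell t z)} := cont_ell2 (D1_cst_cont z s) (@cvg_id _ _).
have nl : \forall t \near s, 0 < ell t z by apply: (cvgr_gt _ cl); exact: lp.
have h : \forall t \near s^'+, Kd (refl t z).
  have h1 : \forall t \near s^'+, s < t -> Good t  by apply: cvg_within; exact: hG.
  have h2 : \forall t \near s^'+, 0 < ell t z  by apply: cvg_within; exact: nl.
  have h3 : \forall t \near s^'+, s < t  by exact: nbhs_right_gt.
  apply: (@filterS3 _ (s^'+) _ _ _ _ _ _ h1 h2 h3) => t e1 e2 e3.
  by left; have [g1 _] := e1 e3; exact: g1.
exact: (closed_cvg Kd (closed_Kd S_hyp cS S0) h _ (cvg_at_right_filter cr)).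
Qed.

Lemma segment_mono (f : V -> R) z d x u :
  (forall y, `|z - y| < d -> D1 f y (fun v => 'D_v f y) /\ 0 < 'D_u f y) ->
  `|z - x| < d -> `|z - (x + u)| < d -> f x < f (x + u).
Proof.
move=> H zx zu.
have seg (t : R) : 0 <= t <= 1 -> `|z - (x + t *: u)| < d.
  move=> /andP[t0 t1].
  have -> : z - (x + t *: u) = (1 - t) *: (z - x) + t *: (z - (x + u)) by apply/rowP => i; rewrite !mxE; ring.
  apply: le_lt_trans (ler_normD _ _) _; rewrite !normrZ (ger0_norm t0) ger0_norm ?subr_ge0 //.
  have [t10|t10] := eqVneq t 1; first by rewrite t10 subrr mul0r add0r mul1r.
  have tl : 0 < 1 - t by rewrite subr_gt0 lt_neqAle t10.
  have h1 : (1 - t) * `|z - x| < (1 - t) * d by rewrite ltr_pM2l.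
  have h2 : t * `|z - (x + u)| <= t * d by rewrite ler_wpM2l // ltW.
  lra.
pose phi (t : R) := f (x + t *: u); pose dphi (t : R) := 'D_u f (x + t *: u).
have dph (t : R) : 0 <= t <= 1 -> is_derive t 1 phi (dphi t).
  move=> /seg /H [fx _].
  have e0 : D1 (fun t : R => x + t *: u) t (fun h => 0 + ((h * 1) *: u + t *: 0)).
    exact: (D1_add (D1_cst x t) (D1_bil (bbil_scale V) (D1_real (is_derive_id t 1)) (D1_cst u t))).
  by have := D1_is_derive (1 : R) (D1_comp e0 fx); rewrite mulr1 scale1r scaler0 addr0 add0r.
have hm1 (t : R) : t \in `]0, 1[%R -> is_derive t 1 phi (dphi t).
  by rewrite in_itv /= => /andP[h1 h2]; apply: dph; rewrite !ltW.
have hm2 : {within `[0, 1], continuous phi}.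
  apply: continuous_in_subspaceT => t /set_mem /=; rewrite in_itv /= => /dph [h1 _].
  exact/differentiable_continuous/derivable1_diffP.
have [t] := MVT ltr01 hm1 hm2; rewrite in_itv /= => /andP[c1 c2] hE.
have -> : f x = phi 0 by rewrite /phi scale0r addr0.
have -> : f (x + u) = phi 1 by rewrite /phi scale1r.
rewrite -subr_gt0 hE subr0 mulr1.
by have [] : D1 f (x + t *: u) (fun v => 'D_v f (x + t *: u)) /\ 0 < 'D_u f (x + t *: u) by apply: H; apply: seg; rewrite !ltW.
Qed.

(** The condition is localized at pairs of a point and a parameter, and compactness of [Kd] makes
    the neighbourhood of [s] uniform. Off the mirror, or in the open domain, strict conditions
    persist by continuity. *)
Lemma open_step s : Good s -> (forall z, Kd z -> 0 <= ell s z -> 0 < qf s) -> \forall t \near s, Good t.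
Proof.
move=> [g1 g2] hq; have cK := compact_Kd S_hyp cS S0.
pose PP (t : R) (z : V) := Kd z -> (0 < ell t z -> Om (refl t z)) /\ (S z -> ell t z = 0 -> ip (Nf z z) (wv t) < 0).
suff key : forall z, Kd z -> \forall p \near ((z, s) : V * R), PP p.2 p.1.
  have H : \forall t \near s, Kd `<=` PP t by exact: (proj1 (compact_near_coveringP Kd) cK R (nbhs s) PP _ key).
  apply: (@filterS _ (nbhs s) _ _ _ _ H) => t ht; split=> [z Kz lp | z Sz l0].
    by have [h _] := ht z Kz Kz; exact: h.
  by have [_ h] := ht z (or_intror Sz) (or_intror Sz); exact: h.
move=> z Kz; have Mz := Kd_M S_hyp Kz; pose p0 : V * R := (z, s).
have c1 : {for p0, continuous (fun p : V * R => p.1)}  by exact: cvg_fst.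
have c2 : {for p0, continuous (fun p : V * R => p.2)}  by exact: cvg_snd.
have cE : {for p0, continuous (fun p : V * R => ell p.2 p.1)} := cont_ell2 c1 c2.
have nO : 0 < qf s -> Om (refl s z) -> \forall p \near p0, Kd p.1 -> Om (refl p.2 p.1).
  move=> q0 O; have cR : {for p0, continuous (fun p : V * R => refl p.2 p.1)} := cont_refl2 c1 c2 q0.
  have n1 : \forall p \near p0, M (refl p.2 p.1) -> Om (refl p.2 p.1) := cR _ (Om_near O).
  have n2 : \forall p \near p0, delta != 0 -> 0 < refl p.2 p.1 0 ord0.
    have [e0|d0] := eqVneq delta 0; first by apply: (@filterE _ (nbhs p0)).
    have ci : {for p0, continuous (fun p : V * R => refl p.2 p.1 0 ord0)}.
      exact: (cont_coord cR).
    have h : \forall p \near p0, 0 < refl p.2 p.1 0 ord0 by apply: (cvgr_gt _ ci); exact: (M_pos (Om_M O) d0).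
    by apply: (@filterS _ (nbhs p0) _ _ _ _ h).
  have cq : {for p0, continuous (fun p : V * R => qf p.2)} by apply: (continuous_comp c2); exact: (@cont_qf s).
  have n3 : \forall p \near p0, 0 < qf p.2 by apply: (cvgr_gt _ cq); exact: q0.
  apply: (@filterS3 _ (nbhs p0) _ _ _ _ _ _ n1 n2 n3) => p h1 h2 h3 Kp; apply: h1.
  exact: (M_refl Mc Tw ww h3 (Kd_M S_hyp Kp) h2).
have [ln|lp|l0] := ltgtP (ell s z) 0.
- have h : \forall p \near p0, ell p.2 p.1 < 0 by apply: (cvgr_lt _ cE); exact: ln.
  apply: (@filterS _ (nbhs p0) _ _ _ _ h) => p hp _; split=> [lp|_ le]; last by rewrite le ltxx in hp.
  by have := lt_trans lp hp; rewrite ltxx.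
- have h : \forall p \near p0, 0 < ell p.2 p.1 by apply: (cvgr_gt _ cE); exact: lp.
  apply: (@filterS2 _ (nbhs p0) _ _ _ _ _ h (nO (hq _ Kz (ltW lp)) (g1 _ Kz lp))) => p h1 h2 Kp.
  by split=> [_|_ le]; [exact: h2 | rewrite le ltxx in h1].
have q0 : 0 < qf s by apply: (hq _ Kz); rewrite l0.
have rz : refl s z = z := refl_id l0.
case: Kz => [Oz|Sz].
  have O : Om (refl s z) by rewrite rz.
  have h : \forall p \near p0, M p.1 -> Om p.1 := c1 _ (Om_near Oz).
  apply: (@filterS2 _ (nbhs p0) _ _ _ _ _ h (nO q0 O)) => p h1 h2 Kp; split=> [_|Sp]; first exact: h2.
  by have := Om_S (h1 (SM Sp)).
(* Near a point of [S] on the mirror, [f] decreases along [wv] by the second clause of [Good]. The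
   reflection moves a point with positive [ell] along [- wv], so [f] increases and the image is in
   the domain. *)
have [f [D1f cf T1 fN side]] := defining_side S_hyp hS cS S0 S_conn Sz.
have cW : {for p0, continuous (fun p : V * R => wv p.2)} by apply: (continuous_comp c2); exact: (@cont_wv s).
have cD : {for p0, continuous (fun p : V * R => 'D_(wv p.2) f p.1)}.
  exact: (cont_derive (w := fun p : V * R => wv p.2) (xf := fun p : V * R => p.1) (t := p0) D1f cf cW c1).
have Twv := TM_wv Mc Tw Mz l0.
have ng := g2 _ Sz l0.
have nD : \forall p \near p0, 'D_(wv p.2) f p.1 < 0.
  by apply: (cvgr_lt _ cD); rewrite /= T1 // pmulr_llt0 // ipC.
have nD1 : \forall p \near p0, D1 f p.1 (fun v => 'D_v f p.1) := c1 _ D1f.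
have [[A B] /= [nA nB] AB] := near_and nD nD1.
have /nbhs_normP[d /= d0 Hd] := nA.
have cR : {for p0, continuous (fun p : V * R => refl p.2 p.1)} := cont_refl2 c1 c2 q0.
have nbd : \forall y \near z, `|z - y| < d by apply/nbhs_normP; exists d.
have m1 : \forall p \near p0, `|z - p.1| < d := c1 _ nbd.
have m2 : \forall p \near p0, `|z - refl p.2 p.1| < d.
  by have h := nbd; rewrite -{1}rz in h; exact: (cR _ h).
have m3 : \forall p \near p0, B p.2 := c2 _ nB.
have m4 : \forall p \near p0, M p.1 -> (Om p.1 <-> 0 < f p.1) /\ (S p.1 <-> f p.1 = 0) := c1 _ side.
have m5 : \forall p \near p0, M (refl p.2 p.1) -> (Om (refl p.2 p.1) <-> 0 < f (refl p.2 p.1)) /\ (S (refl p.2 p.1) <-> f (refl p.2 p.1) = 0).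
  by have h := side; rewrite -{1}rz in h; exact: (cR _ h).
have m6 : \forall p \near p0, delta != 0 -> 0 < refl p.2 p.1 0 ord0.
  have [e0|dn] := eqVneq delta 0; first by apply: (@filterE _ (nbhs p0)).
  have ci : {for p0, continuous (fun p : V * R => refl p.2 p.1 0 ord0)}.
    exact: (cont_coord cR).
  have h : \forall p \near p0, 0 < refl p.2 p.1 0 ord0.
    by apply: (cvgr_gt _ ci); rewrite /= rz; exact: (M_pos Mz dn).
  by apply: (@filterS _ (nbhs p0) _ _ _ _ h).
have cq : {for p0, continuous (fun p : V * R => qf p.2)} by apply: (continuous_comp c2); exact: (@cont_qf s).
have m7 : \forall p \near p0, 0 < qf p.2 by apply: (cvgr_gt _ cq); exact: q0.
have m8 : \forall p \near p0, S p.1 -> Nf z p.1 = Nf p.1 p.1 := c1 _ (Nf_near S_hyp hS cS S0 S_conn Sz).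
have cN : {for z, continuous (Nf z)} by have [h _ _ _ _] := hS Sz; exact: D1_cont (nbhs_singleton (smooth_D1 h)).
have cN2 : {for p0, continuous (fun p : V * R => Nf z p.1)} by apply: (continuous_comp c1); exact: cN.
have m9 : \forall p \near p0, ip (Nf z p.1) (wv p.2) < 0.
  exact: (cvgr_lt _ (cont_ip (delta := delta) cN2 cW)).
have mm := near_and (near_and (near_and m1 m2) (near_and m3 m4)) (near_and (near_and m5 m6) (near_and m7 (near_and m8 m9))).
apply: (@filterS _ (nbhs p0) _ _ _ _ mm) => -[x t] /= [[[h1 h2] [h3 h4]] [[h5 h6] [h7 [h8 h9]]]] Kx.
split=> [lx|Sx _]; last by rewrite -h8.
have Mx := Kd_M S_hyp Kx; have My := M_refl Mc Tw ww h7 Mx h6.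
have [i1 i2] := h4 Mx; have [i3 _] := h5 My; apply/i3.
have fx : 0 <= f x by case: Kx => [/i1 /ltW //|/i2 ->].
apply: (le_lt_trans fx).
pose ka := 2 * ell t x / qf t; have ka0 : 0 < ka by rewrite divr_gt0 // mulr_gt0.
have rE : refl t x = x + (- ka) *: wv t by rewrite scaleNr.
rewrite rE; apply: (@segment_mono f z d); rewrite -?rE //.
move=> y zy; have Ay : A y by exact: Hd.
have [e1 e2] := AB (y, t) (conj Ay h3); split=> //.
have [bl _] := e2; rewrite (blin_scale _ _ bl) -[_ *: _]/(- ka * _) mulNr oppr_gt0 pmulr_rlt0 //.
Qed.

(** Propagation down from a parameter [s1] at which the mirror misses [Kd]. The failure of the
    property at a parameter is shown to be open: at the end of an interval of good parameters,
    [weak_limit] and [closed_step] recover [Good]. *)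
Lemma Good_all s : 0 < s -> Good s.
Proof.
move=> s0; have Kn : Kd !=set0 by have [x Sx] := S0; exists x; right.
have cK := compact_Kd S_hyp cS S0.
have cp : continuous (fun z : V => - psi c z).
  by move=> x; exact: (continuousN (@cont_psi _ _ delta c x)).
have [zm Km Hm] := cmax Kn cK cp.
have ci : continuous (fun z : V => ip (z - c) w0).
  move=> x; have h : {for x, continuous (fun y : V => y - c)} := continuousB (@cvg_id _ _) (D1_cst_cont c x).
  exact: (cont_ip (delta := delta) h (D1_cst_cont w0 x)).
have [zB KB HB] := cmax Kn cK ci.
have pm := psi_Kd Km.
(* Beyond [b0], [t * psi c z] exceeds [ip (z - c) w0] on all of [Kd], since [psi c zm] is the
   minimum of [psi c] there. *)
pose b0 := (`|ip (zB - c) w0| + 1) / psi c zm; pose s1 := Num.max s b0.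
have ss1 : s <= s1 by rewrite le_max lexx.
have bs1 : b0 <= s1 by rewrite le_max lexx orbT.
have vac t : s1 <= t -> forall z, Kd z -> ell t z < 0.
  move=> st z Kz; rewrite /Reflections.ell subr_lt0; apply: (le_lt_trans (HB _ Kz)).
  have h1 : b0 * psi c zm = `|ip (zB - c) w0| + 1 by rewrite /b0 divfK // gt_eqF.
  have h2 : psi c zm <= psi c z by have := Hm _ Kz; rewrite lerN2.
  have h3 : b0 * psi c zm <= t * psi c zm by rewrite ler_pM2r // (le_trans bs1).
  have t0 : 0 < t by lra.
  have h4 : t * psi c zm <= t * psi c z by rewrite ler_pM2l.
  have := ler_norm (ip (zB - c) w0); lra.
have Gv t : s1 <= t -> Good t.
  move=> st; split=> [z Kz lp|z Sz le]; first by have := lt_trans lp (vac _ st _ Kz); rewrite ltxx.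
  by have := vac _ st _ (or_intror Sz : Kd z); rewrite le ltxx.
(* The property of [t] is that [Good] holds on the whole of [[t, s1]], so that a failure at [v > t]
   is inherited by the parameters near [t]. *)
suff H : forall t, `[s, s1]%classic t -> forall u, t <= u <= s1 -> Good u.
  by apply: (H s); rewrite ?lexx //= in_itv /= lexx.
apply: (conn_ind (@segment_connected R s s1)).
- exists s1; first by rewrite /= in_itv /= ss1 lexx.
  by move=> u /andP[h _]; exact: Gv.
- move=> t; rewrite /= in_itv /= => /andP[t1 t2] Ht.
  have t0 : 0 < t by exact: lt_le_trans t1.
  have Gt : Good t by apply: Ht; rewrite lexx.
  have no := open_step Gt (fun z Kz l0 => ell_qf t0 Kz l0).
  have /nbhs_normP[d /= d0 Hd] := no; apply/nbhs_normP; exists d => // u /= tu _ v /andP[uv v1].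
  have [tv|vt] := leP t v; first by apply: Ht; rewrite tv.
  apply: Hd => /=; move: tu; rewrite !gtr0_norm ?subr_gt0 //; last exact: le_lt_trans vt.
  lra.
move=> t; rewrite /= in_itv /= => /andP[t1 t2] nt.
have t0 : 0 < t by exact: lt_le_trans t1.
have [[v /andP[tv v1] nv]|hv] := pselect (exists2 v, t < v <= s1 & ~ Good v).
  have h : \forall u \near t, u < v by apply: (cvgr_lt _ (@cvg_id _ _)); exact: tv.
  apply: (@filterS _ (nbhs t) _ _ _ _ h) => u uv _ Hu; apply: nv; apply: Hu.
  by rewrite (ltW uv).
have Ga v : t < v -> Good v.
  move=> tv; have [vs|sv] := leP s1 v; first exact: Gv.
  by apply: contrapT => nv; apply: hv; exists v => //; rewrite tv ltW.
exfalso; apply: nt => u /andP[tu us]; move: tu; rewrite le_eqVlt => /orP[/eqP <-|]; last exact: Ga.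
apply: (closed_step t0) => z Kz lz.
apply: (weak_limit (ell_qf t0 Kz (ltW lz)) _ Kz lz).
by apply: (@filterE _ (nbhs t)) => v; exact: Ga.
Qed.

Lemma weakP0 : weakP 0.
Proof.
apply: weak_limit; first by rewrite /Reflections.qf expr0n mulr0 addr0.
by apply: (@filterE _ (nbhs (0 : R))) => t; exact: Good_all.
Qed.

End Direction.

(** For [x] and [y] at the same distance from [c], [x - y] is tangent at [c], and the mirror through
    [c] orthogonal to it exchanges them, with [x] on its positive side. *)
Lemma Kd_sym x y : Kd x -> M y -> sqd c y = sqd c x -> Kd y.
Proof.
move=> Kx My H; have [->//|ne] := eqVneq y x.
have Mx := Kd_M S_hyp Kx; have [p0 pz] := sqd_ge0 Mx My.
have p1 : 0 < sqd x y.
  by rewrite lt_neqAle p0 andbT eq_sym; apply/eqP => /pz yx; rewrite yx eqxx in ne.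
pose l := Num.sqrt (sqd x y); have l0 : 0 < l by rewrite sqrtr_gt0.
have l2 : l ^+ 2 = sqd x y by rewrite sqr_sqrtr.
have dd : ip (x - y) (x - y) = l ^+ 2 by rewrite l2.
have Txy : TM c (x - y).
  split; first by apply: V0D; [exact: M_V0 | apply: V0N; exact: M_V0].
  have := psi_sqd Mc Mx; rewrite -H -(psi_sqd Mc My) !psiE // => e.
  by rewrite ipDr ipNr mulrDr mulrN ![ip c _]ipC; lra.
have xc : ip (x - c) (x - y) = l ^+ 2 / 2.
  move: H dd; rewrite /SpaceForm.sqd !ipL [ip x c]ipC [ip y c]ipC [ip y x]ipC; lra.
move: l0 {l2} dd xc; move: l => l l0 dd xc.
pose w0 := l^-1 *: (x - y).
have Tw : TM c w0 := TMZ l^-1 Txy.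
have ww : ip w0 w0 = 1 by rewrite /w0 ipZl ipZr dd; field; rewrite gt_eqF.
have le : ell delta c w0 0 x = l / 2.
  by rewrite /Reflections.ell mul0r subr0 /w0 ipZr xc; field; rewrite gt_eqF.
have lp : 0 < ell delta c w0 0 x by rewrite le divr_gt0.
have := weakP0 Tw ww Kx lp.
have -> // : refl delta c w0 0 x = y.
rewrite /Reflections.refl le /Reflections.qf /Reflections.wv expr0n /= mulr0 addr0 mul0r scale0r subr0 /w0 scalerA.
rewrite (_ : _ * _ = 1); last by field; rewrite gt_eqF.
by rewrite scale1r opprB addrC subrK.
Qed.

(** If [sqd c] took two values on [S], it would take all values in between by connectedness. By
    [Kd_sym] the spheres in between would lie in [Kd], so some point of [S] would be interior to
    [Kd]. *)
Lemma round : exists d, [/\ 0 < d, 0 < delta -> delta * d < 2 & forall x, S x <-> M x /\ sqd c x = d].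
Proof.
have [x0 Sx0] := S0; have M0 := SM Sx0; pose d := sqd c x0.
have ivt x1 x2 u : S x1 -> S x2 -> sqd c x1 < u -> u < sqd c x2 -> exists2 x, S x & sqd c x = u.
  move=> S1 S2 u1 u2; apply: contrapT => nx.
  have : sqd c x2 < u; last by move=> h; have := lt_trans h u2; rewrite ltxx.
  apply: (conn_ind (P := fun x => sqd c x < u) S_conn) S2; first by exists x1.
    move=> x _ xu; have h : \forall y \near x, sqd c y < u by apply: (cvgr_lt _ (@cont_sqd _ _ delta c x)); exact: xu.
    by apply: (@filterS _ (nbhs x) _ _ _ _ h).
  move=> x Sx /negP; rewrite -leNgt le_eqVlt => /orP[/eqP ux|ux]; first by case: nx; exists x.
  have h : \forall y \near x, u < sqd c y by apply: (cvgr_gt _ (@cont_sqd _ _ delta c x)); exact: ux.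
  by apply: (@filterS _ (nbhs x) _ _ _ _ h) => y uy _ yu; have := lt_trans uy yu; rewrite ltxx.
have cst x1 x2 : S x1 -> S x2 -> ~ sqd c x1 < sqd c x2.
  move=> S1 S2 h12.
  have [||x Sx xu] := @ivt x1 x2 ((sqd c x1 + sqd c x2) / 2) S1 S2; [lra | lra |].
  apply: (not_interior S_hyp hS cS S0 S_conn Sx).
  have n1 : \forall y \near x, sqd c x1 < sqd c y.
    by apply: (cvgr_gt _ (@cont_sqd _ _ delta c x)); rewrite xu; lra.
  have n2 : \forall y \near x, sqd c y < sqd c x2.
    by apply: (cvgr_lt _ (@cont_sqd _ _ delta c x)); rewrite xu; lra.
  apply: (@filterS2 _ (nbhs x) _ _ _ _ _ n1 n2) => y y1 y2 My.
  have [z Sz zy] := ivt x1 x2 _ S1 S2 y1 y2.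
  exact: (Kd_sym (or_intror Sz) My).
have Sd x : S x -> sqd c x = d.
  by move=> Sx; have [h|h|//] := ltgtP (sqd c x) d; have := cst _ _ Sx Sx0; have := cst _ _ Sx0 Sx.
exists d; split.
- have [h _] := sqd_ge0 Mc M0; rewrite lt_neqAle h andbT eq_sym; apply/eqP => dz.
  have [_ TN _ _ NN] := frame_Nf S_hyp hS Sx0.
  have [_ _ _ Hc] := inner_Nf hS Sx0.
  have [t Ot] : exists t, Om (arc delta x0 (Nf x0 x0) 1 t).
    apply: (@filter_ex _ (0 : R)^'+); exact: (Hc _ (arc_curve M0 TN NN)).
  have hd x : S x -> sqd c x <= d by move=> /Sd ->.
  have := domain_sqd cS S0 SM Mc hd Ot; have [h2 _] := sqd_ge0 Mc (Om_M Ot).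
  by rewrite dz ltNge h2.
- by move=> dp; have := psic Sx0; rewrite (psi_sqd Mc M0) -/d; lra.
move=> x; split=> [Sx|[Mx xd]]; first by split; [exact: SM | exact: Sd].
case: (Kd_sym (or_intror Sx0) Mx xd) => // Ox.
have hd y : S y -> sqd c y <= d by move=> /Sd ->.
by have := domain_sqd cS S0 SM Mc hd Ox; rewrite xd ltxx.
Qed.

End MovingPlanes.

Lemma esp_1 (R : realType) (T : finType) (k : T -> R) : esp k [set: T]%SET 1 = \sum_i k i.
Proof.
rewrite /esp (eq_bigl (fun I : {set T} => I \in [set [set i]%SET | i in T]%SET)) => [|I].
  rewrite big_imset /=; last by move=> i j _ _; exact: finset.set1_inj.
  by apply: eq_bigr => i _; rewrite big_set1.
rewrite finset.subsetT /=; apply/cards1P/imsetP => [[i ->]|[i _ ->]]; first by exists i.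
by exists i.
Qed.

Theorem theorem1p2 (R : realType) (n r : nat) (hn : (2 <= n)%N)
    (hr : (2 <= r <= n)%N) (delta : R) (S : set 'rV[R]_n.+2)
    (S_hyp : embedded_hypersurface delta S) (S_nonempty : S !=set0)
    (S_closed : compact S) (S_connected : connected S)
    (k : 'rV[R]_n.+2 -> 'I_n -> R)
    (hk : forall p, S p -> principal_curvatures delta S p (k p))
    (Hr_gt0 : forall p, S p -> 0 < higher_mean_curvature r (k p))
    (a b : R) (ha : 0 <= a) (hb : 0 < b)
    (Hr_eq : forall p, S p ->
       higher_mean_curvature r (k p) = a * mean_curvature (k p) + b) :
  exists (p : 'rV[R]_n.+2) (rho : R),
    [/\ space_form delta p, 0 < rho & S = geodesic_sphere delta p rho].
Proof.
have [r1 rn] := andP hr.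
have /choice [Ne hNe] : forall p, exists Ne : ('rV[R]_n.+2 -> 'rV[R]_n.+2) * ('I_n -> 'rV[R]_n.+2),
    S p -> curvature_data delta S k p Ne.1 Ne.2.
  move=> p; have [Sp|nS] := pselect (S p); last by exists ((fun=> 0), (fun=> 0)).
  by have [N [e h]] := hk p Sp; exists (N, e).
pose Nf p := (Ne p).1; pose ef p := (Ne p).2.
have hS p : S p -> curvature_data delta S k p (Nf p) (ef p) by exact: hNe.
have SM : S `<=` space_form delta by case: S_hyp.
have espE p : \sum_(I : {set 'I_n} | #|I| == r) \prod_(i in I) k p i = esp (k p) [set: 'I_n]%SET r.
  by rewrite /esp; apply: eq_bigl => I; rewrite finset.subsetT.
have Wk p : S p -> 'C(n, r)%:R^-1 * esp (k p) [set: 'I_n]%SET r =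
    a * (n%:R^-1 * esp (k p) [set: 'I_n]%SET 1) + b.
  by move=> Sp; have := Hr_eq p Sp; rewrite /higher_mean_curvature /mean_curvature espE esp_1.
have pos p : S p -> 0 < esp (k p) [set: 'I_n]%SET r.
  by move=> Sp; have := Hr_gt0 p Sp; rewrite /higher_mean_curvature espE pmulr_rgt0 // invr_gt0 ltr0n bin_gt0.
have hr0 : (0 < r <= n)%N by rewrite rn (ltn_trans _ r1).
have gc p : S p -> gcone r [set: 'I_n]%SET (k p).
  exact: (gcone_S S_hyp hS S_closed S_nonempty S_connected hr0 pos).
have [c [Mc psic circ]] := circumcenter S_closed S_nonempty SM.
have [d [d0 dd HS]] := round S_hyp hS S_closed S_nonempty S_connected hr hb Wk gc Mc psic circ.
by have [rho [rho0 E]] := sphere_geodesic Mc d0 dd HS; exists c, rho.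
Qed.
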